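(* Let $p>2$, let $\mathcal{G}\in\mathbf{G}$ be a noncompact graph with at least one half-line, let $Z\subseteq\mathbb{V}\setminus\mathbb{V}_\infty$ be a set of vertices of degree $1$, and let $\lambda>0$. Then $$\inf_{v\in\mathcal{N}_{\lambda,Z}(\mathcal{G})}J_\lambda(v)\le s_\lambda$$ and $$\inf_{v\in\mathcal{M}_{\lambda,Z}(\mathcal{G})}J_\lambda(v)\le s_\lambda+\inf_{v\in\mathcal{N}_{\lambda,Z}(\mathcal{G})}J_\lambda(v).$$ Moreover: (i) if $\#F(\mathcal{G})=0$, then $$\inf_{v\in\mathcal{N}_{\lambda,Z}(\mathcal{G})}J_\lambda(v)=s_\lambda$$ and it is not achieved, unless $\mathcal{G}$ is isometric to $\mathbb{R}$ or to a tower of bubbles; (ii) if $\#F(\mathcal{G})\le1$, then $$\inf_{v\in\mathcal{M}_{\lambda,Z}(\mathcal{G})}J_\lambda(v)=s_\lambda+\inf_{v\in\mathcal{N}_{\lambda,Z}(\mathcal{G})}J_\lambda(v)$$ and it is never achieved.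
   Context: $\mathbf{G}$ is the class of connected metric graphs $\mathcal{G}=(\mathbb{V},\mathbb{E})$ with at most countably many edges and vertices, every vertex of finite degree, and edge lengths bounded away from $0$: $\inf_{e\in\mathbb{E}}\ell_e>0$. Edges are bounded intervals or half-lines; each half-line is considered to end at a vertex at infinity of degree $1$, $\mathbb{V}_\infty$ is the set of these vertices; they belong to $\mathbb{V}$ but are not points of the metric space $\mathcal{G}$. $Z\subseteq\mathbb{V}\setminus\mathbb{V}_\infty$ is a (possibly empty or infinite) set of degree $1$ vertices. $H^1(\mathcal{G})$ is the space of continuous real functions on $\mathcal{G}$ that are $H^1$ on each edge with finite total $H^1$ norm, and $H^1_Z(\mathcal{G})=\{u\in H^1(\mathcal{G}): u(\mathrm{v})=0\ \forall\,\mathrm{v}\in Z\}$. Define $$J_\lambda(u)=\tfrac12\|u'\|_{L^2(\mathcal{G})}^2+\tfrac{\lambda}{2}\|u\|_{L^2(\mathcal{G})}^2-\tfrac1p\|u\|_{L^p(\mathcal{G})}^p ,$$ $$\mathcal{N}_{\lambda,Z}(\mathcal{G})=\{u\in H^1_Z(\mathcal{G}): u\neq0,\ \|u'\|_{L^2}^2+\lambda\|u\|_{L^2}^2=\|u\|_{L^p}^p\},$$ $$\mathcal{M}_{\lambda,Z}(\mathcal{G})=\{u\in H^1_Z(\mathcal{G}): u^+,u^-\in\mathcal{N}_{\lambda,Z}(\mathcal{G})\},\quad u^+=\max(u,0),\ u^-=\min(u,0).$$ $s_\lambda=\inf_{v\in\mathcal{N}_\lambda(\mathbb{R})}J_\lambda(v)$,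 where $\mathcal{N}_\lambda(\mathbb{R})=\mathcal{N}_{\lambda,\emptyset}(\mathbb{R})=\{u\in H^1(\mathbb{R}): u\neq0,\ \|u'\|_{L^2(\mathbb{R})}^2+\lambda\|u\|_{L^2(\mathbb{R})}^2=\|u\|_{L^p(\mathbb{R})}^p\}$ (the real line, with no Dirichlet vertices) and, for $v\in H^1(\mathbb{R})$, $J_\lambda(v)=\tfrac12\|v'\|_{L^2(\mathbb{R})}^2+\tfrac{\lambda}{2}\|v\|_{L^2(\mathbb{R})}^2-\tfrac1p\|v\|_{L^p(\mathbb{R})}^p$. $F(\mathcal{G})$ is the set of edges $e\in\mathbb{E}$ such that at least one connected component of the (combinatorial) graph $(\mathbb{V},\mathbb{E}\setminus\{e\})$ has no vertices in $\mathbb{V}_\infty\cup Z$. (All vertices of $\mathbb{V}$, including those at infinity, remain after the removal of an edge.) A tower of bubbles is a graph made of a real line and a finite sequence of two-by-two tangent circles: the first circle is attached to the line at one point, and each successive circle is attached to the previous one at the point of the previous circle that is antipodal to the point at which that previous circle was attached; the circles may have arbitrary lengths. *)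

(* Defs.v *)
From HB Require Import structures.
From mathcomp Require Import all_boot all_order all_algebra.
From mathcomp Require Import all_classical all_reals all_analysis.

Set Implicit Arguments.
Unset Strict Implicit.
Unset Printing Implicit Defensive.

Import Order.TTheory GRing.Theory Num.Theory.
Import numFieldNormedType.Exports.

Local Open Scope classical_set_scope.
Local Open Scope ring_scope.

(** Metric graphs.  Loops and multiple edges are allowed.  The edge [e] is
    parametrized by [0, len e] from [tail e] to [head e]; it is a half-line
    when [len e = +oo], and then [head e] is its vertex at infinity. *)
Record metric_graph (R : realType) := MetricGraph {
  vertex : countType;
  edge : countType;
  tail : edge -> vertex;
  head : edge -> vertex;
  len : edge -> \bar R }.

Section Combinatorics.
Context {R : realType} (G : metric_graph R).
Implicit Types (v w : vertex G) (e : edge G) (A : set (edge G)).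

Definition half_line e := len e = +oo%E.

Definition Vinf : set (vertex G) := [set v | exists2 e, half_line e & head e = v].

(* The ends of edges at [v]: [(e, false)] is the tail of [e] and [(e, true)]
   its head, so that a loop contributes twice to the degree. *)
Definition ends v : set (edge G * bool) :=
  [set h | (if h.2 then head h.1 else tail h.1) = v].

Definition degree1 v := (ends v #= `I_1)%card.

Inductive reach A v : vertex G -> Prop :=
| reach_refl : reach A v v
| reach_fwd e of A e & reach A v (tail e) : reach A v (head e)
| reach_bwd e of A e & reach A v (head e) : reach A v (tail e).

Definition component A v : set (vertex G) := [set w | reach A v w].

Definition classG : Prop :=
  [/\ forall v w, reach [set: edge G] v w,
      forall v, finite_set (ends v),
      forall e, half_line e -> degree1 (head e)
    & (0 < ereal_inf [set len e | e in [set: edge G]])%E].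

Definition Fedges (Z : set (vertex G)) : set (edge G) :=
  [set e | exists v, component (~` [set e]) v `&` (Vinf `|` Z) = set0].

End Combinatorics.

Section MetricSpace.
Context {R : realType} (G : metric_graph R).
Implicit Types (e : edge G) (x : R).

Definition open_edge e : set R := [set x | 0 < x /\ (x%:E < len e)%E].
Definition closed_edge e : set R := [set x | 0 <= x /\ (x%:E <= len e)%E].

(* A point is either a vertex not at infinity or an interior point of an edge,
   given by the edge and the coordinate on it. *)
Definition raw : choiceType := (vertex G + edge G * R)%type.

Definition points : set raw :=
  [set q | match q with
           | inl v => ~ Vinf v
           | inr (e, x) => open_edge e x
           end].

Definition pt := set_type points.

(* the point at coordinate [x] in [closed_edge e] *)
Definition edge_pt e x : raw :=
  if x == 0 then inl (tail e)
  else if x%:E == len e then inl (head e) else inr (e, x).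

(* A chain from [q] to [q'] is a sequence of moves [(e, x, y)] inside a closed
   edge [e], from the coordinate [x] to the coordinate [y]. *)
Fixpoint chain (q : raw) (c : seq (edge G * R * R)) (q' : raw) : Prop :=
  match c with
  | [::] => q = q'
  | (e, x, y) :: c' =>
      [/\ closed_edge e x, closed_edge e y, edge_pt e x = q
        & chain (edge_pt e y) c' q']
  end.

Definition chain_length (c : seq (edge G * R * R)) : R :=
  \sum_(s <- c) `|s.1.2 - s.2|.

Definition gdist (q q' : pt) : R :=
  inf [set chain_length c | c in [set c | chain (val q) c (val q')]].

End MetricSpace.

Definition isometric (R : realType) (X Y : Type)
    (dX : X -> X -> R) (dY : Y -> Y -> R) : Prop :=
  exists f : X -> Y, bijective f /\ forall x x', dY (f x) (f x') = dX x x'.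

(** The line together with circles of lengths [ls`_0, ls`_1, ...].
    The two half-lines start at [inl ord0]; the [i]-th circle consists of two
    edges, both of length [ls`_i / 2], from [inl i] to [inl i.+1], which are
    therefore antipodal on it. *)
Definition tower (R : realType) (ls : seq R) : metric_graph R :=
  @MetricGraph R ('I_(size ls).+1 + bool)%type (bool + 'I_(size ls) * bool)%type
    (fun e => match e with
              | inl _ => inl ord0
              | inr (i, _) => inl (widen_ord (leqnSn _) i)
              end)
    (fun e => match e with
              | inl b => inr b
              | inr (i, _) => inl (lift ord0 i)
              end)
    (fun e => match e with
              | inl _ => +oo%E
              | inr (i, _) => (ls`_i / 2)%:E
              end).

Definition isometric_to_line (R : realType) (G : metric_graph R) : Prop :=
  isometric (@gdist R G) (fun x y : R => `|x - y|).

Definition isometric_to_tower (R : realType) (G : metric_graph R) : Prop :=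
  exists2 ls : seq R, (forall l, l \in ls -> 0 < l)
                    & isometric (@gdist R G) (@gdist R (tower ls)).

Section WeakDerivative.
Context {R : realType}.
Local Notation mu := (@lebesgue_measure R).
Implicit Types (D : set R) (f g phi : R -> R).

Definition test_function D phi : Prop :=
  [/\ forall x, derivable phi x 1,
      continuous (derive1 phi)
    & exists2 K, compact K /\ K `<=` D & forall x, ~ K x -> phi x = 0].

Definition is_wderiv D f g : Prop :=
  locally_integrable D g /\
  forall phi, test_function D phi ->
    (\int[mu]_(x in D) (f x * derive1 phi x)%:E
     = - \int[mu]_(x in D) (g x * phi x)%:E)%E.

(* The weak derivative, well defined up to a null set. *)
Definition wderiv D f : R -> R := get (is_wderiv D f).

End WeakDerivative.

(** [energy] is J_lambda, as a function of the squared L^2 norm [d2] of the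
    derivative, of the squared L^2 norm [n2] and of the p-th power [np] of the
    L^p norm. *)
Definition energy (R : realType) (p lambda : R) (d2 n2 np : \bar R) : \bar R :=
  ((2^-1)%:E * d2 + (lambda / 2)%:E * n2 - (p^-1)%:E * np)%E.

Definition level (R : realType) (T : Type) (J : T -> \bar R) (S : set T) : \bar R :=
  ereal_inf [set J u | u in S].

Definition achieved (R : realType) (T : Type) (J : T -> \bar R) (S : set T) : Prop :=
  exists2 u, S u & J u = level J S.

Section RealLine.
Context {R : realType}.
Local Notation mu := (@lebesgue_measure R).
Implicit Types (p lambda q : R) (u f : R -> R).

Definition normR q f : \bar R := (\int[mu]_x (`|f x| `^ q)%:E)%E.

Definition H1R : set (R -> R) :=
  [set u | [/\ continuous u, exists g, is_wderiv setT u g,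
    (normR 2 (wderiv setT u) < +oo)%E & (normR 2 u < +oo)%E]].

Definition JR p lambda u : \bar R :=
  energy p lambda (normR 2 (wderiv setT u)) (normR 2 u) (normR p u).

Definition nehariR p lambda : set (R -> R) :=
  [set u | [/\ H1R u, u <> cst 0 &
    (normR 2 (wderiv setT u) + lambda%:E * normR 2 u = normR p u)%E]].

Definition s_level p lambda : \bar R := level (JR p lambda) (nehariR p lambda).

End RealLine.

Section Graph.
Context {R : realType} (G : metric_graph R).
Local Notation mu := (@lebesgue_measure R).
Implicit Types (p lambda q : R) (u : pt G -> R) (e : edge G).
Implicit Types (w : edge G -> R -> R) (Z : set (vertex G)).

(* the value of [u] at [r], with the junk value 0 when [r] is not a point *)
Definition eval u (r : raw G) : R := oapp u 0 (insub r).

Definition on_edge u e : R -> R := fun x => eval u (edge_pt e x).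

Definition deriv_on_edge u e : R -> R := wderiv (open_edge e) (on_edge u e).

(* the [q]-th power of the L^q norm of a family of functions on the edges *)
Definition normG q w : \bar R :=
  (\esum_(e in [set: edge G]) \int[mu]_(x in open_edge e) (`|w e x| `^ q)%:E)%E.

(* As [u] is single-valued at the vertices, it is continuous on the graph when
   it is so on each closed edge. *)
Definition H1 : set (pt G -> R) :=
  [set u | [/\ forall e, {within closed_edge e, continuous (on_edge u e)},
    forall e, exists g, is_wderiv (open_edge e) (on_edge u e) g,
    (normG 2 (deriv_on_edge u) < +oo)%E & (normG 2 (on_edge u) < +oo)%E]].

Definition H1Z Z : set (pt G -> R) :=
  [set u | H1 u /\ forall v, Z v -> eval u (inl v) = 0].

Definition J p lambda u : \bar R :=
  energy p lambda (normG 2 (deriv_on_edge u)) (normG 2 (on_edge u))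
         (normG p (on_edge u)).

Definition nehari p lambda Z : set (pt G -> R) :=
  [set u | [/\ H1Z Z u, u <> cst 0 &
    (normG 2 (deriv_on_edge u) + lambda%:E * normG 2 (on_edge u)
     = normG p (on_edge u))%E]].

Definition nodal_nehari p lambda Z : set (pt G -> R) :=
  [set u | [/\ H1Z Z u,
    nehari p lambda Z (fun x : pt G => Num.max (u x) 0) &
    nehari p lambda Z (fun x : pt G => Num.min (u x) 0)]].

End Graph.

(* Main.v *)
(** Let [well y = sqrt (lambda y^2 - (2/p) |y|^p)], let [peak] be its positive
    zero and [phase] its primitive; then [s_lambda = 2 phase(peak)].  For [u] on
    the Nehari manifold scale [u] by the [t] such that [max |t u| = peak].
    Completing the square bounds the energy of [u] from below by the total
    variation of [phase (t u)], a function that vanishes on the vertices at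
    infinity and on [Z].  If no edge separates the maximum point from these
    vertices, Menger's theorem yields two edge-disjoint paths to them, so that
    the total variation is at least [2 phase(peak)]: no rearrangement is needed.
    When at most one edge separates, this works for the positive or for the
    negative part of a nodal function, on adding the maximum point of the other
    part to the target vertices; the inequality is strict, as a solution of
    [|w'| = well w] that vanishes somewhere vanishes identically.  Solitons
    truncated and moved to infinity along a half-line give the upper bounds.

    In the equality case the energy density must be exhausted by the variation
    of [virial] along the two paths.  They cover the graph, and [|u|] is along
    each of them the half-soliton as a function of the arc length, so that they
    meet only at points of equal arc length, finitely many: the graph is a tower
    of bubbles. *)
Require Import Defs.
From mathcomp Require Import all_boot all_order all_algebra.
From mathcomp Require Import all_classical all_reals all_analysis.
From mathcomp Require Import measurable_realfun ring lra.

Set Implicit Arguments.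
Unset Strict Implicit.
Unset Printing Implicit Defensive.

Import Order.TTheory GRing.Theory Num.Theory.
Import numFieldNormedType.Exports.
Import Defs.

Local Open Scope classical_set_scope.
Local Open Scope ring_scope.

(** * Primitives of integrable functions *)

Section Primitives.
Context {R : realType}.
Local Notation mu := (@lebesgue_measure R).
Implicit Types (I U : set R) (f g h w F K H : R -> R) (a b c d e : R).

(** Scaling by [t] loses nothing: on the Nehari manifold the energy of [t u] is largest at [t = 1].
    The maximum points are usually interior to edges, so paths must be sought in subdivisions.
    Subdividing the only edge of [Fedges] produces two cut edges, so the count of these edges is
    useless there; it is replaced by a nesting property of the regions cut off, which subdivision
    preserves. Vertices at infinity are not points. Since functions decay along half-lines, they act
    as Dirichlet vertices. Regularity is expressed by [prim]: a function is the integral of a given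
    density. This reaches the ends of an edge, where test functions do not, and allows the density
    to be modified on null sets. The equation [|w'| = well w] holds only almost everywhere and
    admits plateaus at [peak], where [well] vanishes; hence the equality case needs a second
    potential, with capacities that are positive on every edge. Competitors have bounded support on
    the half-line, so that two of them can be made disjoint. Cutting at height [d] costs little in
    the p-th power, because small values are dominated there by the square norm. *)

Lemma withinP I f : {within I, continuous f} <->
  forall x, I x -> forall e, 0 < e ->
    exists2 d : R, 0 < d & forall y, I y -> `|y - x| < d -> `|f y - f x| < e.
Proof.
split=> [/subspace_continuousP cf x Ix e e0|cf].
  have /cvgrPdist_lt/(_ e e0) := cf x Ix.
  rewrite /prop_near1 /within/= => -[d /= d0 hd]; exists d => // y Iy yx.
  by rewrite distrC; apply: hd => //=; rewrite distrC.
apply/subspace_continuousP => x Ix; apply/cvgrPdist_lt => e e0.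
have [d d0 hd] := cf x Ix e e0.
rewrite /prop_near1 /within/=; exists d => //= y yx Iy.
by rewrite distrC; apply: hd => //; rewrite distrC.
Qed.

(* Cousin's lemma, for an additive interval function. *)
Lemma local_bound K H a b e : a <= b ->
  (forall x, a <= x <= b -> exists2 d : R, 0 < d & forall y z,
     a <= y -> y <= x -> x <= z -> z <= b -> x - d < y -> z < x + d ->
     `|K z - K y| <= e * (H z - H y)) ->
  `|K b - K a| <= e * (H b - H a).
Proof.
move=> ab loc.
pose S := [set x | a <= x <= b /\ `|K x - K a| <= e * (H x - H a)].
have Sa : S a by split; rewrite ?lexx//= !subrr normr0 mulr0.
have supS : has_sup S by split; [exists a|exists b => x [/andP[]]].
set s := sup S.
have sa : a <= s by apply: sup_upper_bound.
have sb : s <= b by apply: sup_le_ub; [exists a|move=> x [/andP[]]].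
have [|d d0 hd] := loc s; first by rewrite sa sb.
have [y [/andP[ay yb] Sy] sy] := sup_adherent d0 supS.
have ys : y <= s by apply: sup_upper_bound => //; split => //; rewrite ay yb.
have step z : s <= z -> z <= b -> z < s + d -> S z.
  move=> sz zb zd; split; first by rewrite (le_trans sa sz) zb.
  have := hd y z ay ys sz zb sy zd.
  have -> : K z - K a = (K z - K y) + (K y - K a) by ring.
  move=> h1; apply: (le_trans (ler_normD _ _)).
  have -> : e * (H z - H a) = e * (H z - H y) + e * (H y - H a) by ring.
  exact: lerD.
have [sltb|] := ltP s b; last first.
  move=> bs; have sbE : s = b by apply/eqP; rewrite eq_le sb bs.
  by have [] := step s (lexx s) sb; rewrite ?ltrDl// sbE.
pose z := Num.min b (s + d / 2).
have sz : s < z by rewrite lt_min sltb ltrDl divr_gt0.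
have zS : S z.
  apply: step; rewrite ?(ltW sz)//; first by rewrite ge_min lexx.
  by rewrite gt_min ltrD2l ltr_pdivrMr// ltr_pMr// ltr1n orbT.
by have := sup_upper_bound supS zS; rewrite leNgt sz.
Qed.

Lemma integrable_sub_itv a b c d g : a <= c -> d <= b ->
  mu.-integrable `[a, b] (EFin \o g) -> mu.-integrable `[c, d] (EFin \o g).
Proof.
move=> ac db; apply: integrableS => // x /=; rewrite !in_itv/=.
by move=> /andP[cx xd]; rewrite (le_trans ac cx) (le_trans xd db).
Qed.

Lemma Rintegral_cat a b c g : a <= b -> b <= c ->
  mu.-integrable `[a, c] (EFin \o g) ->
  \int[mu]_(x in `[a, c]) g x =
  \int[mu]_(x in `[a, b]) g x + \int[mu]_(x in `[b, c]) g x.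
Proof.
move=> ab bc ig.
have := @Rintegral_itvB R g (BLeft a) (BRight c) b ig.
rewrite !bnd_simp => /(_ ab bc) h.
rewrite Rintegral_itv_obnd_cbnd in h.
  by rewrite -h addrC subrK.
apply: integrableS ig => // x /=; rewrite !in_itv/= => /andP[bx ->].
by rewrite (le_trans ab (ltW bx)).
Qed.

Lemma integrable_normr I g : mu.-integrable I (EFin \o g) ->
  mu.-integrable I (EFin \o (fun x => `|g x|)).
Proof. by move=> /integrable_abse. Qed.

(** Local absolute continuity on [I] with a chosen density. Unlike a weak derivative it makes sense
    up to the ends of a closed edge, and it passes to limits under domination. *)
Definition prim I f g := forall a b, a <= b -> I a -> I b ->
  mu.-integrable `[a, b] (EFin \o g) /\
  f b - f a = \int[mu]_(x in `[a, b]) g x.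

Lemma primS I U f g : U `<=` I -> prim I f g -> prim U f g.
Proof. by move=> UI h a b ab Ua Ub; apply: h => //; apply: UI. Qed.

Lemma prim_eq I f f' g g' : is_interval I -> {in I, f =1 f'} -> {in I, g =1 g'} ->
  prim I f g -> prim I f' g'.
Proof.
move=> iI ff gg h a b ab Ia Ib; have [ig e] := h a b ab Ia Ib.
have gab : {in `[a, b], g =1 g'}.
  by move=> x; rewrite in_itv/= => xab; apply: gg; rewrite inE; exact: iI Ia Ib _ xab.
split.
  by apply: eq_integrable ig => // x; rewrite inE/= => xab; rewrite gab.
rewrite -!ff ?inE// e; apply: eq_Rintegral => x; rewrite inE/= => xab.
exact: gab.
Qed.

Lemma prim_cst I c : prim I (fun=> c) (fun=> 0).
Proof.
move=> a b ab _ _; split; last by rewrite subrr Rintegral_cst// mul0r.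
exact: integrable0.
Qed.

Lemma primD I f g f' g' : prim I f g -> prim I f' g' ->
  prim I (fun x => f x + f' x) (fun x => g x + g' x).
Proof.
move=> h h' a b ab Ia Ib; have [i e] := h a b ab Ia Ib.
have [i' e'] := h' a b ab Ia Ib; split.
  by have := integrableD _ i i'; apply.
by rewrite RintegralD// -e -e'; ring.
Qed.

Lemma primZ I f g k : prim I f g -> prim I (fun x => k * f x) (fun x => k * g x).
Proof.
move=> h a b ab Ia Ib; have [i e] := h a b ab Ia Ib; split.
  by have := integrableZl _ k i; apply.
by rewrite RintegralZl// -e; ring.
Qed.

Lemma primN I f g : prim I f g -> prim I (fun x => - f x) (fun x => - g x).
Proof.
move=> /(@primZ _ _ _ (-1)) h a b ab Ia Ib; have [] := h a b ab Ia Ib.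
have -> : (fun x => -1 * g x) = (fun x => - g x) by apply/funext => x; rewrite mulN1r.
by move=> i; rewrite !mulN1r => ->; split => //; apply: eq_Rintegral => x _; rewrite mulN1r.
Qed.

Lemma primB I f g f' g' : prim I f g -> prim I f' g' ->
  prim I (fun x => f x - f' x) (fun x => g x - g' x).
Proof. by move=> h /primN; exact: primD. Qed.

Lemma prim_within I f g : is_interval I -> prim I f g -> {within I, continuous f}.
Proof.
move=> iI h; apply/withinP => x Ix e e0.
(* Continuity of the integral is available on a segment with both ends in [I]. Each side of [x] on
   which [I] has a point [y0] is treated separately; on a side without such a point there is only
   [x] itself. *)
have side y0 : I y0 -> exists2 d : R, 0 < d & forall y,
    `|y - x| < d -> (x <= y <= y0) || (y0 <= y <= x) -> `|f y - f x| < e.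
  move=> Iy0; have [xy|yx] := leP x y0.
    have [i _] := h _ _ xy Ix Iy0.
    have /withinP hc := parameterized_integral_continuous xy i.
    have [|d d0 hd] := hc x _ e e0; first by rewrite /= in_itv/= lexx xy.
    exists d => // y yd; case/orP=> [/andP[xy1 yy0]|/andP[y0y yx]].
      have Iy : I y by apply: iI Ix Iy0 _ _; rewrite xy1.
      have := hd y; rewrite /= in_itv/= xy1 yy0 => /(_ erefl yd).
      rewrite /parameterized_integral set_itv1 Rintegral_set1 subr0.
      by have [_ <-] := h _ _ xy1 Ix Iy.
    have -> : y = x by apply/eqP; rewrite eq_le yx (le_trans xy y0y).
    by rewrite subrr normr0.
  have [i _] := h _ _ (ltW yx) Iy0 Ix.
  have /withinP hc := parameterized_integral_continuous (ltW yx) i.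
  have [|d d0 hd] := hc x _ e e0; first by rewrite /= in_itv/= lexx (ltW yx).
  exists d => // y yd; case/orP=> [/andP[xy1 yy0]|/andP[y0y yx1]].
    by have := lt_le_trans yx (le_trans xy1 yy0); rewrite ltxx.
  have Iy : I y by apply: iI Iy0 Ix _ _; rewrite y0y.
  have := hd y; rewrite /= in_itv/= yx1 y0y => /(_ erefl yd).
  rewrite /parameterized_integral.
  have [_ <-] := h _ _ y0y Iy0 Iy; have [_ <-] := h _ _ (ltW yx) Iy0 Ix.
  by congr (`| _ | < _); ring.
pose Rt := exists2 y, I y & x < y.
pose Lt := exists2 y, I y & y < x.
have [d1 d10 h1] : exists2 d : R, 0 < d & forall y, I y -> x <= y ->
    `|y - x| < d -> `|f y - f x| < e.
  have [[y0 Iy0 xy0]|nR] := pselect Rt.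
    have [d d0 hd] := side _ Iy0; exists (Num.min d (y0 - x)).
      by rewrite lt_min d0 subr_gt0.
    move=> y Iy xy; rewrite lt_min => /andP[yd yy0]; apply: hd => //.
    rewrite xy/=; apply/orP; left; move: yy0.
    by rewrite ger0_norm ?subr_ge0// ltrD2r => /ltW.
  exists 1 => // y Iy xy _.
  have -> : y = x.
    by apply/eqP; rewrite eq_le xy andbT leNgt; apply/negP => xy'; apply: nR; exists y.
  by rewrite subrr normr0.
have [d2 d20 h2] : exists2 d : R, 0 < d & forall y, I y -> y <= x ->
    `|y - x| < d -> `|f y - f x| < e.
  have [[y0 Iy0 xy0]|nR] := pselect Lt.
    have [d d0 hd] := side _ Iy0; exists (Num.min d (x - y0)).
      by rewrite lt_min d0 subr_gt0.
    move=> y Iy xy; rewrite lt_min => /andP[yd yy0]; apply: hd => //.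
    rewrite xy/= andbT; apply/orP; right; move: yy0.
    rewrite distrC ger0_norm ?subr_ge0// ltrD2l ltrN2 => /ltW//.
  exists 1 => // y Iy xy _.
  have -> : y = x.
    by apply/eqP; rewrite eq_le xy /= leNgt; apply/negP => xy'; apply: nR; exists y.
  by rewrite subrr normr0.
exists (Num.min d1 d2); first by rewrite lt_min d10 d20.
move=> y Iy; rewrite lt_min => /andP[y1 y2].
by have [xy|yx] := leP x y; [exact: h1|exact: h2 (ltW yx) y2].
Qed.

Lemma le_prim I f g a b : a <= b -> I a -> I b -> prim I f g ->
  `|f b - f a| <= \int[mu]_(x in `[a, b]) `|g x|.
Proof.
by move=> ab Ia Ib h; have [i ->] := h _ _ ab Ia Ib; exact: le_normr_Rintegral.
Qed.

Lemma prim_integrableM I f g h a b : prim I f g -> a <= b -> I a -> I b ->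
  {within `[a, b], continuous h} ->
  mu.-integrable `[a, b] (EFin \o (fun x => h x * g x)).
Proof.
move=> pf ab Ia Ib ch; have [ig _] := pf _ _ ab Ia Ib.
have mh : measurable_fun `[a, b] h by apply: subspace_continuous_measurable_fun.
have bh : [bounded h x | x in `[a, b]].
  have := continuous_compact ch (@segment_compact R a b).
  by move/compact_bounded => [M [Mr hM]]; exists M; split => // N MN x xab; apply: hM MN _ _; exists x.
by have := @integrableMr _ _ _ mu _ (measurable_itv `[a, b]) h (EFin \o g) mh bh ig.
Qed.

Lemma ge0_le_Rintegral_itv a b c d g : a <= c -> d <= b ->
  (forall x, a <= x <= b -> 0 <= g x) ->
  mu.-integrable `[a, b] (EFin \o g) ->
  \int[mu]_(x in `[c, d]) g x <= \int[mu]_(x in `[a, b]) g x.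
Proof.
move=> ac db g0 ig; have icd := integrable_sub_itv ac db ig.
rewrite /Rintegral fine_le ?integrable_fin_num//.
apply: ge0_subset_integral => //.
- exact: measurable_int ig.
- move=> x /=; rewrite !in_itv/= => /andP[cx xd].
  by rewrite (le_trans ac cx) (le_trans xd db).
Qed.

(** As [w] is only absolutely continuous, nothing is differentiated pointwise. The defect [K] of the
    formula is shown to vary, near each point, by at most [e] times the variation [H] of [w], and
    [local_bound] spreads this over the whole segment. *)
Lemma prim_chain I U w g F f : is_interval I -> is_interval U -> prim I w g ->
  (forall x, I x -> U (w x)) -> (forall y, U y -> is_derive y 1 F (f y)) ->
  {within U, continuous f} -> prim I (F \o w) (fun x => f (w x) * g x).
Proof.
move=> iI iU pw Uw dF cf a b ab Ia Ib.
have Iab x : a <= x <= b -> I x by move=> xab; exact: iI Ia Ib _ xab.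
have cw : {within I, continuous w} by exact: prim_within pw.
have cwab c d : a <= c -> d <= b -> {within `[c, d], continuous w}.
  move=> ac db; apply/withinP => x; rewrite /= in_itv/= => /andP[cx xd] e e0.
  have Ix : I x by apply: Iab; rewrite (le_trans ac cx) (le_trans xd db).
  have [d' d0 hd] := (withinP _ _).1 cw x Ix e e0; exists d' => // y.
  rewrite /= in_itv/= => /andP[cy yd]; apply: hd; apply: Iab.
  by rewrite (le_trans ac cy) (le_trans yd db).
have cfw x : a <= x <= b -> forall e, 0 < e -> exists2 d : R, 0 < d &
    forall y, a <= y <= b -> `|y - x| < d -> `|f (w y) - f (w x)| < e.
  move=> xab e e0.
  have [d1 d10 h1] := (withinP _ _).1 cf (w x) (Uw _ (Iab _ xab)) e e0.
  have [d2 d20 h2] := (withinP _ _).1 cw x (Iab _ xab) d1 d10.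
  exists d2 => // y yab yx; apply: h1; first exact/Uw/Iab.
  by apply: h2 => //; exact: Iab.
have cfwab : {within `[a, b], continuous (f \o w)}.
  apply/withinP => x; rewrite /= in_itv/= => xab e e0.
  by have [d d0 hd] := cfw x xab e e0; exists d.
have [ig _] := pw _ _ ab Ia Ib.
have ifg : mu.-integrable `[a, b] (EFin \o (fun x => f (w x) * g x)).
  exact: prim_integrableM pw ab Ia Ib cfwab.
split => //.
pose K x := F (w x) - \int[mu]_(t in `[a, x]) (f (w t) * g t).
pose H x := \int[mu]_(t in `[a, x]) `|g t|.
have Ksub y z : a <= y -> y <= z -> z <= b ->
    K z - K y = F (w z) - F (w y) - \int[mu]_(t in `[y, z]) (f (w t) * g t).
  move=> ay yz zb; rewrite /K (Rintegral_cat ay yz); first by ring.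
  exact: integrable_sub_itv ifg.
have Hsub y z : a <= y -> y <= z -> z <= b ->
    H z - H y = \int[mu]_(t in `[y, z]) `|g t|.
  move=> ay yz zb; rewrite /H (Rintegral_cat ay yz); first by ring.
  by apply: (integrable_sub_itv (lexx a) zb); exact: integrable_normr.
suff : forall e, 0 < e -> `|K b - K a| <= e * (H b - H a).
  move=> he; have H0 : 0 <= H b - H a.
    by rewrite Hsub//; apply: Rintegral_ge0 => x _.
  have /eqP : `|K b - K a| = 0.
    apply/eqP; rewrite eq_le normr_ge0 andbT; apply/ler_addgt0Pl => e e0; rewrite addr0.
    have h1 : 0 < e / (H b - H a + 1) by rewrite divr_gt0// ltr_wpDl.
    apply: (le_trans (he _ h1)); rewrite mulrAC ler_pdivrMr ?ltr_wpDl//.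
    by rewrite ler_pM2l// lerDl.
  by rewrite normr_eq0 Ksub// subr_eq0 => /eqP.
move=> e e0; apply: local_bound => // x xab.
have e2 : 0 < e / 2 by rewrite divr_gt0.
have [d d0 hd] := cfw x xab _ e2; exists d => // y z ay yx xz zb yd zd.
have yz := le_trans yx xz.
have near_x t : y <= t <= z -> `|f (w t) - f (w x)| <= e / 2.
  move=> /andP[yt tz]; apply/ltW/hd; first by rewrite (le_trans ay yt) (le_trans tz zb).
  by rewrite ltr_norml; lra.
have igyz : mu.-integrable `[y, z] (EFin \o g) by exact: integrable_sub_itv ig.
have ifyz : mu.-integrable `[y, z] (EFin \o (fun t => f (w t) * g t)).
  exact: integrable_sub_itv ifg.
have Iy : I y by apply: Iab; rewrite ay (le_trans yz zb).
have Iz : I z by apply: Iab; rewrite zb (le_trans ay yz).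
(* The mean value theorem gives an intermediate value of [w], and the intermediate value theorem
   brings it back to a parameter [xi], where [f (w xi)] is close to [f (w x)]. *)
have [xi xiyz FE] : exists2 xi, y <= xi <= z &
    F (w z) - F (w y) = f (w xi) * (w z - w y).
  have core p q : y <= p <= z -> y <= q <= z -> w p <= w q -> exists2 xi, y <= xi <= z &
      F (w q) - F (w p) = f (w xi) * (w q - w p).
    move=> pyz qyz pq.
    have Up : U (w p).
      by apply/Uw/Iab; move: pyz => /andP[p1 p2]; rewrite (le_trans ay p1) (le_trans p2 zb).
    have Uq : U (w q).
      by apply/Uw/Iab; move: qyz => /andP[p1 p2]; rewrite (le_trans ay p1) (le_trans p2 zb).
    have dFpq v : w p <= v <= w q -> is_derive v 1 F (f v).
      by move=> v1; apply: dF; exact: iU Up Uq _ v1.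
    have [||v] := @MVT_segment R F f (w p) (w q) pq.
    - by move=> v; rewrite in_itv/= => /andP[v1 v2]; apply: dFpq; rewrite !ltW.
    - apply: derivable_within_continuous => v; rewrite in_itv/= => /dFpq.
      by move=> [].
    rewrite in_itv/= => vpq FE.
    have [|||xi] := @IVT R w (Num.min p q) (Num.max p q) v.
    - by rewrite ge_min !le_max !lexx.
    - by apply: cwab; [rewrite le_min; lra|rewrite ge_max; lra].
    - have [pq'|pq'] := leP p q.
        by rewrite ge_min le_max; move: vpq => /andP[-> ->]; rewrite orbT.
      by rewrite ge_min le_max; move: vpq => /andP[-> ->]; rewrite orbT.
    rewrite in_itv/= ge_min le_max => xi1 wxi; exists xi; last by rewrite wxi.
    clear -pyz qyz xi1.
    by move: xi1; case/andP => /orP[] ? /orP[] ?; lra.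
  have yyz : y <= y <= z by rewrite lexx.
  have zyz : y <= z <= z by rewrite lexx yz.
  have [wyz|/ltW wzy] := leP (w y) (w z); first exact: core.
  by have [xi xi1 FE] := core _ _ zyz yyz wzy; exists xi => //; lra.
have [_ wE] := pw _ _ yz Iy Iz.
rewrite Ksub// Hsub// FE.
have -> : f (w xi) * (w z - w y) - \int[mu]_(t in `[y, z]) (f (w t) * g t) =
    (f (w xi) - f (w x)) * (w z - w y) +
    \int[mu]_(t in `[y, z]) (f (w x) * g t - f (w t) * g t).
  rewrite RintegralB//; last by have := integrableZl _ (f (w x)) igyz; apply.
  by rewrite RintegralZl// -wE; ring.
have Hyz0 : 0 <= \int[mu]_(t in `[y, z]) `|g t| by apply: Rintegral_ge0.
have iabs : mu.-integrable `[y, z] (EFin \o (fun t => `|g t|)) by exact: integrable_normr.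
set X := \int[mu]_(t in `[y, z]) `|g t| in Hyz0 *.
have -> : e * X = e / 2 * X + e / 2 * X by field.
apply: (le_trans (ler_normD _ _)); apply: lerD.
  rewrite normrM; apply: ler_pM => //; first exact: near_x.
  exact: le_prim pw.
have iB : mu.-integrable `[y, z] (EFin \o (fun t => f (w x) * g t - f (w t) * g t)).
  have i1 : mu.-integrable `[y, z] (EFin \o (fun t => f (w x) * g t)).
    by have := integrableZl _ (f (w x)) igyz; apply.
  by have := integrableB _ i1 ifyz; apply.
apply: (le_trans (le_normr_Rintegral _ iB)) => //.
rewrite -RintegralZl//; apply: le_Rintegral => //; first exact: integrable_normr.
  by have := integrableZl _ (e / 2) iabs; apply.
move=> t; rewrite /= in_itv/= => tyz; rewrite -mulrBl normrM ler_wpM2r//.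
by rewrite distrC; exact: near_x.
Qed.

Lemma is_derive_sqr (x : R) : is_derive x 1 (fun y => y ^+ 2) (2 * x).
Proof.
have := @is_deriveX R R id 2 x 1 1 _.
rewrite /= expr1 -[_ *: 1]/(_ * 1) mulr1 -[id ^+ 2]/(fun y : R => y ^+ 2); apply.
Qed.

Lemma continuous_withinT I f : continuous f -> {within I, continuous f}.
Proof. by move=> cf; apply: continuous_subspaceT. Qed.

Lemma prim_chainT I w g F f : is_interval I -> prim I w g ->
  (forall y : R, is_derive y 1 F (f y)) -> continuous f ->
  prim I (F \o w) (fun x => f (w x) * g x).
Proof.
move=> iI pw dF cf; apply: (@prim_chain I setT) => //.
exact: continuous_withinT.
Qed.

Lemma prim_sqr I w g : is_interval I -> prim I w g ->
  prim I (fun x => w x ^+ 2) (fun x => 2 * w x * g x).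
Proof.
move=> iI pw; apply: (@prim_chainT _ _ _ (fun y => y ^+ 2) (fun y => 2 * y)) => //.
- exact: is_derive_sqr.
- by move=> x; apply: cvgM; [exact: cvg_cst|exact: cvg_id].
Qed.

(** Polarization: a product is a quarter of the difference of two squares, and squares fall under
    the chain rule. *)
Lemma primM I f g f' g' : is_interval I -> prim I f g -> prim I f' g' ->
  prim I (fun x => f x * f' x) (fun x => g x * f' x + f x * g' x).
Proof.
move=> iI h h'.
have := primZ (1 / 4) (primB (prim_sqr iI (primD h h')) (prim_sqr iI (primB h h'))).
by apply: prim_eq => // x _; field.
Qed.

(** Dominated convergence. It extends the chain rule to outer functions that are only limits of C^1
    functions, such as [pos] and [y * well y]. *)
Lemma prim_lim I (f_ g_ : nat -> R -> R) f g h : is_interval I ->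
  (forall n, prim I (f_ n) (g_ n)) ->
  (forall x, I x -> f_ n x @[n --> \oo] --> f x) ->
  (forall x, I x -> g_ n x @[n --> \oo] --> g x) ->
  (forall n x, I x -> `|g_ n x| <= h x) ->
  (forall a b, a <= b -> I a -> I b -> mu.-integrable `[a, b] (EFin \o h)) ->
  prim I f g.
Proof.
move=> iI pf ff gg gh ih a b ab Ia Ib.
have Iab x : `[a, b]%classic x -> I x by rewrite /= in_itv/= => /(iI _ _ Ia Ib).
have mg n : measurable_fun (`[a, b] : set (measurableTypeR R)) (EFin \o g_ n : measurableTypeR R -> \bar R).
  by have [i _] := pf n _ _ ab Ia Ib; exact: measurable_int i.
have cg x : `[a, b]%classic x -> (EFin \o g_ n) x @[n --> \oo] --> (EFin \o g) x.
  by move=> /Iab /gg gx; apply/cvg_EFin; [exact: nearW|exact: gx].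
have [||||ig _ lg] := @dominated_convergence _ _ _ mu _ (measurable_itv `[a, b]) _ (EFin \o g) (EFin \o h) mg.
- exact: emeasurable_fun_cvg mg cg.
- exact: aeW.
- exact: ih.
- by apply: aeW => x n /Iab Ix; rewrite lee_fin; exact: gh.
split => //.
have lf : (f_ n b - f_ n a) @[n --> \oo] --> f b - f a.
  by apply: cvgB; exact: ff.
have : (fine (\int[mu]_(x in `[a, b]) (EFin \o g_ n) x)%E) @[n --> \oo] -->
    \int[mu]_(x in `[a, b]) g x.
  apply: fine_cvg; rewrite fineK; first exact: lg.
  exact: integrable_fin_num ig.
rewrite (_ : (fun n => _) = (fun n => f_ n b - f_ n a)); last first.
  by apply/funext => n; have [_ ->] := pf n _ _ ab Ia Ib.
by move=> lf'; exact: (cvg_unique _ lf lf').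
Qed.

Definition pos (x : R) := Num.max x 0.

Lemma pos_ge0 x : 0 <= pos x. Proof. by rewrite /pos le_max lexx orbT. Qed.
Lemma ge0_pos x : 0 <= x -> pos x = x. Proof. by move=> x0; apply/max_idPl. Qed.
Lemma le0_pos x : x <= 0 -> pos x = 0. Proof. by move=> x0; apply/max_idPr. Qed.

Lemma continuous_pos : continuous pos.
Proof. by move=> x; apply: continuous_max; [exact: cvg_id|exact: cvg_cst]. Qed.

Lemma is_derive_quadratic F (x l C : R) :
  (forall h : R, `|F (x + h) - F x - l * h| <= C * h ^+ 2) -> is_derive x 1 F l.
Proof.
move=> hF.
have C0 : 0 <= C.
  by have h1 := normr_ge0 (F (x + 1) - F x - l * 1); have h2 := hF 1; nra.
suff cF : (fun h : R => h^-1 *: (F (h *: (1 : R) + x) - F x)) @ 0^' --> l.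
  by apply: DeriveDef; [apply/cvg_ex; exists l|apply/cvg_lim].
apply/cvgrPdist_le => e e0.
have eC : 0 < e / (C + 1) by rewrite divr_gt0// ltr_wpDl.
near=> h.
have h0 : h != 0 by near: h; exact: nbhs_dnbhs_neq.
rewrite -[_ *: (_ - _)]/(_ * _) -[h *: 1]/(h * 1) mulr1 (addrC h).
have -> : l - h^-1 * (F (x + h) - F x) = - (h^-1 * (F (x + h) - F x - l * h)).
  by field.
rewrite normrN normrM normfV ler_pdivrMl ?normr_gt0//.
apply: (le_trans (hF h)).
have -> : h ^+ 2 = `|h| * `|h| by rewrite -normrM -expr2 ger0_norm// sqr_ge0.
rewrite mulrCA ler_wpM2l//.
have he : `|h| <= e / (C + 1).
  near: h; apply: dnbhs0_le => //.
apply: (@le_trans _ _ ((C + 1) * `|h|)); first by rewrite ler_wpM2r// lerDl.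
by rewrite -ler_pdivlMl ?ltr_wpDl// mulrC.
Unshelve. all: by end_near. Qed.

Lemma is_derive_pos2 (x : R) : is_derive x 1 (fun y => pos y ^+ 2) (2 * pos x).
Proof.
apply: (@is_derive_quadratic _ _ _ 1) => h; rewrite mul1r ler_norml /pos.
have h2 := sqr_ge0 h; have xh2 := sqr_ge0 (x + h); have x2 := sqr_ge0 x.
by case: (ltP x 0) => x0; case: (ltP (x + h) 0) => xh0; apply/andP; split; nra.
Qed.

Lemma is_derive_sqrt_pos2 k (x : R) : 0 < k ->
  is_derive x 1 (fun y => Num.sqrt (pos y ^+ 2 + k)) (pos x / Num.sqrt (pos x ^+ 2 + k)).
Proof.
move=> k0.
have p0 : 0 < pos x ^+ 2 + k by rewrite ltr_wpDl// sqr_ge0.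
have := @is_derive1_comp R Num.sqrt (fun y => pos y ^+ 2 + k) x _ _ (is_derive1_sqrt p0)
  (is_deriveD (is_derive_pos2 x) (is_derive_cst k x 1)).
move=> dF; apply: (is_derive_eq dF); rewrite addr0.
by field; rewrite sqrtr_eq0 -ltNge p0.
Qed.

Lemma cvg_sqrt (T : Type) (P : set_system T) {FP : Filter P} (u : T -> R) (l : R) :
  u x @[x --> P] --> l -> Num.sqrt (u x) @[x --> P] --> Num.sqrt l.
Proof. by move=> ul; exact: (cvg_comp u Num.sqrt ul (@sqrt_continuous R l)). Qed.

(** The functions [sqrt (pos y ^+ 2 + k n)] are C^1, with derivatives between 0 and 1 that tend to
    the indicator of [0 < y]. The density 0 on the set [w = 0] thus comes out of the limit, without
    any study of level sets. *)
Lemma prim_pos I w g : is_interval I -> prim I w g ->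
  prim I (fun x => pos (w x)) (fun x => (0 < w x)%R%:R * g x).
Proof.
move=> iI pw; pose k n : R := n.+1%:R^-1.
have k0 n : 0 < k n by rewrite invr_gt0.
have kl : k n @[n --> \oo] --> 0 by exact: cvg_harmonic.
have p0 n y : 0 < pos y ^+ 2 + k n by rewrite ltr_wpDl// sqr_ge0.
have sl y : Num.sqrt (pos y ^+ 2 + k n) @[n --> \oo] --> pos y.
  rewrite [X in _ --> X](_ : _ = Num.sqrt (pos y ^+ 2 + 0)); last first.
    by rewrite addr0 sqrtr_sqr ger0_norm// pos_ge0.
  apply: cvg_sqrt.
  by apply: cvgD => //; exact: cvg_cst.
apply: (@prim_lim I (fun n x => Num.sqrt (pos (w x) ^+ 2 + k n))
  (fun n x => pos (w x) / Num.sqrt (pos (w x) ^+ 2 + k n) * g x) _ _ (fun x => `|g x|)) => //.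
- move=> n; apply: (@prim_chainT I w g (fun y => Num.sqrt (pos y ^+ 2 + k n))
    (fun y => pos y / Num.sqrt (pos y ^+ 2 + k n))) => //.
    by move=> y; exact: is_derive_sqrt_pos2.
  move=> y; apply: cvgM; first exact: continuous_pos.
  apply: cvgV; first by rewrite sqrtr_eq0 -ltNge.
  apply: cvg_sqrt.
  apply: cvgD; last exact: cvg_cst.
  by rewrite expr2; under eq_fun do rewrite expr2; apply: cvgM; exact: continuous_pos.
- move=> x Ix; apply: cvgM; last exact: cvg_cst.
  have [w0|w0] := ltP 0 (w x); last first.
    by rewrite le0_pos//; under eq_fun do rewrite mul0r; exact: cvg_cst.
  have pw0 : pos (w x) != 0 by rewrite ge0_pos ?ltW// gt_eqF.
  rewrite -[X in _ --> X](divff pw0); apply: cvgM; first exact: cvg_cst.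
  by apply: cvgV.
- move=> n x Ix; rewrite normrM -[leRHS]mul1r ler_wpM2r//.
  rewrite ger0_norm ?divr_ge0 ?pos_ge0 ?sqrtr_ge0//.
  rewrite ler_pdivrMr ?sqrtr_gt0// mul1r.
  rewrite -[leLHS](ger0_norm (pos_ge0 _)) -sqrtr_sqr ler_sqrt ?lerDl ?ltW//.
- move=> a b ab Ia Ib; have [i _] := pw _ _ ab Ia Ib; exact: integrable_normr.
Qed.

(** The difference of the densities has a vanishing indefinite integral, so it is zero almost
    everywhere by Lebesgue differentiation. *)
Lemma prim_ae_eq I f g h a b : is_interval I -> prim I f g -> prim I f h -> I a -> I b ->
  {ae mu, forall x, a < x < b -> g x = h x}.
Proof.
move=> iI pg ph Ia Ib.
have [ab|ba] := ltP a b; last first.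
  by apply: aeW => x /andP[ax xb]; have := lt_le_trans (lt_trans ax xb) ba; rewrite ltxx.
pose k := (fun x => g x - h x) \_ `[a, b].
have pk := primB pg ph.
have [ik _] := pk _ _ (ltW ab) Ia Ib.
have ikT : mu.-integrable setT (EFin \o k).
  by rewrite -restrict_EFin; apply/integrable_restrict => //=; rewrite setTI.
have F0 x : a <= x <= b -> \int[mu]_(t in `[a, x]) k t = 0.
  move=> /andP[ax xb].
  rewrite (_ : \int[mu]_(t in `[a, x]) k t = \int[mu]_(t in `[a, x]) (g t - h t)).
    have Ix : I x by apply: iI Ia Ib _ _; rewrite ax xb.
    by have [_ <-] := pk _ _ ax Ia Ix; rewrite !subrr.
  apply: eq_Rintegral => t; rewrite inE/= in_itv/= => /andP[at_ tx].
  by rewrite /k patchE ifT// inE/= in_itv/= at_ (le_trans tx xb).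
have loc : locally_integrable setT k.
  by apply: open_integrable_locally => //; exact: openT.
have ik' y : mu.-integrable [set` Interval (BLeft a) (BRight y)] (EFin \o k).
  exact: integrableS ikT.
have := @FTC1 R k (BLeft a) ik' loc.
apply: filterS; first exact: (ae_filter_ringOfSetsType mu).
move=> x hx /andP[ax xb]; have [|dF FE] := hx; last 1 first.
  have : k x = 0.
    rewrite -FE derive1E (@near_eq_derive _ _ _ _ (cst 0)) ?derive_cst//.
    near=> y; apply: F0; apply/andP; split.
      by apply/ltW; near: y; exact: lt_nbhsr.
    by apply/ltW; near: y; exact: lt_nbhsl.
  rewrite /k patchE ifT; first by move/eqP; rewrite subr_eq0 => /eqP.
  by rewrite inE/= in_itv/= !ltW.
Unshelve. all: by end_near. Qed.

(** A quadratic spline rising from 0 at [x = 0] to 1 at [x = 1]. Squared positive parts suffice, as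
    a [test_function] has to be C^1 only. *)
Definition smooth (x : R) := 2 * (pos x ^+ 2 - 2 * pos (x - 2^-1) ^+ 2 + pos (x - 1) ^+ 2).
Definition dsmooth (x : R) := 4 * (pos x - 2 * pos (x - 2^-1) + pos (x - 1)).

Lemma is_derive_shift F (k x l : R) : is_derive (x + k) 1 F l ->
  is_derive x 1 (fun y => F (y + k)) l.
Proof.
move=> dF.
have := @is_derive1_comp R F (fun y => y + k) x _ _ dF
  (is_deriveD (is_derive_id x 1) (is_derive_cst k x 1)).
by rewrite addr0 mulr1.
Qed.

Lemma is_derive_affine F (n k x l : R) : is_derive (n * x + k) 1 F l ->
  is_derive x 1 (fun y => F (n * y + k)) (n * l).
Proof.
move=> dF.
have dlin : is_derive x 1 (fun y => n * y + k) n.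
  have := is_deriveD (is_deriveZ n (is_derive_id x 1)) (is_derive_cst k x 1).
  by rewrite addr0 -[n *: 1]/(n * 1) mulr1.
by have := @is_derive1_comp R F (fun y => n * y + k) x _ _ dF dlin; rewrite mulrC.
Qed.

Lemma is_derive_smooth (x : R) : is_derive x 1 smooth (dsmooth x).
Proof.
have d0 := is_derive_pos2 x.
have d1 := is_derive_shift (is_derive_pos2 (x - 2^-1)).
have d2 := is_derive_shift (is_derive_pos2 (x - 1)).
have := is_deriveZ 2 (is_deriveD (is_deriveB d0 (is_deriveZ 2 d1)) d2).
by move=> d; apply: (is_derive_eq d); rewrite /dsmooth -![_ *: _]/(_ * _); ring.
Qed.

Lemma continuous_dsmooth : continuous dsmooth.
Proof.
move=> x; apply: cvgM; first exact: cvg_cst.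
have sh k : (fun y : R => pos (y - k)) y @[y --> x] --> pos (x - k).
  apply: (cvg_comp (fun y => y - k) pos _ (@continuous_pos (x - k))).
  by apply: cvgB; [exact: cvg_id|exact: cvg_cst].
apply: cvgD; last exact: sh.
apply: cvgB; first exact: continuous_pos.
by apply: cvgM; [exact: cvg_cst|exact: sh].
Qed.

Lemma smooth_le0 x : x <= 0 -> smooth x = 0.
Proof. by move=> x0; rewrite /smooth !le0_pos; [ring|lra..]. Qed.

Lemma smooth_ge1 x : 1 <= x -> smooth x = 1.
Proof. by move=> x0; rewrite /smooth !ge0_pos; [field|lra..]. Qed.

Lemma dsmooth_ge0 x : 0 <= dsmooth x.
Proof.
rewrite /dsmooth /pos.
by case: (ltP x 0) => ?; case: (ltP (x - 2^-1) 0) => ?; case: (ltP (x - 1) 0) => ?; lra.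
Qed.

Lemma dsmooth_le0 x : x <= 0 -> dsmooth x = 0.
Proof. by move=> x0; rewrite /dsmooth !le0_pos; [ring|lra..]. Qed.

Lemma dsmooth_ge1 x : 1 <= x -> dsmooth x = 0.
Proof. by move=> x0; rewrite /dsmooth !ge0_pos; [field|lra..]. Qed.

Lemma smooth_bound x : 0 <= smooth x <= 1.
Proof.
rewrite /smooth /pos.
by case: (ltP x 0) => ?; case: (ltP (x - 2^-1) 0) => ?; case: (ltP (x - 1) 0) => ?;
  apply/andP; split; nra.
Qed.

Lemma prim_C1 I F f : (forall x : R, is_derive x 1 F (f x)) -> continuous f ->
  prim I F f.
Proof.
move=> dF cf a b ab _ _.
have ic : mu.-integrable `[a, b] (EFin \o f).
  apply: continuous_compact_integrable; first exact: segment_compact.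
  exact: continuous_withinT.
split => //; move: ab; rewrite le_eqVlt => /predU1P[->|ab].
  by rewrite set_itv1 Rintegral_set1 subrr.
rewrite /Rintegral (continuous_FTC2 ab (F := F)) => //.
- exact: continuous_withinT.
- split.
  + by move=> x _; have [] := dF x.
  + apply: cvg_at_right_filter; apply: differentiable_continuous.
    by apply/derivable1_diffP; have [] := dF a.
  + apply: cvg_at_left_filter; apply: differentiable_continuous.
    by apply/derivable1_diffP; have [] := dF b.
- by move=> x _; rewrite derive1E; apply: derive_val.
Qed.

End Primitives.

(** * Weak derivatives *)

Section WeakDerivatives.
Context {R : realType}.
Local Notation mu := (@lebesgue_measure R).
Implicit Types (I D : set R) (f g h w F phi : R -> R) (a b c d e : R).

Lemma integral_subset0 (D A : set R) (h : R -> \bar R) : A `<=` D ->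
  (forall x, D x -> ~ A x -> h x = 0%E) ->
  (\int[mu]_(x in D) h x = \int[mu]_(x in A) h x)%E.
Proof.
move=> AD h0; rewrite integral_mkcond [RHS]integral_mkcond.
apply: eq_integral => x _; rewrite !patchE.
case: ifPn => [|]; rewrite ?inE ?notin_setE => Dx; case: ifPn; rewrite ?inE ?notin_setE => Ax //.
  exact: h0.
by exfalso; apply: Dx; exact: AD.
Qed.

Lemma open_interval_right D x : open D -> D x -> exists2 y, x < y & D y.
Proof.
move=> oD Dx; have : \forall y \near x, D y by exact: open_nbhs_nbhs.
move=> [e /= e0 he]; exists (x + e / 2); first by rewrite ltrDl divr_gt0.
by apply: he => /=; rewrite opprD addrA subrr sub0r normrN gtr0_norm ?divr_gt0//; lra.
Qed.

Lemma open_interval_left D x : open D -> D x -> exists2 y, y < x & D y.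
Proof.
move=> oD Dx; have : \forall y \near x, D y by exact: open_nbhs_nbhs.
move=> [e /= e0 he]; exists (x - e / 2); first by rewrite ltrBlDr ltrDl divr_gt0.
by apply: he => /=; rewrite opprB addrC subrK gtr0_norm ?divr_gt0//; lra.
Qed.

Lemma compact_bounds (K : set R) : K !=set0 -> compact K ->
  exists m M, [/\ K m, K M & forall x, K x -> m <= x <= M].
Proof.
move=> K0 cK.
have [M KM hM] := @compact_EVT_max _ R id K K0 cK (continuous_withinT (fun x => cvg_id)).
have [m Km hm] := @compact_EVT_max _ R (fun x => - x) K K0 cK
  (continuous_withinT (fun x => cvgN cvg_id)).
rewrite !inE in KM Km; exists m, M; split => // x Kx.
by rewrite -(lerN2 x) hm ?inE// hM ?inE.
Qed.

Lemma test_support D phi x0 : open D -> D x0 -> test_function D phi ->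
  exists a b, [/\ a <= b, D a, D b & forall x, ~ (a < x < b) -> phi x = 0 /\ derive1 phi x = 0].
Proof.
move=> oD Dx0 [dphi _ [K [cK KD phi0]]].
have [[z Kz]|K0] := pselect (K !=set0); last first.
  exists x0, x0; split => // x _.
  have p0 y : phi y = 0 by apply: phi0 => Ky; apply: K0; exists y.
  split => //; rewrite derive1E (_ : phi = cst 0) ?derive_cst//; exact/funext.
have [m [M [Km KM hK]]] := compact_bounds (ex_intro _ z Kz) cK.
have [b Mb Db] := open_interval_right oD (KD _ KM).
have [a am Da] := open_interval_left oD (KD _ Km).
have mM : m <= M by have /andP[] := hK _ KM.
exists a, b; split => //; first by lra.
have out y : y < m \/ M < y -> phi y = 0.
  by move=> yo; apply: phi0 => /hK; lra.
move=> x nx.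
have xo : x < m \/ M < x.
  have [|xa] := ltP a x; last by left; lra.
  have [|bx] := ltP x b; last by right; lra.
  by move=> xb ax; exfalso; apply: nx; rewrite ax xb.
split; first exact: out.
rewrite derive1E (@near_eq_derive _ _ _ _ (cst 0)) ?derive_cst//.
by case: xo => xo; near=> y; apply: out; [left|right]; near: y;
  [exact: lt_nbhsl|exact: lt_nbhsr].
Unshelve. all: by end_near. Qed.

Lemma is_derive_derive1 phi x : derivable phi x 1 -> is_derive x 1 phi (derive1 phi x).
Proof. by move=> /derivableP; rewrite -derive1E. Qed.

Lemma EFin_Rintegral g a b : mu.-integrable `[a, b] (EFin \o g) ->
  ((\int[mu]_(x in `[a, b]) g x)%:E = \int[mu]_(x in `[a, b]) (g x)%:E)%E.
Proof. by move=> ig; rewrite /Rintegral fineK//; exact: integrable_fin_num. Qed.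

Lemma within_continuousM I f g : {within I, continuous f} -> {within I, continuous g} ->
  {within I, continuous (fun x => f x * g x)}.
Proof. by move=> cf cg x; apply: continuousM; [exact: cf|exact: cg]. Qed.

Lemma is_derive_continuous F f : (forall x : R, is_derive x 1 F (f x)) -> continuous F.
Proof.
move=> dF x; apply: differentiable_continuous.
by apply/derivable1_diffP; have [] := dF x.
Qed.

Lemma prim_is_wderiv D f g : open D -> is_interval D -> measurable_fun D g ->
  prim D f g -> is_wderiv D f g.
Proof.
move=> oD iD mg pf; split.
  split => // K KD cK.
  have [[z Kz]|K0] := pselect (K !=set0); last first.
    have -> : K = set0 by apply/eqP; apply/negPn; apply/negP => /set0P.
    by rewrite integral_set0.
  have [m [M [Km KM hK]]] := compact_bounds (ex_intro _ z Kz) cK.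
  have mM : m <= M by have /andP[] := hK _ KM.
  have [ig _] := pf _ _ mM (KD _ Km) (KD _ KM).
  have /integrableP[_] : mu.-integrable K (EFin \o g).
    by apply: integrableS ig => //; exact: compact_measurable.
  by [].
move=> phi tphi.
have [[x0 Dx0]|D0] := pselect (D !=set0); last first.
  have -> : D = set0 by apply/eqP; apply/negPn; apply/negP => /set0P.
  by rewrite !integral_set0 oppe0.
have [a [b [ab Da Db out]]] := test_support oD Dx0 tphi.
have [dphi cphi _] := tphi.
have abD : `[a, b] `<=` D by move=> x /=; rewrite in_itv/=; exact: iD.
have out' x : ~ `[a, b]%classic x -> phi x = 0 /\ derive1 phi x = 0.
  move=> nx; apply: out => /andP[ax xb]; apply: nx.
  by rewrite /= in_itv/= !ltW.
rewrite (@integral_subset0 D `[a, b]) //; last by move=> x _ /out'[_ ->]; rewrite mulr0.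
rewrite [in RHS](@integral_subset0 D `[a, b]) //; last by move=> x _ /out'[-> _]; rewrite mulr0.
have pphi : prim D phi (derive1 phi).
  by apply: prim_C1 => // x; exact: is_derive_derive1.
have pM := primM iD pf pphi.
have iab : is_interval `[a, b] by exact: interval_is_interval.
have cab h : {within D, continuous h} -> {within `[a, b], continuous h}.
  exact: continuous_subspaceW.
have i1 : mu.-integrable `[a, b] (EFin \o (fun x => g x * phi x)).
  have -> : (fun x => g x * phi x) = (fun x => phi x * g x).
    by apply/funext => x; rewrite mulrC.
  apply: prim_integrableM pf ab Da Db _.
  exact/cab/(prim_within iD pphi).
have i2 : mu.-integrable `[a, b] (EFin \o (fun x => f x * derive1 phi x)).
  apply: prim_integrableM pphi ab Da Db _.
  exact/cab/(prim_within iD pf).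
have [_] := pM a b ab Da Db.
rewrite RintegralD//.
have [pa _] : phi a = 0 /\ derive1 phi a = 0 by apply: out; rewrite ltxx.
have [pb _] : phi b = 0 /\ derive1 phi b = 0 by apply: out; rewrite ltxx andbF.
rewrite pa pb !mulr0 subrr => h.
rewrite -(EFin_Rintegral i2) -(EFin_Rintegral i1) -EFinN; congr (_%:E).
by move: h => /esym/eqP; rewrite addrC addr_eq0 => /eqP.
Qed.

Lemma Rintegral_average f g a b k e : a <= b ->
  {within `[a, b], continuous f} -> {within `[a, b], continuous g} ->
  (forall x, 0 <= g x) -> \int[mu]_(x in `[a, b]) g x = 1 ->
  (forall x, a <= x <= b -> g x != 0 -> `|f x - k| <= e) ->
  `|\int[mu]_(x in `[a, b]) (f x * g x) - k| <= e.
Proof.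
move=> ab cf cg g0 g1 fk.
have ig : mu.-integrable `[a, b] (EFin \o g).
  by apply: continuous_compact_integrable => //; exact: segment_compact.
have ci h : {within `[a, b], continuous h} -> mu.-integrable `[a, b] (EFin \o (fun x => h x * g x)).
  move=> ch; apply: continuous_compact_integrable; first exact: segment_compact.
  by move=> x; apply: continuousM; [exact: ch|exact: cg].
have if_ := ci _ cf.
have ik : mu.-integrable `[a, b] (EFin \o (fun x => k * g x)).
  by apply: (ci (cst k)) => x; exact: cvg_cst.
have -> : k = \int[mu]_(x in `[a, b]) (k * g x) by rewrite RintegralZl// g1 mulr1.
rewrite -RintegralB//.
have iB : mu.-integrable `[a, b] (EFin \o (fun x => f x * g x - k * g x)).
  by have := integrableB _ if_ ik; apply.
apply: (le_trans (le_normr_Rintegral _ iB)) => //.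
have -> : e = \int[mu]_(x in `[a, b]) (e * g x) by rewrite RintegralZl// g1 mulr1.
apply: le_Rintegral => //; first exact: integrable_normr.
  by apply: (ci (cst e)) => x; exact: cvg_cst.
move=> x; rewrite /= in_itv/= => xab; rewrite -mulrBl normrM (ger0_norm (g0 x)).
have [->|gx0] := eqVneq (g x) 0; first by rewrite !mulr0.
by rewrite ler_wpM2r//; exact: fk.
Qed.

Section TestSequence.
Variables (a b k : R).
Hypotheses (k0 : 0 < k) (kab : 1 <= k * (b - a)).

Let kab' : 1 <= k * b - k * a. Proof. by rewrite -mulrBr. Qed.
(** Approximates the indicator of [[a, b]]: it climbs on [[a, a + 1/k]] and descends on
    [[b - 1/k, b]], so that its derivative is a difference of two unit masses that concentrate at
    [a] and at [b] as [k] grows. *)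
Let ramp x := smooth (k * x + - (k * a)) - smooth (k * x + (1 - k * b)).
Let dramp x := k * dsmooth (k * x + - (k * a)) - k * dsmooth (k * x + (1 - k * b)).

Lemma ramp_derive (x : R) : is_derive x 1 ramp (dramp x).
Proof.
exact: (is_deriveB (is_derive_affine (is_derive_smooth _))
  (is_derive_affine (is_derive_smooth _))).
Qed.

Lemma continuous_dsmooth_affine (c : R) : continuous (fun x => k * dsmooth (k * x + c)).
Proof.
move=> x; apply: cvgM; first exact: cvg_cst.
apply: (cvg_comp (fun y => k * y + c) dsmooth _ (@continuous_dsmooth R (k * x + c))).
apply: cvgD; last exact: cvg_cst.
by apply: cvgM; [exact: cvg_cst|exact: cvg_id].
Qed.

Lemma dramp_continuous : continuous dramp.
Proof. by move=> x; apply: cvgB; exact: continuous_dsmooth_affine. Qed.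

Lemma ramp_out x : ~ `[a, b]%classic x -> ramp x = 0 /\ dramp x = 0.
Proof.
rewrite /ramp /dramp /= in_itv/= => nx; have [xa|ax] := ltP x a.
  have h : 0 < k * (a - x) by rewrite mulr_gt0// subr_gt0.
  have hk := kab'.
  have h1 : k * x + - (k * a) <= 0 by lra.
  have h2 : k * x + (1 - k * b) <= 0 by lra.
  by rewrite !smooth_le0// !dsmooth_le0// mulr0 subrr.
have [bx|xb] := ltP b x; last by exfalso; apply: nx; rewrite ax xb.
have h : 0 < k * (x - b) by rewrite mulr_gt0// subr_gt0.
have hk := kab'.
have h1 : 1 <= k * x + - (k * a) by lra.
have h2 : 1 <= k * x + (1 - k * b) by lra.
by rewrite !smooth_ge1// !dsmooth_ge1// mulr0 !subrr.
Qed.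

Lemma ramp_test D : `[a, b] `<=` D -> test_function D ramp.
Proof.
move=> abD; have dE : derive1 ramp = dramp.
  by apply/funext => x; rewrite derive1E; have [_ ->] := ramp_derive x.
split.
- by move=> x; have [] := ramp_derive x.
- rewrite dE; exact: dramp_continuous.
- exists `[a, b]%classic; first by split => //; exact: segment_compact.
  by move=> x /ramp_out[].
Qed.

Lemma ramp_le1 x : `|ramp x| <= 1.
Proof.
rewrite /ramp; have := smooth_bound (k * x + - (k * a)).
have := smooth_bound (k * x + (1 - k * b)).
by move=> /andP[? ?] /andP[? ?]; rewrite ler_norml; lra.
Qed.

Lemma ramp_plateau x : 1 <= k * (x - a) -> 1 <= k * (b - x) -> ramp x = 1.
Proof. by move=> xa xb; rewrite /ramp smooth_ge1 ?smooth_le0 ?subr0//; lra. Qed.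

Lemma ramp_average f e : {within `[a, b], continuous f} ->
  (forall x, a <= x <= b -> k * (x - a) < 1 -> `|f x - f a| <= e) ->
  (forall x, a <= x <= b -> k * (b - x) < 1 -> `|f x - f b| <= e) ->
  `|\int[mu]_(x in `[a, b]) (f x * dramp x) - (f a - f b)| <= e + e.
Proof.
move=> cf fa fb.
have hk := kab'.
have ab : a <= b by rewrite -subr_ge0 -(pmulr_rge0 _ k0) (le_trans ler01).
have cw c : {within `[a, b], continuous (fun x => k * dsmooth (k * x + c))}.
  exact/continuous_withinT/continuous_dsmooth_affine.
have one c : k * a + c <= 0 -> 1 <= k * b + c ->
    \int[mu]_(x in `[a, b]) (k * dsmooth (k * x + c)) = 1.
  move=> ca cb.
  have pc : prim setT (fun x => smooth (k * x + c)) (fun x => k * dsmooth (k * x + c)).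
    apply: prim_C1; last exact: continuous_dsmooth_affine.
    by move=> x; apply: is_derive_affine; exact: is_derive_smooth.
  by have [_ <-] := pc a b ab I I; rewrite smooth_ge1// smooth_le0// subr0.
have ci c : mu.-integrable `[a, b] (EFin \o (fun x => f x * (k * dsmooth (k * x + c)))).
  apply: continuous_compact_integrable; first exact: segment_compact.
  exact: within_continuousM.
have -> : \int[mu]_(x in `[a, b]) (f x * dramp x) =
    \int[mu]_(x in `[a, b]) (f x * (k * dsmooth (k * x + - (k * a)))) -
    \int[mu]_(x in `[a, b]) (f x * (k * dsmooth (k * x + (1 - k * b)))).
  by rewrite -RintegralB//; apply: eq_Rintegral => x _; rewrite /dramp mulrBr.
set X := \int[mu]_(x in _) _; set Y := \int[mu]_(x in _) _.
have -> : X - Y - (f a - f b) = (X - f a) - (Y - f b) by ring.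
apply: (le_trans (ler_normB _ _)); apply: lerD.
  apply: Rintegral_average => //; first by move=> x; rewrite mulr_ge0 ?dsmooth_ge0 ?ltW.
    by apply: one; lra.
  move=> x xab; have [xk _|xk] := ltP (k * (x - a)) 1; first exact: fa.
  by rewrite dsmooth_ge1 ?mulr0 ?eqxx//; lra.
apply: Rintegral_average => //; first by move=> x; rewrite mulr_ge0 ?dsmooth_ge0 ?ltW.
  by apply: one; lra.
move=> x xab; have [xk _|xk] := ltP (k * (b - x)) 1; first exact: fb.
by rewrite dsmooth_le0 ?mulr0 ?eqxx//; lra.
Qed.

End TestSequence.

(** The definition of weak derivative is tested on ramps of increasing slope: one side tends to
    [f a - f b] by continuity of [f], the other to minus the integral of [g] by dominated
    convergence. *)
Lemma is_wderiv_prim D f g : open D -> is_interval D -> {within D, continuous f} ->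
  is_wderiv D f g -> prim D f g.
Proof.
move=> oD iD cf [[mg _ lg] wd] a b ab Da Db.
have abD : `[a, b] `<=` D by move=> x /=; rewrite in_itv/=; exact: iD.
have ig : mu.-integrable `[a, b] (EFin \o g).
  apply/integrableP; split; last by apply: lg => //; exact: segment_compact.
  by apply/measurable_EFinP; apply: measurable_funS mg => //; exact: open_measurable.
split => //; move: ab; rewrite le_eqVlt => /predU1P[->|ab].
  by rewrite subrr set_itv1 Rintegral_set1.
have cfab : {within `[a, b], continuous f} by exact: continuous_subspaceW cf.
(* The summand [(b - a)^-1] guarantees [1 <= kk n * (b - a)] already for [n = 0]. *)
pose kk n : R := n%:R + (b - a)^-1.
have ba0 : 0 < b - a by rewrite subr_gt0.
have kk0 n : 0 < kk n by rewrite ltr_wpDl// invr_gt0.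
have kkab n : 1 <= kk n * (b - a).
  by rewrite mulrDl mulVf ?gt_eqF// lerDr mulr_ge0// ltW.
have kkbig d c : 0 < d -> \forall n \near \oo, c <= kk n * d.
  move=> d0; near=> n; rewrite -ler_pdivrMr//.
  apply: (@le_trans _ _ n%:R); last by rewrite lerDl invr_ge0 ltW.
  by near: n; exact: nbhs_infty_ger.
pose ph n x := smooth (kk n * x + - (kk n * a)) - smooth (kk n * x + (1 - kk n * b)).
pose dph n x := kk n * dsmooth (kk n * x + - (kk n * a)) - kk n * dsmooth (kk n * x + (1 - kk n * b)).
have dE n : derive1 (ph n) = dph n.
  by apply/funext => x; rewrite derive1E; have [_] := ramp_derive a b (kk n) x.
have tph n : test_function D (ph n) := ramp_test (kk0 n) (kkab n) abD.
have iph n : mu.-integrable `[a, b] (EFin \o (fun x => g x * ph n x)).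
  have -> : (fun x => g x * ph n x) = (fun x => ph n x * g x).
    by apply/funext => x; rewrite mulrC.
  have mph : measurable_fun (`[a, b] : set (measurableTypeR R)) (ph n).
    apply: measurable_funTS; apply: continuous_measurable_fun.
    exact: is_derive_continuous (fun x => ramp_derive a b (kk n) x).
  have bph : [bounded ph n x | x in `[a, b]].
    by exists 1; split => // N N1 x _; apply: le_trans (ltW N1); exact: ramp_le1.
  by have := @integrableMr _ _ _ mu _ (measurable_itv `[a, b]) (ph n) (EFin \o g) mph bph ig.
have eqn n : \int[mu]_(x in `[a, b]) (f x * dph n x) = - \int[mu]_(x in `[a, b]) (g x * ph n x).
  have := wd _ (tph n); rewrite dE.
  have ph0 x : ~ `[a, b]%classic x -> ph n x = 0 /\ dph n x = 0.
    exact: ramp_out (kk0 n) (kkab n) x.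
  rewrite (@integral_subset0 D `[a, b]) //; last first.
    by move=> x _ /ph0[_ ->]; rewrite mulr0.
  rewrite [in RHS](@integral_subset0 D `[a, b]) //; last by move=> x _ /ph0[-> _]; rewrite mulr0.
  move=> h; rewrite /Rintegral h fineN//.
have l1 : (\int[mu]_(x in `[a, b]) (g x * ph n x)) @[n --> \oo] --> \int[mu]_(x in `[a, b]) g x.
  (* At the end points all the ramps are 0, so the integrands converge to [g] only on the open
     interval. *)
  have oo h : mu.-integrable `[a, b] (EFin \o h) ->
      \int[mu]_(x in `[a, b]) h x = fine (\int[mu]_(x in `]a, b[) (h x)%:E).
    move=> ih; have iho : mu.-integrable `]a, b[ (EFin \o h).
      by apply: integrableS ih => //; exact: subset_itv_oo_cc.
    have [mh _] := integrableP _ _ _ iho.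
    by rewrite /Rintegral (@integral_itv_bndoo R a b (fun x => (h x)%:E) true false mh).
  have oo_sub : `]a, b[%classic `<=` `[a, b]%classic by exact: subset_itv_oo_cc.
  rewrite oo//; under eq_fun do rewrite oo//.
  have igo : mu.-integrable `]a, b[ (EFin \o g) by exact: integrableS ig.
  apply: fine_cvg; rewrite fineK; last exact: integrable_fin_num.
  apply: (@dominated_cvg _ _ _ mu _ (measurable_itv `]a, b[)
    (fun n x => (g x * ph n x)%:E) (fun x => (g x)%:E) (fun x => `|g x|%:E)) => //.
  - move=> n; have iho : mu.-integrable `]a, b[ (EFin \o (fun x => g x * ph n x)).
      by apply: integrableS (iph n).
    by case/integrableP: iho.
  - move=> x; rewrite /= in_itv/= => /andP[ax xb]; apply: cvg_near_cst.
    near=> n; rewrite [ph n x]ramp_plateau ?mulr1//.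
      by near: n; apply: kkbig; rewrite subr_gt0.
    by near: n; apply: kkbig; rewrite subr_gt0.
  - exact: integrable_normr.
  - move=> n x _; rewrite lee_fin normrM ler_piMr//; exact: ramp_le1.
have l2 : (\int[mu]_(x in `[a, b]) (f x * dph n x)) @[n --> \oo] --> f a - f b.
  apply/cvgrPdist_le => e e0; have e2 : 0 < e / 2 by rewrite divr_gt0.
  have [|d1 d10 h1] := (withinP _ _).1 cfab a _ _ e2; first by rewrite /= in_itv/= lexx ltW.
  have [|d2 d20 h2] := (withinP _ _).1 cfab b _ _ e2; first by rewrite /= in_itv/= lexx ltW.
  near=> n; rewrite distrC [e]splitr; apply: ramp_average => //.
    move=> x xab kx; apply/ltW/h1 => //; move: xab => /andP[ax xb].
    rewrite ger0_norm ?subr_ge0// -(ltr_pM2l (kk0 n)); apply: (lt_le_trans kx).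
    by near: n; exact: kkbig.
  move=> x xab kx; apply/ltW/h2 => //; move: xab => /andP[ax xb].
  rewrite distrC ger0_norm ?subr_ge0// -(ltr_pM2l (kk0 n)); apply: (lt_le_trans kx).
  by near: n; exact: kkbig.
have l3 : (\int[mu]_(x in `[a, b]) (f x * dph n x)) @[n --> \oo] --> - \int[mu]_(x in `[a, b]) g x.
  by under eq_fun do rewrite eqn; exact: cvgN.
have E : f a - f b = - \int[mu]_(x in `[a, b]) g x by apply: (cvg_unique _ l2 l3).
by rewrite -[RHS]opprK -E opprB.
Unshelve. all: by end_near. Qed.

Lemma integrable_sqr_itv (g : R -> R) a b : measurable_fun setT g ->
  (\int[mu]_(x in `[a, b]) (g x ^+ 2)%:E < +oo)%E -> mu.-integrable `[a, b] (EFin \o g).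
Proof.
move=> mg g2.
have mg' : measurable_fun (`[a, b] : set (measurableTypeR R)) g by exact: measurable_funTS.
have i1 : mu.-integrable `[a, b] (EFin \o (fun x => g x ^+ 2)).
  apply/integrableP; split; first by apply/measurable_EFinP; exact: measurable_funX.
  by under eq_integral do rewrite /= ger0_norm ?sqr_ge0//.
have i2 : mu.-integrable `[a, b] (EFin \o (fun x => 1 + g x ^+ 2)).
  have ic : mu.-integrable `[a, b] (EFin \o (fun=> 1 : R)).
    by apply: continuous_compact_integrable; [exact: segment_compact|move=> x; exact: cvg_cst].
  by have := integrableD _ ic i1; apply.
apply: le_integrable i2 => //; first exact/measurable_EFinP.
move=> x _; rewrite lee_fin [leRHS]ger0_norm ?addr_ge0 ?sqr_ge0//.
by rewrite ler_norml; apply/andP; split; nra.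
Qed.

(** The difference [H] between [f] and the integral of [g] is constant in the interior, and both are
    continuous up to the ends. Integrability of [g] near the ends must be supplied, since [prim D]
    says nothing there. *)
Lemma prim_extend I D f g : is_interval I -> {within I, continuous f} ->
  (forall a b x, I a -> I b -> a < x < b -> D x) -> prim D f g ->
  (forall a b, I a -> I b -> mu.-integrable `[a, b] (EFin \o g)) ->
  prim I f g.
Proof.
move=> iI cf ID pf ig a b ab Ia Ib; split; first exact: ig.
move: ab; rewrite le_eqVlt => /predU1P[->|ab].
  by rewrite subrr set_itv1 Rintegral_set1.
have iab := ig _ _ Ia Ib.
have Iab x : a <= x <= b -> I x by exact: iI.
pose H x := f x - \int[mu]_(t in `[a, x]) g t.
suff : H b = H a by rewrite /H set_itv1 Rintegral_set1 subr0 => <-; ring.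
have cH x e : a <= x <= b -> 0 < e -> exists2 d : R, 0 < d &
    forall y, a <= y <= b -> `|y - x| < d -> `|H y - H x| < e.
  move=> xab e0; have e2 : 0 < e / 2 by rewrite divr_gt0.
  have [d1 d10 h1] := (withinP _ _).1 cf x (Iab _ xab) _ e2.
  have cP := parameterized_integral_continuous (ltW ab) iab.
  have [d2 d20 h2] := (withinP _ _).1 cP x xab _ e2.
  exists (Num.min d1 d2); first by rewrite lt_min d10.
  move=> y yab; rewrite lt_min => /andP[y1 y2].
  have := h1 y (Iab _ yab) y1; have := h2 y yab y2; rewrite /parameterized_integral /H.
  rewrite !ltr_norml; lra.
have Hc x y : a < x -> x <= y -> y < b -> H y = H x.
  move=> ax xy yb; rewrite /H (Rintegral_cat (ltW ax) xy); last first.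
    by apply: integrable_sub_itv iab => //; exact: ltW.
  have [||_ fE] := pf x y xy.
  - by apply: (ID _ _ _ Ia Ib); rewrite ax (le_lt_trans xy).
  - by apply: (ID _ _ _ Ia Ib); rewrite yb (lt_le_trans ax).
  rewrite -fE; ring.
apply/eqP; rewrite -subr_eq0 -normr_eq0 eq_le normr_ge0 andbT.
apply/ler_addgt0Pl => e e0; rewrite addr0.
have e2 : 0 < e / 2 by rewrite divr_gt0.
have [|d1 d10 h1] := cH a _ _ e2; first by rewrite lexx ltW.
have [|d2 d20 h2] := cH b _ _ e2; first by rewrite lexx ltW.
pose m := (a + b) / 2.
(* Cut off at the midpoint [m], so that [x <= y] whatever [d1] and [d2] are. *)
pose x := Num.min m (a + d1 / 2); pose y := Num.max m (b - d2 / 2).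
have ax : a < x by rewrite lt_min /m; apply/andP; split; lra.
have yb : y < b by rewrite gt_max /m; apply/andP; split; lra.
have xm : x <= m by rewrite ge_min lexx.
have my : m <= y by rewrite le_max lexx.
have xd : x <= a + d1 / 2 by rewrite ge_min lexx orbT.
have yd : b - d2 / 2 <= y by rewrite le_max lexx orbT.
have xab : a <= x <= b by lra.
have yab : a <= y <= b by lra.
have := Hc x y ax (le_trans xm my) yb.
have := h1 x xab; have := h2 y yab.
rewrite !ltr_norml ler_norml => h3 h4 h5.
have /andP[h6 h7] : - (e / 2) < H y - H b < e / 2 by apply: h3; clear -yd yb d20; lra.
have /andP[h8 h9] : - (e / 2) < H x - H a < e / 2 by apply: h4; clear -xd ax d10; lra.
by clear -h5 h6 h7 h8 h9; lra.
Qed.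

End WeakDerivatives.

(** * Walks, cuts and networks *)

Section Walks.
Context {R : realType} (G : metric_graph R).
Local Notation V := (vertex G).
Local Notation E := (edge G).
Implicit Types (x y z v w : V) (e : E) (a c : E * bool) (p q r : seq (E * bool)).

Definition src a := if a.2 then tail a.1 else head a.1.
Definition dst a := if a.2 then head a.1 else tail a.1.
Definition arc_rev a := (a.1, ~~ a.2).

Lemma src_rev a : src (arc_rev a) = dst a. Proof. by case: a => e []. Qed.
Lemma dst_rev a : dst (arc_rev a) = src a. Proof. by case: a => e []. Qed.
Lemma arc_revK : involutive arc_rev. Proof. by case=> e []. Qed.

Lemma same_edge a c : a.1 = c.1 -> a = c \/ a = arc_rev c.
Proof. by case: a c => [e []] [f []] /= ->; [left|right|right|left]. Qed.

Fixpoint walk x p y :=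
  if p is a :: p' then (src a == x) && walk (dst a) p' y else x == y.

Lemma walk_cat x p q y :
  walk x (p ++ q) y <-> exists2 z, walk x p z & walk z q y.
Proof.
elim: p x => [|a p IH] x /=; first by split=> [h|[z /eqP -> //]]; exists x.
split=> [/andP[-> /IH[z pz qz]]|[z /andP[-> pz] qz]]; first by exists z.
by apply/IH; exists z.
Qed.

Lemma walk_rcons x p a y :
  walk x p (src a) -> dst a = y -> walk x (rcons p a) y.
Proof.
by move=> h <-; rewrite -cats1; apply/walk_cat; exists (src a) => //=; rewrite !eqxx.
Qed.

Lemma walk_mid x p a q y : walk x (p ++ a :: q) y -> walk x p (src a) /\ walk (dst a) q y.
Proof. by move=> /walk_cat[z pz /= /andP[/eqP az wq]]; rewrite az. Qed.

Lemma reach_arc A v a : A a.1 -> reach A v (src a) -> reach A v (dst a).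
Proof. by case: a => e []/=; [exact: reach_fwd|exact: reach_bwd]. Qed.

Lemma reach_trans A u v w : reach A u v -> reach A v w -> reach A u w.
Proof.
move=> uv; elim=> // [e Ae _ h|e Ae _ h]; [exact: reach_fwd|exact: reach_bwd].
Qed.

Lemma reach_sym A u v : reach A u v -> reach A v u.
Proof.
elim=> [|e Ae _|e Ae _]; first exact: reach_refl.
  by apply: reach_trans; exact: reach_bwd Ae (reach_refl _ _).
by apply: reach_trans; exact: reach_fwd Ae (reach_refl _ _).
Qed.

Lemma reach_walk A x y : reach A x y -> exists2 p, walk x p y & forall a, a \in p -> A a.1.
Proof.
elim=> [|e Ae _ [p wp Ap]|e Ae _ [p wp Ap]]; first by exists [::] => //=.
  exists (rcons p (e, true)); first exact: walk_rcons.
  by move=> a; rewrite mem_rcons inE => /predU1P[->//|]; exact: Ap.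
exists (rcons p (e, false)); first exact: walk_rcons.
by move=> a; rewrite mem_rcons inE => /predU1P[->//|]; exact: Ap.
Qed.

Lemma reach_ind_arc A v (Q : V -> Prop) : Q v ->
  (forall c, A c.1 -> Q (src c) -> Q (dst c)) -> forall w, reach A v w -> Q w.
Proof. by move=> Qv QA w; elim=> // e Ae _; [apply: (QA (e, true))|apply: (QA (e, false))]. Qed.

Lemma walk_exit (Q : V -> Prop) x p y : walk x p y -> Q x -> ~ Q y ->
  exists p1 a p2, [/\ p = p1 ++ a :: p2, Q (src a) & ~ Q (dst a)].
Proof.
elim: p x => [|a p IH] x /=; first by move=> /eqP ->.
move=> /andP[/eqP <- wp] Qa Qy; have [Qd|Qd] := pselect (Q (dst a)); last by exists [::], a, p.
by have [p1 [c [p2 [-> Qc Qdc]]]] := IH _ wp Qd Qy; exists (a :: p1), c, p2.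
Qed.

Lemma walk_dst x p y a : walk x p y -> a \in p -> dst a \in rcons (map src p) y.
Proof.
elim: p x => // c p IH x /= /andP[_ wp]; rewrite inE => /predU1P[->|ap].
  case: p {IH} wp => [/eqP ->|b p /=/andP[/eqP -> _]]; rewrite !inE eqxx ?orbT//.
by rewrite inE (IH _ wp ap) orbT.
Qed.

Lemma walk_simple x p y : walk x p y -> exists q, [/\ walk x q y,
  {subset q <= p} & uniq (rcons (map src q) y)].
Proof.
elim: p x => [|a p IH] x /=; first by move=> h; exists [::].
move=> /andP[/eqP ax /IH[q [wq qp uq]]].
have [xq|xq] := boolP (x \in rcons (map src q) y); last first.
  exists (a :: q); rewrite /= ax eqxx xq; split => // c; rewrite !inE.
  by case/orP => [->//|/qp ->]; rewrite orbT.
move: xq; rewrite mem_rcons inE => /predU1P[->|/mapP[c cq xc]].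
  by exists [::]; split => //=; rewrite eqxx.
move: cq wq uq qp => /(splitPr) [q1 q2] /walk_mid[_ wq2] uq qp.
exists (c :: q2); split => /=; first by rewrite xc eqxx.
  by move=> b bq; rewrite inE qp ?orbT// mem_cat bq orbT.
move: uq; rewrite map_cat rcons_cat cat_uniq => /and3P[_ _].
by [].
Qed.

(** If an edge is used again, in the same or in the opposite direction, then the source of its first
    arc is met again. *)
Lemma simple_uniq_edges x p y : walk x p y -> uniq (rcons (map src p) y) ->
  uniq (map fst p).
Proof.
elim: p x => // a p IH x /= /andP[_ wp] /andP[ap up].
rewrite (IH _ wp up) andbT; apply/negP => /mapP[c cp ac].
move/negP: ap; apply; have [->|->] := same_edge ac.
  by rewrite mem_rcons inE map_f ?orbT.
by rewrite src_rev; exact: walk_dst wp cp.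
Qed.

Lemma uniq_edges_inj p a c : uniq (map fst p) -> a \in p -> c \in p -> a.1 = c.1 -> a = c.
Proof.
elim: p => // b p IH /= /andP[bp up]; rewrite !inE.
move=> /predU1P[->|ap] /predU1P[->|cp] // ac.
- by move: bp; rewrite ac map_f.
- by move: bp; rewrite -ac map_f.
- exact: IH.
Qed.

End Walks.

(** * Two edge-disjoint paths to a set of vertices: Menger's theorem by augmentation *)

Section Menger.
Context {R : realType} (G : metric_graph R).
Local Notation V := (vertex G).
Local Notation E := (edge G).
Variables (x : V) (B : set V).
Implicit Types (y z v w : V) (e : E) (a c : E * bool) (p q r : seq (E * bool)).

Section Residual.
Variables (P : seq (E * bool)) (b : V).
Hypotheses (wP : walk x P b) (uP : uniq (map fst P)) (Bb : B b).

Let residual a := (a.1 \notin map fst P) || (arc_rev a \in P).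

(** The flow along an augmenting path, kept as two edge-disjoint walks: [p] has reached [B], and [q]
    has followed the residual walk up to [v]. Containment in [P ++ r1] ensures that an edge met
    again is an edge of [P], now traversed the other way. *)
Lemma augment r1 r2 v z : walk v r2 z -> uniq (map fst (r1 ++ r2)) ->
  all residual r2 ->
  (exists p q y, [/\ walk x p y, B y, walk x q v, uniq (map fst (p ++ q)) &
     {subset p ++ q <= P ++ r1}]) ->
  exists p q y, [/\ walk x p y, B y, walk x q z, uniq (map fst (p ++ q)) &
     {subset p ++ q <= P ++ (r1 ++ r2)}].
Proof.
elim: r2 r1 v => [|a r2 IH] r1 v /=.
  by move=> /eqP <- _ _ h; rewrite cats0.
move=> /andP[/eqP av wr] ur /andP[La Lr] [p [q [y [wp By wq upq sub]]]].
rewrite -cat_rcons; apply: (IH _ _ wr) => //; first by rewrite cat_rcons.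
have ar1 : a.1 \notin map fst r1.
  move: ur; rewrite map_cat cat_uniq => /and3P[_ /hasPn h _].
  by apply: h; rewrite inE eqxx.
(* The residual walk does not repeat edges, so [c] comes from [P]; and [a] is residual over an edge
   of [P] only as the reverse of its arc. *)
have old c : c \in p ++ q -> c.1 = a.1 -> c = arc_rev a.
  move=> /sub; rewrite mem_cat => /orP[cP ca|cr ca]; last first.
    by move: ar1; rewrite -ca map_f.
  move: La; rewrite /residual -ca map_f//= => raP.
  by apply: (uniq_edges_inj uP).
have sub' c : c \in p ++ q -> c \in P ++ rcons r1 a.
  by move=> /sub; rewrite !mem_cat mem_rcons inE => /orP[->//|->]; rewrite !orbT.
have [/mapP[c cpq ac]|anpq] := boolP (a.1 \in map fst (p ++ q)); last first.
  exists p, (rcons q a), y; split => //.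
  - by apply: walk_rcons; rewrite ?av.
  - by rewrite -rcons_cat map_rcons rcons_uniq anpq.
  - move=> c; rewrite -rcons_cat mem_rcons inE => /predU1P[->|]; last exact: sub'.
    by rewrite mem_cat mem_rcons inE eqxx orbT.
have ca := old _ cpq (esym ac).
move: (cpq); rewrite mem_cat => /orP[cp|cq].
  (* The new arc cancels one of [p]: the walk [q] continues with the rest of [p] up to [B], and the
     beginning of [p] becomes the new partial walk. *)
  case/splitPr: cp wp upq sub' {sub old cpq} => p1 p2 /walk_mid[wp1 wp2] upq sub'.
  rewrite ca src_rev in wp1; rewrite ca dst_rev av in wp2.
  exists (q ++ p2), p1, y; split => //.
  - by apply/walk_cat; exists v.
  - have pE : perm_eq ((q ++ p2) ++ p1) ((p1 ++ p2) ++ q).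
      by apply/permP => pr; rewrite !count_cat addnC (addnC (count pr q)) addnA.
    rewrite (perm_uniq (perm_map _ pE)); move: upq; apply: subseq_uniq.
    apply: map_subseq; apply: cat_subseq => //; apply: cat_subseq => //.
    exact: subseq_cons.
  - move=> d; rewrite !mem_cat => dd; have := sub' d; rewrite !mem_cat inE; apply.
    by case/orP: dd => [/orP[]|] ->; rewrite ?orbT.
(* The new arc undoes one of [q] itself, which is simply cut back to that point. *)
case/splitPr: cq wq upq sub' {sub old cpq} => q1 q2 /walk_mid[wq1 wq2] upq sub'.
rewrite ca src_rev in wq1.
exists p, q1, y; split => //.
- move: upq; apply: subseq_uniq; apply: map_subseq.
  by apply: cat_subseq => //; exact: prefix_subseq.
- move=> d; rewrite mem_cat => dd; apply: sub'; rewrite !mem_cat.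
  by case/orP: dd => ->; rewrite ?orbT.
Qed.

Let S v := exists2 p, walk x p v & all residual p.

Lemma S_arc a : S (src a) -> residual a -> S (dst a).
Proof.
move=> [p wp Lp] La; exists (rcons p a); first exact: walk_rcons.
by rewrite all_rcons La.
Qed.

Lemma S_back u q v : walk u q v -> {subset q <= P} -> S v -> S u.
Proof.
elim: q u => [|c q IH] u /=; first by move=> /eqP ->.
move=> /andP[/eqP <- wq] qP Sv; rewrite -dst_rev; apply: S_arc.
  by rewrite src_rev; apply: IH wq _ Sv => d dq; apply: qP; rewrite inE dq orbT.
by rewrite /residual arc_revK qP ?orbT// inE eqxx.
Qed.

(** The cut is the edge of an arc [a] by which [P] leaves the residually reachable set [S]. Any
    other arc leaving [S] would be an arc of [P]. Before [a] this is impossible, as [P] can be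
    followed backwards from the source of [a]; after [a], following [P] backwards would bring the
    target of [a] into [S]. *)
Lemma S_cut : ~ S b -> exists e, forall w, reach (~` [set e]) x w -> S w.
Proof.
move=> Sb.
have [p1 [a [p2 [PE Sa Sda]]]] := walk_exit wP (ex_intro2 _ _ [::] (eqxx x) isT : S x) Sb.
move: (wP); rewrite PE => /walk_mid[_ wp2].
exists a.1; apply: reach_ind_arc; first by exists [::] => //=.
move=> c ca Sc; have [Lc|] := boolP (residual c); first exact: S_arc.
rewrite negb_or negbK => /andP[/mapP[d dP cd] rcP].
have cP : c \in P.
  by have [->//|cE] := same_edge cd; move: rcP; rewrite cE arc_revK dP.
move: cP; rewrite PE mem_cat inE => /or3P[cp|/eqP cE|cp]; last 2 first.
- by case: ca; rewrite cE.
- case/splitPr: cp PE wp2 => p21 p22 PE /walk_mid[w1 _]; exfalso; apply: Sda.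
  by apply: S_back w1 _ Sc => d' d'p; rewrite PE !(mem_cat, inE) d'p !orbT.
case/splitPr: cp PE => p11 p12 PE.
move: (wP); rewrite PE => /walk_mid[/walk_mid[_ w1] _].
by apply: S_back w1 _ Sa => d' d'p; rewrite PE !(mem_cat, inE) d'p !orbT.
Qed.

End Residual.

Lemma menger : (exists2 b, B b & reach setT x b) ->
  (forall e, exists2 b, B b & reach (~` [set e]) x b) ->
  exists p q y z, [/\ walk x p y, walk x q z, B y, B z & uniq (map fst (p ++ q))].
Proof.
move=> [b Bb /reach_walk[p0 /walk_simple[P [wP _ /(simple_uniq_edges wP) uP]] _]] nocut.
pose residual a := (a.1 \notin map fst P) || (arc_rev a \in P).
have [[z [r wr Lr] Bz]|nz] := pselect (exists2 z, exists2 r, walk x r z & all residual r & B z).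
  have [r' [wr' sr' ur']] := walk_simple wr.
  have [||p [q [y [wp By wq upq _]]]] :=
    augment (r1 := [::]) uP wr' (simple_uniq_edges wr' ur').
  - by apply/allP => a /sr' ar; move/allP: Lr; apply.
  - by exists P, [::], b; split => //=; rewrite ?cats0.
  by exists p, q, y, z.
have [|e cut] := S_cut wP; first by move=> Sb; apply: nz; exists b.
have [b' Bb' /cut Sb'] := nocut e.
by exfalso; apply: nz; exists b'.
Qed.

End Menger.

(** * Cut edges and their behaviour under subdivision *)

Section Subdivision.
Context {R : realType} (G : metric_graph R) (e0 : edge G).

(* [e0] is split by the new vertex [None] into [Some e0], from its tail, and
   [None], to its head; the lengths play no role. *)
Definition subdiv : metric_graph R :=
  @MetricGraph R (option (vertex G)) (option (edge G))
    (fun o => if o is Some e then Some (tail e) else None)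
    (fun o => if o is Some e then if e == e0 then None else Some (head e)
              else Some (head e0))
    (fun o => len (odflt e0 o)).

Implicit Types (v w : vertex G) (e f : edge G) (h k : edge subdiv).

Definition base h : edge G := odflt e0 h.

Lemma reach_subdiv h v w : reach (~` [set base h]) v w ->
  reach (~` [set h]) (Some v : vertex subdiv) (Some w).
Proof.
elim=> [|e ne _ IH|e ne _ IH]; first exact: reach_refl.
- have [ee0|ee0] := eqVneq e e0.
    have n1 : (~` [set h]) (Some e : edge subdiv) by move=> /= hE; apply: ne; rewrite /base -hE.
    have n2 : (~` [set h]) (None : edge subdiv) by move=> /= hE; apply: ne; rewrite /base -hE ee0.
    have := reach_fwd n1 IH; rewrite /= ee0 eqxx => IH'.
    exact: (reach_fwd n2 IH').
  have n1 : (~` [set h]) (Some e : edge subdiv) by move=> /= hE; apply: ne; rewrite /base -hE.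
  by have := reach_fwd n1 IH; rewrite /= (negbTE ee0).
- have [ee0|ee0] := eqVneq e e0.
    have n1 : (~` [set h]) (Some e : edge subdiv) by move=> /= hE; apply: ne; rewrite /base -hE.
    have n2 : (~` [set h]) (None : edge subdiv) by move=> /= hE; apply: ne; rewrite /base -hE ee0.
    rewrite ee0 in IH.
    have IH' : reach (~` [set h]) (Some v) (None : vertex subdiv) := reach_bwd n2 IH.
    have hN : (None : vertex subdiv) = head (Some e : edge subdiv) by rewrite /= ee0 eqxx.
    by rewrite hN in IH'; exact: (reach_bwd n1 IH').
  have n1 : (~` [set h]) (Some e : edge subdiv) by move=> /= hE; apply: ne; rewrite /base -hE.
  apply: (reach_bwd n1); rewrite /= (negbTE ee0); exact: IH.
Qed.

End Subdivision.

Definition subdiv_set (R : realType) (G : metric_graph R) (e0 : edge G) (B : set (vertex G)) :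
  set (vertex (subdiv e0)) := Some @` B.
Arguments subdiv_set {R G} e0 B.

Section Cuts.
Context {R : realType}.
Implicit Types (G : metric_graph R).

(** When [B] consists of [Z] and of the vertices at infinity, an edge with a dead vertex is an edge
    of [Fedges]. The set is a parameter because maximum points get added to it, and because it moves
    to subdivisions. *)
Definition dead G (B : set (vertex G)) (e : edge G) (s : vertex G) :=
  forall b, B b -> ~ reach (~` [set e]) s b.

(** What remains of the condition that [Fedges] has at most one edge after a subdivision of this
    edge: both halves are then cut edges, but the regions that they cut off still overlap in this
    sense. *)
Definition nested G (B : set (vertex G)) := forall e f s t, dead B e s -> dead B f t ->
  reach (~` [set e]) s t \/ reach (~` [set f]) t s.

Lemma dead_subdiv G (e0 : edge G) B (h : edge (subdiv e0)) v :
  dead (subdiv_set e0 B) h (Some v : vertex (subdiv e0)) -> dead B (base h) v.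
Proof. by move=> dh b Bb /reach_subdiv; apply: dh; exists b. Qed.

Lemma half_edge G (e0 : edge G) (j : edge (subdiv e0)) : base j = e0 ->
  exists v, forall A : set (edge (subdiv e0)), A j -> @reach R (subdiv e0) A None (Some v).
Proof.
case: j => [e /= ->|_].
  exists (tail e0) => A Aj.
  have hN : (None : vertex (subdiv e0)) = head (Some e0 : edge (subdiv e0)) by rewrite /= eqxx.
  have := @reach_refl R (subdiv e0) A None; rewrite {2}hN => h.
  exact: (reach_bwd Aj h).
exists (head e0) => A Aj; exact: (reach_fwd Aj (@reach_refl R (subdiv e0) A None)).
Qed.

Lemma half_other G (e0 : edge G) (h k : edge (subdiv e0)) :
  (exists j, [/\ base j = e0, j <> h & j <> k]) \/ [/\ base h = e0, base k = e0 & h <> k].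
Proof.
pose a : edge (subdiv e0) := Some e0; pose b : edge (subdiv e0) := None.
have [ha|ha] := pselect (h = a); have [kb|kb] := pselect (k = b).
- by right; rewrite ha kb.
- by left; exists b; split => //; [rewrite ha|move/esym].
- have [ka|ka] := pselect (k = a); first by rewrite ka in kb.
  by left; exists a; split => //; [move/esym|move/esym].
have [ka|ka] := pselect (k = a).
  have [hb|hb] := pselect (h = b); first by right; rewrite hb ka.
  by left; exists b; split => //; move/esym.
by left; exists a; split => //; move/esym.
Qed.

Lemma nested_subdiv G (e0 : edge G) (B : set (vertex G)) :
  nested B -> nested (subdiv_set e0 B).
Proof.
move=> nB.
have mixed (h k : edge (subdiv e0)) s : dead (subdiv_set e0 B) h (Some s : vertex (subdiv e0)) ->
    dead (subdiv_set e0 B) k (None : vertex (subdiv e0)) ->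
    reach (~` [set h]) (Some s : vertex (subdiv e0)) None \/
    reach (~` [set k]) (None : vertex (subdiv e0)) (Some s).
  move=> dh dk.
  have ds := dead_subdiv dh.
  (* If a half of [e0] survives both cuts, the new vertex can be traded for the end of [e0] on that
     half. Otherwise [h] and [k] are the two halves: both cuts lie over [e0], and the cut at [k]
     leaves the half [h]. *)
  have [[j [je jh jk]]|[he ke hk]] := half_other h k.
    have [v vj] := half_edge je.
    have dv : dead B (base k) v.
      apply: dead_subdiv => b Bb rb; apply: (dk b Bb); apply: reach_trans rb.
      exact: vj.
    have [/reach_subdiv sv|/reach_subdiv vs] := nB _ _ _ _ ds dv; [left|right].
      by apply: reach_trans sv _; apply: reach_sym; exact: vj.
    by apply: reach_trans vs; exact: vj.
  have [v vh] := half_edge he.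
  have dv : dead B (base k) v.
    apply: dead_subdiv => b Bb rb; apply: (dk b Bb); apply: reach_trans rb.
    exact: vh.
  right; have nk := vh (~` [set k]) hk; apply: (reach_trans nk).
  apply: reach_subdiv; rewrite ke; rewrite he in ds; rewrite ke in dv.
  by have [/reach_sym|] := nB _ _ _ _ ds dv.
move=> h k [s|] [t|] dh dk.
- by have [/reach_subdiv|/reach_subdiv] := nB _ _ _ _ (dead_subdiv dh) (dead_subdiv dk); [left|right].
- exact: mixed.
- by have [|] := mixed _ _ _ dk dh; [right|left].
- by left; exact: reach_refl.
Qed.

Lemma nodead_subdiv G (e0 : edge G) (B : set (vertex G)) :
  (forall e s, ~ dead B e s) ->
  forall (h : edge (subdiv e0)) s, ~ dead (subdiv_set e0 B) h s.
Proof.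
move=> nB h [s|] dh; first exact: nB (dead_subdiv dh).
have [[j [je jh _]]|[_ _ //]] := half_other h h.
have [v vj] := half_edge je.
apply: (nB (base h) v); apply: dead_subdiv => b Bb rb; apply: (dh b Bb).
by apply: reach_trans rb; exact: vj.
Qed.

End Cuts.

(** * Discrete potentials and the two-path bound *)

Section Networks.
Context {R : realType}.
Implicit Types (G : metric_graph R).

(** A potential vanishing on [B], with [W] as capacities and [T] as their total. Bounding all finite
    duplicate-free sums gives the total a meaning on an infinite graph. *)
Definition network G (B : set (vertex G)) (P : vertex G -> R) (W : edge G -> R) (T : R) :=
  [/\ forall e, `|P (head e) - P (tail e)| <= W e, forall v, B v -> P v = 0 &
      forall s, uniq s -> \sum_(e <- s) W e <= T].

Lemma le_walk G (P : vertex G -> R) (W : edge G -> R) x p y :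
  (forall e, `|P (head e) - P (tail e)| <= W e) -> walk x p y ->
  `|P y - P x| <= \sum_(a <- p) W a.1.
Proof.
move=> PW; elim: p x => [|a p IH] x /=; first by move=> /eqP ->; rewrite subrr normr0 big_nil.
move=> /andP[/eqP <- /IH h]; rewrite big_cons.
have -> : P y - P (src a) = (P (dst a) - P (src a)) + (P y - P (dst a)) by ring.
apply: (le_trans (ler_normD _ _)); apply: lerD => //.
by case: a {h} => e []; rewrite /src /dst/=; [exact: PW|rewrite distrC; exact: PW].
Qed.

Lemma network_bound G B P W T x : @network G B P W T -> B !=set0 ->
  (forall v w, reach [set: edge G] v w) -> (forall e, ~ dead B e x) -> 2 * `|P x| <= T.
Proof.
move=> [PW PB WT] [b0 Bb0] conn ndead.
have [||p [q [y [z [wp wq By Bz upq]]]]] := @menger _ G x B.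
- by exists b0.
- move=> e; apply: contrapT => h; apply: (ndead e) => b Bb rb; apply: h.
  by exists b.
have := le_walk PW wp; have := le_walk PW wq.
rewrite (PB _ By) (PB _ Bz) !sub0r !normrN.
have := WT _ upq; rewrite map_cat big_cat/= !big_map; lra.
Qed.

Lemma ler_sum_subset (I : eqType) (f : I -> R) (s t : seq I) :
  (forall i, 0 <= f i) -> uniq s -> {subset s <= t} ->
  \sum_(i <- s) f i <= \sum_(i <- t) f i.
Proof.
move=> f0; elim: s t => [|a s IH] t /=; first by move=> _ _; rewrite big_nil sumr_ge0.
move=> /andP[as_ us] st; have at_ : a \in t by apply: st; rewrite inE eqxx.
rewrite big_cons (perm_big _ (perm_to_rem at_)) big_cons lerD2l; apply: IH => // c cs.
have ct : c \in t by apply: st; rewrite inE cs orbT.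
have := perm_mem (perm_to_rem at_) c; rewrite ct inE => /esym/predU1P[ca|//].
by move: as_; rewrite -ca cs.
Qed.

Lemma network_subdiv G (e0 : edge G) B P W T y W1 W2 : @network G B P W T ->
  W1 + W2 <= W e0 -> `|y - P (tail e0)| <= W1 -> `|P (head e0) - y| <= W2 ->
  network (subdiv_set e0 B) (fun o => oapp P y o)
    (fun o => if o is Some e then if e == e0 then W1 else W e else W2) T.
Proof.
move=> [PW PB WT] W12 y1 y2; split.
- by case=> [e|] //=; case: eqVneq => [->|_] /=.
- by move=> _ [b Bb <-]; exact: PB.
move=> s us.
set W' := (fun o : edge (subdiv e0) => _).
have W10 : 0 <= W1 by exact: le_trans (normr_ge0 _) y1.
have W20 : 0 <= W2 by exact: le_trans (normr_ge0 _) y2.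
have W0 e : 0 <= W e by exact: le_trans (normr_ge0 _) (PW e).
(* A finite family of new edges is compared with the old edges below it, where [e0] is always
   counted, once, to pay for both halves. *)
pose s2 := [seq e <- undup (pmap id s) | e != e0].
have us2 : uniq (e0 :: s2).
  by rewrite /= mem_filter eqxx/= filter_uniq// undup_uniq.
apply: le_trans (WT _ us2).
have sub : {subset s <= [:: None, Some e0 & map Some s2]}.
  move=> [e|]; rewrite !inE//= => es; have [->|ee0] := eqVneq e e0; first by rewrite eqxx.
  apply/orP; right; apply: map_f; rewrite mem_filter ee0 mem_undup mem_pmap.
  by rewrite map_id.
apply: (le_trans (ler_sum_subset _ us sub)); first by case=> [e|] /=; [case: eqP|].
rewrite !big_cons big_map /W'/= eqxx addrA.
apply: lerD; first by rewrite addrC.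
rewrite big_seq [leRHS]big_seq; apply: ler_sum => e.
by rewrite mem_filter => /andP[/negbTE ->].
Qed.

(* Each extremal point is in the boundary of the other's network, so that by
   nestedness the two cannot both be cut off. *)
Lemma nested_networks G B P W T P' W' T' s t : @network G B P W T -> network B P' W' T' ->
  P t = 0 -> P' s = 0 -> B !=set0 -> (forall v w, reach [set: edge G] v w) ->
  nested B -> 2 * `|P s| <= T \/ 2 * `|P' t| <= T'.
Proof.
move=> [PW PB WT] [PW' PB' WT'] Pt Ps [b0 Bb0] conn nB.
have net : network (B `|` [set t]) P W T.
  by split => // v [/PB//|->].
have net' : network (B `|` [set s]) P' W' T'.
  by split => // v [/PB'//|->].
have [h|h] := pselect (forall e, ~ dead (B `|` [set t]) e s).
  by left; apply: (network_bound net) => //; exists b0; left.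
have [h'|h'] := pselect (forall e, ~ dead (B `|` [set s]) e t).
  by right; apply: (network_bound net') => //; exists b0; left.
exfalso; apply: h => e de; apply: h' => f df.
have deB : dead B e s by move=> b Bb; apply: de; left.
have dfB : dead B f t by move=> b Bb; apply: df; left.
have [st|ts] := nB e f s t deB dfB.
  by apply: (de t) => //; right.
by apply: (df s) => //; right.
Qed.

End Networks.

(** * The phase function *)

Section Potential.
Context {R : realType}.
Local Notation mu := (@lebesgue_measure R).
Variables (p lambda : R).
Hypotheses (hp : 2 < p) (hlambda : 0 < lambda).

Let p0 : 0 < p. Proof. by apply: lt_trans hp. Qed.
Let p20 : 0 < p - 2. Proof. by rewrite subr_gt0. Qed.

Definition peak : R := (lambda * p / 2) `^ (p - 2)^-1.

Lemma peak_gt0 : 0 < peak.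
Proof. by rewrite /peak powR_gt0// divr_gt0// mulr_gt0. Qed.

Lemma peak_powR : peak `^ (p - 2) = lambda * p / 2.
Proof.
rewrite /peak -powRrM mulVf ?gt_eqF// powRr1//.
by rewrite divr_ge0// mulr_ge0// ltW.
Qed.

Definition well2 (y : R) := lambda * y ^+ 2 - 2 / p * `|y| `^ p.
Definition well (y : R) := Num.sqrt (well2 y).

Lemma normr_powR_sub2 y : `|y| `^ p = `|y| `^ (p - 2) * y ^+ 2.
Proof.
have [->|y0] := eqVneq y 0; first by rewrite normr0 powR0 ?gt_eqF// expr0n/= mulr0.
have -> : y ^+ 2 = `|y| `^ 2 by rewrite powR_mulrn// real_normK// num_real.
rewrite -powRD ?subrK//; apply/implyP => _; by rewrite normr_eq0.
Qed.

Lemma well2E y : well2 y = (lambda - 2 / p * `|y| `^ (p - 2)) * y ^+ 2.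
Proof. by rewrite /well2 normr_powR_sub2; ring. Qed.

Lemma well2_ge0 y : `|y| <= peak -> 0 <= well2 y.
Proof.
move=> ym; rewrite well2E mulr_ge0 ?sqr_ge0// subr_ge0.
rewrite mulrC -ler_pdivlMr ?divr_gt0//.
apply: (@le_trans _ _ (peak `^ (p - 2))).
  by apply: ge0_ler_powR => //; rewrite ?ltW// nnegrE ?normr_ge0// ltW// peak_gt0.
by rewrite peak_powR invf_div mulrA.
Qed.

Lemma well2_peak : well2 peak = 0.
Proof.
rewrite well2E ger0_norm ?ltW ?peak_gt0// peak_powR.
have -> : 2 / p * (lambda * p / 2) = lambda by field; rewrite gt_eqF.
by rewrite subrr mul0r.
Qed.

Lemma well_ge0 y : 0 <= well y. Proof. exact: sqrtr_ge0. Qed.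

Lemma sqr_well y : `|y| <= peak -> well y ^+ 2 = well2 y.
Proof. by move=> ym; rewrite /well sqr_sqrtr// well2_ge0. Qed.

Lemma well2N y : well2 (- y) = well2 y.
Proof. by rewrite /well2 sqrrN normrN. Qed.

Lemma wellN y : well (- y) = well y.
Proof. by rewrite /well well2N. Qed.

Lemma continuous_normr_powR : continuous (fun y : R => `|y| `^ p).
Proof.
move=> y.
have [->|y0] := eqVneq y 0; last first.
  have ny0 : 0 < `|y| by rewrite normr_gt0.
  have [dp _] := @is_derive1_powR R p _ ny0.
  have cp : {for `|y|, continuous (fun z : R => z `^ p)}.
    by apply: differentiable_continuous; exact/derivable1_diffP.
  exact: (cvg_comp (@Num.norm R R) (fun z : R => z `^ p) (@norm_continuous _ R y) cp).
rewrite /continuous_at normr0 powR0 ?gt_eqF//; apply/cvgrPdist_lt => e e0.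
exists (Num.min 1 e) => /=; first by rewrite lt_min ltr01 e0.
move=> z /=; rewrite sub0r normrN lt_min => /andP[/ltW z1 ze].
rewrite sub0r normrN ger0_norm ?powR_ge0//.
have [->|z0] := eqVneq z 0; first by rewrite normr0 powR0 ?gt_eqF.
apply: le_lt_trans ze; apply: ge1r_powR; last by rewrite ltW// (lt_trans _ hp)// ltr1n.
by rewrite normr_gt0 z0.
Qed.

Lemma continuous_well2 : continuous well2.
Proof.
move=> y; apply: cvgB.
  apply: cvgM; first exact: cvg_cst.
  by rewrite expr2; under eq_fun do rewrite expr2; apply: cvgM; exact: cvg_id.
by apply: cvgM; [exact: cvg_cst|exact: continuous_normr_powR].
Qed.

Lemma continuous_well : continuous well.
Proof. by move=> y; apply: cvg_sqrt; exact: continuous_well2. Qed.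

(** The base point [- peak - 1] is to the left of every value considered, so that the fundamental
    theorem gives the derivative on all of [[- peak, peak]], ends included; the second integral
    normalizes [phase] at 0. *)
Definition phase (y : R) : R :=
  \int[mu]_(x in `[- peak - 1, y]) well x - \int[mu]_(x in `[- peak - 1, 0]) well x.

Lemma integrable_well a b : mu.-integrable `[a, b] (EFin \o well).
Proof.
apply: continuous_compact_integrable; first exact: segment_compact.
exact/continuous_withinT/continuous_well.
Qed.

Lemma is_derive_phase (y : R) : - peak - 1 < y -> is_derive y 1 phase (well y).
Proof.
move=> ym.
have yy : y < y + 1 by rewrite ltrDl.
have [dF FE] := continuous_FTC1_closed yy (integrable_well _ _) ym (@continuous_well y).
have := is_deriveB (is_derive_derive1 dF)
  (is_derive_cst (\int[mu]_(x in `[- peak - 1, 0]) well x) y 1).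
by rewrite FE subr0.
Qed.

Lemma phase0 : phase 0 = 0. Proof. by rewrite /phase subrr. Qed.

Lemma phaseN y : `|y| <= peak -> phase (- y) = - phase y.
Proof.
wlog y0 : y / 0 <= y.
  move=> h ym; have [y0|/ltW y0] := leP 0 y; first exact: h.
  by have := h (- y); rewrite opprK oppr_ge0 normrN => -> //; rewrite opprK.
move=> ym; rewrite ger0_norm// in ym.
have pk := peak_gt0.
pose H x := phase x + phase (- x).
have dH (x : R) : - peak - 1 < x < peak + 1 -> is_derive x 1 H 0.
  move=> xp; have d1 : is_derive x 1 phase (well x) by apply: is_derive_phase; lra.
  have d2 : is_derive (- x) 1 phase (well (- x)) by apply: is_derive_phase; lra.
  have := is_deriveD d1 (is_derive1_comp d2 (is_deriveN (is_derive_id x 1))).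
  by rewrite wellN mulrN1 subrr.
have [||z _] := @MVT_segment R H (fun=> 0) 0 y y0.
- by move=> x; rewrite in_itv/= => xy; apply: dH; lra.
- apply: derivable_within_continuous => x; rewrite in_itv/= => xy.
  have xp : - peak - 1 < x < peak + 1 by lra.
  by have [] := dH x xp.
by rewrite mul0r /H oppr0 !phase0 addr0 subr0 => /eqP; rewrite addrC addr_eq0 => /eqP.
Qed.

Lemma phase_sub a b : - peak <= a -> a <= b -> phase b - phase a = \int[mu]_(x in `[a, b]) well x.
Proof.
move=> pa ab; rewrite /phase (@Rintegral_cat _ (- peak - 1) a b) ?integrable_well//.
  ring.
by lra.
Qed.

Lemma phase_le a b : - peak <= a -> a <= b -> phase a <= phase b.
Proof.
move=> pa ab; rewrite -subr_ge0 phase_sub//; apply: Rintegral_ge0 => x _; exact: well_ge0.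
Qed.

Lemma continuous_phase (y : R) : - peak - 1 < y -> {for y, continuous phase}.
Proof.
move=> ym; apply: differentiable_continuous.
by apply/derivable1_diffP; have [] := is_derive_phase ym.
Qed.

Lemma norm_phase y : `|y| <= peak -> `|phase y| = phase `|y|.
Proof.
have ph0 x : 0 <= x -> 0 <= phase x.
  by move=> x0; rewrite -phase0; apply: phase_le => //; have := peak_gt0; lra.
have [y0|/ltW y0] := leP 0 y; first by move=> _; rewrite [in RHS]ger0_norm// ger0_norm// ph0.
rewrite -normrN => ym; rewrite -[y in phase y]opprK phaseN// normrN.
by rewrite normrN (ger0_norm (ph0 _ _)) ?oppr_ge0// ler0_norm.
Qed.

Definition soliton_energy : R := 2 * phase peak.

(* Bernoulli's inequality for [t ^ p = (t ^ 2) ^ (p / 2)]. *)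
Lemma young_powR t : 0 < t ->
  t ^+ 2 / 2 - t `^ p / p <= 2^-1 - p^-1 /\
  (t ^+ 2 / 2 - t `^ p / p = 2^-1 - p^-1 -> t = 1).
Proof.
move=> t0; have t20 : 0 < t ^+ 2 by rewrite exprn_gt0.
have tpE : t `^ p = expR ((p - 2) * ln t) * t ^+ 2.
  by rewrite -[t in LHS]gtr0_norm// normr_powR_sub2 gtr0_norm// /powR gt_eqF.
have h1 : t ^+ 2 - 1 <= 2 * (t ^+ 2 * ln t).
  have := expR_ge1Dx (- (2 * ln t)).
  have -> : 2 * ln t = ln (t ^+ 2) by rewrite lnXn// mulr_natl.
  rewrite expRN lnK ?posrE// => /(ler_wpM2l (ltW t20)); rewrite mulfV ?gt_eqF//.
  rewrite lnXn// mulr2n; lra.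
have h2 : t ^+ 2 * (1 + (p - 2) * ln t) <= t `^ p.
  by rewrite tpE [leRHS]mulrC ler_wpM2l ?(ltW t20)//; exact: expR_ge1Dx.
have id a : t ^+ 2 / 2 - a / p = (2^-1 - p^-1) - (a - (t ^+ 2 + (p - 2) / 2 * (t ^+ 2 - 1))) / p.
  by field; rewrite gt_eqF.
have h3 : (p - 2) / 2 * (t ^+ 2 - 1) <= (p - 2) * (t ^+ 2 * ln t).
  have -> : (p - 2) * (t ^+ 2 * ln t) = (p - 2) / 2 * (2 * (t ^+ 2 * ln t)) by field.
  by rewrite ler_wpM2l// divr_ge0// ltW.
rewrite id; split.
  by rewrite lerBlDr lerDl divr_ge0 ?(ltW p0)//; lra.
set q := (_ - (_ + _)) / p => hq.
have /eqP : q = 0 by lra.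
rewrite mulf_eq0 invr_eq0 (gt_eqF p0) orbF subr_eq0 => /eqP h4; apply/eqP; rewrite -ln_eq0//; apply/eqP.
apply: contrapT => /eqP l0.
have l0' : (p - 2) * ln t != 0 by rewrite mulf_neq0// gt_eqF.
have : t ^+ 2 * (1 + (p - 2) * ln t) < t `^ p.
  by rewrite tpE [ltRHS]mulrC ltr_pM2l//; exact: expR_gt1Dx.
lra.
Qed.

End Potential.

Section IntervalEstimates.
Context {R : realType}.
Local Notation mu := (@lebesgue_measure R).
Implicit Types (I D : set R) (w g h : R -> R) (a b : R).

Lemma integral_oo_cc h a b : a <= b -> mu.-integrable `[a, b] (EFin \o h) ->
  (\int[mu]_(x in `]a, b[) (h x)%:E = (\int[mu]_(x in `[a, b]) h x)%:E)%E.
Proof.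
move=> ab ih; rewrite EFin_Rintegral//.
have iho : mu.-integrable `]a, b[ (EFin \o h).
  by apply: integrableS ih => //; exact: subset_itv_oo_cc.
have [mh _] := integrableP _ _ _ iho.
by rewrite (@integral_itv_bndoo R a b (fun x => (h x)%:E) true false mh).
Qed.

(** The Sobolev inequality on a segment: the minimum of [w ^+ 2] is at most its mean, and its
    variation is at most the integral of [2 |w g|], itself bounded by that of [w ^+ 2 + g ^+ 2]. *)
Lemma prim_sup_bound I w g a b x : is_interval I -> prim I w g -> I a -> I b -> a < b ->
  mu.-integrable `[a, b] (EFin \o (fun x => g x ^+ 2)) -> a <= x <= b ->
  w x ^+ 2 <= (1 + (b - a)^-1) * \int[mu]_(x in `[a, b]) (w x ^+ 2 + g x ^+ 2).
Proof.
move=> iI pw Ia Ib ab ig2 xab.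
have Iab y : a <= y <= b -> I y by exact: iI.
have ba0 : 0 < b - a by rewrite subr_gt0.
have cw2 : {within `[a, b], continuous (fun y => w y ^+ 2)}.
  have pw2 := prim_sqr iI pw.
  by apply: (@continuous_subspaceW _ _ _ I) (prim_within iI pw2) => y; rewrite /= in_itv/=; exact: Iab.
have iw2 : mu.-integrable `[a, b] (EFin \o (fun x => w x ^+ 2)).
  by apply: continuous_compact_integrable => //; exact: segment_compact.
have iD : mu.-integrable `[a, b] (EFin \o (fun x => w x ^+ 2 + g x ^+ 2)).
  by have := integrableD _ iw2 ig2; apply.
set T := \int[mu]_(x in `[a, b]) (w x ^+ 2 + g x ^+ 2).
have T0 : 0 <= T by apply: Rintegral_ge0 => y _; rewrite addr_ge0 ?sqr_ge0.
have [y yab ymin] := @EVT_min R (fun y => w y ^+ 2) a b (ltW ab) cw2.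
rewrite in_itv/= in yab.
have wy : w y ^+ 2 <= (b - a)^-1 * T.
  rewrite -ler_pdivrMl ?invr_gt0// invrK.
  have -> : (b - a) * w y ^+ 2 = \int[mu]_(x in `[a, b]) (cst (w y ^+ 2) x).
    rewrite Rintegral_cst//= lebesgue_measure_itv/= lte_fin ab.
    by rewrite -EFinD/= mulrC.
  apply: le_Rintegral => //.
    by apply: continuous_compact_integrable; [exact: segment_compact|move=> z; exact: cvg_cst].
  move=> z /= zab; rewrite -[leLHS]addr0; apply: lerD; last exact: sqr_ge0.
  exact: ymin.
have key u v : a <= u -> u <= v -> v <= b -> `|w v ^+ 2 - w u ^+ 2| <= T.
  move=> au uv vb; have Iu : I u by apply: Iab; rewrite au (le_trans uv).
  have Iv : I v by apply: Iab; rewrite vb (le_trans au).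
  have p2 := prim_sqr iI pw.
  apply: (le_trans (le_prim uv Iu Iv p2)).
  have [i2 _] := p2 _ _ (ltW ab) Ia Ib.
  apply: (@le_trans _ _ (\int[mu]_(x in `[u, v]) (w x ^+ 2 + g x ^+ 2))).
    apply: le_Rintegral => //.
    - by apply: (integrable_sub_itv au vb); exact: integrable_normr.
    - exact: (integrable_sub_itv au vb).
    - move=> z _; rewrite ler_norml; apply/andP; split.
        have := sqr_ge0 (w z + g z); nra.
      have := sqr_ge0 (w z - g z); nra.
  by apply: ge0_le_Rintegral_itv => // z _; rewrite addr_ge0 ?sqr_ge0.
have : `|w x ^+ 2 - w y ^+ 2| <= T.
  move: xab yab => /andP[ax xb] /andP[ay yb].
  by have [yx|/ltW xy] := leP y x; [exact: key|rewrite distrC; exact: key].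
rewrite ler_norml => /andP[_ h]; rewrite mulrDl mul1r; lra.
Qed.

End IntervalEstimates.

(** * The energy density and the completion of the square *)

Section Bogomolny.
Context {R : realType}.
Local Notation mu := (@lebesgue_measure R).
Variables (p lambda : R).
Hypotheses (hp : 2 < p) (hlambda : 0 < lambda).
Implicit Types (I D : set R) (w g h : R -> R) (a b t : R).

Local Notation peak := (peak p lambda).
Local Notation well2 := (well2 p lambda).
Local Notation well := (well p lambda).
Local Notation phase := (phase p lambda).

(** The integrand of the energy at [t * w], because [well2 y / 2] equals lambda y^2 / 2 - |y|^p /
    p. *)
Definition density t w g (x : R) := 2^-1 * ((t * g x) ^+ 2 + well2 (t * w x)).

Lemma density_ge0 t w g x : `|t * w x| <= peak -> 0 <= density t w g x.
Proof. by move=> wx; rewrite /density mulr_ge0 ?invr_ge0// addr_ge0 ?sqr_ge0// well2_ge0. Qed.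

Lemma measurable_density D t w g : measurable D -> measurable_fun D w -> measurable_fun D g ->
  measurable_fun D (density t w g).
Proof.
move=> mD mw mg; apply: measurable_funM => //; apply: measurable_funD.
  by apply: measurable_funX; apply: measurable_funM.
apply: (measurableT_comp (f := well2)); last exact: measurable_funM.
by apply: continuous_measurable_fun; exact: continuous_well2.
Qed.

Lemma prim_phase I w g : is_interval I -> prim I w g ->
  (forall x, I x -> `|w x| <= peak) ->
  prim I (phase \o w) (fun x => well (w x) * g x).
Proof.
move=> iI pw wm; apply: (@prim_chain _ I `[- peak, peak]) => //.
- exact: interval_is_interval.
- by move=> x Ix; rewrite /= in_itv/= -ler_norml; exact: wm.
- move=> y; rewrite /= in_itv/= => /andP[py _]; apply: is_derive_phase => //.
  by rewrite ltrBlDr (le_lt_trans py)// ltrDl.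
- exact/continuous_withinT/continuous_well.
Qed.

(* The Bogomolny trick: completing the square turns the energy into a total
   variation. *)
Lemma bogomolny I w g t a b : is_interval I -> prim I w g -> a <= b -> I a -> I b ->
  (forall x, a <= x <= b -> `|t * w x| <= peak) ->
  ((`|phase (t * w b) - phase (t * w a)|)%:E <=
   \int[mu]_(x in `]a, b[) (density t w g x)%:E)%E.
Proof.
move=> iI pw ab Ia Ib wm.
have Iab : `[a, b] `<=` I by move=> x; rewrite /= in_itv/=; exact: iI.
have iab : is_interval `[a, b] by exact: interval_is_interval.
have ptw : prim `[a, b] (fun x => t * w x) (fun x => t * g x).
  exact: primS Iab (primZ t pw).
have pp := prim_phase iab ptw (fun x xab => wm x xab).
have aa : `[a, b]%classic a by rewrite /= in_itv/= lexx.
have bb : `[a, b]%classic b by rewrite /= in_itv/= lexx andbT.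
have := le_prim ab aa bb pp; rewrite -lee_fin; move=> /le_trans; apply.
have [ip _] := pp _ _ ab aa bb.
have [ig _] := ptw _ _ ab aa bb.
rewrite -integral_oo_cc//; last exact: integrable_normr.
have mw : measurable_fun (`[a, b] : set R) (fun x => t * w x).
  by apply: subspace_continuous_measurable_fun => //; exact: prim_within ptw.
have oc : `]a, b[%classic `<=` `[a, b]%classic by exact: subset_itv_oo_cc.
have mg : measurable_fun (`[a, b] : set R) (fun x => t * g x).
  by apply/measurable_EFinP; exact: measurable_int ig.
apply: ge0_le_integral => //.
- apply/measurable_EFinP; apply: (@measurable_funS _ _ _ _ `[a, b]) => //.
  by apply/measurable_EFinP; exact: measurable_int (integrable_normr ip).
- apply/measurable_EFinP; apply: measurable_funM => //; apply: measurable_funD.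
    by apply: measurable_funX; exact: measurable_funS mg.
  apply: (measurableT_comp (f := well2)); last exact: measurable_funS mw.
  by apply: continuous_measurable_fun; exact: continuous_well2.
- move=> x /oc; rewrite /= in_itv/= => /wm wx; rewrite lee_fin /density -sqr_well//.
  rewrite normrM (ger0_norm (well_ge0 _ _ _)) -[(t * g x) ^+ 2]real_normK ?num_real//.
  have := sqr_ge0 (`|t * g x| - well (t * w x)); nra.
Qed.

Lemma integral_lincomb D (h1 h2 : R -> R) (c1 c2 : R) : measurable D ->
  0 <= c1 -> 0 <= c2 -> (forall x, D x -> 0 <= h1 x) -> (forall x, D x -> 0 <= h2 x) ->
  measurable_fun D h1 -> measurable_fun D h2 ->
  (c1%:E * \int[mu]_(x in D) (h1 x)%:E + c2%:E * \int[mu]_(x in D) (h2 x)%:E =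
   \int[mu]_(x in D) (c1 * h1 x + c2 * h2 x)%:E)%E.
Proof.
move=> mD c10 c20 h10 h20 mh1 mh2.
have m1 : measurable_fun D (fun x => (h1 x)%:E) by exact/measurable_EFinP.
have m2 : measurable_fun D (fun x => (h2 x)%:E) by exact/measurable_EFinP.
have g1 x : D x -> (0 <= (h1 x)%:E)%E by move=> /h10; rewrite lee_fin.
have g2 x : D x -> (0 <= (h2 x)%:E)%E by move=> /h20; rewrite lee_fin.
rewrite -(ge0_integralZl_EFin mu mD g1 m1 c10) -(ge0_integralZl_EFin mu mD g2 m2 c20).
rewrite -ge0_integralD//.
- by move=> x Dx; rewrite mule_ge0 ?g1.
- exact: measurable_funeM.
- by move=> x Dx; rewrite mule_ge0 ?g2.
- exact: measurable_funeM.
Qed.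

(** Arranged as an equality of sums of nonnegative terms, so that it holds, and can be summed over
    the edges, before anything is known to be finite. *)
Lemma integral_density D t w g : measurable D -> measurable_fun D w -> measurable_fun D g ->
  0 < t -> (forall x, D x -> `|t * w x| <= peak) ->
  (\int[mu]_(x in D) (density t w g x)%:E +
     (t `^ p / p)%:E * \int[mu]_(x in D) (`|w x| `^ p)%:E =
   (t ^+ 2 / 2)%:E * \int[mu]_(x in D) (`|g x| `^ 2)%:E +
     (lambda * t ^+ 2 / 2)%:E * \int[mu]_(x in D) (`|w x| `^ 2)%:E)%E.
Proof.
move=> mD mw mg t0 wm; have p0 : 0 < p by exact: lt_trans hp.
have mE (h : R -> R) (q : R) : measurable_fun D h -> measurable_fun D (fun x => `|h x| `^ q).
  move=> mh; apply: (measurableT_comp (@measurable_powR R q)).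
  exact: measurableT_comp.
have pw0 (h : R -> R) (q : R) x : D x -> 0 <= `|h x| `^ q by rewrite powR_ge0.
have c1 : 0 <= t `^ p / p by rewrite divr_ge0 ?powR_ge0 ?ltW.
have c2 : 0 <= t ^+ 2 / 2 by rewrite divr_ge0 ?sqr_ge0.
have c3 : 0 <= lambda * t ^+ 2 / 2 by rewrite divr_ge0// mulr_ge0 ?sqr_ge0// ltW.
have := integral_lincomb mD ler01 c1 (fun x Dx => density_ge0 _ (wm x Dx)) (pw0 w p)
  (measurable_density t mD mw mg) (mE w p mw).
rewrite mul1e => ->.
rewrite (integral_lincomb mD c2 c3 (pw0 g 2) (pw0 w 2) (mE g 2 mg) (mE w 2 mw)).
apply: eq_integral => x _; congr (_%:E).
rewrite !powR_mulrn// !real_normK ?num_real// /density /well2.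
by rewrite normrM powRM// (gtr0_norm t0); field; exact: lt0r_neq0.
Qed.

End Bogomolny.

Section Esum.
Context {R : realType} {T : choiceType}.
Implicit Types (a : T -> \bar R) (s : seq T).
Local Open Scope ereal_scope.

Lemma esum_uniq_ge a s : uniq s -> (forall i, 0 <= a i) ->
  \sum_(i <- s) a i <= \esum_(i in [set: T]) a i.
Proof.
move=> us a0; apply: esum_ge; exists [set` s]; first by split => //; exact: finite_seq.
by rewrite fsbig_seq.
Qed.

Lemma esum_term_le a i : (forall i, 0 <= a i) -> a i <= \esum_(i in [set: T]) a i.
Proof. by move=> a0; have := @esum_uniq_ge a [:: i] erefl a0; rewrite big_seq1. Qed.

Lemma esumZl (c : R) a : (0 < c)%R -> (forall i, 0 <= a i) ->
  \esum_(i in [set: T]) (c%:E * a i) = c%:E * \esum_(i in [set: T]) a i.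
Proof.
have half (k : R) (b : T -> \bar R) : (0 < k)%R -> (forall i, 0 <= b i) ->
    \esum_(i in [set: T]) (k%:E * b i) <= k%:E * \esum_(i in [set: T]) b i.
  move=> k0 b0; apply: ge_ereal_sup => _ [X [Xf _] <-].
  rewrite -ge0_mule_fsumr// lee_pmul2l//.
  by apply: esum_ge; exists X => //; split.
move=> c0 a0; apply/eqP; rewrite eq_le half//=.
have ci : (0 < c^-1)%R by rewrite invr_gt0.
rewrite -(@lee_pmul2l _ c^-1%:E)// muleA -EFinM mulVf ?gt_eqF// mul1e.
apply: le_trans (half _ _ ci _); last by move=> i; rewrite mule_ge0// lee_fin ltW.
by apply: le_esum => i _; rewrite muleA -EFinM mulVf ?gt_eqF// mul1e.
Qed.

End Esum.

(** * Sobolev functions on a metric graph *)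

Section EdgeSets.
Context {R : realType} (G : metric_graph R).
Local Notation mu := (@lebesgue_measure R).
Hypothesis hG : classG G.
Implicit Types (e : edge G) (x : R).

Lemma len_gt0 e : (0 < len e)%E.
Proof.
by have [_ _ _ h] := hG; apply: (lt_le_trans h); apply: ereal_inf_lbound; exists e.
Qed.

Lemma len_lower_bound : exists2 l : R, 0 < l & forall e, (l%:E <= len e)%E.
Proof.
have [_ _ _ h] := hG.
have lb e : (ereal_inf [set len e | e in [set: edge G]] <= len e)%E.
  by apply: ereal_inf_lbound; exists e.
case: (ereal_inf _) h lb => [r| |]//.
  by rewrite lte_fin => r0 lb; exists r.
move=> _ lb; exists 1 => // e; apply: le_trans (lb e); exact: leey.
Qed.

Lemma edge_cases e :
  (exists r, [/\ 0 < r, len e = r%:E, open_edge e = `]0, r[%classic & closed_edge e = `[0, r]%classic]) \/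
  [/\ half_line e, open_edge e = `]0, +oo[%classic & closed_edge e = `[0, +oo[%classic].
Proof.
have := len_gt0 e; case E : (len e) => [r| |]//; rewrite ?lte_fin => r0.
  left; exists r; split => //; apply/seteqP; split => x; rewrite /open_edge /closed_edge /= E in_itv/=
    ?lte_fin ?lee_fin; by [move=> [-> ->]|move=> /andP[-> ->]].
by right; split => //; apply/seteqP; split => x; rewrite /open_edge /closed_edge /= E in_itv/= andbT
    ?ltry ?leey; by [move=> []|].
Qed.

Lemma open_edge_open e : open (open_edge e).
Proof. by have [[r [_ _ -> _]]|[_ -> _]] := edge_cases e; exact: interval_open. Qed.

Lemma open_edge_interval e : is_interval (open_edge e).
Proof. by have [[r [_ _ -> _]]|[_ -> _]] := edge_cases e; exact: interval_is_interval. Qed.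

Lemma closed_edge_interval e : is_interval (closed_edge e).
Proof. by have [[r [_ _ _ ->]]|[_ _ ->]] := edge_cases e; exact: interval_is_interval. Qed.

Lemma open_closed_edge e : open_edge e `<=` closed_edge e.
Proof. by move=> x [x0 xl]; split; rewrite ltW. Qed.

Lemma between_closed_edge e a b x : closed_edge e a -> closed_edge e b -> a < x < b -> open_edge e x.
Proof.
move=> [a0 _] [_ bl] /andP[ax xb]; split; first exact: le_lt_trans ax.
by apply: lt_le_trans bl; rewrite lte_fin.
Qed.

Lemma closed_edge0 e : closed_edge e 0.
Proof. by split => //; exact/ltW/len_gt0. Qed.

Lemma open_edge_measurable e : measurable (open_edge e).
Proof. by apply: open_measurable; exact: open_edge_open. Qed.

Lemma degree1_inj (v : vertex G) h h' : degree1 v -> ends v h -> ends v h' -> h = h'.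
Proof.
move=> /card_set_bijP[f [fI finj _]] eh eh'.
apply: finj; rewrite ?inE//; have := fI _ eh; have := fI _ eh'.
by rewrite /= !ltnS !leqn0 => /eqP -> /eqP ->.
Qed.

Lemma Vinf_end v e b : Vinf v -> (if b then head e else tail e) = v -> half_line e /\ b.
Proof.
move=> [e' he' <-] E; have [_ _ /(_ _ he') d _] := hG.
by have [<- <-] := degree1_inj d (erefl : ends (head e') (e', true)) (E : ends (head e') (e, b)).
Qed.

Lemma tail_not_Vinf e : ~ Vinf (tail e).
Proof. by move=> h; have [] := @Vinf_end _ e false h erefl. Qed.

Lemma head_Vinf e : Vinf (head e) <-> half_line e.
Proof. by split=> [h|he]; [have [] := @Vinf_end _ e true h erefl|exists e]. Qed.

Lemma edge_pt_point e x : closed_edge e x -> points (edge_pt e x).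
Proof.
move=> [x0 xl]; rewrite /edge_pt; case: eqVneq => [_|xn0]; first exact: tail_not_Vinf.
case: eqVneq => [xE|xnl]; last first.
  by split; [rewrite lt_neqAle eq_sym xn0|rewrite lt_neqAle xnl].
by move=> /head_Vinf hl; rewrite hl in xE.
Qed.

Lemma edge_pt_tail e : edge_pt e 0 = inl (tail e).
Proof. by rewrite /edge_pt eqxx. Qed.

Lemma edge_pt_head e r : len e = r%:E -> edge_pt e r = inl (head e).
Proof.
move=> er; rewrite /edge_pt er eqxx; case: eqVneq => // r0.
by have := len_gt0 e; rewrite er r0 ltxx.
Qed.

Lemma edge_pt_open e x : open_edge e x -> edge_pt e x = inr (e, x).
Proof. by move=> [x0 xl]; rewrite /edge_pt gt_eqF// lt_eqF. Qed.

Lemma pt_on_edge (e0 : edge G) (q : pt G) : exists e x, closed_edge e x /\ edge_pt e x = val q.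
Proof.
case: q => -[v|[e x]] /=; rewrite inE => qp; last first.
  by exists e, x; split; [exact: open_closed_edge|exact: edge_pt_open].
have [conn _ _ _] := hG.
have : exists e b, (if b then head e else tail e) = v.
  have := conn (tail e0) v => h; case: h qp => [|e _ _|e _ _] _; [by exists e0, false|by exists e, true|by exists e, false].
move=> [e [[] ev]]; last by exists e, 0; rewrite edge_pt_tail ev; split => //; exact: closed_edge0.
have [[r [r0 er _ ce]]|[hl _ _]] := edge_cases e; last first.
  by case: qp; rewrite -ev; apply/head_Vinf.
by exists e, r; rewrite (edge_pt_head er) ev ce; split => //; rewrite /= in_itv/= lexx ltW.
Qed.

End EdgeSets.

Section RestrictedDerivative.
Context {R : realType}.
Local Notation mu := (@lebesgue_measure R).
Implicit Types (I D : set R) (f g h : R -> R).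

Lemma prim_ae_open D f g h : open D -> is_interval D -> prim D f g -> prim D f h ->
  {ae mu, forall x, D x -> g x = h x}.
Proof.
move=> oD iD pg ph.
pose P (n : nat) (x : R) := if (unpickle n : option (rat * rat)) is Some qr then
  D (ratr qr.1) -> D (ratr qr.2) -> ratr qr.1 < x < ratr qr.2 -> g x = h x else True.
have : {ae mu, forall x, forall n, P n x}.
  apply: ae_foralln => n; rewrite /P; case: (unpickle n) => [[q r]|]; last exact: aeW.
  have [Dq|nDq] := pselect (D (ratr q)); last by apply: aeW => x /=.
  have [Dr|nDr] := pselect (D (ratr r)); last by apply: aeW => x /=.
  have := prim_ae_eq iD pg ph Dq Dr.
  apply: filterS; first exact: (ae_filter_ringOfSetsType mu).
  by move=> x hx _ _.
apply: filterS; first exact: (ae_filter_ringOfSetsType mu).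
move=> x Px Dx.
have [y xy Dy] := open_interval_right oD Dx.
have [z zx Dz] := open_interval_left oD Dx.
have [r] := rat_in_itvoo xy; rewrite in_itv/= => /andP[xr ry].
have [q] := rat_in_itvoo zx; rewrite in_itv/= => /andP[zq qx].
have := Px (pickle (q, r)); rewrite /P pickleK; apply => /=.
- by apply: iD Dz Dx _ _; rewrite (ltW zq) ltW.
- by apply: iD Dx Dy _ _; rewrite (ltW ry) ltW.
- by rewrite qx xr.
Qed.

Lemma measurable_normpow D f (q : R) : measurable_fun D f ->
  measurable_fun D (fun x => (`|f x| `^ q)%:E).
Proof.
move=> mh; apply/measurable_EFinP; apply: (measurableT_comp (@measurable_powR R q)).
exact: measurableT_comp.
Qed.

Lemma ae_eq_normpow D f g (q : R) : measurable D -> measurable_fun D f -> measurable_fun D g ->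
  {ae mu, forall x, D x -> f x = g x} ->
  (\int[mu]_(x in D) (`|f x| `^ q)%:E = \int[mu]_(x in D) (`|g x| `^ q)%:E)%E.
Proof.
move=> mD mf mg fg; apply: ae_eq_integral => //; [exact: measurable_normpow..|].
by apply: filterS fg; [exact: (ae_filter_ringOfSetsType mu)|move=> x h Dx; rewrite /= h].
Qed.

End RestrictedDerivative.

Section Sobolev.
Context {R : realType} (G : metric_graph R).
Local Notation mu := (@lebesgue_measure R).
Hypothesis hG : classG G.
Implicit Types (e : edge G) (x : R) (u : pt G -> R).

(** Extended by zero, so that it is measurable on the whole line and square integrable on segments
    touching the ends of the edge. *)
Definition edge_deriv u e : R -> R := (deriv_on_edge u e) \_ (open_edge e).

Lemma normG_eq (q : R) (w w' : edge G -> R -> R) :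
  (forall e x, open_edge e x -> w e x = w' e x) -> normG q w = normG q w'.
Proof.
move=> ww'; apply: eq_esum => e _; apply: eq_integral => x; rewrite inE => ex.
by rewrite ww'.
Qed.

Lemma normG_edge_deriv q u : normG q (edge_deriv u) = normG q (deriv_on_edge u).
Proof. by apply: normG_eq => e x ex; rewrite /edge_deriv patchE mem_set. Qed.

Lemma normG_term q (w : edge G -> R -> R) e :
  (\int[mu]_(x in open_edge e) (`|w e x| `^ q)%:E <= normG q w)%E.
Proof.
apply: (@esum_term_le _ _ (fun e => \int[mu]_(x in open_edge e) (`|w e x| `^ q)%:E)%E) => i.
by apply: integral_ge0 => x _; rewrite lee_fin powR_ge0.
Qed.

Lemma integral_restrict_sqr D (h : R -> R) a b : measurable D -> measurable_fun D h ->
  (\int[mu]_(x in `[a, b]) ((h \_ D) x ^+ 2)%:E <= \int[mu]_(x in D) (`|h x| `^ 2)%:E)%E.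
Proof.
move=> mD mh.
have mk : measurable_fun setT (fun x => (((h \_ D) x) ^+ 2)%:E).
  by apply/measurable_EFinP; apply: measurable_funX; exact/(measurable_restrictT h mD).
apply: (@le_trans _ _ (\int[mu]_(x in setT) ((h \_ D) x ^+ 2)%:E)%E).
  by apply: ge0_subset_integral => // x _; rewrite lee_fin sqr_ge0.
rewrite (@integral_subset0 R setT D)//; last first.
  by move=> x _ nDx; rewrite patchE memNset// expr0n.
rewrite le_eqVlt; apply/orP; left; apply/eqP; apply: eq_integral => x Dx.
by rewrite patchE Dx powR_mulrn// real_normK// num_real.
Qed.

Section Regular.
Variable u : pt G -> R.
Hypothesis Hu : H1 u.

Lemma H1_wderiv e : is_wderiv (open_edge e) (on_edge u e) (deriv_on_edge u e).
Proof. by have [_ /(_ e) h _ _] := Hu; exact: getPex h. Qed.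

Lemma H1_deriv_measurable e : measurable_fun (open_edge e) (deriv_on_edge u e).
Proof. by have [[]] := H1_wderiv e. Qed.

Lemma edge_deriv_measurable e : measurable_fun setT (edge_deriv u e).
Proof.
apply/(measurable_restrictT _ (open_edge_measurable hG e)).
exact: H1_deriv_measurable.
Qed.

Lemma edge_deriv_sqr_integrable e a b :
  mu.-integrable `[a, b] (EFin \o (fun x => edge_deriv u e x ^+ 2)).
Proof.
apply/integrableP; split.
  apply/measurable_EFinP; apply: measurable_funX; apply: measurable_funTS.
  exact: edge_deriv_measurable.
under eq_integral do rewrite /= ger0_norm ?sqr_ge0//.
have le1 := integral_restrict_sqr a b (open_edge_measurable hG e) (H1_deriv_measurable (e := e)).
apply: (le_lt_trans le1); apply: le_lt_trans (normG_term _ _ _) _; by have [_ _ ? _] := Hu.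
Qed.

(** On the open edge the weak derivative is a density by [is_wderiv_prim]; its square integrability
    and the continuity of [u] carry this to the closed edge. *)
Lemma H1_prim e : prim (closed_edge e) (on_edge u e) (edge_deriv u e).
Proof.
have [cu _ _ _] := Hu.
apply: (@prim_extend R _ (open_edge e)) => //.
- exact: closed_edge_interval.
- by move=> a b x; exact: between_closed_edge.
- apply: (@prim_eq _ _ (on_edge u e) _ (deriv_on_edge u e)) => //.
  + exact: open_edge_interval.
  + by move=> x ex; rewrite /edge_deriv patchE ex.
  apply: is_wderiv_prim; [exact: open_edge_open|exact: open_edge_interval| |exact: H1_wderiv].
  by apply: continuous_subspaceW (cu e); exact: open_closed_edge.
- move=> a b _ _; apply: integrable_sqr_itv; first exact: edge_deriv_measurable.
  have /integrableP[_] := edge_deriv_sqr_integrable e a b.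
  by under eq_integral do rewrite /= ger0_norm ?sqr_ge0//.
Qed.

End Regular.

Lemma on_edge_measurable e (f g : R -> R) : prim (closed_edge e) f g ->
  measurable_fun (open_edge e) f.
Proof.
move=> pf; apply: subspace_continuous_measurable_fun; first exact: open_edge_measurable.
apply: continuous_subspaceW (prim_within (closed_edge_interval hG (e := e)) pf).
exact: open_closed_edge.
Qed.

(** As [deriv_on_edge] is picked by a choice operator, its norm is only accessible through the
    uniqueness of densities up to null sets. *)
Lemma H1_of_prim u (h : edge G -> R -> R) :
  (forall e, prim (closed_edge e) (on_edge u e) (h e)) ->
  (forall e, measurable_fun (open_edge e) (h e)) ->
  (normG 2 h < +oo)%E -> (normG 2 (on_edge u) < +oo)%E ->
  H1 u /\ normG 2 (deriv_on_edge u) = normG 2 h.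
Proof.
move=> ph mh h2 u2.
have wd e : is_wderiv (open_edge e) (on_edge u e) (h e).
  apply: prim_is_wderiv => //; [exact: open_edge_open|exact: open_edge_interval|].
  exact: primS (@open_closed_edge _ _ e) (ph e).
have wd' e : is_wderiv (open_edge e) (on_edge u e) (deriv_on_edge u e).
  by apply: getPex; exists (h e).
have E : normG 2 (deriv_on_edge u) = normG 2 h.
  apply: eq_esum => e _; apply: ae_eq_normpow => //; first exact: open_edge_measurable.
    by have [[]] := wd' e.
  apply: (@prim_ae_open _ _ (on_edge u e)); [exact: open_edge_open|exact: open_edge_interval| |].
    apply: is_wderiv_prim => //; [exact: open_edge_open|exact: open_edge_interval|].
    apply: continuous_subspaceW (prim_within (closed_edge_interval hG (e := e)) (ph e)).
    exact: open_closed_edge.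
  exact: primS (@open_closed_edge _ _ e) (ph e).
split; last exact: E.
split; last exact: u2.
- by move=> e; apply: prim_within (ph e); exact: closed_edge_interval.
- by move=> e; exists (h e).
- by rewrite E.
Qed.

Lemma eval_pt u (q : pt G) : eval u (val q) = u q.
Proof. by rewrite /eval valK. Qed.

Lemma on_edgeE u e x (q : pt G) : edge_pt e x = val q -> on_edge u e x = u q.
Proof. by rewrite /on_edge => ->; exact: eval_pt. Qed.

End Sobolev.

Section SobolevBounds.
Context {R : realType} (G : metric_graph R).
Local Notation mu := (@lebesgue_measure R).
Hypothesis hG : classG G.
Variable u : pt G -> R.
Hypothesis Hu : H1 u.
Implicit Types (e : edge G) (x : R).

Lemma on_edge_sqr_integrable e a b : closed_edge e a -> closed_edge e b ->
  mu.-integrable `[a, b] (EFin \o (fun x => on_edge u e x ^+ 2)).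
Proof.
move=> ea eb; apply: continuous_compact_integrable; first exact: segment_compact.
have p2 := prim_sqr (closed_edge_interval hG (e := e)) (H1_prim hG Hu (e := e)).
apply: continuous_subspaceW (prim_within (closed_edge_interval hG (e := e)) p2).
move=> x; rewrite /= in_itv/=; exact: (closed_edge_interval hG) ea eb _.
Qed.

Let sob e x := ((on_edge u e) \_ (open_edge e)) x ^+ 2 + edge_deriv u e x ^+ 2.

Let sob_ge0 e x : 0 <= sob e x. Proof. by rewrite addr_ge0 ?sqr_ge0. Qed.

Let sob_measurable e : measurable_fun setT (sob e).
Proof.
apply: measurable_funD; apply: measurable_funX; last exact: edge_deriv_measurable.
apply/(measurable_restrictT _ (open_edge_measurable hG e)).
apply: on_edge_measurable => //; exact: H1_prim.
Qed.

Let sob_integral e : (\int[mu]_x (sob e x)%:E =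
  \int[mu]_(x in open_edge e) (`|on_edge u e x| `^ 2)%:E +
  \int[mu]_(x in open_edge e) (`|deriv_on_edge u e x| `^ 2)%:E)%E.
Proof.
rewrite (@integral_subset0 R setT (open_edge e))//; last first.
  by move=> x _ nx; rewrite /sob /edge_deriv !patchE memNset// expr0n addr0.
have mu_ : measurable_fun (open_edge e) (on_edge u e).
  by apply: on_edge_measurable => //; exact: H1_prim.
have md : measurable_fun (open_edge e) (deriv_on_edge u e) by exact: H1_deriv_measurable.
rewrite -ge0_integralD//.
- apply: eq_integral => x ex; rewrite /sob /edge_deriv !patchE ex -EFinD; congr (_%:E).
  by rewrite !powR_mulrn// !real_normK// num_real.
all: first [exact: open_edge_measurable|exact: measurable_normpow|by move=> x _; rewrite lee_fin powR_ge0].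
Qed.

Let total := fine (normG 2 (on_edge u) + normG 2 (deriv_on_edge u))%E.
Let tot e := fine (\int[mu]_x (sob e x)%:E)%E.

Let total_fin : (normG 2 (on_edge u) + normG 2 (deriv_on_edge u) = total%:E)%E.
Proof.
have [_ _ h1 h2] := Hu.
have ge0 (w : edge G -> R -> R) : (0 <= normG 2 w)%E.
  by apply: esum_ge0 => e _; apply: integral_ge0 => x _; rewrite lee_fin powR_ge0.
have f1 : normG 2 (on_edge u) \is a fin_num by rewrite ge0_fin_numE; [exact: h2|exact: ge0].
have f2 : normG 2 (deriv_on_edge u) \is a fin_num by rewrite ge0_fin_numE; [exact: h1|exact: ge0].
rewrite /total; move: (normG 2 (on_edge u)) (normG 2 (deriv_on_edge u)) f1 f2 => a b fa fb.
by rewrite fineK// fin_numD fa fb.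
Qed.

Let sob_finite e : (\int[mu]_x (sob e x)%:E <= total%:E)%E.
Proof. by rewrite -total_fin sob_integral; apply: leeD; exact: normG_term. Qed.

Let tot_fin e : (\int[mu]_x (sob e x)%:E = (tot e)%:E)%E.
Proof.
rewrite /tot fineK// ge0_fin_numE; last by apply: integral_ge0 => x _; rewrite lee_fin.
by apply: le_lt_trans (sob_finite e) _; rewrite ltry.
Qed.

Let tot_ge0 e : 0 <= tot e.
Proof. by apply: fine_ge0; apply: integral_ge0 => x _; rewrite lee_fin. Qed.

Let tot_le e : tot e <= total.
Proof. by rewrite -lee_fin -tot_fin. Qed.

Let sum_tot : (\esum_(e in [set: edge G]) (tot e)%:E <= total%:E)%E.
Proof.
rewrite -total_fin /normG -esumD; last 2 first.
- by move=> e _; apply: integral_ge0 => x _; rewrite lee_fin powR_ge0.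
- by move=> e _; apply: integral_ge0 => x _; rewrite lee_fin powR_ge0.
by apply: le_esum => e _; rewrite -tot_fin sob_integral.
Qed.

Let sob_integrable e : mu.-integrable setT (EFin \o sob e).
Proof.
apply/integrableP; split; first by apply/measurable_EFinP; exact: sob_measurable.
under eq_integral do rewrite /= ger0_norm//.
by apply: le_lt_trans (sob_finite e) _; rewrite ltry.
Qed.

Let sob_itv_integrable e a b : mu.-integrable `[a, b] (EFin \o sob e).
Proof. exact: integrableS (sob_integrable e). Qed.

Let sob_itv_le e a b : \int[mu]_(x in `[a, b]) sob e x <= tot e.
Proof.
rewrite -lee_fin EFin_Rintegral// -tot_fin; apply: ge0_subset_integral => //.
- by apply/measurable_EFinP; exact: sob_measurable.
- by move=> x _; rewrite lee_fin.
Qed.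

Let sob_prim_bound e a b x : closed_edge e a -> closed_edge e b -> a < b -> a <= x <= b ->
  on_edge u e x ^+ 2 <= (1 + (b - a)^-1) * \int[mu]_(x in `[a, b]) sob e x.
Proof.
move=> ea eb ab xab.
have := prim_sup_bound (closed_edge_interval hG (e := e)) (H1_prim hG Hu (e := e)) ea eb ab
  (edge_deriv_sqr_integrable hG Hu e a b) xab.
congr (_ <= _ * _); rewrite /Rintegral.
have iD : mu.-integrable `[a, b] (EFin \o (fun x => on_edge u e x ^+ 2 + edge_deriv u e x ^+ 2)).
  have := integrableD _ (on_edge_sqr_integrable ea eb) (edge_deriv_sqr_integrable hG Hu e a b).
  by apply.
apply: EFin_inj; rewrite -(integral_oo_cc (ltW ab) iD) -(integral_oo_cc (ltW ab) (sob_itv_integrable e a b)).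
apply: eq_integral => y; rewrite inE/= in_itv/= => yab; rewrite /sob patchE mem_set//.
exact: between_closed_edge ea eb yab.
Qed.

Let edge_bound l e x : 0 < l -> (l%:E <= len e)%E -> closed_edge e x ->
  on_edge u e x ^+ 2 <= (1 + l^-1) * tot e.
Proof.
move=> l0 le ex.
have [a [b [ea eb ab xab]]] : exists a b, [/\ closed_edge e a, closed_edge e b, b - a = l & a <= x <= b].
  have [lx|xl] := leP l x; last first.
    exists 0, l; split; [exact: closed_edge0|split => //|by rewrite subr0|].
      exact: ltW.
    by have [x0 _] := ex; rewrite x0 ltW.
  exists (x - l), x; split => //; last 2 first.
  - by rewrite opprB addrC subrK.
  - by rewrite lexx andbT lerBlDr lerDl ltW.
  split; first by rewrite subr_ge0.
  have [_ xe] := ex; apply: le_trans xe.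
  by rewrite lee_fin lerBlDr lerDl ltW.
have ltab : a < b by rewrite -subr_gt0 ab.
apply: le_trans (sob_prim_bound ea eb ltab xab) _; rewrite ab.
by rewrite ler_wpM2l// addr_ge0// invr_ge0 ltW.
Qed.

(** Edge lengths are bounded below by some [l], so that every point lies on a segment of length [l]
    of its edge; this makes the Sobolev constant [1 + l^-1] uniform. *)
Lemma H1_sup_norm : exists2 K : R, 0 < K & forall e x, closed_edge e x ->
  on_edge u e x ^+ 2 <= K * fine (normG 2 (on_edge u) + normG 2 (deriv_on_edge u))%E.
Proof.
have [l l0 hl] := len_lower_bound hG.
have K0 : 0 < 1 + l^-1 by rewrite ltr_wpDr// invr_ge0 ltW.
exists (1 + l^-1) => // e x ex; apply: le_trans (edge_bound l0 (hl e) ex) _.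
by apply: ler_wpM2l; [exact: ltW|exact: tot_le].
Qed.

Lemma H1_bounded : exists2 M, 0 < M & forall e x, closed_edge e x -> `|on_edge u e x| <= M.
Proof.
have [K K0 hK] := H1_sup_norm; rewrite -/total in hK.
have T0 : 0 <= total.
  by rewrite /total; apply: fine_ge0; apply: adde_ge0; apply: esum_ge0 => e _;
    apply: integral_ge0 => x _; rewrite lee_fin powR_ge0.
exists (K * total + 1); first by rewrite ltr_wpDl// mulr_ge0// ltW.
move=> e x ex; have := hK e x ex.
have : 0 <= K * total by rewrite mulr_ge0// ltW.
rewrite -[on_edge u e x ^+ 2]real_normK ?num_real//.
have := normr_ge0 (on_edge u e x); move: (K * total) => L; nra.
Qed.

Let tail_estimate (Y s a b z t : R) : 0 <= a -> s + a + b <= Y -> Y - s < t / 2 ->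
  z <= (1 + 1) * b -> z <= t.
Proof. lra. Qed.

(** The norm carried by the end of the half-line tends to 0, and the value at [x] is bounded by the
    norm on [[x, x + 1]] with constant [1 + 1]; hence the threshold [eta ^+ 2 / 2]. *)
Lemma H1_decay e eta : half_line e -> 0 < eta ->
  exists2 T, 0 <= T & forall x, T <= x -> `|on_edge u e x| <= eta.
Proof.
move=> he eta0.
have [[r [_]]|[_ _ ce]] := edge_cases hG e; first by rewrite he.
have cvg := ge0_cvgn_integral (mu := mu) (sob_ge0 e) (sob_measurable e).
pose S b := \int[mu]_(x in `[0, b]) sob e x.
have SE b : (\int[mu]_(x in `[0%R, b]) (sob e x)%:E = (S b)%:E)%E by rewrite /S EFin_Rintegral.
set Sy := (\int[mu]_(x in `[0%R, +oo[) (sob e x)%:E)%E in cvg.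
have Sy_fin : Sy \is a fin_num.
  by apply: integrable_fin_num => //; exact: integrableS (sob_integrable e).
have Sb b : S b <= fine Sy.
  rewrite -lee_fin (fineK Sy_fin) -SE; apply: ge0_subset_integral => //.
  - by apply/measurable_EFinP; apply: measurable_funTS; exact: sob_measurable.
  - by move=> x _; rewrite lee_fin.
  - by move=> x; rewrite /= !in_itv/= => /andP[-> _].
have cS : S n%:R @[n --> \oo] --> fine Sy.
  rewrite -(fineK Sy_fin) in cvg; have E : (fun n : nat => (\int[mu]_(x in `[0%R, n%:R]) (sob e x)%:E)%E) = (fun n => (S n%:R)%:E).
    by apply/funext => n; rewrite SE.
  rewrite E in cvg.
  exact: (fine_cvg cvg).
have e2 : 0 < eta ^+ 2 / 2 by rewrite divr_gt0// exprn_gt0.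
have [n Hn] : exists n : nat, fine Sy - S n%:R < eta ^+ 2 / 2.
  move/cvgrPdist_lt: cS => /(_ _ e2) [n _ hn]; exists n.
  by have := hn n (leqnn n); apply: le_lt_trans; exact: ler_norm.
exists n%:R => // x nx.
have x0 : 0 <= x by exact: le_trans nx.
have ex : closed_edge e x by rewrite ce /= in_itv/= x0.
have ex1 : closed_edge e (x + 1) by rewrite ce /= in_itv/= addr_ge0.
have xx1 : x < x + 1 by rewrite ltrDl.
have := sob_prim_bound ex ex1 xx1 (_ : x <= x <= x + 1).
rewrite lexx (ltW xx1) => /(_ isT); rewrite addrAC subrr add0r invr1.
have i1 := sob_itv_integrable e 0 (x + 1).
have := Sb (x + 1); rewrite /S (Rintegral_cat x0 (ltW xx1))//.
rewrite (Rintegral_cat (ler0n _ n) nx)//.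
have : 0 <= \int[mu]_(y in `[n%:R, x]) sob e y by apply: Rintegral_ge0.
rewrite -/(S n%:R) => h1 h2 h3.
have : on_edge u e x ^+ 2 <= eta ^+ 2 by exact: tail_estimate h1 h2 Hn h3.
by rewrite -[_ ^+ 2]real_normK ?num_real// ler_sqr// nnegrE ltW.
Qed.

Let tot_level_finite eta : 0 < eta -> finite_set [set e | eta <= tot e].
Proof.
move=> eta0; apply: contrapT => /infinite_set_fset inf.
pose n := Num.bound `|total / eta|.
have Hn : total < n%:R * eta.
  by rewrite -ltr_pdivrMr// (le_lt_trans (ler_norm _))// archi_boundP.
have [B BX nB] := inf n.
have := le_trans (esum_uniq_ge (finmap.fset_uniq B) (fun e => tot_ge0 e : (0 <= (tot e)%:E)%E)) sum_tot.
rewrite sumEFin lee_fin leNgt => /negP; apply; apply: (lt_le_trans Hn).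
apply: (@le_trans _ _ (\sum_(e <- finmap.enum_fset B) eta)).
  rewrite big_const_seq count_predT iter_addr_0 -[leRHS]mulr_natl ler_wpM2r ?ler_nat//.
  exact: ltW.
rewrite big_seq [leRHS]big_seq; apply: ler_sum => e eB; exact: (BX e).
Qed.

Lemma seq_argmax (T : Type) (f : T -> R) (x : T) (s : seq T) :
  exists2 y, List.In y (x :: s) & forall z, List.In z (x :: s) -> f z <= f y.
Proof.
elim: s x => [|a s IH] x; first by exists x; [left|move=> z [->|]].
have [y ys hy] := IH a.
have [xy|yx] := leP (f x) (f y).
  by exists y; [right|move=> z [<-//|]; exact: hy].
by exists x; [left|move=> z [<-//|/hy zy]; apply: le_trans zy (ltW yx)].
Qed.

(* Only finitely many edges carry enough norm for a value above any given
   positive level. *)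
Lemma H1_max_attained : (exists e x, closed_edge e x /\ on_edge u e x != 0) ->
  exists e x, closed_edge e x /\ forall e' y, closed_edge e' y -> `|on_edge u e' y| <= `|on_edge u e x|.
Proof.
move=> [e0 [x0 [ex0 ux0]]].
have [l l0 hl] := len_lower_bound hG.
have K0 : 0 < 1 + l^-1 by rewrite ltr_wpDr// invr_ge0 ltW.
set y0 := `|on_edge u e0 x0|.
have y00 : 0 < y0 by rewrite normr_gt0.
have /finite_fsetP[X XE] := tot_level_finite (divr_gt0 (exprn_gt0 2 y00) K0).
(* On a half-line only a compact part is searched: beyond [T] the values do not exceed the reference
   value [y0], whence the comparison with the larger of the two. *)
have pick e : exists x, closed_edge e x /\ forall y, closed_edge e y ->
    `|on_edge u e y| <= Num.max y0 `|on_edge u e x|.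
  have cn T : closed_edge e T -> {within `[0, T], continuous (fun x => `|on_edge u e x|)}.
    move=> eT; have [cu _ _ _] := Hu.
    apply/withinP => x xT d d0.
    have sub y : `[0, T]%classic y -> closed_edge e y.
      rewrite /= in_itv/=; exact: (closed_edge_interval hG) (closed_edge0 hG e) eT _.
    have [k k0 hk] := (withinP _ _).1 (cu e) x (sub _ xT) d d0; exists k => // y yT yx.
    by apply: le_lt_trans (ler_dist_dist _ _) _; apply: hk => //; exact: sub.
  have [[r [r0 er _ ce]]|[he _ ce]] := edge_cases hG e.
    have [|x] := @EVT_max R (fun x => `|on_edge u e x|) 0 r (ltW r0).
      by apply: cn; rewrite ce /= in_itv/= lexx ltW.
    rewrite in_itv/= => xr hx; exists x; rewrite ce; split => // y /= yr.
    by rewrite le_max hx ?orbT.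
  have [T T0 hT] := H1_decay he y00.
  have eT : closed_edge e T by rewrite ce /= in_itv/= T0.
  have [|x] := @EVT_max R (fun x => `|on_edge u e x|) 0 T T0; first exact: cn.
  rewrite in_itv/= => /andP[x0' xT] hx; exists x; rewrite ce /= in_itv/= x0'; split => // y.
  rewrite in_itv/= andbT => y0'; have [Ty|/ltW yT] := leP T y; first by rewrite le_max hT.
  by rewrite le_max hx ?orbT// in_itv/= y0'.
have [xe hxe] := choice pick.
pose val_ (q : edge G * R) := `|on_edge u q.1 q.2|.
have [q qs hq] := seq_argmax val_ (e0, x0) [seq (e, xe e) | e <- finmap.enum_fset X].
exists q.1, q.2; split.
  case: qs => [<-//|]; elim: (finmap.enum_fset X) => //= e s IH [<-|//] /=; exact: (hxe e).1.
move=> e y ey; have [eX|eX] := boolP (e \in finmap.enum_fset X).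
  apply: le_trans ((hxe e).2 y ey) _; rewrite ge_max; apply/andP; split.
    by apply: (hq (e0, x0)); left.
  apply: (hq (e, xe e)); right.
  elim: (finmap.enum_fset X) eX => //= a s IH; rewrite inE => /predU1P[->|/IH]; [by left|by right].
have : ~ (e \in finmap.enum_fset X) by apply/negP.
move=> nX; have te : tot e < y0 ^+ 2 / (1 + l^-1).
  rewrite ltNge; apply/negP => te; apply: nX.
  by have : [set e | y0 ^+ 2 / (1 + l^-1) <= tot e] e by []; rewrite XE.
apply: (@le_trans _ _ y0); last by apply: (hq (e0, x0)); left.
rewrite -(@ler_sqr _ _ y0) ?nnegrE ?(ltW y00)// real_normK ?num_real//.
apply: le_trans (edge_bound l0 (hl e) ey) _.
by rewrite mulrC -ler_pdivlMr// ltW.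
Qed.

End SobolevBounds.

Lemma esum_lincomb (R : realType) (T : choiceType) (k1 k2 k3 : R) (a b c d : T -> \bar R) :
  0 < k1 -> 0 < k2 -> 0 < k3 -> (forall i, 0 <= a i)%E -> (forall i, 0 <= b i)%E ->
  (forall i, 0 <= c i)%E -> (forall i, 0 <= d i)%E ->
  (forall i, a i + k1%:E * b i = k2%:E * c i + k3%:E * d i)%E ->
  (\esum_(i in [set: T]) a i + k1%:E * (\esum_(i in [set: T]) b i) =
   k2%:E * (\esum_(i in [set: T]) c i) + k3%:E * (\esum_(i in [set: T]) d i))%E.
Proof.
move=> k10 k20 k30 a0 b0 c0 d0 E; rewrite -!esumZl// -!esumD//.
- by apply: eq_esum => i _; exact: E.
- by move=> i _; rewrite mule_ge0// lee_fin ltW.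
- by move=> i _; rewrite mule_ge0// lee_fin ltW.
- by move=> i _; rewrite mule_ge0// lee_fin ltW.
Qed.

(** * Refinements of a graph and total variation *)

Section Refinements.
Context {R : realType} (G : metric_graph R).
Local Notation mu := (@lebesgue_measure R).
Hypothesis hG : classG G.
Variable B : set (vertex G).
Implicit Types (e : edge G) (x y : R) (d : edge G -> R -> R).

Definition seg (a : R) (b : \bar R) : set R := [set x | a < x /\ (x%:E < b)%E].

Definition position e (x : \bar R) : raw G := if x is r%:E then edge_pt e r else inl (head e).

Definition total d : \bar R := (\esum_(e in [set: edge G]) \int[mu]_(x in open_edge e) (d e x)%:E)%E.

(** A finite partition in the form of a tree: a subdivision only splits a leaf, and the same tree is
    read in [covered_pieces] as a decomposition into pieces of rays. *)
Inductive covered (H : Type) (on : H -> edge G) (lo : H -> R) (hi : H -> \bar R) e : R -> R -> Prop :=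
| covered_one h z z' of on h = e & lo h <= z & z <= z' & (z'%:E <= hi h)%E : covered on lo hi e z z'
| covered_cat z z' z'' of covered on lo hi e z z' & covered on lo hi e z' z'' : covered on lo hi e z z''.

(* A subdivision of [G]: the edge [h] is the part of the edge [on h] of [G]
   between the coordinates [lo h] and [hi h]. *)
Record refinement := Refinement {
  rgraph :> metric_graph R;
  on : edge rgraph -> edge G;
  lo : edge rgraph -> R;
  hi : edge rgraph -> \bar R;
  at_ : vertex rgraph -> raw G;
  bdry : set (vertex rgraph);
  lo_ge0 : forall h, 0 <= lo h;
  lo_hi : forall h, ((lo h)%:E < hi h)%E;
  hi_len : forall h, (hi h <= len (on h))%E;
  at_tail : forall h, at_ (tail h) = edge_pt (on h) (lo h);
  at_head : forall h, at_ (head h) = position (on h) (hi h);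
  bdry_at : forall v, bdry v -> exists2 b, B b & at_ v = inl b;
  at_bdry : forall b, B b -> exists2 v, bdry v & at_ v = inl b;
  refinement_conn : forall v w : vertex rgraph, reach [set: edge rgraph] v w;
  refinement_covered : forall e z z', closed_edge e z -> closed_edge e z' -> z <= z' ->
    covered on lo hi e z z';
  refinement_disj : forall h h', on h = on h' -> h <> h' ->
    (hi h <= (lo h')%:E)%E \/ (hi h' <= (lo h)%:E)%E;
  refinement_sums : forall d (T : R), (forall e x, 0 <= d e x) ->
    (forall e, measurable_fun (open_edge e) (d e)) -> (total d <= T%:E)%E ->
    forall s, uniq s ->
    \sum_(h <- s) fine (\int[mu]_(x in seg (lo h) (hi h)) (d (on h) x)%:E)%E <= T }.

Lemma refinement_cover (r : refinement) e x : closed_edge e x ->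
  exists h : edge r, [/\ on h = e, lo h <= x & (x%:E <= hi h)%E].
Proof.
move=> ex; have gen z z' : covered (@on r) (@lo r) (@hi r) e z z' ->
    exists h : edge r, [/\ on h = e, lo h <= z & (z%:E <= hi h)%E].
  by elim=> [h {}z {}z' oh h1 h2 h3|//]; exists h; split => //; apply: le_trans h3; rewrite lee_fin.
exact: gen (refinement_covered r ex ex (lexx x)).
Qed.

Lemma term_le_total d e : (forall e x, 0 <= d e x) ->
  (\int[mu]_(x in open_edge e) (d e x)%:E <= total d)%E.
Proof.
move=> d0; apply: (@esum_term_le _ _ (fun e => \int[mu]_(x in open_edge e) (d e x)%:E)%E) => i.
by apply: integral_ge0 => x _; rewrite lee_fin.
Qed.

Program Definition trivial_refinement : refinement :=
  @Refinement G id (fun=> 0) (@len R G) inl B _ _ _ _ _ _ _ _ _ _ _.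
Next Obligation. by []. Qed.
Next Obligation. by move=> h; exact: len_gt0. Qed.
Next Obligation. by []. Qed.
Next Obligation. by move=> h; rewrite edge_pt_tail. Qed.
Next Obligation.
move=> h; rewrite /position; case E : (len h) => [r| |] //.
by rewrite (edge_pt_head hG E).
Qed.
Next Obligation. by move=> v Bv; exists v. Qed.
Next Obligation. by move=> v Bv; exists v. Qed.
Next Obligation. by have [conn _ _ _] := hG. Qed.
Next Obligation. by move=> e z z' [z0 _] [_ zl] zz; apply: (@covered_one _ _ _ _ _ e). Qed.
Next Obligation. by []. Qed.
Next Obligation.
move=> d T d0 md dT s us; rewrite -lee_fin; apply: (le_trans _ dT).
apply: le_trans (esum_uniq_ge us _); last first.
  by move=> e; apply: integral_ge0 => x _; rewrite lee_fin.
rewrite -sumEFin; apply: lee_sum => e _; rewrite fineK//.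
rewrite ge0_fin_numE; last by apply: integral_ge0 => x _; rewrite lee_fin.
apply: le_lt_trans (ltry T); apply: le_trans dT; exact: term_le_total.
Qed.

Lemma seg_sub_open (r : refinement) (h : edge r) : seg (lo h) (hi h) `<=` open_edge (on h).
Proof.
move=> x [x0 xl]; split; first exact: le_lt_trans (lo_ge0 h) x0.
exact: lt_le_trans xl (hi_len h).
Qed.

Lemma seg_measurable a b : measurable (seg a b).
Proof.
case: b => [b| |].
- have -> : seg a b%:E = `]a, b[%classic; last exact: measurable_itv.
  by apply/seteqP; split => x; rewrite /seg /= in_itv/= lte_fin; [move=> [-> ->]|move=> /andP[]].
- have -> : seg a +oo = `]a, +oo[%classic; last exact: measurable_itv.
  by apply/seteqP; split => x; rewrite /seg /= in_itv/= ltry andbT; [move=> []|].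
- have -> : seg a -oo = set0; last exact: measurable0.
  by apply/seteqP; split => x // [].
Qed.

Section Subdivide.
Variables (r : refinement) (h0 : edge r) (y : R).
Hypotheses (ly : lo h0 < y) (yh : (y%:E < hi h0)%E).

Lemma seg_split d : (forall e x, 0 <= d e x) -> measurable_fun (open_edge (on h0)) (d (on h0)) ->
  (\int[mu]_(x in seg (lo h0) y%:E) (d (on h0) x)%:E + \int[mu]_(x in seg y (hi h0)) (d (on h0) x)%:E
   <= \int[mu]_(x in seg (lo h0) (hi h0)) (d (on h0) x)%:E)%E.
Proof.
move=> d0 md.
have sub1 : seg (lo h0) y%:E `<=` seg (lo h0) (hi h0).
  by move=> x [x1 x2]; split => //; exact: lt_trans x2 yh.
have sub2 : seg y (hi h0) `<=` seg (lo h0) (hi h0).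
  by move=> x [x1 x2]; split => //; exact: lt_trans x1.
have mseg A : measurable A -> A `<=` seg (lo h0) (hi h0) ->
    measurable_fun A (fun x => (d (on h0) x)%:E).
  move=> mA As; apply/measurable_EFinP; apply: measurable_funS md; first exact: open_edge_measurable.
  exact: subset_trans As (@seg_sub_open r h0).
rewrite -ge0_integral_setU; last 5 first.
- exact: seg_measurable.
- exact: seg_measurable.
- by apply: mseg; [apply: measurableU; exact: seg_measurable|move=> x [/sub1|/sub2]].
- by move=> x _; rewrite lee_fin.
- apply/disj_setPS => x [[_ +] [+ _]] /=; rewrite lte_fin => xy yx.
  by have := lt_trans xy yx; rewrite ltxx.
apply: ge0_subset_integral.
- by apply: measurableU; exact: seg_measurable.
- exact: seg_measurable.
- by apply: mseg => //; exact: seg_measurable.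
- by move=> x _; rewrite lee_fin.
- by move=> x [/sub1|/sub2].
Qed.

Let sgraph := @subdiv R r h0.
Let son (h : edge sgraph) : edge G := on (base h).
Let slo (h : edge sgraph) : R := if h is Some h' then lo h' else y.
Let shi (h : edge sgraph) : \bar R := if h is Some h' then if h' == h0 then y%:E else hi h' else hi h0.
Let sat (v : vertex sgraph) : raw G := if v is Some v' then at_ v' else edge_pt (on h0) y.

Let y0 : 0 <= y. Proof. exact: le_trans (lo_ge0 h0) (ltW ly). Qed.
Let yl : (y%:E < len (on h0))%E. Proof. exact: lt_le_trans yh (hi_len h0). Qed.

Program Definition subdivision : refinement :=
  @Refinement sgraph son slo shi sat (subdiv_set h0 (@bdry r)) _ _ _ _ _ _ _ _ _ _ _.
Next Obligation. by case=> [h|] //=; exact: lo_ge0. Qed.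
Next Obligation.
by case=> [h|] //=; case: eqVneq => [->|_]; rewrite ?lte_fin//; exact: lo_hi.
Qed.
Next Obligation.
case=> [h|]; rewrite /son /base/=; last exact: hi_len.
by case: eqVneq => [->|_]; [exact: ltW|exact: hi_len].
Qed.
Next Obligation. by case=> [h|] //=; exact: at_tail. Qed.
Next Obligation.
case=> [h|]; rewrite /son /base/=; last exact: at_head.
by case: eqVneq => [->|_] //=; exact: at_head.
Qed.
Next Obligation. by move=> _ [v /bdry_at[b Bb E] <-]; exists b. Qed.
Next Obligation. by move=> b /(at_bdry r)[v Bv E]; exists (Some v) => //; exists v. Qed.
Next Obligation.
have some v w : reach [set: edge r] v w -> reach [set: edge sgraph] (Some v : vertex sgraph) (Some w).
  move: w; apply: reach_ind_arc; first exact: reach_refl.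
  move=> c _ h; apply: (reach_trans h).
  have [ch|ch] := eqVneq c.1 h0; last first.
    have := @reach_arc _ sgraph setT (Some (src c)) (Some c.1, c.2) I.
    case: c ch {h} => c [] /= /negbTE ch; rewrite /src /dst /= ch => h; apply: h; exact: reach_refl.
  have st := @reach_fwd _ sgraph setT (Some (tail h0)) (Some h0) I (reach_refl _ _).
  rewrite /= eqxx in st.
  have := @reach_fwd _ sgraph setT (Some (tail h0)) None I st => /= st'.
  case: c ch {h} => c [] /= ->; rewrite /src /dst /=; first exact: st'.
  exact: reach_sym.
have none : reach [set: edge sgraph] (None : vertex sgraph) (Some (head h0)).
  exact: (@reach_fwd _ sgraph setT None None I (reach_refl _ _)).
move=> [v|] [w|].
- exact/some/refinement_conn.
- by apply: reach_trans (some _ _ (refinement_conn _ _)) (reach_sym none).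
- by apply: reach_trans none (some _ _ (refinement_conn _ _)).
- exact: reach_refl.
Qed.
Next Obligation.
move=> e z z' ez ez' /(refinement_covered r ez ez') {ez ez'}.
elim=> [h {}z {}z' oh lz zz zh|z1 z2 z3 _ h1 _ h2]; last exact: covered_cat h1 h2.
have [hh|hh] := eqVneq h h0; last first.
  by apply: (@covered_one _ _ _ _ _ (Some h)); rewrite /son /slo /shi /base /= ?(negbTE hh).
have left_ w : w <= y -> z <= w -> covered son slo shi e z w.
  by move=> wy zw; apply: (@covered_one _ _ _ _ _ (Some h)); rewrite /son /slo /shi /base /= ?hh ?eqxx ?lee_fin -?hh.
have right_ w : y <= w -> w <= z' -> covered son slo shi e w z'.
  by move=> yw wz; apply: (@covered_one _ _ _ _ _ None); rewrite /son /slo /shi /base /= -?hh.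
have [z'y|/ltW yz'] := leP z' y; first exact: left_.
have [zy|/ltW yz] := leP z y; last exact: right_.
by apply: covered_cat (left_ y _ zy) (right_ y _ yz').
Qed.
Next Obligation.
have H (h h' : edge r) : on h = on h' -> h <> h' -> (hi h <= (lo h')%:E)%E \/ (hi h' <= (lo h)%:E)%E.
  exact: refinement_disj.
have mixed (h : edge r) : on h = on h0 -> (shi (Some h) <= y%:E)%E \/ (hi h0 <= (lo h)%:E)%E.
  move=> oh; rewrite /shi; case: eqVneq => [_|/eqP hh]; first by left.
  have [h1|h1] := H h h0 oh hh; last by right.
  by left; apply: (le_trans h1); rewrite lee_fin ltW.
move=> [h|] [h'|]; rewrite /son /slo /base //= => oh hh.
- have hh' : h <> h' by move=> E; apply: hh; rewrite E.
  have [h1|h1] := H _ _ oh hh'.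
    left; case: eqVneq => [E|//]; apply: le_trans h1; rewrite E; exact: ltW.
  right; case: eqVneq => [E|//]; apply: le_trans h1; rewrite E; exact: ltW.
- exact: mixed.
- by have [|] := mixed h' (esym oh); [right|left].
Qed.
Next Obligation.
move=> d T d0 md dT.
pose W (h : edge r) := fine (\int[mu]_(x in seg (lo h) (hi h)) (d (on h) x)%:E)%E.
have W0 h : 0 <= W h by apply: fine_ge0; apply: integral_ge0 => x _; rewrite lee_fin.
(* Only the bound on sums is wanted, so [network_subdiv] is applied to the zero potential. *)
have net : network (@bdry r) (fun=> 0) W T.
  split => //; first by move=> h; rewrite subr0 normr0.
  by move=> s; exact: refinement_sums.
pose W1 := fine (\int[mu]_(x in seg (lo h0) y%:E) (d (on h0) x)%:E)%E.
pose W2 := fine (\int[mu]_(x in seg y (hi h0)) (d (on h0) x)%:E)%E.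
have fin a b : seg a b `<=` open_edge (on h0) ->
    (\int[mu]_(x in seg a b) (d (on h0) x)%:E)%E \is a fin_num.
  move=> ab; rewrite ge0_fin_numE; last by apply: integral_ge0 => x _; rewrite lee_fin.
  apply: (@le_lt_trans _ _ T%:E); last exact: ltry.
  apply: le_trans dT; apply: le_trans (term_le_total (on h0) d0).
  apply: ge0_subset_integral => //; [exact: seg_measurable|exact: open_edge_measurable| |].
    by apply/measurable_EFinP; exact: md.
  by move=> x _; rewrite lee_fin.
have sub := @seg_sub_open r h0.
have W12 : W1 + W2 <= W h0.
  rewrite -lee_fin EFinD !fineK; first exact: seg_split.
  - exact: fin.
  - by apply: fin => x [x1 x2]; apply: sub; split => //; exact: lt_trans x1.
  - by apply: fin => x [x1 x2]; apply: sub; split => //; exact: lt_trans x2 yh.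
have g1 : 0 <= W1 by apply: fine_ge0; apply: integral_ge0 => x _; rewrite lee_fin.
have g2 : 0 <= W2 by apply: fine_ge0; apply: integral_ge0 => x _; rewrite lee_fin.
have [||_ _ h] := @network_subdiv _ _ _ _ _ _ _ 0 _ _ net W12; rewrite ?subr0 ?normr0//.
move=> s us; apply: le_trans (h s us); rewrite le_eqVlt; apply/orP; left; apply/eqP.
apply: eq_bigr => -[h'|] _ //=; rewrite /son /base /slo /shi /=.
by case: eqVneq => [->|].
Qed.

End Subdivide.

(** Vertices keep their places, so the operation can be iterated to turn two maximum points into
    vertices of one refinement; the two properties of cuts used later are preserved. *)
Lemma refine_at (r : refinement) e x : closed_edge e x -> exists r' : refinement,
  [/\ nested (@bdry r) -> nested (@bdry r'),
      (forall h s, ~ dead (@bdry r) h s) -> (forall h s, ~ dead (@bdry r') h s),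
      exists v : vertex r', at_ v = edge_pt e x &
      forall v : vertex r, exists v' : vertex r', at_ v' = at_ v].
Proof.
move=> /(refinement_cover r)[h [<- lx xh]].
move: lx; rewrite le_eqVlt => /predU1P[lx|lx].
  by exists r; split => // [|v]; [exists (tail h); rewrite at_tail lx|exists v].
move: xh; rewrite le_eqVlt => /predU1P[xh|xh].
  by exists r; split => // [|v]; [exists (head h); rewrite at_head -xh|exists v].
exists (subdivision lx xh); split.
- exact: nested_subdiv.
- exact: nodead_subdiv.
- by exists (None : vertex (subdivision lx xh)).
- by move=> v; exists (Some v : vertex (subdivision lx xh)).
Qed.

(** The continuous counterpart of [network], with [|k|] integrated over an edge as its capacity.
    Decay along half-lines plays the role of continuity at the vertices at infinity, where values
    are conventional. *)
Definition bv_potential (V : raw G -> R) (k : edge G -> R -> R) (T : R) : Prop :=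
  [/\ forall e, prim (closed_edge e) (fun x => V (edge_pt e x)) (k e),
      forall e, measurable_fun (open_edge e) (k e),
      forall e eta, half_line e -> 0 < eta -> exists2 a, 0 <= a & forall x, a <= x -> `|V (edge_pt e x)| <= eta,
      forall b, B b -> V (inl b) = 0 &
      (total (fun e x => `|k e x|%R) <= T%:E)%E].

Hypothesis hB : @Vinf R G `<=` B.

Section TotalVariation.
Variables (V : raw G -> R) (k : edge G -> R -> R) (T : R).
Hypothesis hV : bv_potential V k T.

Let mk e : measurable_fun (open_edge e) (fun x => `|k e x|).
Proof. by have [_ /(_ e) h _ _ _] := hV; exact: measurableT_comp. Qed.

Let sub_len e a b : 0 <= a -> (b <= len e)%E -> seg a b `<=` open_edge e.
Proof. by move=> a0 bl x [ax xb]; split; [exact: le_lt_trans ax|exact: lt_le_trans bl]. Qed.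

Let seg_fin e a b : 0 <= a -> (b <= len e)%E ->
  (\int[mu]_(x in seg a b) `|k e x|%:E)%E \is a fin_num.
Proof.
move=> a0 bl; rewrite ge0_fin_numE; last by apply: integral_ge0 => x _; rewrite lee_fin.
apply: (@le_lt_trans _ _ T%:E); last exact: ltry.
have [_ _ _ _ dT] := hV; apply: le_trans dT.
apply: le_trans (term_le_total (d := fun e x => `|k e x|) e (fun e x => normr_ge0 _)).
apply: ge0_subset_integral => //; [exact: seg_measurable|exact: open_edge_measurable| |].
  by apply/measurable_EFinP; exact: mk.
exact: sub_len.
Qed.

Lemma seg_cat e a b c : 0 <= a -> a <= b -> (b%:E <= c)%E -> (c <= len e)%E ->
  (\int[mu]_(x in seg a b%:E) `|k e x|%:E + \int[mu]_(x in seg b c) `|k e x|%:E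
   <= \int[mu]_(x in seg a c) `|k e x|%:E)%E.
Proof.
move=> a0 ab bc cl.
have sub1 : seg a b%:E `<=` seg a c by move=> x [x1 x2]; split => //; exact: lt_le_trans bc.
have sub2 : seg b c `<=` seg a c by move=> x [x1 x2]; split => //; exact: le_lt_trans x1.
have ms A : measurable A -> A `<=` seg a c -> measurable_fun A (fun x => `|k e x|%:E).
  move=> mA As; apply/measurable_EFinP; apply: measurable_funS (@mk e); first exact: open_edge_measurable.
  exact: subset_trans As (sub_len a0 cl).
rewrite -ge0_integral_setU; last 5 first.
- exact: seg_measurable.
- exact: seg_measurable.
- by apply: ms; [apply: measurableU; exact: seg_measurable|move=> x [/sub1|/sub2]].
- by move=> x _; rewrite lee_fin.
- apply/disj_setPS => x [[_ +] [+ _]] /=; rewrite lte_fin => xy yx.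
  by have := lt_trans xy yx; rewrite ltxx.
apply: ge0_subset_integral.
- by apply: measurableU; exact: seg_measurable.
- exact: seg_measurable.
- by apply: ms => //; exact: seg_measurable.
- by move=> x _; rewrite lee_fin.
- by move=> x [/sub1|/sub2].
Qed.

Lemma bv_potential_itv e a b : closed_edge e a -> closed_edge e b -> a <= b ->
  (`|V (edge_pt e b) - V (edge_pt e a)|%:E <= \int[mu]_(x in seg a b%:E) `|k e x|%:E)%E.
Proof.
move=> ea eb ab; have [pk _ _ _ _] := hV.
have := le_prim ab ea eb (pk e); rewrite -lee_fin => /le_trans; apply.
have [ik _] := pk e _ _ ab ea eb.
rewrite -integral_oo_cc//; last exact: integrable_normr.
rewrite le_eqVlt; apply/orP; left; apply/eqP; congr (integral _ _ _).
by apply/seteqP; split => x; rewrite /seg /= in_itv/= lte_fin; [move=> /andP[]|move=> [-> ->]].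
Qed.

Lemma bv_potential_half_line e a : half_line e -> closed_edge e a ->
  (`|V (edge_pt e a)|%:E <= \int[mu]_(x in seg a +oo) `|k e x|%:E)%E.
Proof.
move=> he ea; have [a0 _] := ea; apply/lee_addgt0Pr => eta eta0.
have [_ _ /(_ e eta he eta0)[b b0 hb] _ _] := hV.
pose c := Num.max a b.
have ac : a <= c by rewrite le_max lexx.
have ec : closed_edge e c by split; [exact: le_trans ac|rewrite he leey].
have tri : `|V (edge_pt e a)| <= `|V (edge_pt e c) - V (edge_pt e a)| + eta.
  have := hb c; rewrite le_max lexx orbT => /(_ isT) hc.
  have := ler_normB (V (edge_pt e c)) (V (edge_pt e c) - V (edge_pt e a)).
  rewrite opprB addrC subrK => h; apply: (le_trans h); rewrite addrC; exact: lerD.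
apply: (@le_trans _ _ (`|V (edge_pt e c) - V (edge_pt e a)|%:E + eta%:E)%E); first by rewrite -EFinD lee_fin.
apply: leeD => //; apply: le_trans (bv_potential_itv ea ec ac) _.
apply: le_trans (@seg_cat e a c +oo a0 ac (leey _) _); last by rewrite he.
by rewrite leeDl// integral_ge0// => x _; rewrite lee_fin.
Qed.

Lemma bv_potential_network (r : refinement) : network (@bdry r) (fun v => V (at_ v))
  (fun h => fine (\int[mu]_(x in seg (lo h) (hi h)) `|k (on h) x|%:E)%E) T.
Proof.
have [pk _ _ VB dT] := hV.
split.
- move=> h; rewrite -lee_fin (fineK (seg_fin (lo_ge0 h) (hi_len h))) at_tail at_head.
  have el : closed_edge (on h) (lo h).
    split; first exact: lo_ge0.
    by apply: le_trans (hi_len h); exact/ltW/lo_hi.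
  have := hi_len h; have := lo_hi h; case: (hi h) => [b| |]//=.
    rewrite lte_fin => lb bl; apply: bv_potential_itv => //; last exact: ltW.
    by split => //; apply: le_trans (ltW lb); exact: lo_ge0.
  move=> _; rewrite leye_eq => /eqP hl.
  rewrite VB ?sub0r ?normrN; last by apply: hB; exists (on h).
  exact: bv_potential_half_line.
- by move=> v /bdry_at[b Bb ->]; exact: VB.
- move=> s us; exact: (refinement_sums (d := fun e x => `|k e x|)).
Qed.

End TotalVariation.

Lemma bv_potential_bound (r : refinement) V k T (v : vertex r) : bv_potential V k T -> B !=set0 ->
  (forall h s, ~ dead (@bdry r) h s) -> 2 * `|V (at_ v)| <= T.
Proof.
move=> hV [b Bb] nd; apply: (network_bound (bv_potential_network hV r)) => //; last exact: refinement_conn.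
by have [w Bw _] := at_bdry r Bb; exists w.
Qed.

Lemma bv_potentials_bound (r : refinement) V k T V' k' T' (s t : vertex r) :
  bv_potential V k T -> bv_potential V' k' T' -> B !=set0 -> V (at_ t) = 0 -> V' (at_ s) = 0 ->
  nested (@bdry r) -> 2 * `|V (at_ s)| <= T \/ 2 * `|V' (at_ t)| <= T'.
Proof.
move=> hV hV' [b Bb] Vt Vs nd.
apply: (nested_networks (bv_potential_network hV r) (bv_potential_network hV' r)) => //; last exact: refinement_conn.
by have [w Bw _] := at_bdry r Bb; exists w.
Qed.

End Refinements.

(** * Total variation bound for the energy on the Nehari manifold *)

Section NehariBound.
Context {R : realType} (G : metric_graph R).
Local Notation mu := (@lebesgue_measure R).
Variables (p lambda : R) (Z : set (vertex G)) (e0 : edge G).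
Hypotheses (hG : classG G) (hp : 2 < p) (hlambda : 0 < lambda).
Implicit Types (e : edge G) (x : R) (u : pt G -> R).

Local Notation peak := (peak p lambda).
Local Notation well2 := (well2 p lambda).
Local Notation well := (well p lambda).
Local Notation phase := (phase p lambda).

Lemma normG_ge0 q (w : edge G -> R -> R) : (0 <= normG q w)%E.
Proof. by apply: esum_ge0 => e _; apply: integral_ge0 => x _; rewrite lee_fin powR_ge0. Qed.

Lemma H1_normp u : H1 u -> (normG p (on_edge u) < +oo)%E.
Proof.
move=> hu; have [M M0 hM] := H1_bounded hG hu.
have [_ _ _ h2] := hu.
have M2 : 0 < M `^ (p - 2) by rewrite powR_gt0.
apply: (@le_lt_trans _ _ ((M `^ (p - 2))%:E * normG 2 (on_edge u))%E); last first.
  by rewrite lte_mul_pinfty// lee_fin ltW.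
rewrite -esumZl//; last by move=> e; apply: integral_ge0 => x _; rewrite lee_fin powR_ge0.
have mw e : measurable_fun (open_edge e) (on_edge u e).
  by apply: (on_edge_measurable hG); exact: H1_prim.
apply: le_esum => e _.
have g0 x : open_edge e x -> (0 <= (`|on_edge u e x| `^ 2)%:E)%E by rewrite lee_fin powR_ge0.
rewrite -(ge0_integralZl_EFin mu (open_edge_measurable hG e) g0 (measurable_normpow 2 (mw e)) (ltW M2)).
apply: ge0_le_integral => //; [exact: open_edge_measurable|exact: measurable_normpow| |].
  by apply: measurable_funeM; exact: measurable_normpow.
move=> x ex; rewrite -EFinM lee_fin normr_powR_sub2// powR_mulrn// real_normK ?num_real//.
rewrite ler_wpM2r ?sqr_ge0// ge0_ler_powR//.
- by rewrite subr_ge0 ltW.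
- by rewrite nnegrE ltW.
- by apply: hM; exact: open_closed_edge.
Qed.

Lemma eval_Vinf u v : Vinf v -> eval u (inl v) = 0.
Proof. by move=> hv; rewrite /eval insubF//; apply/negP; rewrite inE => /(_ hv). Qed.

Section Nehari.
Variable u : pt G -> R.
Hypothesis hu : nehari p lambda Z u.

Let Hu : H1 u. Proof. by have [[]] := hu. Qed.

Let mw e : measurable_fun (open_edge e) (on_edge u e).
Proof. by apply: (on_edge_measurable hG); exact: H1_prim. Qed.

Let mg e : measurable_fun (open_edge e) (edge_deriv u e).
Proof. apply: measurable_funTS; exact: edge_deriv_measurable. Qed.

Lemma nehari_nonzero : exists e x, closed_edge e x /\ on_edge u e x != 0.
Proof.
have [_ un0 _] := hu; apply: contrapT => h; apply: un0; apply/funext => q /=.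
have [e [x [ex eq]]] := pt_on_edge hG e0 q.
rewrite -(on_edgeE u eq); apply/eqP; rewrite -[_ == _]negbK; apply/negP => n0.
by apply: h; exists e, x.
Qed.

Lemma nehari_real : exists A B C : R,
  [/\ normG 2 (deriv_on_edge u) = A%:E, normG 2 (on_edge u) = B%:E,
      normG p (on_edge u) = C%:E, A + lambda * B = C & [/\ 0 <= A, 0 <= B & 0 < C]].
Proof.
have [_ _ a_ b_] := Hu; have c_ := H1_normp Hu; have [_ _ E] := hu.
have [K K0 hK] := H1_sup_norm hG Hu; have [e [x [ex ux]]] := nehari_nonzero.
have := hK e x ex; move: a_ b_ c_ E (normG_ge0 2 (deriv_on_edge u)) (normG_ge0 2 (on_edge u)).
case: (normG 2 (deriv_on_edge u)) => [A| |]// _.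
case: (normG 2 (on_edge u)) => [B| |]// _.
case: (normG p (on_edge u)) => [C| |]// _.
rewrite -EFinM -EFinD !lee_fin /= => -[E] A0 B0 ub; exists A, B, C; split => //; split => //.
rewrite -E; have u0 : 0 < on_edge u e x ^+ 2 by rewrite exprn_even_gt0.
have := lt_le_trans u0 ub; rewrite pmulr_rgt0// => BA.
have [B1|B1] := eqVneq B 0; first by move: BA; rewrite B1 add0r mulr0 addr0.
by rewrite ltr_wpDl// mulr_gt0// lt_neqAle eq_sym B1.
Qed.

Lemma nehari_energy C : normG p (on_edge u) = C%:E -> J p lambda u = ((2^-1 - p^-1) * C)%:E.
Proof.
have [A [B [C' [EA EB EC ABC _]]]] := nehari_real; rewrite EC => -[<-].
rewrite /J /energy EA EB EC -!EFinM; apply: (congr1 EFin).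
by rewrite -ABC; field; rewrite gt_eqF// (lt_trans _ hp).
Qed.

(** On the Nehari manifold the energy of [t u] depends on [u] through [C] only, which reduces its
    comparison with [J u] to a function of [t]. *)
Lemma total_density t A B C : 0 < t -> (forall e x, open_edge e x -> `|t * on_edge u e x| <= peak) ->
  normG 2 (deriv_on_edge u) = A%:E -> normG 2 (on_edge u) = B%:E ->
  normG p (on_edge u) = C%:E -> A + lambda * B = C ->
  total (fun e => density p lambda t (on_edge u e) (edge_deriv u e)) = ((t ^+ 2 / 2 - t `^ p / p) * C)%:E.
Proof.
move=> t0 tu EA EB EC ABC; have p0 : 0 < p by exact: lt_trans hp.
have D0 e : (0 <= \int[mu]_(x in open_edge e)
    (density p lambda t (on_edge u e) (edge_deriv u e) x)%:E)%E.
  by apply: integral_ge0 => x ex; rewrite lee_fin density_ge0// tu.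
have N0 q (w : edge G -> R -> R) e : (0 <= \int[mu]_(x in open_edge e) (`|w e x| `^ q)%:E)%E.
  by apply: integral_ge0 => x ex; rewrite lee_fin powR_ge0.
have c1 : 0 < t `^ p / p by rewrite divr_gt0// powR_gt0.
have c2 : 0 < t ^+ 2 / 2 by rewrite divr_gt0// exprn_gt0.
have c3 : 0 < lambda * t ^+ 2 / 2 by rewrite divr_gt0// mulr_gt0// exprn_gt0.
have : (total (fun e => density p lambda t (on_edge u e) (edge_deriv u e)) +
    (t `^ p / p)%:E * normG p (on_edge u) =
    (t ^+ 2 / 2)%:E * normG 2 (edge_deriv u) + (lambda * t ^+ 2 / 2)%:E * normG 2 (on_edge u))%E.
  apply: (esum_lincomb c1 c2 c3) => [e|e|e|e|e]; [exact: D0|exact: N0|exact: N0|exact: N0|].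
  by apply: integral_density => //; [exact: open_edge_measurable|exact: tu].
rewrite normG_edge_deriv EA EB EC -!EFinM -EFinD.
case: (total _) => [d| |]// => -[E]; congr (_%:E).
by rewrite -[d](addrK (t `^ p / p * C)) E -ABC; field; rewrite gt_eqF.
Qed.

(** Two losses separate the total variation [T] from the energy [j]: the integral of the square [h]
    left over by its completion, and the drop from the energy of [u] to that of [t u], bounded by
    [young_powR]. If [j <= T], both vanish: [h] is zero almost everywhere and [t = 1]. *)
Lemma nehari_bv_potential : exists V k T e1 x1 j,
  [/\ [/\ bv_potential (@Vinf R G `|` Z) V k T, closed_edge e1 x1 /\ on_edge u e1 x1 != 0, `|V (edge_pt e1 x1)| = phase peak &
        forall q, eval u q = 0 -> V q = 0],
      J p lambda u = j%:E, T <= j & j <= T -> [/\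
        forall e, {ae mu, forall x, open_edge e x -> `|edge_deriv u e x| = well (on_edge u e x)},
        forall e x, closed_edge e x -> `|on_edge u e x| <= peak &
        `|on_edge u e1 x1| = peak]].
Proof.
have pk := peak_gt0 hp hlambda.
have [A [B [C [EA EB EC ABC [A0 B0 C0]]]]] := nehari_real.
have [e1 [x1 [ex1 mx]]] := H1_max_attained hG Hu nehari_nonzero.
set M := `|on_edge u e1 x1| in mx.
have M0 : 0 < M.
  have [e [x [ex ux]]] := nehari_nonzero; apply: lt_le_trans (mx e x ex).
  by rewrite normr_gt0.
pose t := peak / M; have t0 : 0 < t by rewrite divr_gt0.
have tM : t * M = peak by rewrite /t divfK// gt_eqF.
have tu e x : closed_edge e x -> `|t * on_edge u e x| <= peak.
  by move=> ex; rewrite normrM (gtr0_norm t0) -tM ler_pM2l// mx.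
have tu' e x : open_edge e x -> `|t * on_edge u e x| <= peak.
  by move=> ex; apply: tu; exact: open_closed_edge.
pose V (q : raw G) := phase (t * eval u q).
pose k e x := well (t * on_edge u e x) * (t * edge_deriv u e x).
pose D e := density p lambda t (on_edge u e) (edge_deriv u e).
pose h e x := 2^-1 * (`|t * edge_deriv u e x| - well (t * on_edge u e x)) ^+ 2.
have Dkh e x : open_edge e x -> D e x = `|k e x| + h e x.
  move=> ex; rewrite /D /density -sqr_well//; last exact: tu'.
  rewrite /h /k normrM (ger0_norm (well_ge0 _ _ _)) -[(t * edge_deriv u e x) ^+ 2]real_normK ?num_real//.
  by field.
have mwell e : measurable_fun (open_edge e) (fun x => well (t * on_edge u e x)).
  apply: (measurableT_comp (f := well)); last exact: measurable_funM.
  by apply: continuous_measurable_fun; exact: continuous_well.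
have mk e : measurable_fun (open_edge e) (k e).
  by apply: measurable_funM => //; exact: measurable_funM.
have mak e : measurable_fun (open_edge e) (fun x => `|k e x|) by exact: measurableT_comp.
have mh e : measurable_fun (open_edge e) (h e).
  apply: measurable_funM => //; apply: measurable_funX; apply: measurable_funB => //.
  by apply: measurableT_comp => //; exact: measurable_funM.
have h0 e x : 0 <= h e x by rewrite /h mulr_ge0 ?invr_ge0 ?sqr_ge0.
have DT := total_density t0 tu' EA EB EC ABC.
have split : (total D = total (fun e x => `|k e x|%R) + total h)%E.
  rewrite /total -esumD; last 2 first.
  - by move=> e _; apply: integral_ge0 => x _; rewrite lee_fin.
  - by move=> e _; apply: integral_ge0 => x _; rewrite lee_fin.
  apply: eq_esum => e _; rewrite -ge0_integralD//.
  - by apply: eq_integral => x; rewrite inE => ex; rewrite -EFinD Dkh.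
  - exact: open_edge_measurable.
  - by apply/measurable_EFinP; exact: mak.
  - by move=> x _; rewrite lee_fin.
  - by apply/measurable_EFinP; exact: mh.
have tk0 : (0 <= total (fun e x => `|k e x|%R))%E.
  by apply: esum_ge0 => e _; apply: integral_ge0 => x _; rewrite lee_fin.
have th0 : (0 <= total h)%E.
  by apply: esum_ge0 => e _; apply: integral_ge0 => x _; rewrite lee_fin.
have [T [H [TE HE TH]]] : exists T H, [/\ total (fun e x => `|k e x|%R) = T%:E, total h = H%:E &
    T + H = (t ^+ 2 / 2 - t `^ p / p) * C].
  move: split tk0 th0; rewrite {1}/D DT.
  case: (total (fun e x => `|k e x|%R)) => [T| |]//; case: (total h) => [H| |]//.
  by rewrite -EFinD => -[E] _ _; exists T, H.
rewrite HE lee_fin in th0.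
have [y1 y2] := young_powR hp t0.
exists V, k, T, e1, x1, ((2^-1 - p^-1) * C); split.
- split => //.
  + split => //.
    * move=> e; apply: (prim_phase hp (I := closed_edge e) (w := fun x => t * on_edge u e x) (g := fun x => t * edge_deriv u e x)).
      - exact: closed_edge_interval.
      - exact: primZ (H1_prim hG Hu (e := e)).
      - exact: tu.
    * move=> e eta he eta0.
      have c0 : {for 0, continuous phase} by apply: continuous_phase => //; lra.
      move/cvgrPdist_lt: c0 => /(_ _ eta0)[d /= d0 hd].
      have dt0 : 0 < d / (2 * t) by rewrite divr_gt0// mulr_gt0.
      have [a a0 ha] := H1_decay hG Hu he dt0; exists a => // x /ha.
      rewrite -/(on_edge u e x) => hx; apply: ltW.
      have := hd (t * on_edge u e x); rewrite /= phase0 !sub0r !normrN; apply.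
      rewrite normrM (gtr0_norm t0); apply: (@le_lt_trans _ _ (t * (d / (2 * t)))).
        by rewrite ler_pM2l.
      have -> : t * (d / (2 * t)) = d / 2 by field; rewrite gt_eqF.
      by rewrite ltr_pdivrMr// ltr_pMr// ltr1n.
    * move=> b [bi|bZ]; rewrite /V; first by rewrite eval_Vinf// mulr0 phase0.
      by have [[_ /(_ b bZ) ->] _ _] := hu; rewrite mulr0 phase0.
    * by rewrite TE.
  + by split => //; rewrite -normr_gt0.
  + have := norm_phase hp hlambda (tu _ _ ex1).
    by rewrite normrM (gtr0_norm t0) -/M tM.
  + by move=> q q0; rewrite /V q0 mulr0 phase0.
- exact: nehari_energy.
- have := ler_wpM2r (ltW C0) y1; lra.
move=> jT.
have H0 : H = 0 by have := ler_wpM2r (ltW C0) y1; lra.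
have t1 : t = 1.
  by apply: y2; apply/eqP; rewrite -(inj_eq (mulIf (lt0r_neq0 C0))); apply/eqP; have := ler_wpM2r (ltW C0) y1; lra.
split.
- move=> e.
  have he : (\int[mu]_(x in open_edge e) (h e x)%:E = 0)%E.
    apply/eqP; rewrite eq_le; apply/andP; split; last by apply: integral_ge0 => x _; rewrite lee_fin.
    by apply: le_trans (term_le_total e h0) _; rewrite HE H0.
  have mhe : measurable_fun (open_edge e) (fun x => (h e x)%:E) by apply/measurable_EFinP; exact: mh.
  have := (ae_eq_integral_abs mu (open_edge_measurable hG e) mhe).1.
  under eq_integral do rewrite gee0_abs ?lee_fin//.
  move=> ae0; have {ae0} := ae0 he; rewrite /ae_eq; apply: filterS.
  move=> x hx ex; have /eqP := hx ex; rewrite /= eqe /h t1 !mul1r mulf_eq0 invr_eq0 pnatr_eq0/=.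
  by rewrite expf_eq0/= subr_eq0 => /eqP.
- by move=> e x /tu; rewrite t1 mul1r.
- by rewrite -/M -tM t1 mul1r.
Qed.

End Nehari.
End NehariBound.

(** * Lower bounds for the energy *)

Section Vanishing.
Context {R : realType}.
Local Notation mu := (@lebesgue_measure R).
Implicit Types (I : set R) (w g f : R -> R) (a b L : R).

Lemma Rintegral_le0_ae f a b : a <= b -> mu.-integrable `[a, b] (EFin \o f) ->
  {ae mu, forall x, a < x < b -> f x <= 0} -> \int[mu]_(x in `[a, b]) f x <= 0.
Proof.
move=> ab fi f0.
have mf : measurable_fun (`[a, b] : set R) f by apply/measurable_EFinP; exact: measurable_int fi.
have mp : measurable_fun (`[a, b] : set R) (fun x => pos (f x)).
  apply: (measurableT_comp (f := @pos R)) => //.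
  by apply: continuous_measurable_fun; exact: continuous_pos.
have ip : mu.-integrable `[a, b] (EFin \o (fun x => pos (f x))).
  apply: le_integrable fi => //; first exact/measurable_EFinP.
  move=> x _ /=; rewrite lee_fin ger0_norm ?pos_ge0//.
  by have := normr_ge0 (f x); have := ler_norm (f x); rewrite /pos; case: (leP (f x) 0).
apply: (@le_trans _ _ (\int[mu]_(x in `[a, b]) pos (f x))).
  by apply: le_Rintegral => // x _; rewrite /pos le_max lexx.
rewrite -lee_fin -integral_oo_cc//.
have E : (\int[mu]_(x in `]a, b[) (pos (f x))%:E = \int[mu]_(x in `]a, b[) (cst 0%E x))%E.
  apply: ae_eq_integral => //.
    apply/measurable_EFinP; apply: measurable_funS mp => //; exact: subset_itv_oo_cc.
  apply: filterS f0; first exact: (ae_filter_ringOfSetsType mu).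
  by move=> x fx; rewrite /= in_itv/= => /fx fx0; rewrite le0_pos.
by rewrite E integral0.
Qed.

Lemma prim_exp_weight I w g k : is_interval I -> prim I w g ->
  prim I (fun x => w x ^+ 2 * expR (k * x)) (fun x => (2 * w x * g x + k * w x ^+ 2) * expR (k * x)).
Proof.
move=> iI pw.
have dE (x : R) : is_derive x 1 (fun y => expR (k * y)) (k * expR (k * x)).
  have := is_derive_affine (is_derive_expR (k * x + 0)).
  by rewrite addr0; under eq_fun do rewrite addr0.
have cE : continuous (fun x => k * expR (k * x)).
  move=> x; apply: cvgM; first exact: cvg_cst.
  exact: is_derive_continuous dE x.
have := primM iI (prim_sqr iI pw) (prim_C1 (I := I) dE cE).
apply: prim_eq => // x _ /=; ring.
Qed.

(** Gronwall's argument under an almost everywhere bound: [w ^+ 2] times [expR (- 2 L x)] does not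
    increase to the right of [a], and [w ^+ 2] times [expR (2 L x)] does not decrease to its
    left. *)
Lemma prim_vanish I w g L a b : is_interval I -> prim I w g -> 0 <= L ->
  (forall a b, I a -> I b -> {ae mu, forall x, a < x < b -> `|g x| <= L * `|w x|}) ->
  I a -> I b -> w a = 0 -> w b = 0.
Proof.
move=> iI pw L0 gL Ia Ib wa.
have key x : `|g x| <= L * `|w x| -> 2 * w x * g x <= 2 * L * w x ^+ 2 /\
    - (2 * w x * g x) <= 2 * L * w x ^+ 2.
  move=> gx; have : `|w x| * `|g x| <= L * w x ^+ 2.
    apply: (le_trans (ler_wpM2l (normr_ge0 (w x)) gx)).
    by rewrite mulrCA -expr2 real_normK ?num_real.
  by rewrite -normrM ler_norml => /andP[h1 h2]; split; lra.
have e0 (y : R) : 0 < expR y by exact: expR_gt0.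
have sq0 k : w a ^+ 2 * expR (k * a) = 0 by rewrite wa expr0n mul0r.
suff h : w b ^+ 2 <= 0 by apply/eqP; rewrite -sqrf_eq0 eq_le h sqr_ge0.
have [ab|/ltW ba] := leP a b.
  have [i E] := prim_exp_weight (- (2 * L)) iI pw ab Ia Ib.
  rewrite -(pmulr_rle0 _ (e0 (- (2 * L) * b))).
  have -> : expR (- (2 * L) * b) * w b ^+ 2 =
      w b ^+ 2 * expR (- (2 * L) * b) - w a ^+ 2 * expR (- (2 * L) * a).
    by rewrite sq0 subr0 mulrC.
  rewrite E; apply: Rintegral_le0_ae => //.
  apply: filterS (gL _ _ Ia Ib); first exact: (ae_filter_ringOfSetsType mu).
  move=> x h /h /key[k1 _]; rewrite pmulr_lle0//; lra.
have [i E] := prim_exp_weight (2 * L) iI pw ba Ib Ia.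
have iN : mu.-integrable `[b, a] (EFin \o (fun x => - ((2 * w x * g x + 2 * L * w x ^+ 2) * expR (2 * L * x)))).
  have := integrableN i; congr (_.-integrable _ _); exact/funext.
rewrite -(pmulr_rle0 _ (e0 (2 * L * b))).
have -> : expR (2 * L * b) * w b ^+ 2 =
    - (w a ^+ 2 * expR (2 * L * a) - w b ^+ 2 * expR (2 * L * b)).
  by rewrite sq0 sub0r opprK mulrC.
rewrite E.
rewrite -mulN1r -RintegralZl//.
have -> : \int[mu]_(x in `[b, a]) (-1 * ((2 * w x * g x + 2 * L * w x ^+ 2) * expR (2 * L * x))) =
   \int[mu]_(x in `[b, a]) - ((2 * w x * g x + 2 * L * w x ^+ 2) * expR (2 * L * x)).
  by apply: eq_Rintegral => x _; rewrite mulN1r.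
apply: Rintegral_le0_ae => //.
apply: filterS (gL _ _ Ib Ia); first exact: (ae_filter_ringOfSetsType mu).
move=> x h /h /key[_ k1]; rewrite oppr_le0 pmulr_lge0//; lra.
Qed.

End Vanishing.

Section GraphVanishing.
Context {R : realType} (G : metric_graph R).
Local Notation mu := (@lebesgue_measure R).
Variables (p lambda : R).
Hypotheses (hG : classG G) (hp : 2 < p) (hlambda : 0 < lambda).
Implicit Types (e : edge G) (x : R) (u : pt G -> R) (v : vertex G).

(* A zero propagates along the edges by Gronwall's inequality, as
   [well y <= sqrt lambda * |y|]. *)
Lemma H1_vanish u : H1 u ->
  (forall e, {ae mu, forall x, open_edge e x -> `|edge_deriv u e x| = well p lambda (on_edge u e x)}) ->
  (exists e x, closed_edge e x /\ on_edge u e x = 0) -> forall e x, closed_edge e x -> on_edge u e x = 0.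
Proof.
move=> Hu gu [e1 [x1 [ex1 u1]]].
have wL y : well p lambda y <= Num.sqrt lambda * `|y|.
  have -> : `|y| = Num.sqrt (y ^+ 2) by rewrite sqrtr_sqr.
  rewrite /well -sqrtrM; last exact: ltW.
  apply: ler_wsqrtr.
  rewrite /well2 lerBlDr lerDl mulr_ge0 ?powR_ge0// divr_ge0//.
  exact/ltW/(lt_trans _ hp).
have prop e x y : closed_edge e x -> closed_edge e y -> on_edge u e x = 0 -> on_edge u e y = 0.
  apply: (prim_vanish (closed_edge_interval hG (e := e)) (H1_prim hG Hu (e := e)) (sqrtr_ge0 lambda)).
  move=> a b ea eb; apply: filterS (gu e); first exact: (ae_filter_ringOfSetsType mu).
  by move=> z h ab; rewrite h; [exact: wL|exact: between_closed_edge ab].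
pose van e := forall x, closed_edge e x -> on_edge u e x = 0.
(* At a vertex at infinity the value is the junk 0 and carries no information, so what is propagated
   is the vanishing on all the edges at a vertex. *)
pose Q v := forall e b, (if b then head e else tail e) = v -> van e.
have start e v b : van e -> (if b then head e else tail e) = v -> Q v.
  move=> ve ev; have [iv|niv] := pselect (Vinf v).
    have [he bb] := Vinf_end hG iv ev; rewrite bb in ev => {b bb}.
    move=> e' b' ev'; have [he' bb'] := Vinf_end hG iv ev'; rewrite bb' in ev'.
    have [_ _ /(_ _ he) d _] := hG; rewrite ev in d.
    by have [<-] := degree1_inj d (ev : ends v (e, true)) (ev' : ends v (e', true)).
  have val0 : eval u (inl v) = 0.
    case: b ev => ev; last by rewrite -ev -edge_pt_tail; apply: ve; exact: closed_edge0.
    have [[r [r0 er _ ce]]|[he _ _]] := edge_cases hG e; last by case: niv; rewrite -ev; exists e.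
    rewrite -ev -(edge_pt_head hG er); apply: ve; by rewrite ce /= in_itv/= lexx ltW.
  move=> e' [] ev' x ex.
    have [[r [r0 er _ ce]]|[he _ _]] := edge_cases hG e'; last by case: niv; rewrite -ev'; exists e'.
    apply: (prop e' r) => //; first by rewrite ce /= in_itv/= lexx ltW.
    by rewrite /on_edge (edge_pt_head hG er) ev'.
  apply: (prop e' 0) => //; first exact: closed_edge0.
  by rewrite /on_edge edge_pt_tail ev'.
have [conn _ _ _] := hG.
have Qall v : Q v.
  apply: (@reach_ind_arc _ _ setT (tail e1)) (conn _ v).
    by apply: (@start e1 _ false) => // x ex; exact: (prop e1 x1).
  move=> [e b] _ Qs; apply: (@start e _ b); last by case: b Qs.
  by apply: (Qs e (~~ b)); case: b Qs.
by move=> e; apply: (Qall (tail e) e false).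
Qed.

End GraphVanishing.

(** * From the count of [Fedges] to properties of cuts *)

Section Cutting.
Context {R : realType} (G : metric_graph R) (Z : set (vertex G)).
Hypothesis hG : classG G.
Local Notation B := (@Vinf R G `|` Z).

Lemma dead_Fedges e s : dead B e s -> Fedges Z e.
Proof.
by move=> d; exists s; apply/seteqP; split => // b [sb /d]; apply.
Qed.

Lemma Fedges0_nodead : (Fedges Z #= `I_0)%card -> forall e s, ~ dead B e s.
Proof.
rewrite II0 card_eq0 => /eqP F0 e s /dead_Fedges.
by rewrite F0.
Qed.

Lemma end_of_edge (e : edge G) (v : vertex G) : reach (~` [set e]) v (tail e) \/ reach (~` [set e]) v (head e).
Proof.
have [conn _ _ _] := hG.
suff : reach (~` [set e]) (tail e) v \/ reach (~` [set e]) (head e) v.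
  by case=> /reach_sym; [left|right].
apply: (@reach_ind_arc _ _ setT (tail e) (fun v => reach (~` [set e]) (tail e) v \/ reach (~` [set e]) (head e) v)) (conn _ v); first by left; exact: reach_refl.
move=> c _ Qc; have [ce|ce] := eqVneq c.1 e; last first.
  by case: Qc => h; [left|right]; apply: (reach_arc _ h); exact/eqP.
case: c ce {Qc} => c [] /= ->; [right|left]; exact: reach_refl.
Qed.

(** Both cuts are the same edge, whose removal leaves at most two components. One of them meets [B],
    so the two dead vertices are together in the other. *)
Lemma Fedges1_nested : B !=set0 -> (Fedges Z #<= `I_1)%card -> nested B.
Proof.
move=> [b Bb] F1 e f s t ds dt.
have ef : e = f.
  have Fe := dead_Fedges ds; have Ff := dead_Fedges dt.
  have /pcard_leP[g] := F1.
  have inj := @inj _ _ _ g; apply: inj; rewrite ?inE//.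
  have ge : `I_1 (g e) by apply: funS.
  have gf : `I_1 (g f) by apply: funS.
  by move: ge gf; rewrite /= !ltnS !leqn0 => /eqP -> /eqP ->.
subst f; left.
have nsb := ds b Bb; have ntb := dt b Bb.
have [sa|sa] := end_of_edge e s; have [ta|ta] := end_of_edge e t.
- exact: reach_trans sa (reach_sym ta).
- have [ba|ba] := end_of_edge e b.
    by case: nsb; exact: reach_trans sa (reach_sym ba).
  by case: ntb; exact: reach_trans ta (reach_sym ba).
- have [ba|ba] := end_of_edge e b.
    by case: ntb; exact: reach_trans ta (reach_sym ba).
  by case: nsb; exact: reach_trans sa (reach_sym ba).
- exact: reach_trans sa (reach_sym ta).
Qed.

End Cutting.

Section LowerBounds.
Context {R : realType} (G : metric_graph R).
Local Notation mu := (@lebesgue_measure R).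
Variables (p lambda : R) (Z : set (vertex G)) (e0 : edge G).
Hypotheses (hG : classG G) (hp : 2 < p) (hlambda : 0 < lambda).
Hypotheses (he0 : half_line e0).
Implicit Types (e : edge G) (x : R) (u : pt G -> R).

Local Notation B := (@Vinf R G `|` Z).
Local Notation c := (soliton_energy p lambda).
Local Notation upos u := (fun q : pt G => Num.max (u q) 0).
Local Notation uneg u := (fun q : pt G => Num.min (u q) 0).

Let B0 : B !=set0. Proof. by exists (head e0); left; exists e0. Qed.

Lemma on_edge_max u e x : on_edge (upos u) e x = pos (on_edge u e x).
Proof. by rewrite /on_edge /eval /pos; case: insubP => [q _ _|_] //=; rewrite maxxx. Qed.

Lemma on_edge_min u e x : on_edge (uneg u) e x = - pos (- on_edge u e x).
Proof.
rewrite /on_edge /eval /pos; case: insubP => [q _ _|_] /=; last by rewrite oppr0 maxxx oppr0.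
by rewrite oppr_max opprK oppr0.
Qed.

Lemma pos_parts (y : R) : y = pos y - pos (- y).
Proof. by rewrite /pos; case: (leP y 0); case: (leP (- y) 0); lra. Qed.

Lemma normG_parts q u : q != 0 -> H1 u -> H1 (upos u) -> H1 (uneg u) ->
  (normG q (on_edge u) = normG q (on_edge (upos u)) + normG q (on_edge (uneg u)))%E.
Proof.
move=> q0 hu hp_ hn.
have mw w e : H1 w -> measurable_fun (open_edge e) (on_edge w e).
  by move=> hw; apply: (on_edge_measurable hG); exact: H1_prim.
rewrite /normG -esumD; last 2 first.
- by move=> e _; apply: integral_ge0 => x _; rewrite lee_fin powR_ge0.
- by move=> e _; apply: integral_ge0 => x _; rewrite lee_fin powR_ge0.
apply: eq_esum => e _.
have mo := open_edge_measurable hG e.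
have f0 (w : pt G -> R) x : open_edge e x -> (0 <= (`|on_edge w e x| `^ q)%:E)%E by rewrite lee_fin powR_ge0.
have m1 w : H1 w -> measurable_fun (open_edge e) (fun x => (`|on_edge w e x| `^ q)%:E).
  by move=> hw; apply: measurable_normpow; exact: mw.
rewrite -(ge0_integralD mu mo (f0 _) (m1 _ hp_) (f0 _) (m1 _ hn)).
apply: eq_integral => x _; rewrite -EFinD on_edge_max on_edge_min normrN; congr (_%:E).
rewrite /pos; case: (leP (on_edge u e x) 0) => h.
  by rewrite normr0 powR0// add0r max_l ?normrN// oppr_ge0.
by rewrite max_r ?normr0 ?powR0 ?addr0// oppr_le0 ltW.
Qed.

(** The densities of the two parts carry the indicators of [0 < u] and of [u < 0], by [prim_pos].
    Their sum is a density of [u], so uniqueness also shows that the derivative vanishes almost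
    everywhere on the set [u = 0]. *)
Lemma edge_deriv_parts u e : H1 u -> H1 (upos u) -> H1 (uneg u) ->
  {ae mu, forall x, open_edge e x -> edge_deriv u e x = edge_deriv (upos u) e x + edge_deriv (uneg u) e x
    /\ edge_deriv (upos u) e x * edge_deriv (uneg u) e x = 0}.
Proof.
move=> hu hp_ hn.
have oI : open (open_edge e) by exact: open_edge_open.
have iI : is_interval (open_edge e) by exact: open_edge_interval.
have P w : H1 w -> prim (open_edge e) (on_edge w e) (edge_deriv w e).
  by move=> hw; apply: primS (H1_prim hG hw (e := e)); exact: open_closed_edge.
have h1 : {ae mu, forall x, open_edge e x -> edge_deriv u e x = edge_deriv (upos u) e x + edge_deriv (uneg u) e x}.
  apply: (prim_ae_open oI iI (P u hu)).
  apply: prim_eq (primD (P _ hp_) (P _ hn)) => // x _.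
  by rewrite /= on_edge_max on_edge_min -pos_parts.
have h2 : {ae mu, forall x, open_edge e x -> edge_deriv (upos u) e x = (0 < on_edge u e x)%R%:R * edge_deriv u e x}.
  apply: (prim_ae_open oI iI (P _ hp_)).
  by apply: prim_eq (prim_pos iI (P _ hu)) => // x _; rewrite /= on_edge_max.
have h3 : {ae mu, forall x, open_edge e x -> edge_deriv (uneg u) e x = - ((0 < - on_edge u e x)%R%:R * (- edge_deriv u e x))}.
  apply: (prim_ae_open oI iI (P _ hn)).
  by apply: prim_eq (primN (prim_pos iI (primN (P _ hu)))) => // x _; rewrite /= on_edge_min.
apply: filterS3 h1 h2 h3; first exact: (ae_filter_ringOfSetsType mu).
move=> x h1 h2 h3 ex; split; first exact: h1.
rewrite h2// h3//; case: (ltP 0 (on_edge u e x)) => h; last by rewrite mul0r mul0r.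
by rewrite oppr_gt0 ltNge (ltW h)/= mul0r oppr0 mulr0.
Qed.

Lemma deriv_parts u : H1 u -> H1 (upos u) -> H1 (uneg u) ->
  (normG 2 (deriv_on_edge u) = normG 2 (deriv_on_edge (upos u)) + normG 2 (deriv_on_edge (uneg u)))%E.
Proof.
move=> hu hp_ hn; rewrite -!normG_edge_deriv.
have mg w e : H1 w -> measurable_fun (open_edge e) (edge_deriv w e).
  by move=> hw; apply: measurable_funTS; exact: edge_deriv_measurable.
rewrite /normG -esumD; last 2 first.
- by move=> e _; apply: integral_ge0 => x _; rewrite lee_fin powR_ge0.
- by move=> e _; apply: integral_ge0 => x _; rewrite lee_fin powR_ge0.
apply: eq_esum => e _.
have mo := open_edge_measurable hG e.
have f0 (w : pt G -> R) x : open_edge e x -> (0 <= (`|edge_deriv w e x| `^ 2)%:E)%E by rewrite lee_fin powR_ge0.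
have m1 w : H1 w -> measurable_fun (open_edge e) (fun x => (`|edge_deriv w e x| `^ 2)%:E).
  by move=> hw; apply: measurable_normpow; exact: mg.
rewrite -(ge0_integralD mu mo (f0 _) (m1 _ hp_) (f0 _) (m1 _ hn)).
apply: ae_eq_integral => //; first exact: m1.
  by apply: emeasurable_funD; exact: m1.
rewrite /ae_eq; apply: filterS (edge_deriv_parts e hu hp_ hn); first exact: (ae_filter_ringOfSetsType mu).
move=> x h ex; have [E0 E1] := h ex; rewrite -EFinD; congr (_%:E).
rewrite E0 !powR_mulrn// !real_normK ?num_real// sqrrD E1; ring.
Qed.

Lemma J_parts u : nodal_nehari p lambda Z u ->
  J p lambda u = (J p lambda (upos u) + J p lambda (uneg u))%E.
Proof.
move=> [[hu _] hP hN].
have H1P : H1 (upos u) by have [[]] := hP.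
have H1N : H1 (uneg u) by have [[]] := hN.
have [A [B [C [EA EB EC _ _]]]] := nehari_real e0 hG hp hlambda hP.
have [A' [B' [C' [EA' EB' EC' _ _]]]] := nehari_real e0 hG hp hlambda hN.
have p0 : p != 0 by rewrite gt_eqF// (lt_trans _ hp).
rewrite /J /energy deriv_parts// (@normG_parts 2)// (@normG_parts p)//.
rewrite EA EB EC EA' EB' EC'; apply: (congr1 EFin); ring.
Qed.

Lemma nehari_lower u : (forall e s, ~ dead B e s) -> nehari p lambda Z u ->
  (c%:E <= J p lambda u)%E /\ ((J p lambda u <= c%:E)%E -> [/\
        forall e, {ae mu, forall x, open_edge e x -> `|edge_deriv u e x| = well p lambda (on_edge u e x)},
        forall e x, closed_edge e x -> `|on_edge u e x| <= peak p lambda &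
        exists e1 x1, closed_edge e1 x1 /\ `|on_edge u e1 x1| = peak p lambda]).
Proof.
move=> nd hu.
have [V [k [T [e1 [x1 [j [[tv [ex1 _] Vpk _] -> Tj jT]]]]]]] := nehari_bv_potential e0 hG hp hlambda hu.
have [r [_ ndr [v va] _]] := refine_at hG (trivial_refinement hG B) ex1.
have := bv_potential_bound hG (@subsetUl _ _ _) v tv B0 (ndr nd).
rewrite va Vpk -/c => cT; rewrite lee_fin; split; first exact: le_trans Tj.
rewrite lee_fin => jc; have [h1 h2 h3] := jT (le_trans jc cT).
by split => //; exists e1, x1.
Qed.

Lemma nodal_lower u : nested B -> nodal_nehari p lambda Z u ->
  (c%:E < J p lambda (upos u))%E \/ (c%:E < J p lambda (uneg u))%E.
Proof.
move=> nB [[hu _] hP hN].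
have [V [k [T [e1 [x1 [j [[tv [ex1 u1] Vpk V0] EJ Tj jT]]]]]]] := nehari_bv_potential e0 hG hp hlambda hP.
have [V' [k' [T' [e1' [x1' [j' [[tv' [ex1' u1'] Vpk' V0'] EJ' Tj' jT']]]]]]] :=
  nehari_bv_potential e0 hG hp hlambda hN.
have H1P : H1 (upos u) by have [[]] := hP.
have H1N : H1 (uneg u) by have [[]] := hN.
have excl (y : R) : pos y = 0 \/ - pos (- y) = 0.
  by rewrite /pos; case: (leP y 0) => h; [left|right; rewrite max_r ?oppr0// oppr_le0 ltW].
have z1 : on_edge (uneg u) e1 x1 = 0.
  by have [h|//] := excl (on_edge u e1 x1); [move: u1; rewrite on_edge_max h eqxx|rewrite on_edge_min].
have z1' : on_edge (upos u) e1' x1' = 0.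
  by have [h|h] := excl (on_edge u e1' x1'); [rewrite on_edge_max|move: u1'; rewrite on_edge_min h eqxx].
(* Both maximum points must be vertices of one refinement: the second subdivision starts from the
   first and keeps its vertices. *)
have [r [nr _ [v0 v0a] _]] := refine_at hG (trivial_refinement hG B) ex1.
have [r' [nr' _ [t ta] /(_ v0)[s sa]]] := refine_at hG r ex1'.
rewrite v0a in sa.
have := bv_potentials_bound hG (@subsetUl _ _ _) (s := s) (t := t) tv tv' B0 _ _ (nr' (nr nB)).
rewrite ta sa Vpk Vpk' -/c V0// V0'// => /(_ erefl erefl).
case=> cT; [left; rewrite EJ lte_fin|right; rewrite EJ' lte_fin].
  rewrite ltNge; apply/negP => jc; have [h1 _ _] := jT (le_trans jc cT).
  by move/eqP: u1; apply; apply: (H1_vanish hG hp hlambda H1P h1) => //; exists e1', x1'.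
rewrite ltNge; apply/negP => jc; have [h1 _ _] := jT' (le_trans jc cT).
by move/eqP: u1'; apply; apply: (H1_vanish hG hp hlambda H1N h1) => //; exists e1, x1.
Qed.

End LowerBounds.

(** * The soliton *)

Section Rescaling.
Context {R : realType}.
Variables (p lambda : R).
Hypotheses (hp : 2 < p) (hlambda : 0 < lambda).
Implicit Types (d eps : R).

Let p0 : 0 < p. Proof. exact: lt_trans hp. Qed.
Let q0 : 0 < p - 2. Proof. by rewrite subr_gt0. Qed.

(* Lower bound for the proportion of the [p]-th power norm which is kept when
   [|u|] is replaced by the positive part of [|u| - d]. *)
Definition trunc_loss d := (1 - Num.sqrt d) `^ p * (1 - d `^ ((p - 2) / 2) / lambda).

(** The threshold is [sqrt d]. Above it, [y - d >= (1 - sqrt d) y]. Below it, y^p is at most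
    d^((p-2)/2) y^2, so that the left-hand side is not positive. *)
Lemma trunc_powR d y : 0 < d -> d < 1 -> 0 <= y ->
  (1 - Num.sqrt d) `^ p * (y `^ p - d `^ ((p - 2) / 2) * y ^+ 2) <= pos (y - d) `^ p.
Proof.
move=> d0 d1 y0.
have s0 : 0 < Num.sqrt d by rewrite sqrtr_gt0.
have s1 : Num.sqrt d < 1 by rewrite -sqrtr1 ltr_sqrt.
have s2 : Num.sqrt d ^+ 2 = d by rewrite sqr_sqrtr// ltW.
have [sy|ys] := leP (Num.sqrt d) y.
  have le1 : (1 - Num.sqrt d) * y <= pos (y - d).
    rewrite /pos le_max; apply/orP; left; rewrite mulrBl mul1r lerD2l lerN2 -{1}s2 expr2.
    by rewrite ler_wpM2l// ltW.
  apply: (@le_trans _ _ (((1 - Num.sqrt d) * y) `^ p)).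
    rewrite powRM ?subr_ge0 ?(ltW s1)// ler_wpM2l ?powR_ge0//.
    by rewrite lerBlDr lerDl mulr_ge0 ?powR_ge0 ?sqr_ge0.
  apply: ge0_ler_powR; rewrite ?nnegrE ?(ltW p0) ?pos_ge0//.
  by rewrite mulr_ge0// subr_ge0 ltW.
apply: (@le_trans _ _ 0); last exact: powR_ge0.
rewrite pmulr_rle0 ?powR_gt0 ?subr_gt0// subr_le0.
have := normr_powR_sub2 hp y; rewrite ger0_norm// => ->.
rewrite ler_wpM2r ?sqr_ge0//.
have -> : (p - 2) / 2 = 2^-1 * (p - 2) by rewrite mulrC.
rewrite powRrM powR12_sqrt ?(ltW d0)//.
by apply: ge0_ler_powR; rewrite ?nnegrE ?(ltW q0) ?(ltW s0) ?(ltW ys).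
Qed.

Lemma trunc_loss_small eps : 0 < eps -> exists2 d0, 0 < d0 & forall d, 0 < d -> d <= d0 ->
  [/\ d < 1, 0 < trunc_loss d & trunc_loss d `^ (- (2 / (p - 2))) <= 1 + eps].
Proof.
move=> eps0.
have one (q : R) : 1 `^ q = 1 by rewrite powR1.
(* [r] is the loss for which the rescaling factor is exactly [1 + eps]. Each of the two factors of
   [trunc_loss] is asked to be at least [r' = sqrt r]: the first through [a], whose p-th power is
   [r'], the second through [k]. *)
pose r := (1 + eps) `^ (- ((p - 2) / 2)).
have e1 : 1 < 1 + eps by rewrite ltrDl.
have r0 : 0 < r by rewrite powR_gt0// (lt_trans _ e1).
have r1 : r < 1.
  rewrite /r powRN invf_lt1 ?powR_gt0 ?(lt_trans _ e1)//.
  rewrite -[ltLHS](one ((p - 2) / 2)); apply: gt0_ltr_powR; rewrite ?nnegrE ?divr_gt0//.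
  by rewrite ltW// (lt_trans _ e1).
pose r' := Num.sqrt r.
have r'0 : 0 < r' by rewrite sqrtr_gt0.
have r'1 : r' < 1 by rewrite -sqrtr1 ltr_sqrt.
have r'2 : r' * r' = r by rewrite -expr2 sqr_sqrtr// ltW.
pose a := r' `^ p^-1.
have a0 : 0 < a by rewrite powR_gt0.
have a1 : a < 1.
  rewrite -[ltRHS](one p^-1); apply: gt0_ltr_powR; rewrite ?nnegrE ?invr_gt0//; exact: ltW.
have ap : a `^ p = r' by rewrite /a -powRrM mulVf ?gt_eqF// powRr1// ltW.
pose k := (lambda * (1 - r')) `^ (2 / (p - 2)).
have lr : 0 < lambda * (1 - r') by rewrite mulr_gt0// subr_gt0.
have k0 : 0 < k by rewrite powR_gt0.
have kE : k `^ ((p - 2) / 2) = lambda * (1 - r').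
  rewrite /k -powRrM; have -> : 2 / (p - 2) * ((p - 2) / 2) = 1 by field; rewrite gt_eqF.
  by rewrite powRr1// ltW.
exists (Num.min ((1 - a) ^+ 2) k); first by rewrite lt_min k0 exprn_gt0 ?subr_gt0.
move=> d d0; rewrite le_min => /andP[da dk].
have sd : Num.sqrt d <= 1 - a.
  rewrite -(@ler_sqr _ (Num.sqrt d)) ?nnegrE ?sqrtr_ge0 ?subr_ge0 ?(ltW a1)//.
  by rewrite sqr_sqrtr// ltW.
have h1 : r' <= (1 - Num.sqrt d) `^ p.
  have h0 : a <= 1 - Num.sqrt d by rewrite lerBrDr addrC -lerBrDr.
  by rewrite -ap; apply: ge0_ler_powR; rewrite ?nnegrE ?(ltW p0) ?(ltW a0) ?(le_trans (ltW a0) h0).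
have h2 : r' <= 1 - d `^ ((p - 2) / 2) / lambda.
  rewrite lerBrDr addrC -lerBrDr ler_pdivrMr// [leRHS]mulrC -kE.
  by apply: ge0_ler_powR; rewrite ?nnegrE ?divr_ge0 ?(ltW q0) ?(ltW d0) ?(ltW k0).
have h3 : r <= trunc_loss d.
  rewrite -r'2 /trunc_loss; apply: (@le_trans _ _ (r' * (1 - d `^ ((p - 2) / 2) / lambda))).
    by rewrite ler_wpM2l// ltW.
  by rewrite ler_wpM2r//; apply: le_trans h2; exact: ltW.
have t0 : 0 < trunc_loss d by exact: lt_le_trans h3.
split => //.
  by apply: le_lt_trans da _; rewrite expr_lt1// ?subr_ge0 ?(ltW a1)// ltrBlDl ltrDr.
have -> : 1 + eps = r `^ (- (2 / (p - 2))).
  rewrite /r -powRrM.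
  have -> : - ((p - 2) / 2) * - (2 / (p - 2)) = 1 by field; rewrite gt_eqF.
  by rewrite powRr1// ltW// (lt_trans _ e1).
rewrite !powRN lef_pV2 ?posrE ?powR_gt0//.
apply: ge0_ler_powR; rewrite ?nnegrE ?(ltW r0) ?(ltW t0)//.
- by rewrite divr_ge0// ltW.
- by rewrite (lt_trans _ e1).
Qed.

(** [t] projects onto the Nehari manifold a function with quadratic part [N] and p-th power norm
    [C']. The exponent comes from t^(p-2) = N / C', which is at most [rho^-1]. *)
Lemma rescale rho N C C' : 0 < rho -> 0 < N -> N <= C -> rho * C <= C' ->
  exists2 t, 0 < t & t ^+ 2 * N = t `^ p * C' /\ t `^ p * C' <= rho `^ (- (2 / (p - 2))) * C.
Proof.
move=> r0 N0 NC rC.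
have C0 : 0 < C by exact: lt_le_trans NC.
have C'0 : 0 < C' by apply: lt_le_trans rC; rewrite mulr_gt0.
have x0 : 0 < N / C' by rewrite divr_gt0.
pose t := (N / C') `^ (p - 2)^-1.
have t0 : 0 < t by rewrite powR_gt0.
have tp : t `^ p = N / C' * t ^+ 2.
  have := normr_powR_sub2 hp t; rewrite gtr0_norm// => ->.
  by rewrite /t -powRrM mulVf ?gt_eqF// powRr1// ltW.
have e1 : t ^+ 2 * N = t `^ p * C' by rewrite tp; field; rewrite gt_eqF.
exists t => //; split => //; rewrite -e1.
have t2 : t ^+ 2 = (N / C') `^ (2 / (p - 2)).
  have -> : 2 / (p - 2) = (p - 2)^-1 * 2 by rewrite mulrC.
  by rewrite powRrM powR_mulrn// powR_ge0.
have h : t ^+ 2 <= rho `^ (- (2 / (p - 2))).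
  have rV : rho `^ (- (2 / (p - 2))) = rho^-1 `^ (2 / (p - 2)).
    have r1 : rho `^ (2 / (p - 2)) != 0 by rewrite gt_eqF// powR_gt0.
    by apply: (mulIf r1); rewrite powRN mulVf// -powRM ?invr_ge0 ?(ltW r0)// mulVf ?gt_eqF// powR1.
  rewrite t2 rV.
  apply: ge0_ler_powR; rewrite ?nnegrE ?divr_ge0 ?invr_ge0 ?(ltW q0) ?(ltW r0) ?(ltW N0) ?(ltW C'0)//.
  rewrite ler_pdivrMr// mulrC ler_pdivlMr//.
  by apply: le_trans rC; rewrite mulrC ler_pM2l.
apply: (@le_trans _ _ (rho `^ (- (2 / (p - 2))) * N)); first by rewrite ler_wpM2r// ltW.
by rewrite ler_wpM2l// powR_ge0.
Qed.

End Rescaling.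

(** * The explicit soliton and its integrals over a box *)

Section Soliton.
Context {R : realType}.
Local Notation mu := (@lebesgue_measure R).
Variables (p lambda : R).
Hypotheses (hp : 2 < p) (hlambda : 0 < lambda).
Implicit Types (s x y T : R).

Local Notation peak := (peak p lambda).
Local Notation well2 := (well2 p lambda).
Local Notation well := (well p lambda).
Local Notation phase := (phase p lambda).

Let p0 : 0 < p. Proof. exact: lt_trans hp. Qed.
Let q0 : 0 < p - 2. Proof. by rewrite subr_gt0. Qed.
Let pk : 0 < peak. Proof. exact: peak_gt0. Qed.

Definition ch x : R := (expR x + expR (- x)) / 2.
Definition sh x : R := (expR x - expR (- x)) / 2.
Definition th x := sh x / ch x.

Lemma ch_gt0 x : 0 < ch x.
Proof. by rewrite divr_gt0// addr_gt0// expR_gt0. Qed.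

Lemma ch_sh x : ch x ^+ 2 - sh x ^+ 2 = 1.
Proof.
have h : expR x * expR (- x) = 1 by rewrite -expRD subrr expR0.
rewrite /ch /sh; transitivity (expR x * expR (- x)); last exact: h.
by field.
Qed.

Let is_derive_expRN x : is_derive x 1 (fun y => expR (- y)) (- expR (- x)).
Proof.
have := is_derive_affine (is_derive_expR (-1 * x + 0)).
by under eq_fun do rewrite addr0 mulN1r; rewrite addr0 !mulN1r.
Qed.

Lemma is_derive_ch x : is_derive x 1 ch (sh x).
Proof.
have := is_deriveZ 2^-1 (is_deriveD (is_derive_expR x) (is_derive_expRN x)).
rewrite (_ : _ \*: _ = ch); last by apply/funext => y; rewrite /ch mulrC.
by rewrite /sh [2^-1 *: _]mulrC.
Qed.

Lemma is_derive_sh x : is_derive x 1 sh (ch x).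
Proof.
have := is_deriveZ 2^-1 (is_deriveB (is_derive_expR x) (is_derive_expRN x)).
rewrite (_ : _ \*: _ = sh); last by apply/funext => y; rewrite /sh mulrC.
by rewrite opprK /ch [2^-1 *: _]mulrC.
Qed.

Lemma is_derive_th x : is_derive x 1 th (1 - th x ^+ 2).
Proof.
have c0 : ch x != 0 by rewrite gt_eqF// ch_gt0.
have := is_deriveM (is_derive_sh x) (is_deriveV c0 (is_derive_ch x)).
rewrite (_ : _ * _ = th)//.
suff -> : 1 - th x ^+ 2 = sh x *: (- ch x ^- 2 *: sh x) + (ch x)^-1 *: ch x by [].
rewrite /GRing.scale/= /th; field; exact: c0.
Qed.

Let rate := (p - 2) / 2 * Num.sqrt lambda.

Let rate0 : 0 < rate. Proof. by rewrite mulr_gt0 ?sqrtr_gt0// divr_gt0. Qed.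

(** [peak] times the power -2/(p-2) of a hyperbolic cosine: the positive solution, centred at [s],
    of v'' = lambda v - v^(p-1) on the line. *)
Definition soliton s x := peak * expR (- (2 / (p - 2)) * ln (ch (rate * (x - s)))).
Definition dsoliton s x := - (Num.sqrt lambda * th (rate * (x - s)) * soliton s x).

Lemma soliton_gt0 s x : 0 < soliton s x.
Proof. by rewrite mulr_gt0// expR_gt0. Qed.

Let affE s x : rate * (x - s) = rate * x + - (rate * s). Proof. by rewrite mulrBr. Qed.

Lemma is_derive_soliton s x : is_derive x 1 (soliton s) (dsoliton s x).
Proof.
set k := - (2 / (p - 2)).
have d1 y : is_derive y 1 (fun y => peak * expR (k * ln (ch y)))
    (peak * (expR (k * ln (ch y)) * (k * ((ch y)^-1 * sh y)))).
  have dl := is_derive1_comp (is_derive1_ln (ch_gt0 y)) (is_derive_ch y).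
  have dk : is_derive y 1 (fun y => k * ln (ch y)) (k * ((ch y)^-1 * sh y)) by exact: (is_deriveZ k dl).
  have de := @is_derive1_comp R expR _ y _ _ (is_derive_expR _) dk.
  exact: (is_deriveZ peak de).
have := is_derive_affine (d1 (rate * x + - (rate * s))).
rewrite (_ : (fun y => _) = soliton s); last by apply/funext => y; rewrite /soliton affE.
suff -> : dsoliton s x = rate * (peak * (expR (k * ln (ch (rate * x - rate * s))) *
   (k * ((ch (rate * x - rate * s))^-1 * sh (rate * x - rate * s))))) by [].
rewrite /dsoliton /soliton affE /th /rate /k; field.
by apply/andP; split; rewrite gt_eqF// ch_gt0.
Qed.

Lemma soliton_powR s x : soliton s x `^ (p - 2) = lambda * p / 2 * (1 - th (rate * (x - s)) ^+ 2).
Proof.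
rewrite /soliton powRM ?(ltW pk) ?expR_ge0// peak_powR//; congr (_ * _).
have c0 := ch_gt0 (rate * (x - s)); set y := rate * (x - s) in c0 *.
rewrite /powR gt_eqF ?expR_gt0// expRK mulrA.
have -> : (p - 2) * - (2 / (p - 2)) = - 2 by field; rewrite gt_eqF.
rewrite mulNr expRN mulr_natl -lnXn// lnK ?posrE ?exprn_gt0//.
rewrite /th -[LHS]mul1r -{1}(ch_sh y); field; exact: lt0r_neq0.
Qed.

Lemma soliton_well s x : well2 (soliton s x) = dsoliton s x ^+ 2.
Proof.
rewrite well2E// (gtr0_norm (soliton_gt0 s x)) soliton_powR /dsoliton.
move: (th _) (soliton s x) => t f; rewrite sqrrN !exprMn sqr_sqrtr ?ltW//.
by field; rewrite gt_eqF.
Qed.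

(** The equation v'' = lambda v - v^(p-1) multiplied by v, in divergence form: integrated over a
    box, it is the Nehari identity up to boundary terms. *)
Lemma soliton_equation s x : is_derive x 1 (fun y => soliton s y * dsoliton s y)
  (dsoliton s x ^+ 2 + lambda * soliton s x ^+ 2 - soliton s x `^ p).
Proof.
set ths := fun y => th (rate * (y - s)).
have dth : is_derive x 1 ths (rate * (1 - ths x ^+ 2)).
  have := is_derive_affine (is_derive_th (rate * x + - (rate * s))).
  by rewrite (_ : (fun y => _) = ths) /ths ?affE//; apply/funext => y; rewrite affE.
have ds := is_derive_soliton s x.
have := is_deriveM ds (is_deriveM (is_deriveZ (- Num.sqrt lambda) dth) ds).
rewrite (_ : _ * _ = (fun y => soliton s y * dsoliton s y)); last first.
  apply/funext => y; transitivity (soliton s y * (- Num.sqrt lambda * ths y * soliton s y)); first by [].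
  by rewrite /dsoliton !mulNr.
suff -> : dsoliton s x ^+ 2 + lambda * soliton s x ^+ 2 - soliton s x `^ p =
  soliton s x * ((- Num.sqrt lambda * ths x) * dsoliton s x +
    soliton s x * (- Num.sqrt lambda * (rate * (1 - ths x ^+ 2)))) +
  (- Num.sqrt lambda * ths x * soliton s x) * dsoliton s x by [].
have := normr_powR_sub2 hp (soliton s x); rewrite (gtr0_norm (soliton_gt0 s x)) => ->.
rewrite soliton_powR /dsoliton -/(ths x).
have l2 : Num.sqrt lambda * Num.sqrt lambda = lambda by rewrite -expr2 sqr_sqrtr// ltW.
rewrite /rate; move: (Num.sqrt lambda) (ths x) (soliton s x) l2 => q t f <-; by field.
Qed.

Lemma continuous_soliton s : continuous (soliton s).
Proof. exact: is_derive_continuous (is_derive_soliton s). Qed.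

Lemma continuous_dsoliton s : continuous (dsoliton s).
Proof.
have cth : continuous th by exact: is_derive_continuous is_derive_th.
move=> x; apply: cvgN; apply: cvgM; last exact: continuous_soliton.
apply: cvgM; first exact: cvg_cst.
apply: (@cvg_comp _ _ _ (fun y => rate * (y - s)) th); last exact: cth.
by apply: cvgM; [exact: cvg_cst|apply: cvgB; [exact: cvg_id|exact: cvg_cst]].
Qed.

Lemma chN x : ch (- x) = ch x.
Proof. by rewrite /ch opprK addrC. Qed.

Lemma ch_le x y : 0 <= x -> x <= y -> ch x <= ch y.
Proof.
move=> x0 xy; rewrite /ch ler_pM2r//.
have e1 : expR x <= expR y by rewrite ler_expR.
have e2 : expR (- x) * expR (- y) <= 1 by rewrite -expRD -expR0 ler_expR; lra.
have h1 : expR x * expR (- x) = 1 by rewrite -expRD subrr expR0.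
have h2 : expR y * expR (- y) = 1 by rewrite -expRD subrr expR0.
have : 0 <= (expR y - expR x) * (1 - expR (- x) * expR (- y)) by rewrite mulr_ge0// subr_ge0.
have -> : (expR y - expR x) * (1 - expR (- x) * expR (- y)) =
  expR y - expR x - (expR y * expR (- y)) * expR (- x) + (expR x * expR (- x)) * expR (- y) by ring.
rewrite h1 h2; lra.
Qed.

Lemma soliton_decr s x y : `|x - s| <= `|y - s| -> soliton s y <= soliton s x.
Proof.
have chn z : ch (rate * z) = ch (rate * `|z|).
  by case: (leP 0 z) => h; [rewrite ger0_norm|rewrite ltr0_norm// mulrN chN].
move=> xy; rewrite /soliton ler_pM2l// ler_expR !mulNr lerN2 ler_pM2l ?divr_gt0//.
rewrite ler_ln ?posrE ?ch_gt0// chn [leRHS]chn; apply: ch_le.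
  by rewrite mulr_ge0// ltW.
by rewrite ler_pM2l.
Qed.

Lemma soliton_center s : soliton s s = peak.
Proof.
rewrite /soliton subrr mulr0 /ch oppr0 expR0.
by rewrite (_ : (1 + 1) / 2 = 1) ?ln1 ?mulr0 ?expR0 ?mulr1//; field.
Qed.

Lemma soliton_peak s x : `|soliton s x| <= peak.
Proof.
rewrite gtr0_norm ?soliton_gt0// -(soliton_center s); apply: soliton_decr.
by rewrite subrr normr0.
Qed.

Definition tail_height T := soliton 0 T.

Lemma soliton_right s T : soliton s (s + T) = tail_height T.
Proof. by rewrite /tail_height /soliton subr0 addrAC subrr add0r. Qed.

Lemma soliton_left s T : soliton s (s - T) = tail_height T.
Proof.
by rewrite /tail_height /soliton subr0 addrAC subrr add0r mulrN chN.
Qed.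

Lemma tail_height_small d : 0 < d -> exists2 T, 0 < T & tail_height T <= d.
Proof.
move=> d0; set k := 2 / (p - 2); have k0 : 0 < k by rewrite divr_gt0.
pose z := `|ln (peak / d)| / k.
have z0 : 0 <= z by rewrite divr_ge0// ltW.
have l2 : 0 <= ln 2 :> R by rewrite ln_ge0// ler1n.
(* As [ch y >= expR y / 2], the summand [ln 2] absorbs the factor 1/2 and [z] gives the required
   size of [ln (ch y)]; the 1 keeps the witness positive. *)
exists ((ln 2 + z + 1) / rate); first by rewrite divr_gt0// ltr_wpDl ?addr_ge0.
rewrite /tail_height /soliton subr0 mulrCA mulfV ?gt_eqF// mulr1 -/k.
have h1 : z <= ln (ch (ln 2 + z + 1)).
  rewrite -ler_expR lnK ?posrE ?ch_gt0//.
  rewrite /ch; apply: (@le_trans _ _ (expR (ln 2 + z + 1) / 2)).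
    rewrite -addrA expRD lnK ?posrE// mulrAC mulfV// mul1r ler_expR; lra.
  by rewrite ler_pM2r// lerDl expR_ge0.
have h2 : ln (peak / d) <= k * ln (ch (ln 2 + z + 1)).
  apply: le_trans (ler_norm _) _; rewrite [leRHS]mulrC -ler_pdivrMr//.
rewrite mulNr expRN ler_pdivrMr ?expR_gt0// mulrC -ler_pdivrMr//.
by rewrite -ler_ln ?posrE ?divr_gt0 ?expR_gt0// expRK.
Qed.

Lemma th_ge0 x : 0 <= x -> 0 <= th x.
Proof.
move=> x0; rewrite /th divr_ge0 ?(ltW (ch_gt0 _))// divr_ge0// subr_ge0 ler_expR; lra.
Qed.

Lemma th_lt1 x : th x <= 1.
Proof.
rewrite /th ler_pdivrMr ?ch_gt0// mul1r /sh /ch ler_pM2r// lerD2l.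
by apply: (@le_trans _ _ 0); rewrite ?oppr_le0 expR_ge0.
Qed.

Lemma thN x : th (- x) = - th x.
Proof. by rewrite /th chN /sh opprK -mulNr -mulNr opprB. Qed.

Section SolitonIntegrals.
Variables (s T : R).
Hypothesis T0 : 0 < T.
Local Notation box := (`[s - T, s + T]%classic).
Local Notation delta := (tail_height T).

Let sT : s - T <= s + T. Proof. by have := T0; lra. Qed.

Lemma integrable_continuous f a b : continuous f -> mu.-integrable `[a, b] (EFin \o (f : R -> R)).
Proof.
by move=> cf; apply: continuous_compact_integrable; [exact: segment_compact|exact: continuous_withinT].
Qed.

Let cds2 : continuous (fun x => dsoliton s x ^+ 2).
Proof. by move=> x; apply: (cvgM (@continuous_dsoliton s x) (@continuous_dsoliton s x)). Qed.

Let cs2 : continuous (fun x => soliton s x ^+ 2).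
Proof. by move=> x; apply: (cvgM (@continuous_soliton s x) (@continuous_soliton s x)). Qed.

Let csp : continuous (fun x => soliton s x `^ p).
Proof.
have -> : (fun x => soliton s x `^ p) = (fun y => `|y| `^ p) \o soliton s.
  by apply/funext => x /=; rewrite gtr0_norm// soliton_gt0.
by move=> x; apply: continuous_comp; [exact: continuous_soliton|exact: continuous_normr_powR].
Qed.

Let A := \int[mu]_(x in box) (dsoliton s x ^+ 2).
Let B := \int[mu]_(x in box) (soliton s x ^+ 2).
Let C := \int[mu]_(x in box) (soliton s x `^ p).

(** Equipartition: as [well v = |v'|] along the soliton, the square of [v'] is, up to sign, the
    derivative of [phase v] on each side of the centre. *)
Lemma soliton_kinetic : A = 2 * (phase peak - phase delta).
Proof.
have ps : prim setT (soliton s) (dsoliton s).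
  by apply: prim_C1; [exact: is_derive_soliton|exact: continuous_dsoliton].
have iT : is_interval [set: R] by move=> *.
have {}pp := prim_phase hp iT ps (fun x _ => soliton_peak s x).
have wd x : well (soliton s x) = `|dsoliton s x| by rewrite /well soliton_well sqrtr_sqr.
have t0 x : s <= x -> dsoliton s x <= 0.
  move=> sx; rewrite /dsoliton oppr_le0 mulr_ge0 ?(ltW (soliton_gt0 _ _))// mulr_ge0 ?sqrtr_ge0//.
  by rewrite th_ge0// mulr_ge0 ?subr_ge0// ltW.
have t1 x : x <= s -> 0 <= dsoliton s x.
  move=> xs; rewrite /dsoliton oppr_ge0 mulr_le0_ge0 ?(ltW (soliton_gt0 _ _))//.
  rewrite mulr_ge0_le0 ?sqrtr_ge0// -[_ * _]opprK thN oppr_le0 th_ge0//.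
  by rewrite -mulrN opprB mulr_ge0 ?subr_ge0// ltW.
have st1 : s <= s + T by rewrite lerDl ltW.
have st2 : s - T <= s by rewrite gerDl oppr_le0 ltW.
have [_ h1] := pp _ _ st1 I I; have [_ h2] := pp _ _ st2 I I.
have e1 : \int[mu]_(x in `[s, s + T]) (well (soliton s x) * dsoliton s x) =
    - \int[mu]_(x in `[s, s + T]) (dsoliton s x ^+ 2).
  rewrite -mulN1r -RintegralZl//; last exact: integrable_continuous.
  apply: eq_Rintegral => x; rewrite inE /= in_itv/= => /andP[/t0 dx _].
  by rewrite wd ler0_norm// mulNr mulN1r expr2.
have e2 : \int[mu]_(x in `[s - T, s]) (well (soliton s x) * dsoliton s x) =
    \int[mu]_(x in `[s - T, s]) (dsoliton s x ^+ 2).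
  apply: eq_Rintegral => x; rewrite inE /= in_itv/= => /andP[_ /t1 dx].
  by rewrite wd ger0_norm// expr2.
rewrite /A (Rintegral_cat st2 st1); last exact: integrable_continuous.
move: h1 h2; rewrite /= soliton_center soliton_right soliton_left e1 e2; lra.
Qed.

Lemma soliton_virial : A = lambda * B - 2 / p * C.
Proof.
rewrite /A /B /C -!RintegralZl//; try exact: integrable_continuous.
have i1 : mu.-integrable box (EFin \o (fun x => lambda * soliton s x ^+ 2)).
  by apply: integrable_continuous => x; apply: cvgM; [exact: cvg_cst|exact: cs2].
have i2 : mu.-integrable box (EFin \o (fun x => 2 / p * soliton s x `^ p)).
  by apply: integrable_continuous => x; apply: cvgM; [exact: cvg_cst|exact: csp].
rewrite -RintegralB//; apply: eq_Rintegral => x _.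
by rewrite -soliton_well /well2 gtr0_norm// soliton_gt0.
Qed.

(** [k] is the boundary term of [soliton_equation], the two ends of the box contributing equally. *)
Lemma soliton_nehari : exists2 k, 0 <= k <= 2 * Num.sqrt lambda * delta ^+ 2 & A + lambda * B = C - k.
Proof.
exists (2 * Num.sqrt lambda * th (rate * T) * delta ^+ 2).
  have t0 : 0 <= th (rate * T) by rewrite th_ge0// mulr_ge0// ltW.
  have l0 := sqrtr_ge0 lambda; have t1 := th_lt1 (rate * T); apply/andP; split.
    by rewrite mulr_ge0 ?sqr_ge0// mulr_ge0// mulr_ge0.
  by rewrite ler_wpM2r ?sqr_ge0// ler_piMr// mulr_ge0.
have ceq : continuous (fun x => dsoliton s x ^+ 2 + lambda * soliton s x ^+ 2 - soliton s x `^ p).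
  move=> x; apply: cvgB; last exact: csp.
  by apply: cvgD; [exact: cds2|apply: cvgM; [exact: cvg_cst|exact: cs2]].
have [_ h] := prim_C1 (I := setT) (@soliton_equation s) ceq sT I I.
have i1 := integrable_continuous (s - T) (s + T) cds2.
have i2 : mu.-integrable box (EFin \o (fun x => lambda * soliton s x ^+ 2)).
  by apply: integrable_continuous => x; apply: cvgM; [exact: cvg_cst|exact: cs2].
have i3 : mu.-integrable box (EFin \o (fun x => dsoliton s x ^+ 2 + lambda * soliton s x ^+ 2)).
  by have := integrableD _ i1 i2; apply.
have i4 := integrable_continuous (s - T) (s + T) csp.
have : A + lambda * B - C = \int[mu]_(x in box) (dsoliton s x ^+ 2 + lambda * soliton s x ^+ 2 - soliton s x `^ p).
  rewrite /A /B /C -RintegralZl//; last exact: integrable_continuous.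
  by rewrite -RintegralD// -RintegralB.
rewrite -h !soliton_left !soliton_right /dsoliton soliton_left soliton_right.
have -> : rate * (s + T - s) = rate * T by rewrite addrAC subrr add0r.
have -> : rate * (s - T - s) = - (rate * T) by rewrite addrAC subrr add0r mulrN.
rewrite thN => h'; apply/eqP; rewrite -subr_eq0; apply/eqP.
transitivity (A + lambda * B - C + 2 * Num.sqrt lambda * th (rate * T) * delta ^+ 2); first ring.
rewrite h'; ring.
Qed.

Lemma soliton_bounds : [/\ 0 <= A, 0 <= B, A + lambda * B <= C &
  (2^-1 - p^-1) * C <= soliton_energy p lambda + Num.sqrt lambda * delta ^+ 2].
Proof.
have [k /andP[k0 k1] E] := soliton_nehari.
have A0 : 0 <= A by apply: Rintegral_ge0 => x _; rewrite sqr_ge0.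
have B0 : 0 <= B by apply: Rintegral_ge0 => x _; rewrite sqr_ge0.
have Ac : A <= soliton_energy p lambda.
  rewrite soliton_kinetic /soliton_energy ler_pM2l// gerBl.
  by rewrite -(phase0 p lambda) phase_le// ?oppr_le0 ?(ltW pk)// ltW// soliton_gt0.
split => //; first by rewrite E gerBl.
(* Through [soliton_virial], the excess of the energy over [A] is half of the Nehari defect [k]. *)
have -> : (2^-1 - p^-1) * C = A - (A + lambda * B - C) / 2.
  by rewrite soliton_virial; field; rewrite gt_eqF.
rewrite E; lra.
Qed.

End SolitonIntegrals.
End Soliton.

(** * The level of the line *)

Section Truncation.
Context {R : realType}.
Local Notation mu := (@lebesgue_measure R).
Implicit Types (I D : set R) (w g : R -> R) (d t q : R).

Definition dabs w g (x : R) : R := (0 < w x)%R%:R * g x + (0 < - w x)%R%:R * (- g x).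
Definition trunc d w (x : R) : R := pos (`|w x| - d).
Definition dtrunc d w g (x : R) : R := (0 < `|w x| - d)%R%:R * dabs w g x.

Lemma prim_abs I w g : is_interval I -> prim I w g -> prim I (fun x => `|w x|) (dabs w g).
Proof.
move=> iI pw.
apply: prim_eq (primD (prim_pos iI pw) (prim_pos iI (primN pw))) => // x _ /=.
rewrite /pos; case: (leP 0 (w x)) => h.
  by rewrite max_r ?oppr_le0// addr0 ger0_norm.
by rewrite add0r max_l ?ltr0_norm// oppr_ge0 ltW.
Qed.

Lemma prim_trunc I w g d : is_interval I -> prim I w g -> prim I (trunc d w) (dtrunc d w g).
Proof.
move=> iI pw.
have pd := primB (prim_abs iI pw) (@prim_cst _ I d).
apply: prim_eq (prim_pos iI pd) => // x _.
by rewrite /dtrunc subr0.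
Qed.

Lemma measurable_indic_gt0 D w g : measurable D -> measurable_fun D w -> measurable_fun D g ->
  measurable_fun D (fun x => (0 < w x)%R%:R * g x).
Proof.
move=> mD mw mg.
have -> : (fun x => (0 < w x)%R%:R * g x) = (fun x => if 0 < w x then g x else 0).
  by apply/funext => x; case: ifP; rewrite ?mul1r ?mul0r.
apply: measurable_fun_if => //.
- exact: measurable_fun_ltr.
- by apply: measurable_funS mg => //; exact: subIsetl.
Qed.

Lemma measurable_dtrunc D w g d : measurable D -> measurable_fun D w -> measurable_fun D g ->
  measurable_fun D (dtrunc d w g).
Proof.
move=> mD mw mg; apply: measurable_indic_gt0 => //.
  by apply: measurable_funB => //; exact: measurableT_comp.
apply: measurable_funD; apply: measurable_indic_gt0 => //; exact: measurable_funN.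
Qed.

Lemma measurable_trunc D w d : measurable_fun D w -> measurable_fun D (trunc d w).
Proof.
move=> mw; apply: (measurableT_comp (f := @pos R)).
  by apply: continuous_measurable_fun; exact: continuous_pos.
by apply: measurable_funB => //; exact: measurableT_comp.
Qed.

Lemma norm_dtrunc d w g x : `|dtrunc d w g x| <= `|g x|.
Proof.
have h : `|dabs w g x| <= `|g x|.
  rewrite /dabs; case: (ltP 0 (w x)) => h.
    by rewrite oppr_gt0 ltNge (ltW h)/= mul0r addr0 mul1r.
  rewrite mul0r add0r; case: (0 < - w x); by rewrite ?mul1r ?mul0r ?normrN ?normr0.
by rewrite /dtrunc; case: (0 < _); rewrite ?mul1r// mul0r normr0.
Qed.

Lemma norm_trunc d w x : 0 <= d -> `|trunc d w x| <= `|w x|.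
Proof.
move=> d0; rewrite ger0_norm ?pos_ge0// /trunc /pos ge_max normr_ge0 andbT.
by rewrite lerBlDr lerDl.
Qed.

Lemma trunc_out d w g x : `|w x| <= d -> trunc d w x = 0 /\ dtrunc d w g x = 0.
Proof.
by move=> wd; rewrite /trunc le0_pos ?subr_le0// /dtrunc subr_gt0 ltNge wd mul0r.
Qed.

Lemma le_normpow D w g q : 0 <= q -> measurable D -> measurable_fun D w -> measurable_fun D g ->
  (forall x, D x -> `|w x| <= `|g x|) ->
  (\int[mu]_(x in D) (`|w x| `^ q)%:E <= \int[mu]_(x in D) (`|g x| `^ q)%:E)%E.
Proof.
move=> q0 mD mw mg wg; apply: ge0_le_integral => //; try exact: measurable_normpow.
by move=> x Dx; rewrite lee_fin ge0_ler_powR ?nnegrE// wg.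
Qed.

Lemma normpow_scale D w t q : 0 < t -> measurable D -> measurable_fun D w ->
  (\int[mu]_(x in D) (`|t * w x| `^ q)%:E = (t `^ q)%:E * \int[mu]_(x in D) (`|w x| `^ q)%:E)%E.
Proof.
move=> t0 mD mw.
have f0 x : D x -> (0 <= (`|w x| `^ q)%:E)%E by rewrite lee_fin powR_ge0.
rewrite -(ge0_integralZl_EFin mu mD f0 (measurable_normpow q mw) (powR_ge0 _ _)).
by apply: eq_integral => x _; rewrite normrM (gtr0_norm t0) powRM// ltW.
Qed.

Lemma trunc_normpow (p : R) D w d : 2 < p -> 0 < d -> d < 1 -> measurable D -> measurable_fun D w ->
  (((1 - Num.sqrt d) `^ p)%:E * \int[mu]_(x in D) (`|w x| `^ p)%:E <=
   \int[mu]_(x in D) (`|trunc d w x| `^ p)%:E +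
   ((1 - Num.sqrt d) `^ p * d `^ ((p - 2) / 2))%:E * \int[mu]_(x in D) (`|w x| `^ 2)%:E)%E.
Proof.
move=> hp d0 d1 mD mw.
have mt := measurable_trunc d mw.
have f0 q (f : R -> R) x : D x -> (0 <= (`|f x| `^ q)%:E)%E by rewrite lee_fin powR_ge0.
have k1 : 0 <= (1 - Num.sqrt d) `^ p by exact: powR_ge0.
have k2 : 0 <= (1 - Num.sqrt d) `^ p * d `^ ((p - 2) / 2) by rewrite mulr_ge0// powR_ge0.
have mp (f : R -> R) q : measurable_fun D f -> measurable_fun D (fun x => `|f x| `^ q).
  by move=> mf; apply: (measurableT_comp (@measurable_powR R q)); exact: measurableT_comp.
have := integral_lincomb mD ler01 k2 (fun x _ => powR_ge0 `|trunc d w x| p)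
  (fun x _ => powR_ge0 `|w x| 2) (mp _ p mt) (mp _ 2 mw).
rewrite mul1e => ->.
rewrite -(ge0_integralZl_EFin mu mD (f0 p w) (measurable_normpow p mw) k1).
apply: ge0_le_integral => //.
- by move=> x _; rewrite mule_ge0 ?lee_fin// powR_ge0.
- by apply: measurable_funeM; exact: measurable_normpow.
- apply/measurable_EFinP; apply: measurable_funD; apply: measurable_funM => //; exact: mp.
move=> x _; rewrite -EFinM lee_fin mul1r.
have := trunc_powR hp d0 d1 (normr_ge0 (w x)).
rewrite (ger0_norm (pos_ge0 _)) mulrBr lerBlDr => /le_trans; apply.
by rewrite lerD2l powR_mulrn// mulrA.
Qed.

End Truncation.

Section LineFunctions.
Context {R : realType}.
Local Notation mu := (@lebesgue_measure R).
Implicit Types (w g u : R -> R) (x : R).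

Let iT : is_interval [set: R]. Proof. by move=> *. Qed.

Lemma H1R_of_prim w g : prim setT w g -> measurable_fun setT g ->
  (normR 2 g < +oo)%E -> (normR 2 w < +oo)%E -> H1R w /\ normR 2 (wderiv setT w) = normR 2 g.
Proof.
move=> pw mg g2 w2.
have wd : is_wderiv setT w g by apply: prim_is_wderiv => //; exact: openT.
have wd' : is_wderiv setT w (wderiv setT w) by apply: getPex; exists g.
have cw : {within setT, continuous w} by exact: prim_within pw.
have E : normR 2 (wderiv setT w) = normR 2 g.
  apply: (ae_eq_normpow (D := setT)) => //; first by have [[]] := wd'.
  apply: (prim_ae_open openT iT _ pw).
  exact: is_wderiv_prim openT iT cw wd'.
split; last exact: E.
split; last exact: w2.
- move=> x; apply/cvgrPdist_lt => e e0.
  have [k k0 hk] := (withinP _ _).1 cw x I e e0.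
  exists k => // y /= xy; rewrite distrC; apply: hk => //; by rewrite distrC.
- by exists g.
- by rewrite E; exact: g2.
Qed.

Lemma H1R_prim u : H1R u -> prim setT u (wderiv setT u) /\ measurable_fun setT (wderiv setT u).
Proof.
move=> [cu [g wd] _ _].
have wd' : is_wderiv setT u (wderiv setT u) by apply: getPex; exists g.
split; last by have [[]] := wd'.
by apply: is_wderiv_prim => //; [exact: openT|exact: continuous_withinT].
Qed.

Lemma prim_measurable w g : prim setT w g -> measurable_fun setT w.
Proof.
move=> pw; apply: subspace_continuous_measurable_fun => //; exact: prim_within pw.
Qed.

Lemma line_sup_norm w g A B x : prim setT w g -> measurable_fun setT g ->
  normR 2 g = A%:E -> normR 2 w = B%:E -> w x ^+ 2 <= 2 * (A + B).
Proof.
move=> pw mg EA EB.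
have mw := prim_measurable pw.
have xx : x < x + 1 by rewrite ltrDl.
have sq (y : R) : `|y| `^ 2 = y ^+ 2 by rewrite powR_mulrn// real_normK// num_real.
have sqi f a b : measurable_fun setT f -> (normR 2 f < +oo)%E ->
    mu.-integrable `[a, b] (EFin \o (fun x => f x ^+ 2)).
  move=> mf f2; apply/integrableP; split.
    by apply/measurable_EFinP; apply: measurable_funX; exact: measurable_funTS.
  apply: le_lt_trans f2; rewrite /normR.
  under eq_integral do rewrite /= ger0_norm ?sqr_ge0//.
  under [leRHS]eq_integral do rewrite sq.
  apply: ge0_subset_integral => //; first by apply/measurable_EFinP; exact: measurable_funX.
  by move=> y _; rewrite lee_fin sqr_ge0.
have ig : mu.-integrable `[x, x + 1] (EFin \o (fun x => g x ^+ 2)) by apply: sqi => //; rewrite EA ltry.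
have iw : mu.-integrable `[x, x + 1] (EFin \o (fun x => w x ^+ 2)) by apply: sqi => //; rewrite EB ltry.
have := prim_sup_bound iT pw I I xx ig (_ : x <= x <= x + 1).
rewrite lexx (ltW xx) => /(_ isT) /le_trans; apply.
rewrite [x + 1 - x]addrAC subrr add0r invr1.
have -> : 1 + 1 = 2 :> R by [].
rewrite ler_pM2l// -lee_fin EFin_Rintegral; last first.
  by have := integrableD _ iw ig; apply.
rewrite EFinD -EA -EB /normR.
under [X in (_ <= X + _)%E]eq_integral do rewrite sq.
under [X in (_ <= _ + X)%E]eq_integral do rewrite sq.
rewrite addeC -ge0_integralD//.
- apply: ge0_subset_integral => //.
    by apply/measurable_EFinP; apply: measurable_funD; exact: measurable_funX.
  by move=> y _; rewrite lee_fin addr_ge0 ?sqr_ge0.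
- by move=> y _; rewrite lee_fin sqr_ge0.
- by apply/measurable_EFinP; exact: measurable_funX.
- by move=> y _; rewrite lee_fin sqr_ge0.
- by apply/measurable_EFinP; exact: measurable_funX.
Qed.

End LineFunctions.

(** * Compactly supported competitors made from solitons *)

Section Bump.
Context {R : realType}.
Local Notation mu := (@lebesgue_measure R).
Variables (p lambda : R).
Hypotheses (hp : 2 < p) (hlambda : 0 < lambda).
Local Notation c := (soliton_energy p lambda).

Let p0 : 0 < p. Proof. exact: lt_trans hp. Qed.

Lemma soliton_energy_ge0 : 0 <= c.
Proof.
have pk := peak_gt0 hp hlambda.
rewrite /soliton_energy mulr_ge0// -(phase0 p lambda) phase_le//; last exact: ltW.
by rewrite oppr_le0 ltW.
Qed.

Let iT : is_interval [set: R]. Proof. by move=> *. Qed.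

Let far_norm (s T x : R) : ~ (s - T < x < s + T) -> T <= `|x - s|.
Proof.
move/negP; rewrite negb_and -!leNgt ler_normr => /orP[h|h]; apply/orP; [right|left]; lra.
Qed.

(* A truncated and rescaled soliton. *)
Lemma nehari_bump eps : 0 < eps -> exists2 T : R, 0 < T & forall s : R, exists w g A B C,
  [/\ prim setT w g, measurable_fun setT g,
      forall x, 0 <= w x,
      forall x, ~ (s - T < x < s + T) -> w x = 0 /\ g x = 0 &
      [/\ 0 < w s, 0 < C, A + lambda * B = C, (2^-1 - p^-1) * C <= c + eps &
      forall D, measurable D -> `]s - T, s + T[ `<=` D ->
        [/\ (\int[mu]_(x in D) (`|g x| `^ 2)%:E = A%:E)%E,
            (\int[mu]_(x in D) (`|w x| `^ 2)%:E = B%:E)%E &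
            (\int[mu]_(x in D) (`|w x| `^ p)%:E = C%:E)%E]]].
Proof.
move=> eps0; have c0 := soliton_energy_ge0; have pk := peak_gt0 hp hlambda.
have l0 : 0 < Num.sqrt lambda by rewrite sqrtr_gt0.
(* Rescaling costs a factor at most [1 + e1]: the part [e1 * c] takes half of [eps], and as
   [e1 <= 1] the box error, at most [eps / 4], is counted at most twice. *)
pose e1 := Num.min 1 (eps / (2 * (c + 1))).
have c1 : 0 < 2 * (c + 1) by rewrite mulr_gt0// ltr_wpDl.
have e10 : 0 < e1 by rewrite lt_min ltr01 divr_gt0.
have e11 : e1 <= 1 by rewrite ge_min lexx.
have e1c : e1 * c <= eps / 2.
  have : e1 <= eps / (2 * (c + 1)) by rewrite ge_min lexx orbT.
  rewrite ler_pdivlMr// => h; have : 0 <= e1 by exact: ltW.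
  move: e1 h {e10 e11} => z h z0; nra.
have [d0 d00 hd] := trunc_loss_small hp hlambda e10.
(* Four demands on the truncation height: a small loss, a value below [peak] so that the bump is not
   zero, and, together, the last two bound [sqrt lambda * d ^+ 2] by [eps / 4]. *)
pose d1 := Num.min d0 (Num.min (peak p lambda / 2) (Num.min 1 (eps / (4 * Num.sqrt lambda)))).
have d10 : 0 < d1 by rewrite !lt_min d00 ltr01 !divr_gt0// mulr_gt0.
have [T T0 hT] := tail_height_small hp hlambda d10.
exists T => // s.
(* Truncation exactly at the height of the soliton at distance [T] from its centre makes the result
   vanish outside the box. *)
set d := tail_height p lambda T in hT.
have dd : 0 < d by exact: soliton_gt0.
have [d_d0 d_pk d_1 d_l] : [/\ d <= d0, d <= peak p lambda / 2, d <= 1 & d <= eps / (4 * Num.sqrt lambda)].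
  by move: hT; rewrite !le_min => /and4P[].
have [dlt1 loss0 loss1] := hd d dd d_d0.
have [A0 B0 ABC Cc] := soliton_bounds hp hlambda s T0.
move: A0 ABC; set A := (X in 0 <= X) => A0 ABC.
move: B0 ABC; set B := (X in 0 <= X) => B0 ABC.
move: Cc ABC; set C := (X in _ * X <= _) => Cc ABC.
have sT : s - T <= s + T by lra.
pose f := soliton p lambda s; pose f' := dsoliton p lambda s.
have pf : prim setT f f'.
  by apply: prim_C1; [exact: is_derive_soliton|exact: continuous_dsoliton].
have mf : measurable_fun setT f by exact: prim_measurable pf.
have mf' : measurable_fun setT f'.
  by apply: continuous_measurable_fun; exact: continuous_dsoliton.
pose O : set R := `]s - T, s + T[%classic.
have mO : measurable O by exact: measurable_itv.
have sq (y : R) : `|y| `^ 2 = y ^+ 2 by rewrite powR_mulrn// real_normK// num_real.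
have cf := @continuous_soliton R p lambda hp s.
have cf' := @continuous_dsoliton R p lambda hp s.
have EA : (\int[mu]_(x in O) (`|f' x| `^ 2)%:E = A%:E)%E.
  under eq_integral do rewrite sq.
  rewrite (integral_oo_cc (h := fun x => f' x ^+ 2))//.
  apply: integrable_continuous => x; exact: (cvgM (cf' x) (cf' x)).
have EB : (\int[mu]_(x in O) (`|f x| `^ 2)%:E = B%:E)%E.
  under eq_integral do rewrite sq.
  rewrite (integral_oo_cc (h := fun x => f x ^+ 2))//.
  apply: integrable_continuous => x; exact: (cvgM (cf x) (cf x)).
have fp x : `|f x| = f x := gtr0_norm (soliton_gt0 hp hlambda s x).
have EC : (\int[mu]_(x in O) (`|f x| `^ p)%:E = C%:E)%E.
  under eq_integral do rewrite fp.
  rewrite (integral_oo_cc (h := fun x => f x `^ p))//.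
  apply: integrable_continuous.
  have -> : (fun x => f x `^ p) = (fun y => `|y| `^ p) \o f by apply/funext => x /=; rewrite fp.
  by move=> x; apply: continuous_comp; [exact: cf|exact: continuous_normr_powR].
pose w := trunc d f; pose g := dtrunc d f f'.
have pw : prim setT w g by exact: prim_trunc.
have mw : measurable_fun setT w by exact: prim_measurable pw.
have mg : measurable_fun setT g by exact: measurable_dtrunc.
have ge q (h : R -> R) : (0 <= \int[mu]_(x in O) (`|h x| `^ q)%:E)%E.
  by apply: integral_ge0 => x _; rewrite lee_fin powR_ge0.
have mTO (h : R -> R) : measurable_fun setT h -> measurable_fun O h by exact: measurable_funTS.
have lA : (\int[mu]_(x in O) (`|g x| `^ 2)%:E <= A%:E)%E.
  rewrite -EA; apply: le_normpow => //; [exact: mTO|exact: mTO|].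
  by move=> x _; exact: norm_dtrunc.
have lB : (\int[mu]_(x in O) (`|w x| `^ 2)%:E <= B%:E)%E.
  rewrite -EB; apply: le_normpow => //; [exact: mTO|exact: mTO|].
  by move=> x _; apply: norm_trunc; exact: ltW.
have lC : (\int[mu]_(x in O) (`|w x| `^ p)%:E <= C%:E)%E.
  rewrite -EC; apply: le_normpow => //; [exact: ltW|exact: mTO|exact: mTO|].
  by move=> x _; apply: norm_trunc; exact: ltW.
have fin (a : \bar R) (b : R) : (0 <= a)%E -> (a <= b%:E)%E -> exists2 r, a = r%:E & 0 <= r <= b.
  by case: a => [r| |]//; rewrite !lee_fin => r0 rb; exists r => //; rewrite r0.
have [A' EA' /andP[A'0 A'A]] := fin _ _ (ge 2 g) lA.
have [B' EB' /andP[B'0 B'B]] := fin _ _ (ge 2 w) lB.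
have [C' EC' /andP[C'0 C'C]] := fin _ _ (ge p w) lC.
have trC : trunc_loss p lambda d * C <= C'.
  have := trunc_normpow hp dd dlt1 mO (mTO _ mf).
  rewrite EC EC' EB -!EFinM lee_fin => h.
  have k0 : 0 <= (1 - Num.sqrt d) `^ p by exact: powR_ge0.
  have k1 : 0 <= (1 - Num.sqrt d) `^ p * d `^ ((p - 2) / 2) by rewrite mulr_ge0// powR_ge0.
  have BC : B <= C / lambda.
    by rewrite ler_pdivlMr// mulrC; apply: le_trans ABC; rewrite lerDr.
  have := ler_wpM2l k1 BC; rewrite /trunc_loss.
  have -> : (1 - Num.sqrt d) `^ p * (1 - d `^ ((p - 2) / 2) / lambda) * C =
    (1 - Num.sqrt d) `^ p * C - (1 - Num.sqrt d) `^ p * d `^ ((p - 2) / 2) * (C / lambda).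
    by field; rewrite gt_eqF.
  move: h; lra.
have out x : ~ (s - T < x < s + T) -> w x = 0 /\ g x = 0.
  move=> nx; apply: trunc_out; rewrite fp /f /d -(soliton_right p lambda s T).
  apply: soliton_decr => //; rewrite addrAC subrr add0r (gtr0_norm T0).
  exact: far_norm.
have ws : 0 < w s.
  have dpk : d < peak p lambda.
    by apply: (le_lt_trans d_pk); rewrite ltr_pdivrMr// ltr_pMr// ltr1n.
  by rewrite /w /trunc fp /f soliton_center// ge0_pos ?subr_gt0 ?subr_ge0// ltW.
have Dint D q (h : R -> R) : q != 0 -> O `<=` D -> (forall x, ~ (s - T < x < s + T) -> h x = 0) ->
    (\int[mu]_(x in D) (`|h x| `^ q)%:E = \int[mu]_(x in O) (`|h x| `^ q)%:E)%E.
  move=> q0 OD h0; apply: integral_subset0 => // x _ nx.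
  by rewrite h0 ?normr0 ?powR0//; move: nx; rewrite /O /= in_itv.
have pn0 : p != 0 by rewrite gt_eqF.
have DA D : O `<=` D -> (\int[mu]_(x in D) (`|g x| `^ 2)%:E = A'%:E)%E.
  by move=> OD; rewrite Dint ?pnatr_eq0// => x /out[].
have DB D : O `<=` D -> (\int[mu]_(x in D) (`|w x| `^ 2)%:E = B'%:E)%E.
  by move=> OD; rewrite Dint ?pnatr_eq0// => x /out[].
have DC D : O `<=` D -> (\int[mu]_(x in D) (`|w x| `^ p)%:E = C'%:E)%E.
  by move=> OD; rewrite Dint// => x /out[].
have N0 : 0 < A' + lambda * B'.
  have := line_sup_norm s pw mg (DA setT (@subsetT _ _)) (DB setT (@subsetT _ _)).
  have := exprn_gt0 2 ws => h1 h2.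
  have AB0 : 0 < A' + B' by have := lt_le_trans h1 h2; lra.
  have [B1|B1] := eqVneq B' 0; first by move: AB0; rewrite B1 mulr0.
  by rewrite ltr_wpDl// mulr_gt0// lt_neqAle eq_sym B1.
have NC : A' + lambda * B' <= C.
  by apply: le_trans ABC; apply: lerD => //; rewrite ler_pM2l.
have [t t0 [tE tC]] := rescale hp loss0 N0 NC trC.
have C0 : 0 < C by exact: lt_le_trans NC.
have mDw D (h : R -> R) : measurable D -> measurable_fun setT h -> measurable_fun D h.
  by move=> mD; exact: measurable_funTS.
exists (fun x => t * w x), (fun x => t * g x), (t ^+ 2 * A'), (t ^+ 2 * B'), (t `^ p * C'); split.
- exact: primZ.
- exact: measurable_funM.
- by move=> x; rewrite mulr_ge0 ?pos_ge0// ltW.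
- by move=> x /out[-> ->]; rewrite !mulr0.
split.
- exact: mulr_gt0.
- rewrite -tE mulr_gt0// exprn_gt0//.
- by rewrite -tE; ring.
- have k0 : 0 < 2^-1 - p^-1 by rewrite subr_gt0 ltf_pV2// posrE.
  have h1 : t `^ p * C' <= (1 + e1) * C.
    by apply: (le_trans tC); rewrite ler_wpM2r// ltW.
  have h2 : (2^-1 - p^-1) * (t `^ p * C') <= (1 + e1) * ((2^-1 - p^-1) * C).
    by rewrite [leRHS]mulrCA ler_pM2l.
  have eta : Num.sqrt lambda * d ^+ 2 <= eps / 4.
    have d2 : d ^+ 2 <= d by rewrite expr2 ler_piMl// ltW.
    apply: (@le_trans _ _ (Num.sqrt lambda * d)); first by rewrite ler_pM2l.
    rewrite mulrC -ler_pdivlMr//; apply: le_trans d_l _.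
    by rewrite le_eqVlt; apply/orP; left; apply/eqP; field; rewrite gt_eqF.
  have eta0 : 0 <= Num.sqrt lambda * d ^+ 2 by rewrite mulr_ge0 ?sqr_ge0// ltW.
  have h3 : (1 + e1) * ((2^-1 - p^-1) * C) <= (1 + e1) * (c + Num.sqrt lambda * d ^+ 2).
    by rewrite ler_wpM2l// addr_ge0// ltW.
  apply: (le_trans h2); apply: (le_trans h3).
  move: (Num.sqrt lambda * d ^+ 2) eta eta0 => eta h4 h5.
  have h6 : e1 * eta <= eta by rewrite ler_piMl.
  have -> : (1 + e1) * (c + eta) = c + eta + e1 * c + e1 * eta by ring.
  by move: (e1 * c) (e1 * eta) e1c h6 => a b; lra.
move=> D mD OD; rewrite !normpow_scale//; try exact: mDw.
by rewrite DA// DB// DC// -!EFinM !powR_mulrn// ltW.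
Qed.

End Bump.

Section LineLevel.
Context {R : realType}.
Local Notation mu := (@lebesgue_measure R).
Variables (p lambda : R).
Hypotheses (hp : 2 < p) (hlambda : 0 < lambda).
Local Notation c := (soliton_energy p lambda).
Local Notation peak := (peak p lambda).
Local Notation phase := (phase p lambda).

Let p0 : 0 < p. Proof. exact: lt_trans hp. Qed.
Let iT : is_interval [set: R]. Proof. by move=> *. Qed.

(** If [|u| >= d] on a segment of length [n], then [n * d ^+ 2 <= B]. Small values found on both
    sides of any point replace limits at infinity. *)
Lemma line_small_value (u : R -> R) (B d : R) : measurable_fun setT u -> normR 2 u = B%:E -> 0 < d ->
  exists n : nat, forall a, exists2 y, a <= y <= a + n%:R & `|u y| < d.
Proof.
move=> mw EB d0.
have d2 : 0 < d ^+ 2 by rewrite exprn_gt0.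
pose n := (Num.bound `|B / d ^+ 2|).+1.
have Hn : B < n%:R * d ^+ 2.
  rewrite -ltr_pdivrMr//; apply: (le_lt_trans (ler_norm _)).
  by apply: (lt_trans (archi_boundP _)); rewrite ?normr_ge0// ltr_nat.
exists n => a; apply: contrapT => h.
have hd y : a <= y <= a + n%:R -> d <= `|u y|.
  by move=> ay; rewrite leNgt; apply/negP => yd; apply: h; exists y.
have : (\int[mu]_(y in [set` `[a, (a + n%:R)%R]]) (cst (d ^+ 2)%:E) y <= B%:E)%E.
  rewrite -EB; apply: (@le_trans _ _ (\int[mu]_(x in [set` `[a, (a + n%:R)%R]]) (`|u x| `^ 2)%:E)%E).
    apply: ge0_le_integral => //.
    - by move=> x _; rewrite lee_fin sqr_ge0.
    - by apply: measurable_normpow; exact: measurable_funTS.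
    - move=> x; rewrite /= in_itv/= => /hd dx; rewrite lee_fin powR_mulrn// ler_sqr// nnegrE//.
      exact: ltW.
  by apply: ge0_subset_integral => //; exact: measurable_normpow.
rewrite integral_cst//= lebesgue_measure_itv/= lte_fin ltrDl ltr0n/=.
rewrite -EFinD addrAC subrr add0r -EFinM lee_fin leNgt => /negP; apply.
by rewrite mulrC.
Qed.

(** On the line the two half-lines from a point are the two disjoint paths. The normalization uses
    the supremum of [|u|], which need not be known to be attained: [claim] holds at every point and
    continuity of [phase] passes to the supremum. *)
Lemma nehariR_lower u : nehariR p lambda u -> (c%:E <= JR p lambda u)%E.
Proof.
move=> [hu un0 E].
have [pu mg] := H1R_prim hu.
set g := wderiv setT u in pu mg E.
have mw := prim_measurable pu.
have pk := peak_gt0 hp hlambda.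
have [_ _ a_ b_] := hu.
have ge q (h : R -> R) : (0 <= normR q h)%E.
  by apply: integral_ge0 => x _; rewrite lee_fin powR_ge0.
have [A EA A0] : exists2 A, normR 2 g = A%:E & 0 <= A.
  move: (ge 2 g) a_; rewrite -/g; case: (normR 2 g) => [A| |]// A0 _; exists A => //.
have [B EB B0] : exists2 B, normR 2 u = B%:E & 0 <= B.
  by move: (ge 2 u) b_; case: (normR 2 u) => [B| |]// B0 _; exists B.
rewrite EA EB in E; set C := A + lambda * B.
have EC : normR p u = C%:E by rewrite -E -EFinM -EFinD.
have supn x := line_sup_norm x pu mg EA EB.
have [x0 ux0] : exists x, u x != 0.
  apply: contrapT => h; apply: un0; apply/funext => x /=; apply/eqP.
  by rewrite -[_ == _]negbK; apply/negP => ux; apply: h; exists x.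
have C0 : 0 < C.
  have := supn x0; have : 0 < u x0 ^+ 2 by rewrite exprn_even_gt0.
  move=> h1 h2; have AB : 0 < A + B by have := lt_le_trans h1 h2; rewrite pmulr_rgt0.
  have [B1|B1] := eqVneq B 0; first by move: AB; rewrite /C B1 mulr0.
  by rewrite /C ltr_wpDl// mulr_gt0// lt_neqAle eq_sym B1.
have JE : JR p lambda u = ((2^-1 - p^-1) * C)%:E.
  rewrite /JR /energy -/g EA EB EC -!EFinM; apply: (congr1 EFin).
  by rewrite /C; field; rewrite gt_eqF.
rewrite JE lee_fin.
pose S := range (fun x => `|u x|).
have Sub : has_ubound S.
  exists (2 * (A + B) + 1) => _ [x _ <-]; have := supn x.
  have AB : 0 <= 2 * (A + B) by rewrite mulr_ge0// addr_ge0.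
  rewrite -[u x ^+ 2]real_normK ?num_real//; move: (2 * (A + B)) AB => K K0.
  have := normr_ge0 (u x); move: `|u x| => y y0 yK; nra.
set M := sup S.
have uM x : `|u x| <= M by apply: ub_le_sup => //; exists x.
have M0 : 0 < M by apply: lt_le_trans (uM x0); rewrite normr_gt0.
pose t := peak / M; have t0 : 0 < t by rewrite divr_gt0.
have tM : t * M = peak by rewrite /t divfK// gt_eqF.
have tu x : `|t * u x| <= peak by rewrite normrM (gtr0_norm t0) -tM ler_pM2l.
set e := (t ^+ 2 / 2 - t `^ p / p) * C.
have De : (\int[mu]_(x in setT) (density p lambda t u g x)%:E = e%:E)%E.
  have := integral_density hp hlambda measurableT mw mg t0 (fun x _ => tu x).
  rewrite -/(normR p u) -/(normR 2 u) -/(normR 2 g) EA EB EC -!EFinM -EFinD.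
  case: (integral _ _ _) => [D| |]// -[h]; congr (_%:E).
  rewrite -[D](addrK (t `^ p / p * C)) h /e /C; field; by rewrite gt_eqF.
have D0 x : 0 <= density p lambda t u g x by rewrite density_ge0.
have mD : measurable_fun setT (density p lambda t u g) by exact: measurable_density.
have claim x : 2 * phase (t * `|u x|) <= e.
  apply/ler_addgt0Pr => eta eta0.
  have e20 : 0 < eta / 2 by rewrite divr_gt0.
  have c0 : {for 0, continuous phase} by apply: continuous_phase => //; lra.
  move/cvgrPdist_lt: c0 => /(_ _ e20)[d /= d0 hd].
  have dt0 : 0 < d / t by rewrite divr_gt0.
  have small y : `|u y| < d / t -> `|phase (t * u y)| < eta / 2.
    move=> uy; have := hd (t * u y); rewrite /= phase0 !sub0r !normrN; apply.
    by rewrite normrM (gtr0_norm t0) mulrC -ltr_pdivlMr.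
  have [n hn] := line_small_value mw EB dt0.
  have [y1 /andP[_ y1x] /small s1] := hn (x - n%:R).
  have [y2 /andP[xy2 _] /small s2] := hn x.
  rewrite subrK in y1x.
  have b1 := bogomolny hp hlambda iT pu y1x I I (fun z _ => tu z).
  have b2 := bogomolny hp hlambda iT pu xy2 I I (fun z _ => tu z).
  have sum : (\int[mu]_(x in `]y1, x[) (density p lambda t u g x)%:E +
      \int[mu]_(x in `]x, y2[) (density p lambda t u g x)%:E <= e%:E)%E.
    have mDE D : measurable D -> measurable_fun D (fun z => (density p lambda t u g z)%:E).
      by move=> mA; apply/measurable_EFinP; exact: measurable_funTS.
    have DE0 D z : D z -> (0 <= (density p lambda t u g z)%:E)%E by rewrite lee_fin.
    have mU : measurable (`]y1, x[ `|` `]x, y2[) by exact: measurableU.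
    have disj : [disjoint `]y1, x[%classic & `]x, y2[%classic].
      apply/disj_setPS => z []; rewrite /= !in_itv/= => /andP[_ zx] /andP[xz _].
      by have := lt_trans zx xz; rewrite ltxx.
    rewrite -De -(ge0_integral_setU mu _ _ (mDE _ mU) (DE0 _) disj)//.
    by apply: (@ge0_subset_integral _ _ _ mu _ _ mU measurableT _ (mDE _ measurableT)) => // z _; rewrite lee_fin.
  have := le_trans (leeD b1 b2) sum; rewrite -EFinD lee_fin.
  have -> : phase (t * `|u x|) = `|phase (t * u x)|.
    by rewrite norm_phase// normrM (gtr0_norm t0).
  move: s1 s2; move: (phase (t * u y1)) (phase (t * u y2)) (phase (t * u x)) => a b z.
  have h1 : `|z| <= `|z - a| + `|a| by rewrite -{1}[z](subrK a) ler_normD.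
  have h2 : `|z| <= `|b - z| + `|b| by rewrite distrC -{1}[z](subrK b) ler_normD.
  move: h1 h2; move: `|z| `|z - a| `|b - z| `|a| `|b| => r1 r2 r3 r4 r5; lra.
have ce : c <= e.
  rewrite leNgt; apply/negP => ec.
  have e20 : 0 < phase peak - e / 2 by rewrite subr_gt0 ltr_pdivrMr// mulrC.
  have cp : {for peak, continuous phase}.
    by apply: continuous_phase => //; rewrite ltrBlDr; apply: (@lt_trans _ _ 0); rewrite ?oppr_lt0// addr_gt0.
  move/cvgrPdist_lt: cp => /(_ _ e20)[d /= d0 hd].
  have dt0 : 0 < d / t by rewrite divr_gt0.
  have hS : has_sup S by split => //; exists `|u x0|; exists x0.
  have [_ [x _ <-] ux] := sup_adherent dt0 hS.
  have h1 : t * `|u x| <= peak by rewrite -tM ler_pM2l.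
  have h2 : peak - t * `|u x| < d.
    by rewrite -tM -mulrBr mulrC -ltr_pdivlMr// ltrBlDr addrC -ltrBlDr.
  have := hd (t * `|u x|); rewrite /= ger0_norm ?subr_ge0// => /(_ h2).
  rewrite ger0_norm; last by rewrite subr_ge0 phase_le// (le_trans _ (mulr_ge0 (ltW t0) (normr_ge0 _)))// oppr_le0 ltW.
  by have := claim x; move: (phase (t * `|u x|)) (phase peak) => r1 r2; lra.
have [h _] := young_powR hp t0.
by apply: (le_trans ce); exact: ler_wpM2r (ltW C0) _ _ h.
Qed.

Lemma s_level_eq : s_level p lambda = c%:E :> \bar R.
Proof.
apply/eqP; rewrite eq_le; apply/andP; split; last first.
  by apply: le_ereal_inf_tmp => _ [u hu <-]; exact: nehariR_lower.
apply/lee_addgt0Pr => eps eps0.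
have [T T0 /(_ 0)[w [g [A [B [C [pw mg w0 out [ws C0 ABC Cc hD]]]]]]]] := nehari_bump hp hlambda eps0.
have [EA EB EC] := hD setT measurableT (@subsetT _ _).
have g2 : (normR 2 g < +oo)%E by rewrite /normR EA ltry.
have w2 : (normR 2 w < +oo)%E by rewrite /normR EB ltry.
have [hw E] := H1R_of_prim pw mg g2 w2.
apply: ge_ereal_inf; exists (JR p lambda w).
  exists w; last by [].
  split; first exact: hw.
    by move=> w00; move: ws; rewrite w00 ltxx.
  by rewrite E /normR EA EB EC -EFinM -EFinD ABC.
rewrite /JR /energy E /normR EA EB EC -!EFinM -EFinD.
have -> : 2^-1 * A + lambda / 2 * B - p^-1 * C = (2^-1 - p^-1) * C.
  by rewrite -ABC; field; rewrite gt_eqF.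
by rewrite lee_fin.
Qed.

End LineLevel.

Lemma esum_le_lincomb (R : realType) (T : choiceType) (k1 k2 : R) (a b c : T -> \bar R) :
  0 < k1 -> 0 < k2 -> (forall i, 0 <= b i)%E -> (forall i, 0 <= c i)%E ->
  (forall i, a i <= k1%:E * b i + k2%:E * c i)%E ->
  (\esum_(i in [set: T]) a i <=
   k1%:E * (\esum_(i in [set: T]) b i) + k2%:E * (\esum_(i in [set: T]) c i))%E.
Proof.
move=> k10 k20 b0 c0 abc; rewrite -!esumZl// -!esumD//.
- by apply: le_esum => i _; exact: abc.
- by move=> i _; rewrite mule_ge0// lee_fin ltW.
- by move=> i _; rewrite mule_ge0// lee_fin ltW.
Qed.

(** * Competitors on a graph with a half-line *)

Section Competitors.
Context {R : realType} (G : metric_graph R).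
Local Notation mu := (@lebesgue_measure R).
Variables (p lambda : R) (Z : set (vertex G)) (e0 : edge G).
Hypotheses (hG : classG G) (hp : 2 < p) (hlambda : 0 < lambda) (he0 : half_line e0).
Implicit Types (e : edge G) (x : R) (u v : pt G -> R) (w g : R -> R).
Local Notation c := (soliton_energy p lambda).

Let p0 : 0 < p. Proof. exact: lt_trans hp. Qed.
Let pn0 : p != 0. Proof. by rewrite gt_eqF. Qed.

Lemma esum_single (a : edge G -> \bar R) : (forall e, e != e0 -> a e = 0%E) ->
  (forall e, 0 <= a e)%E -> (\esum_(e in [set: edge G]) a e = a e0)%E.
Proof.
move=> a1 a0; rewrite -(esum_set1 (a0 e0)) [RHS]esum_mkcond; apply: eq_esum => e _.
by case: ifPn => // /negP ne; apply: a1; apply/eqP => ee0; apply: ne; rewrite inE.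
Qed.

Definition place w (q : pt G) : R :=
  if val q is inr (e, x) then if e == e0 then w x else 0 else 0.

Lemma on_edge_place w e x : w 0 = 0 -> closed_edge e x ->
  on_edge (place w) e x = if e == e0 then w x else 0.
Proof.
move=> w0 ex; pose q : pt G := exist _ (edge_pt e x) (mem_set (edge_pt_point hG ex)).
rewrite (@on_edgeE _ _ _ _ _ q)// /place /= /edge_pt.
case: eqVneq => [->|_]; first by rewrite w0 if_same.
by case: eqVneq => // xl; case: eqVneq => // ee0; move: xl; rewrite ee0 he0.
Qed.

Lemma place_nehari w g A B C : prim setT w g -> measurable_fun setT g -> w 0 = 0 ->
  (exists2 x, 0 < x & w x != 0) ->
  (\int[mu]_(x in open_edge e0) (`|g x| `^ 2)%:E = A%:E)%E ->
  (\int[mu]_(x in open_edge e0) (`|w x| `^ 2)%:E = B%:E)%E ->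
  (\int[mu]_(x in open_edge e0) (`|w x| `^ p)%:E = C%:E)%E -> A + lambda * B = C ->
  nehari p lambda Z (place w) /\ J p lambda (place w) = ((2^-1 - p^-1) * C)%:E.
Proof.
move=> pw mg w0 [x1 x10 wx1] EA EB EC ABC.
pose h e := if e == e0 then g else fun=> 0.
have single q (f : edge G -> R -> R) (f1 : R -> R) (F : R) : q != 0 ->
    (forall e x, open_edge e x -> f e x = if e == e0 then f1 x else 0) ->
    (\int[mu]_(x in open_edge e0) (`|f1 x| `^ q)%:E = F%:E)%E -> normG q f = F%:E.
  move=> q0 ff1 <-; rewrite /normG esum_single.
  - by apply: eq_integral => x; rewrite inE => ex; rewrite ff1// eqxx.
  - move=> e ee0; apply: integral0_eq => x ex; rewrite ff1// (negbTE ee0) normr0 powR0//.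
  - by move=> e; apply: integral_ge0 => x _; rewrite lee_fin powR_ge0.
have on_w e x : open_edge e x -> on_edge (place w) e x = if e == e0 then w x else 0.
  by move=> ex; apply: on_edge_place => //; exact: open_closed_edge.
have nB := single 2 _ _ _ (lt0r_neq0 (ltr0Sn R 1)) on_w EB.
have nC := single p _ _ _ pn0 on_w EC.
have nA : normG 2 h = A%:E.
  by apply: (single 2 h g A (lt0r_neq0 (ltr0Sn R 1))) => // e x _; rewrite /h; case: ifP.
have [||||hu hd] := @H1_of_prim _ _ hG (place w) h.
- move=> e; apply: (@prim_eq _ _ (if e == e0 then w else fun=> 0) _ (h e)).
  + exact: closed_edge_interval.
  + by move=> x; rewrite inE => ex; rewrite on_edge_place//; case: ifP.
  + by [].
  rewrite /h; case: ifP => _; last exact: prim_cst.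
  exact: primS (@subsetT _ _) pw.
- by move=> e; rewrite /h; case: ifP => _ //; exact: measurable_funTS.
- by rewrite nA ltry.
- by rewrite nB ltry.
rewrite nA in hd.
split; last first.
  rewrite /J /energy hd nB nC -!EFinM; apply: (congr1 EFin).
  by rewrite -ABC; field; rewrite gt_eqF.
split.
- split; first exact: hu.
  by move=> v _; rewrite /eval; case: insubP => // q _ qv; rewrite /= /place qv.
- move=> z; have e1 : open_edge e0 x1 by split => //; rewrite he0 ltry.
  have := on_w _ _ e1; rewrite eqxx z /on_edge /eval.
  by case: insubP => [q _ _|_] /= wz; move: wx1; rewrite -wz eqxx.
- by rewrite hd nB nC -EFinM -EFinD ABC.
Qed.

Lemma open_half_line a b : 0 <= a -> `]a, b[ `<=` open_edge e0.
Proof.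
move=> a0 x; rewrite /= in_itv/= => /andP[ax _]; split; first exact: le_lt_trans ax.
by rewrite he0 ltry.
Qed.

Lemma far_bump eps a : 0 < eps -> exists w, [/\ forall x, 0 <= w x, forall x, x <= a -> w x = 0, w 0 = 0,
  nehari p lambda Z (place w) /\ (J p lambda (place w) <= (c + eps)%:E)%E &
  nehari p lambda Z (place (fun x => - w x)) /\ (J p lambda (place (fun x => (- w x)%R)) <= (c + eps)%:E)%E].
Proof.
move=> eps0; have [T T0 hT] := nehari_bump hp hlambda eps0.
(* The support of the bump then starts at [max a 0]: it lies on the half-line and beyond [a]. *)
pose s := Num.max a 0 + T.
have sa : s - T = Num.max a 0 by rewrite /s addrK.
have a0 : 0 <= Num.max a 0 by rewrite le_max lexx orbT.
have s0 : 0 < s by rewrite ltr_wpDl.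
have [w [g [A [B [C [pw mg w0 out [ws C0 ABC Cc hD]]]]]]] := hT s.
have [|EA EB EC] := hD (open_edge e0) (open_edge_measurable hG e0).
  by apply: open_half_line; rewrite sa.
have van x : x <= Num.max a 0 -> w x = 0.
  by move=> xa; have [] := out x => //; rewrite sa => /andP[/(le_lt_trans xa)]; rewrite ltxx.
have w00 : w 0 = 0 by apply: van.
have nz : exists2 x, 0 < x & w x != 0 by exists s => //; rewrite gt_eqF.
exists w; split => //.
- by move=> x xa; apply: van; rewrite le_max xa.
- by have [h1 ->] := place_nehari pw mg w00 nz EA EB EC ABC; split => //; rewrite lee_fin.
have Nint q (f : R -> R) : (\int[mu]_(x in open_edge e0) (`|- f x| `^ q)%:E =
    \int[mu]_(x in open_edge e0) (`|f x| `^ q)%:E)%E.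
  by apply: eq_integral => x _; rewrite normrN.
have [|||||||h1 ->] := @place_nehari (fun x => - w x) (fun x => - g x) A B C _ _ _ _ _ _ _ ABC.
- exact: primN.
- exact: measurable_funN.
- by rewrite w00 oppr0.
- by exists s => //; rewrite oppr_eq0 gt_eqF.
- by rewrite Nint.
- by rewrite Nint.
- by rewrite Nint.
by split => //; rewrite lee_fin.
Qed.

Lemma level_nehari_le : (level (J p lambda) (nehari p lambda Z) <= c%:E)%E.
Proof.
apply/lee_addgt0Pr => eps eps0.
have [w [_ _ _ [h1 h2] _]] := far_bump 0 eps0.
by apply: ge_ereal_inf; exists (J p lambda (place w)) => //; exists (place w).
Qed.

(** Makes room for a bump: by [H1_decay], [|v|] stays below the truncation height [d] far out on
    [e0], so its truncation vanishes there. Taking [d] at most half of a nonzero value of [|v|]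
    keeps the result nonzero, and rescaling costs the factor [1 + eps]. *)
Lemma nehari_trunc v eps : nehari p lambda Z v -> 0 < eps -> exists z a,
  [/\ nehari p lambda Z z, forall q, 0 <= z q, forall x, a <= x -> on_edge z e0 x = 0 &
      (J p lambda z <= (1 + eps)%:E * J p lambda v)%E].
Proof.
move=> hv eps0.
have [A [B [C [EA EB EC ABC [A0 B0 C0]]]]] := nehari_real e0 hG hp hlambda hv.
have Hv : H1 v by have [[]] := hv.
have [e1 [x1 [ex1 vx1]]] := nehari_nonzero e0 hG hv.
have v10 : 0 < `|on_edge v e1 x1| by rewrite normr_gt0.
have [d0 d00 hd] := trunc_loss_small hp hlambda eps0.
pose d := Num.min d0 (`|on_edge v e1 x1| / 2).
have dd : 0 < d by rewrite lt_min d00 divr_gt0.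
have dd0 : d <= d0 by rewrite ge_min lexx.
have dv : d < `|on_edge v e1 x1|.
  apply: (@le_lt_trans _ _ (`|on_edge v e1 x1| / 2)); first by rewrite ge_min lexx orbT.
  by rewrite ltr_pdivrMr// ltr_pMr// ltr1n.
have [d1 loss0 loss1] := hd d dd dd0.
have [a a0 ha] := H1_decay hG Hv he0 dd.
pose f e := trunc d (on_edge v e); pose f' e := dtrunc d (on_edge v e) (edge_deriv v e).
have mv e : measurable_fun (open_edge e) (on_edge v e).
  by apply: (on_edge_measurable hG); exact: H1_prim.
have mv' e : measurable_fun (open_edge e) (edge_deriv v e).
  by apply: measurable_funTS; exact: edge_deriv_measurable.
have mf e : measurable_fun (open_edge e) (f e) by exact: measurable_trunc.
have mf' e : measurable_fun (open_edge e) (f' e).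
  by apply: measurable_dtrunc => //; exact: open_edge_measurable.
have pf e : prim (closed_edge e) (f e) (f' e).
  by apply: prim_trunc; [exact: closed_edge_interval|exact: H1_prim].
have le_normG q (w w' : edge G -> R -> R) : 0 <= q -> (forall e, measurable_fun (open_edge e) (w e)) ->
    (forall e, measurable_fun (open_edge e) (w' e)) -> (forall e x, `|w e x| <= `|w' e x|) ->
    (normG q w <= normG q w')%E.
  move=> q0 mw mw' ww'; apply: le_esum => e _; apply: le_normpow => //.
  exact: open_edge_measurable.
have fin (b : \bar R) (r : R) : (0 <= b)%E -> (b <= r%:E)%E -> exists2 r', b = r'%:E & 0 <= r' <= r.
  by case: b => [b| |]//; rewrite !lee_fin => b0 br; exists b => //; rewrite b0.
have lA : (normG 2 f' <= A%:E)%E.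
  rewrite -EA -normG_edge_deriv; apply: le_normG => // e x; exact: norm_dtrunc.
have lB : (normG 2 f <= B%:E)%E.
  by rewrite -EB; apply: le_normG => // e x; apply: norm_trunc; exact: ltW.
have lC : (normG p f <= C%:E)%E.
  by rewrite -EC; apply: le_normG => // [|e x]; [exact: ltW|apply: norm_trunc; exact: ltW].
have [A' EA' /andP[A'0 A'A]] := fin _ _ (normG_ge0 2 f') lA.
have [B' EB' /andP[B'0 B'B]] := fin _ _ (normG_ge0 2 f) lB.
have [C' EC' /andP[C'0 C'C]] := fin _ _ (normG_ge0 p f) lC.
have k0 : 0 < (1 - Num.sqrt d) `^ p.
  by rewrite powR_gt0// subr_gt0 -sqrtr1 ltr_sqrt.
have k1 : 0 < (1 - Num.sqrt d) `^ p * d `^ ((p - 2) / 2) by rewrite mulr_gt0// powR_gt0.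
have I0 q (w : edge G -> R -> R) e : (0 <= \int[mu]_(x in open_edge e) (`|w e x| `^ q)%:E)%E.
  by apply: integral_ge0 => x _; rewrite lee_fin powR_ge0.
have trC : trunc_loss p lambda d * C <= C'.
  have : (((1 - Num.sqrt d) `^ p)%:E * normG p (on_edge v) <=
     normG p f + ((1 - Num.sqrt d) `^ p * d `^ ((p - 2) / 2))%:E * normG 2 (on_edge v))%E.
    rewrite /normG -!esumZl// -esumD//; last by move=> e _; rewrite mule_ge0// lee_fin ltW.
    apply: le_esum => e _; apply: trunc_normpow => //; exact: open_edge_measurable.
  rewrite EC EC' EB -!EFinM lee_fin => h.
  have BC : B <= C / lambda.
    by rewrite ler_pdivlMr// mulrC -ABC lerDr.
  have := ler_wpM2l (ltW k1) BC; rewrite /trunc_loss.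
  have -> : (1 - Num.sqrt d) `^ p * (1 - d `^ ((p - 2) / 2) / lambda) * C =
    (1 - Num.sqrt d) `^ p * C - (1 - Num.sqrt d) `^ p * d `^ ((p - 2) / 2) * (C / lambda).
    by field; rewrite gt_eqF.
  move: h; lra.
pose y (t : R) (q : pt G) := t * pos (`|v q| - d).
have on_y t e x : on_edge (y t) e x = t * f e x.
  rewrite /on_edge /eval /f /trunc /on_edge /eval; case: insubP => [q _ _|_] //=.
  by rewrite normr0 sub0r le0_pos ?mulr0// oppr_le0 ltW.
have scale t q (w : edge G -> R -> R) (F : R) : 0 < t -> (forall e, measurable_fun (open_edge e) (w e)) ->
    normG q w = F%:E -> normG q (fun e x => t * w e x) = (t `^ q * F)%:E.
  move=> t0 mw E; rewrite EFinM -E /normG -esumZl ?powR_gt0//.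
  by apply: eq_esum => e _; apply: normpow_scale => //; exact: open_edge_measurable.
have H1y t : 0 < t -> [/\ H1 (y t), normG 2 (deriv_on_edge (y t)) = (t ^+ 2 * A')%:E,
    normG 2 (on_edge (y t)) = (t ^+ 2 * B')%:E & normG p (on_edge (y t)) = (t `^ p * C')%:E].
  move=> t0.
  have on_yE : on_edge (y t) = fun e x => t * f e x.
    by apply/funext => e; apply/funext => x; exact: on_y.
  have t2 : t `^ 2 = t ^+ 2 by rewrite powR_mulrn// ltW.
  have sA := scale t 2 f' A' t0 mf' EA'; have sB := scale t 2 f B' t0 mf EB'.
  have sC := scale t p f C' t0 mf EC'; rewrite t2 in sA sB.
  have [||||h1 h2] := @H1_of_prim _ _ hG (y t) (fun e x => t * f' e x).
  - by move=> e; rewrite on_yE; exact: primZ.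
  - by move=> e; exact: measurable_funM.
  - by rewrite sA ltry.
  - by rewrite on_yE sB ltry.
  by split; rewrite ?h2 ?on_yE.
have N0 : 0 < A' + lambda * B'.
  have [h1 h2 h3 h4] := H1y 1 ltr01.
  have [K K0 /(_ e1 x1 ex1)] := H1_sup_norm hG h1.
  rewrite h2 h3 -EFinD /= expr1n !mul1r on_y mul1r => hK.
  have f1 : 0 < f e1 x1 by rewrite /f /trunc ge0_pos ?subr_gt0 ?subr_ge0// ltW.
  have : 0 < K * (B' + A') by apply: lt_le_trans hK; rewrite exprn_gt0.
  rewrite pmulr_rgt0// => AB0.
  have [B1|B1] := eqVneq B' 0; first by move: AB0; rewrite B1 mulr0 add0r addr0.
  by rewrite ltr_wpDl// mulr_gt0// lt_neqAle eq_sym B1.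
have NC : A' + lambda * B' <= C.
  by rewrite -ABC; apply: lerD => //; rewrite ler_pM2l.
have [t t0 [tE tC]] := rescale hp loss0 N0 NC trC.
have [Hy yA yB yC] := H1y t t0.
have ny : nehari p lambda Z (y t).
  split.
  - split => // b Zb; have [[_ /(_ b Zb) vb] _ _] := hv.
    move: vb; rewrite /eval; case: insubP => [q _ _|_] //= vb.
    by rewrite /y vb normr0 sub0r le0_pos ?mulr0// oppr_le0 ltW.
  - move=> y0; have := on_y t e1 x1; rewrite y0 /on_edge /eval => h.
    have : 0 < t * f e1 x1.
      by rewrite mulr_gt0// /f /trunc ge0_pos ?subr_gt0 ?subr_ge0// ltW.
    by rewrite -h; case: insubP => [q _ _|_] /=; rewrite ltxx.
  - rewrite yA yB yC -EFinM -EFinD -tE; congr (_%:E); ring.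
exists (y t), a; split => //.
- by move=> q; rewrite /y mulr_ge0 ?pos_ge0// ltW.
- move=> x ax; rewrite on_y /f; have [-> _] := trunc_out (fun=> 0) (ha x ax).
  by rewrite mulr0.
rewrite (nehari_energy e0 hG hp hlambda ny yC) (nehari_energy e0 hG hp hlambda hv EC) -EFinM lee_fin.
have kk : 0 < 2^-1 - p^-1 by rewrite subr_gt0 ltf_pV2// posrE.
rewrite [leRHS]mulrCA ler_pM2l//; apply: (le_trans tC).
by rewrite ler_wpM2r// ltW.
Qed.

Lemma H1_add u v : H1 u -> H1 v -> H1 (fun q => u q + v q).
Proof.
move=> hu hv.
have on_add e x : on_edge (fun q => u q + v q) e x = on_edge u e x + on_edge v e x.
  by rewrite /on_edge /eval; case: insubP => [q _ _|_] //=; rewrite addr0.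
have mw (w : pt G -> R) e : H1 w -> measurable_fun (open_edge e) (on_edge w e).
  by move=> hw; apply: (on_edge_measurable hG); exact: H1_prim.
have mg (w : pt G -> R) e : H1 w -> measurable_fun (open_edge e) (edge_deriv w e).
  by move=> hw; apply: measurable_funTS; exact: edge_deriv_measurable.
have fin (f g : edge G -> R -> R) : (forall e, measurable_fun (open_edge e) (f e)) ->
    (forall e, measurable_fun (open_edge e) (g e)) -> (normG 2 f < +oo)%E -> (normG 2 g < +oo)%E ->
    (normG 2 (fun e x => (f e x + g e x)%R) < +oo)%E.
  move=> mf mg' f2 g2.
  apply: (@le_lt_trans _ _ (2%:E * normG 2 f + 2%:E * normG 2 g)%E); last first.
    move: (normG 2 f) (normG 2 g) f2 g2 => r1 r2 h1 h2.
    by apply: lte_add_pinfty; apply: lte_mul_pinfty.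
  have I0 (w : edge G -> R -> R) e : (0 <= \int[mu]_(x in open_edge e) (`|w e x| `^ 2)%:E)%E.
    by apply: integral_ge0 => x _; rewrite lee_fin powR_ge0.
  apply: (esum_le_lincomb (ltr0Sn R 1) (ltr0Sn R 1)) => e; [exact: I0|exact: I0|].
  have mp (w : R -> R) : measurable_fun (open_edge e) w -> measurable_fun (open_edge e) (fun x => `|w x| `^ 2).
    by move=> mw'; apply: (measurableT_comp (@measurable_powR R 2)); exact: measurableT_comp.
  have mo := open_edge_measurable hG e.
  have := integral_lincomb mo (ler0n _ 2) (ler0n _ 2) (fun x _ => powR_ge0 `|f e x| 2)
    (fun x _ => powR_ge0 `|g e x| 2) (mp _ (mf e)) (mp _ (mg' e)).
  move=> ->; apply: ge0_le_integral => //.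
  - by apply: measurable_normpow; exact: measurable_funD.
  - by apply/measurable_EFinP; apply: measurable_funD; apply: measurable_funM => //; exact: mp.
  move=> x _; rewrite lee_fin !powR_mulrn// !real_normK ?num_real//.
  by have := sqr_ge0 (f e x - g e x); nra.
have [_ _ u1 u2] := hu; have [_ _ v1 v2] := hv.
have on_addE : on_edge (fun q => u q + v q) = fun e x => on_edge u e x + on_edge v e x.
  by apply/funext => e; apply/funext => x.
have [||||//] := @H1_of_prim _ _ hG (fun q => u q + v q) (fun e x => edge_deriv u e x + edge_deriv v e x).
- by move=> e; rewrite on_addE; apply: primD; exact: H1_prim.
- by move=> e; apply: measurable_funD; exact: mg.
- by apply: fin => [e|e| |]; rewrite ?normG_edge_deriv//; exact: mg.
- by rewrite on_addE; apply: fin => [e|e| |] //; exact: mw.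
Qed.

(** A nonnegative function that vanishes beyond [a] on [e0] plus a nonpositive bump supported beyond
    [a]: the two summands are exactly the positive and the negative part of the sum, so both Nehari
    constraints hold. *)
Lemma nodal_competitor v eps : nehari p lambda Z v -> 0 < eps -> exists2 u, nodal_nehari p lambda Z u &
  (J p lambda u <= (c + eps)%:E + (1 + eps)%:E * J p lambda v)%E.
Proof.
move=> hv eps0.
have [z [a [hz z0 za Jz]]] := nehari_trunc hv eps0.
have [w [w0 wa w00 _ [hw Jw]]] := far_bump a eps0.
set b := place (fun x => - w x) in hw Jw.
have b0 q : b q <= 0.
  by rewrite /b /place; case: (val q) => [//|[e x]]; case: ifP => // _; rewrite oppr_le0.
have zb q : z q = 0 \/ b q = 0.
  rewrite /b /place; case E : (val q) => [v'|[e x]]; first by right.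
  case: eqVneq => [ee0|_]; last by right.
  have [xa|/ltW ax] := leP x a; first by right; rewrite wa// oppr0.
  left; rewrite -(za x ax); symmetry; apply: on_edgeE; rewrite E ee0; apply: edge_pt_open.
  by have := valP q; rewrite E inE /= ee0.
pose u q := z q + b q.
have uP : (fun q : pt G => Num.max (u q) 0) = z.
  apply/funext => q; rewrite /u; have [h|h] := zb q.
    by rewrite h add0r max_r.
  by rewrite h addr0 max_l.
have uN : (fun q : pt G => Num.min (u q) 0) = b.
  apply/funext => q; rewrite /u; have [h|h] := zb q.
    by rewrite h add0r min_l.
  by rewrite h addr0 min_r.
have [[Hz zZ] _ _] := hz; have [[Hb bZ] _ _] := hw.
have hM : nodal_nehari p lambda Z u.
  split; [split; first exact: H1_add|by rewrite uP; exact: hz|by rewrite uN; exact: hw].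
  move=> y Zy; have := zZ y Zy; have := bZ y Zy; rewrite /eval.
  by case: insubP => [q _ _|_] //=; rewrite /u => -> ->; rewrite addr0.
exists u; first exact: hM.
rewrite (J_parts e0 hG hp hlambda hM) uP uN addeC; exact: leeD.
Qed.

Lemma nehari_J_ge0 v : nehari p lambda Z v -> exists2 j, J p lambda v = j%:E & 0 <= j.
Proof.
move=> hv; have [A [B [C [_ _ EC _ [_ _ C0]]]]] := nehari_real e0 hG hp hlambda hv.
rewrite (nehari_energy e0 hG hp hlambda hv EC); exists ((2^-1 - p^-1) * C) => //.
by rewrite mulr_ge0 ?(ltW C0)// subr_ge0 lef_pV2 ?posrE// ltW.
Qed.

Lemma level_nehari_fin : exists2 r, level (J p lambda) (nehari p lambda Z) = r%:E & 0 <= r <= c.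
Proof.
have := level_nehari_le.
have : (0 <= level (J p lambda) (nehari p lambda Z))%E.
  by apply: le_ereal_inf_tmp => _ [v /nehari_J_ge0[j -> j0] <-]; rewrite lee_fin.
by case: (level _ _) => [r| |]//; rewrite !lee_fin => r0 rc; exists r; rewrite ?r0.
Qed.

Lemma level_nodal_le :
  (level (J p lambda) (nodal_nehari p lambda Z) <= c%:E + level (J p lambda) (nehari p lambda Z))%E.
Proof.
have [r Er /andP[r0 rc]] := level_nehari_fin.
rewrite Er; apply/lee_addgt0Pr => eps eps0.
(* With an error [k] at each stage and [r <= c], the total excess is at most [2 * k + k * (c + k)],
   which these three bounds keep below [eps]. *)
pose k := Num.min (eps / 4) (Num.min 1 (eps / (4 * (c + 1)))).
have c0 := soliton_energy_ge0 hp hlambda.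
have c1 : 0 < 4 * (c + 1) by rewrite mulr_gt0// ltr_wpDl.
have k0 : 0 < k by rewrite !lt_min ltr01 !divr_gt0.
have [k1 k2 k3] : [/\ k <= eps / 4, k <= 1 & k <= eps / (4 * (c + 1))].
  by have := lexx k; rewrite {2}/k !le_min => /and3P[].
have [v hv Jv] : exists2 v, nehari p lambda Z v & (J p lambda v < (r + k)%:E)%E.
  have fin : level (J p lambda) (nehari p lambda Z) \is a fin_num by rewrite Er.
  have [_ [v hv <-]] := lb_ereal_inf_adherent k0 fin.
  by rewrite -/(level (J p lambda) (nehari p lambda Z)) Er => h; exists v.
have [j Ej j0] := nehari_J_ge0 hv.
have [u hu Ju] := nodal_competitor hv k0.
apply: ge_ereal_inf; exists (J p lambda u); first by exists u.
apply: (le_trans Ju); rewrite Ej -EFinM -!EFinD lee_fin.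
rewrite Ej lte_fin in Jv.
rewrite ler_pdivlMr// in k3.
clear -Jv j0 r0 rc k0 k1 k2 k3 c0.
have kj : k * j <= k * (r + k) by rewrite ler_pM2l// ltW.
have kr : k * r <= k * c by rewrite ler_pM2l.
have kk : k * k <= k by rewrite ler_piMl// ltW.
nra.
Qed.

End Competitors.

Lemma prim_nonincreasing (R : realType) (I : set R) (f g : R -> R) (a b : R) : prim I f g ->
  a <= b -> I a -> I b -> (forall x, a < x < b -> g x <= 0) -> f b <= f a.
Proof.
move=> pf ab Ia Ib g0; have [i E] := pf _ _ ab Ia Ib.
by rewrite -subr_le0 E; apply: Rintegral_le0_ae => //; exact: aeW.
Qed.

(** * The virial function *)

Section Virial.
Context {R : realType}.
Local Notation mu := (@lebesgue_measure R).
Variables (p lambda : R).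
Hypotheses (hp : 2 < p) (hlambda : 0 < lambda).
Implicit Types (s x y T : R) (w g : R -> R) (I : set R).

Local Notation peak := (peak p lambda).
Local Notation well2 := (well2 p lambda).
Local Notation well := (well p lambda).
Local Notation phase := (phase p lambda).
Local Notation soliton := (soliton p lambda).
Local Notation dsoliton := (dsoliton p lambda).

Let p0 : 0 < p. Proof. exact: lt_trans hp. Qed.
Let pk : 0 < peak. Proof. exact: peak_gt0. Qed.
Let k0 : 0 < 2^-1 - p^-1. Proof. by rewrite subr_gt0 ltf_pV2// posrE. Qed.

(* Along a solution of [|w'| = well w] it varies at most by the integral of
   [(1/2 - 1/p) w^p], the energy density on the Nehari manifold, and by less on
   a plateau [w = peak], which [phase] does not detect. *)
Definition virial y := phase y - y * well y / 2.

Lemma virial0 : virial 0 = 0.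
Proof. by rewrite /virial phase0 mul0r mul0r subr0. Qed.

Lemma virial_peak : virial peak = phase peak.
Proof. by rewrite /virial /well well2_peak// sqrtr0 mulr0 mul0r subr0. Qed.

Lemma continuous_virial y : - peak - 1 < y -> {for y, continuous virial}.
Proof.
move=> ym; apply: cvgB; first exact: continuous_phase.
apply: cvgM; last exact: cvg_cst.
by apply: cvgM; [exact: cvg_id|exact: continuous_well].
Qed.

Section Regularization.
Variables (I : set R) (w g : R -> R).
Hypotheses (iI : is_interval I) (pw : prim I w g).
Hypotheses (w0 : forall x, I x -> 0 < w x <= peak) (gw : forall x, I x -> `|g x| <= well (w x)).

(** The chain rule does not apply directly to [y * well y], because the square root is singular at
    [peak], where [well2] vanishes. *)
Let reg (n : nat) y := Num.sqrt (well2 y + n.+1%:R^-1).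
(** Half of [y] times the derivative of [well2], so that [y * reg n y] has derivative
    [reg n y + dquad y / reg n y]. *)
Let dquad y := lambda * y ^+ 2 - `|y| `^ p.
Let U : set R := [set y | 0 < y <= peak].

Let iU : is_interval U.
Proof.
move=> a b /andP[a0 am] /andP[b0 bm] c /andP[ac cb].
by apply/andP; split; [exact: lt_le_trans ac|exact: le_trans bm].
Qed.

Let Unorm y : U y -> `|y| <= peak.
Proof. by move=> /andP[y0 ym]; rewrite gtr0_norm. Qed.

Let reg_arg n y : U y -> 0 < well2 y + n.+1%:R^-1.
Proof. by move=> Uy; rewrite ltr_wpDl ?invr_gt0// well2_ge0// Unorm. Qed.

Let reg_gt0 n y : U y -> 0 < reg n y.
Proof. by move=> Uy; rewrite sqrtr_gt0 reg_arg. Qed.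

Let well_reg n y : well y <= reg n y.
Proof. by apply: ler_wsqrtr; rewrite lerDl invr_ge0. Qed.

Let reg_derive n y : U y -> is_derive y 1 (fun z => z * Num.sqrt (lambda * z ^+ 2 - 2 / p * z `^ p + n.+1%:R^-1))
  (reg n y + dquad y * (reg n y)^-1).
Proof.
move=> Uy; have /andP[y0 ym] := Uy.
set S := fun z => lambda * z ^+ 2 - 2 / p * z `^ p + n.+1%:R^-1.
have dw : is_derive y 1 S (lambda * (2 * y) - 2 / p * (p * y `^ (p - 1)) + 0).
  exact: is_deriveD (is_deriveB (is_deriveZ lambda (is_derive_sqr y))
    (is_deriveZ (2 / p) (is_derive1_powR p y0))) (is_derive_cst _ y 1).
have SE : S y = well2 y + n.+1%:R^-1 by rewrite /S /well2 gtr0_norm.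
have S0 : 0 < S y by rewrite SE reg_arg.
have ds := @is_derive1_comp R Num.sqrt S y _ _ (is_derive1_sqrt S0) dw.
have := is_deriveM (is_derive_id y 1) ds.
suff -> : reg n y + dquad y * (reg n y)^-1 = y *: ((2 * Num.sqrt (S y))^-1 *
  (lambda * (2 * y) - 2 / p * (p * y `^ (p - 1)) + 0)) + Num.sqrt (S y) *: 1 by [].
have yp : `|y| `^ p = y * y `^ (p - 1).
  have : y `^ (p - 1 + 1) = y `^ (p - 1) * y `^ 1 by rewrite powRD// (gt_eqF y0) implybT.
  by rewrite subrK (powRr1 (ltW y0)) gtr0_norm// mulrC.
rewrite /dquad yp /reg -SE /GRing.scale/=.
have r0 : Num.sqrt (S y) != 0 by rewrite gt_eqF// sqrtr_gt0.
field; by rewrite r0 gt_eqF.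
Qed.

Let reg_continuous n : {within U, continuous (fun y => reg n y + dquad y * (reg n y)^-1)}.
Proof.
apply: continuous_in_subspaceT => y /set_mem Uy.
have cr : {for y, continuous (reg n)}.
  by apply: cvg_sqrt; apply: cvgD; [exact: continuous_well2|exact: cvg_cst].
have cd : {for y, continuous dquad}.
  apply: cvgB; last exact: continuous_normr_powR.
  by apply: cvgM; [exact: cvg_cst|apply: (cvgM cvg_id cvg_id)].
apply: cvgD; first exact: cr.
apply: cvgM; first exact: cd.
by apply: cvgV; [rewrite gt_eqF// reg_gt0|exact: cr].
Qed.

Let Uw x : I x -> U (w x). Proof. exact: w0. Qed.

Let prim_reg n : prim I (fun x => w x * reg n (w x)) (fun x => (reg n (w x) + dquad (w x) * (reg n (w x))^-1) * g x).
Proof.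
apply: prim_eq (prim_chain iI iU pw Uw (@reg_derive n) (@reg_continuous n)) => // x.
by rewrite inE => Ix /=; rewrite /reg /well2 gtr0_norm//; have /andP[] := w0 Ix.
Qed.

Let reg_cvg y : reg n y @[n --> \oo] --> well y.
Proof.
apply: cvg_sqrt; rewrite -[X in _ --> X]addr0; apply: cvgD; first exact: cvg_cst.
exact: cvg_harmonic.
Qed.

Let bound := Num.sqrt (lambda * peak ^+ 2 + 1) ^+ 2 + lambda * peak ^+ 2 + peak `^ p.

Let prim_limit : prim I (fun x => w x * well (w x)) (fun x => (well (w x) + dquad (w x) * (well (w x))^-1) * g x).
Proof.
apply: (@prim_lim _ _ _ _ _ _ (fun=> bound) iI prim_reg).
- by move=> x Ix; apply: cvgM; [exact: cvg_cst|exact: reg_cvg].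
(* Where [well] vanishes, so does [g] by the pointwise bound [gw]; both sides are then 0, whatever
   the value of the inverse. *)
- move=> x Ix; have [w1|w1] := eqVneq (well (w x)) 0.
    have -> : g x = 0 by apply/eqP; rewrite -normr_le0 -w1; exact: gw.
    by rewrite mulr0; under eq_fun do rewrite mulr0; exact: cvg_cst.
  apply: cvgM; last exact: cvg_cst.
  apply: cvgD; first exact: reg_cvg.
  by apply: cvgM; [exact: cvg_cst|apply: cvgV => //; exact: reg_cvg].
- move=> n x Ix; have /andP[wx wm] := w0 Ix.
  have w2 : w x ^+ 2 <= peak ^+ 2 by rewrite ler_sqr// nnegrE ltW.
  have wp0 : 0 <= w x `^ p := powR_ge0 _ _.
  have wp : w x `^ p <= peak `^ p by apply: ge0_ler_powR; rewrite ?nnegrE ?(ltW p0) ?(ltW wx) ?(ltW pk).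
  have r0 : 0 < reg n (w x) by apply: reg_gt0; exact: w0.
  have rb : reg n (w x) <= Num.sqrt (lambda * peak ^+ 2 + 1).
    apply: ler_wsqrtr; apply: lerD; last by rewrite invf_le1// ler1n.
    rewrite /well2 lerBlDr (gtr0_norm wx).
    apply: (le_trans (ler_wpM2l (ltW hlambda) w2)); rewrite lerDl mulr_ge0// divr_ge0// ltW//.
  (* The factor [|g|] compensates the inverse of [reg n], which makes the domination uniform in [n]
     up to the peak. *)
  have gr : `|g x| <= reg n (w x) by apply: le_trans (gw Ix) _; exact: well_reg.
  have dq : `|dquad (w x)| <= lambda * peak ^+ 2 + peak `^ p.
    rewrite /dquad (gtr0_norm wx) (le_trans (ler_normB _ _))//.
    rewrite !ger0_norm//; last by rewrite mulr_ge0 ?sqr_ge0// ltW.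
    by apply: lerD => //; rewrite ler_wpM2l// ltW.
  rewrite mulrDl; apply: (le_trans (ler_normD _ _)); rewrite /bound -addrA; apply: lerD.
    rewrite normrM gtr0_norm// expr2; apply: ler_pM => //; first exact: ltW.
    exact: le_trans gr rb.
  rewrite -mulrA normrM; apply: le_trans dq; rewrite ler_piMr//.
  by rewrite normrM normfV (gtr0_norm r0) mulrC ler_pdivrMr// mul1r.
- move=> a b ab _ _; apply: continuous_compact_integrable; first exact: segment_compact.
  by apply: continuous_withinT => x; exact: cvg_cst.
Qed.

(** The terms quadratic in y cancel: [well2 y - dquad y] equals (1 - 2/p) y^p. *)
Lemma prim_virial : prim I (virial \o w) (fun x => (2^-1 - p^-1) * w x `^ p * (well (w x))^-1 * g x).
Proof.
have wn x : I x -> `|w x| <= peak by move=> Ix; exact: Unorm (Uw Ix).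
have pp := prim_phase hp iI pw wn.
apply: prim_eq (primB pp (primZ 2^-1 prim_limit)) => //.
  by move=> x _; rewrite /= /virial [2^-1 * _]mulrC.
move=> x; rewrite inE => Ix /=; have [w1|w1] := eqVneq (well (w x)) 0.
  have -> : g x = 0 by apply/eqP; rewrite -normr_le0 -w1; exact: gw.
  by rewrite !mulr0 subr0.
have wx : 0 < w x by have /andP[] := w0 Ix.
have E : w x `^ p = p / 2 * (lambda * w x ^+ 2 - well (w x) ^+ 2).
  by rewrite sqr_well ?wn// /well2 gtr0_norm//; field; rewrite gt_eqF.
rewrite /dquad gtr0_norm// E; field; by rewrite w1 gt_eqF.
Qed.

End Regularization.
Lemma dsoliton_le0 s x : s <= x -> dsoliton s x <= 0.
Proof.
move=> sx; rewrite /dsoliton oppr_le0 mulr_ge0 ?(ltW (soliton_gt0 hp hlambda _ _))// mulr_ge0 ?sqrtr_ge0//.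
by rewrite th_ge0// mulr_ge0 ?subr_ge0// mulr_ge0 ?sqrtr_ge0// divr_ge0// subr_ge0 ltW.
Qed.

(** To the right of its centre the soliton satisfies [well v = - v'], so that [virial v] is
    [phase v + v v' / 2], whose second term is differentiated by [soliton_equation]. *)
Lemma prim_virial_soliton s : prim `[s, +oo[ (virial \o soliton s)
  (fun x => - ((2^-1 - p^-1) * soliton s x `^ p)).
Proof.
have iI : is_interval `[s, +oo[ by exact: interval_is_interval.
have iT : is_interval [set: R] by move=> *.
have ps : prim setT (soliton s) (dsoliton s).
  by apply: prim_C1; [exact: is_derive_soliton|exact: continuous_dsoliton].
have wd x : well (soliton s x) = `|dsoliton s x| by rewrite /well soliton_well// sqrtr_sqr.
have sn x : `|soliton s x| <= peak by exact: soliton_peak.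
have pp := primS (@subsetT _ _ : `[s, +oo[ `<=` setT) (prim_phase hp iT ps (fun x _ => sn x)).
have pe : prim `[s, +oo[ (fun x => soliton s x * dsoliton s x)
    (fun x => dsoliton s x ^+ 2 + lambda * soliton s x ^+ 2 - soliton s x `^ p).
  have cp : continuous (fun x => soliton s x `^ p).
    have -> : (fun x => soliton s x `^ p) = (fun y => `|y| `^ p) \o soliton s.
      by apply/funext => y /=; rewrite gtr0_norm// soliton_gt0.
    by move=> x; apply: continuous_comp; [exact: continuous_soliton|exact: continuous_normr_powR].
  apply: prim_C1; first exact: soliton_equation.
  have cs := @continuous_soliton R p lambda hp s; have cd := @continuous_dsoliton R p lambda hp s.
  move=> x; apply: cvgB.
    apply: cvgD; first exact: (cvgM (cd x) (cd x)).
    by apply: cvgM; [exact: cvg_cst|exact: (cvgM (cs x) (cs x))].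
  exact: cp.
apply: prim_eq (primD pp (primZ 2^-1 pe)) => //.
  move=> x; rewrite inE /= in_itv/= andbT => sx.
  by rewrite /virial wd ler0_norm ?dsoliton_le0//; field.
move=> x; rewrite inE /= in_itv/= andbT => sx.
have := soliton_well hp hlambda s x; rewrite /well2 (gtr0_norm (soliton_gt0 hp hlambda s x)) => E.
rewrite wd ler0_norm ?dsoliton_le0// -E.
have -> : - dsoliton s x * dsoliton s x = - (dsoliton s x ^+ 2) by rewrite mulNr expr2.
by rewrite -E; field; rewrite gt_eqF.
Qed.

Lemma soliton_surj s y : 0 < y <= peak -> exists2 x, s <= x & soliton s x = y.
Proof.
move=> /andP[y0 ym].
have [T T0 hT] := tail_height_small hp hlambda y0.
have sT : s <= s + T by rewrite lerDl ltW.
have [||x] := @IVT R (soliton s) s (s + T) y sT.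
- exact/continuous_withinT/continuous_soliton.
- rewrite soliton_center// soliton_right ge_min le_max hT ym.
  by rewrite orbT.
by rewrite in_itv/= => /andP[sx _] <-; exists x.
Qed.

Lemma virial_soliton_le s x x' : s <= x -> x <= x' -> virial (soliton s x') <= virial (soliton s x).
Proof.
move=> sx xx'.
have m1 : `[s, +oo[%classic x by rewrite /= in_itv/= sx.
have m2 : `[s, +oo[%classic x' by rewrite /= in_itv/= (le_trans sx).
have [i E] := prim_virial_soliton xx' m1 m2.
rewrite -subr_le0 E -oppr_ge0.
have -> : (fun x => - ((2^-1 - p^-1) * soliton s x `^ p)) = (fun x => -1 * ((2^-1 - p^-1) * soliton s x `^ p)).
  by apply/funext => z; rewrite mulN1r.
have i' : mu.-integrable `[x, x'] (EFin \o (fun x => (2^-1 - p^-1) * soliton s x `^ p)).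
  have := integrableN i; congr (_.-integrable _ _); apply/funext => z /=; by rewrite opprK.
rewrite RintegralZl// mulN1r opprK; apply: Rintegral_ge0 => z _.
by rewrite mulr_ge0 ?powR_ge0// ltW.
Qed.

Lemma virial_soliton_lt s x x' : s <= x -> x < x' -> virial (soliton s x') < virial (soliton s x).
Proof.
move=> sx xx'.
have m1 : `[s, +oo[%classic x by rewrite /= in_itv/= sx.
have m2 : `[s, +oo[%classic x' by rewrite /= in_itv/= (le_trans sx)// ltW.
have [i E] := prim_virial_soliton (ltW xx') m1 m2.
set k := (2^-1 - p^-1) * soliton s x' `^ p.
have k1 : 0 < k by rewrite mulr_gt0// powR_gt0// soliton_gt0.
have h : \int[mu]_(z in `[x, x']) (- ((2^-1 - p^-1) * soliton s z `^ p)) <= \int[mu]_(z in `[x, x']) (cst (- k) z).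
  have ic : mu.-integrable `[x, x'] (EFin \o (cst (- k) : R -> R)).
    by apply: continuous_compact_integrable; [exact: segment_compact|apply: continuous_withinT => z; exact: cvg_cst].
  apply: le_Rintegral; [by []|exact: i|exact: ic|].
  move=> z; rewrite /= in_itv/= => /andP[xz zx']; rewrite lerN2 /k.
  have sp y : soliton s y \in Num.nneg by rewrite nnegrE; apply: ltW; exact: soliton_gt0.
  apply: ler_wpM2l; first exact: ltW.
  apply: ge0_ler_powR; [exact: ltW|exact: sp|exact: sp|].
  apply: soliton_decr; [exact: hp|exact: hlambda|].
  have sz : s <= z by exact: le_trans xz.
  by rewrite !ger0_norm ?subr_ge0 ?lerD2r ?(le_trans sz zx').
rewrite -subr_lt0 E; apply: (le_lt_trans h).
rewrite Rintegral_cst//= lebesgue_measure_itv/= lte_fin xx' -EFinD/= mulNr oppr_lt0.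
by rewrite mulr_gt0// subr_gt0.
Qed.

Lemma soliton_inj s x x' : s <= x -> s <= x' -> soliton s x = soliton s x' -> x = x'.
Proof.
move=> sx sx' E; apply/eqP; rewrite eq_le !leNgt; apply/andP; split; apply/negP => h.
  by have := virial_soliton_lt sx' h; rewrite E ltxx.
by have := virial_soliton_lt sx h; rewrite E ltxx.
Qed.

(** Monotonicity is read off the half-soliton, which parametrizes the values in []0, peak]] and
    along which [virial] is known to decrease; this avoids differentiating [virial] near the
    peak. *)
Lemma virial_le y y' : 0 < y -> y <= y' -> y' <= peak -> virial y <= virial y'.
Proof.
move=> y0 yy' ym.
have [|x x0 xE] := @soliton_surj 0 y; first by rewrite y0 (le_trans yy').
have [|x' x'0 x'E] := @soliton_surj 0 y'; first by rewrite (lt_le_trans y0 yy').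
rewrite -xE -x'E; apply: virial_soliton_le => //; rewrite leNgt; apply/negP => xx'.
have := @soliton_decr R p lambda hp hlambda 0 x x'.
rewrite !subr0 !ger0_norm// => /(_ (ltW xx')); rewrite xE x'E => y'y.
have yE : soliton 0 x = soliton 0 x' by apply/eqP; rewrite eq_le xE x'E yy' y'y.
by move: xx'; rewrite (soliton_inj x0 x'0 yE) ltxx.
Qed.

Lemma virial_inj y y' : 0 < y <= peak -> 0 < y' <= peak -> virial y = virial y' -> y = y'.
Proof.
move=> /(@soliton_surj 0)[x x0 <-] /(@soliton_surj 0)[x' x'0 <-] E; congr (soliton 0).
apply/eqP; rewrite eq_le !leNgt; apply/andP; split; apply/negP => h.
  by have := virial_soliton_lt x'0 h; rewrite E ltxx.
by have := virial_soliton_lt x0 h; rewrite E ltxx.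
Qed.

Lemma virial_ge0 y : 0 < y <= peak -> 0 <= virial y.
Proof.
move=> /andP[y0 ym]; rewrite leNgt; apply/negP => v0.
have e0 : 0 < - virial y by rewrite oppr_gt0.
have c0 : {for 0, continuous virial} by apply: continuous_virial; have := pk; lra.
move/cvgrPdist_lt: c0 => /(_ _ e0)[d /= d0 hd].
pose z := Num.min y (d / 2).
have z0 : 0 < z by rewrite lt_min y0 divr_gt0.
have zy : z <= y by rewrite ge_min lexx.
have zd : z < d by apply: (@le_lt_trans _ _ (d / 2)); [rewrite ge_min lexx orbT|rewrite ltr_pdivrMr// ltr_pMr// ltr1n].
have := hd z; rewrite /= virial0 !sub0r !normrN (gtr0_norm z0) => /(_ zd).
have := virial_le z0 zy ym; rewrite ltr_norml => h /andP[h1 _].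
by have := lt_le_trans h1 h; rewrite opprK ltxx.
Qed.

(* [z' = - kappa * (virial^-1 z) ^ p] is dissipative, hence has at most one
   solution forward in time. *)
Lemma flow_unique v S a b : 0 <= S -> (forall x, a <= x <= b -> 0 < v x <= peak) ->
  prim `[a, b] (virial \o v) (fun x => - ((2^-1 - p^-1) * v x `^ p)) ->
  v a = soliton 0 S -> forall x, a <= x <= b -> v x = soliton 0 (S + (x - a)).
Proof.
move=> S0 vp pv v0 x /andP[x0 xb].
have shift y : soliton 0 (S + (y - a)) = soliton (a - S) y.
  rewrite /soliton; have -> : S + (y - a) - 0 = y - (a - S) by ring.
  exact: erefl.
have sol_p y : 0 < soliton (a - S) y <= peak.
  by rewrite soliton_gt0//= -[leLHS]gtr0_norm ?soliton_gt0// soliton_peak.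
have i0b : is_interval `[a, b] by exact: interval_is_interval.
have ps : prim `[a, b] (virial \o soliton (a - S)) (fun x => - ((2^-1 - p^-1) * soliton (a - S) x `^ p)).
  apply: primS (prim_virial_soliton (s := a - S)) => y; rewrite /= !in_itv/= andbT => /andP[y0 _].
  by apply: le_trans y0; rewrite lerBlDr lerDl.
have pd := prim_sqr i0b (primB pv ps).
have m0 : `[a, b]%classic a by rewrite /= in_itv/= lexx (le_trans x0).
have mx : `[a, b]%classic x by rewrite /= in_itv/= x0.
have D0 : (virial (v a) - virial (soliton (a - S) a)) ^+ 2 = 0.
  by rewrite v0 -shift (subrr a) addr0 (subrr (virial (soliton 0 S))) expr0n.
have le0 : (virial (v x) - virial (soliton (a - S) x)) ^+ 2 <= 0.
  rewrite -D0; apply: (prim_nonincreasing pd x0 m0 mx) => z /andP[z0 zx] /=.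
  have /andP[vz vzm] : 0 < v z <= peak by apply: vp; rewrite (ltW z0) (le_trans (ltW zx)).
  have /andP[sz szm] := sol_p z.
  have -> : 2 * (virial (v z) - virial (soliton (a - S) z)) *
    (- ((2^-1 - p^-1) * v z `^ p) - - ((2^-1 - p^-1) * soliton (a - S) z `^ p)) =
    - (2 * (2^-1 - p^-1) * ((virial (v z) - virial (soliton (a - S) z)) * (v z `^ p - soliton (a - S) z `^ p))).
    by ring.
  rewrite oppr_le0 mulr_ge0//; first by rewrite mulr_ge0// ltW.
  have [h|/ltW h] := leP (v z) (soliton (a - S) z).
    rewrite mulr_le0// subr_le0; first exact: virial_le.
    by apply: ge0_ler_powR; rewrite ?nnegrE ?(ltW p0) ?(ltW vz) ?(ltW sz).
  rewrite mulr_ge0// subr_ge0; first exact: virial_le.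
  by apply: ge0_ler_powR; rewrite ?nnegrE ?(ltW p0) ?(ltW vz) ?(ltW sz).
rewrite shift; apply: virial_inj => //; first by apply: vp; rewrite x0.
by apply/eqP; rewrite -subr_eq0 -sqrf_eq0 eq_le le0 sqr_ge0.
Qed.

End Virial.

(** * Graphs covered by two rays *)

Section Rays.
Context {R : realType} (G : metric_graph R).
Implicit Types (c : seq (edge G * R * R)) (e : edge G) (q : raw G) (s x y z : R).

Definition between y y' z := (y <= z <= y') || (y' <= z <= y).

Lemma betweenr y y' : between y y' y'.
Proof. by rewrite /between lexx/= andbT; case: (leP y y') => //= /ltW ->. Qed.

Lemma between_closed e y y' z : closed_edge e y -> closed_edge e y' -> between y y' z -> closed_edge e z.
Proof.
move=> [y0 yl] [y'0 y'l] /orP[/andP[h1 h2]|/andP[h1 h2]]; split.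
- exact: le_trans h1.
- by apply: le_trans y'l; rewrite lee_fin.
- exact: le_trans h1.
- by apply: le_trans yl; rewrite lee_fin.
Qed.

Definition forth y y' s := if y <= y' then y + s else y - s.

Lemma forth_between y y' s : 0 <= s -> s <= `|y - y'| -> between y y' (forth y y' s).
Proof.
move=> s0; rewrite /between /forth; case: (leP y y') => h.
  by rewrite ler0_norm ?subr_le0// => sL; apply/orP; left; lra.
by rewrite gtr0_norm ?subr_gt0// => sL; apply/orP; right; lra.
Qed.

Lemma forth_dist y y' s s' : `|forth y y' s - forth y y' s'| = `|s - s'|.
Proof.
rewrite /forth; case: ifP => _.
  by congr (`|_|); ring.
by rewrite distrC; congr (`|_|); ring.
Qed.

Lemma forth_inv y y' z : between y y' z -> forth y y' `|z - y| = z /\ `|z - y| <= `|y - y'|.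
Proof.
rewrite /between /forth; case: (leP y y') => h /orP[/andP[h1 h2]|/andP[h1 h2]].
- by rewrite ger0_norm ?subr_ge0// ler0_norm ?subr_le0//; split; lra.
- have yy : y = y' by apply/eqP; rewrite eq_le h (le_trans h1).
  have zy : z = y by apply/eqP; rewrite eq_le h2 yy h1.
  by rewrite zy subrr normr0 addr0.
- by have := le_lt_trans (le_trans h1 h2) h; rewrite ltxx.
- by rewrite ler0_norm ?subr_le0// gtr0_norm ?subr_gt0//; split; lra.
Qed.

(* The point at distance [s] along the chain [c] followed by the half-line [e]
   from the coordinate [x]. *)
Fixpoint ray c e x s : raw G :=
  if c is (e', y, y') :: c' then
    if s <= `|y - y'| then edge_pt e' (forth y y' s) else ray c' e x (s - `|y - y'|)
  else edge_pt e (x + s).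

Definition is_ray q c e x := [/\ chain q c (edge_pt e x), half_line e & closed_edge e x].

Lemma ray0 q c e x : is_ray q c e x -> ray c e x 0 = q.
Proof.
case: c => [|[[e' y] y'] c] /= [h he ex]; first by rewrite addr0 h.
by case: h => _ _ <- _; rewrite normr_ge0 /forth addr0 subr0 if_same.
Qed.

Lemma ray_tail q e' y y' c e x : is_ray q ((e', y, y') :: c) e x -> is_ray (edge_pt e' y') c e x.
Proof. by case=> /= -[]. Qed.

Lemma ray_cons q e' y y' c e x s : is_ray q ((e', y, y') :: c) e x -> 0 <= s ->
  ray ((e', y, y') :: c) e x (`|y - y'| + s) = ray c e x s.
Proof.
move=> hr s0 /=; have [h|h] := leP (`|y - y'| + s) `|y - y'|; last by rewrite addrAC subrr add0r.
have -> : s = 0 by apply/eqP; rewrite eq_le s0 andbT -(lerD2l `|y - y'|) addr0.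
rewrite addr0 (ray0 (ray_tail hr)); congr (edge_pt _ _).
by have [] := forth_inv (betweenr y y'); rewrite distrC.
Qed.

Lemma half_line_closed e x s : half_line e -> closed_edge e x -> 0 <= s -> closed_edge e (x + s).
Proof. by move=> he [x0 _] s0; split; rewrite ?addr_ge0// he leey. Qed.

Lemma ray_closed q c e x s : is_ray q c e x -> 0 <= s ->
  exists e' z, closed_edge e' z /\ ray c e x s = edge_pt e' z.
Proof.
elim: c q s => [|[[e' y] y'] c IH] q s hr s0 /=.
  by exists e, (x + s); split => //; apply: half_line_closed => //; case: hr.
have [h|h] := leP s `|y - y'|.
  exists e', (forth y y' s); split => //; have [[/= h1 h2 _ _] _ _] := hr.
  exact: between_closed h1 h2 (forth_between s0 h).
by apply: (IH _ _ (ray_tail hr)); rewrite subr_ge0 ltW.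
Qed.

Lemma chain_cat q c q' c' q'' : chain q c q' -> chain q' c' q'' -> chain q (c ++ c') q''.
Proof.
elim: c q => [|[[e y] y'] c IH] q /=; first by move=> ->.
by move=> [h1 h2 h3 h4] h5; split => //; exact: IH.
Qed.

Lemma chain_length_cat c c' : chain_length (c ++ c') = chain_length c + chain_length c'.
Proof. by rewrite /chain_length big_cat. Qed.

Lemma chain_sym q c q' : chain q c q' -> exists2 c', chain q' c' q & chain_length c' = chain_length c.
Proof.
elim: c q => [|[[e y] y'] c IH] q /=; first by move=> ->; exists [::].
move=> [h1 h2 h3 /IH[c' hc' Ec']].
exists (c' ++ [:: (e, y', y)]); first by apply: chain_cat hc' _.
by rewrite chain_length_cat Ec' /chain_length big_seq1 big_cons/= addrC distrC.
Qed.

Lemma chain_move q e z z' : closed_edge e z -> closed_edge e z' -> edge_pt e z = q ->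
  chain q [:: (e, z, z')] (edge_pt e z').
Proof. by []. Qed.

Lemma ray_chain q c e x s s' : is_ray q c e x -> 0 <= s -> s <= s' ->
  exists2 c', chain (ray c e x s) c' (ray c e x s') & chain_length c' = s' - s.
Proof.
elim: c q s s' => [|[[e' y] y'] c IH] q s s' hr s0 ss'.
  have [_ he ex] := hr; exists [:: (e, x + s, x + s')].
    by apply: chain_move => //; apply: half_line_closed => //; exact: le_trans ss'.
  rewrite /chain_length big_seq1/= ler0_norm; first by ring.
  by rewrite subr_le0 lerD2l.
have [[/= ey ey' _ _] _ _] := hr.
have cl u : 0 <= u -> u <= `|y - y'| -> closed_edge e' (forth y y' u).
  by move=> u0 uL; apply: between_closed ey ey' (forth_between u0 uL).
have [s'L|Ls'] := leP s' `|y - y'|.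
  have sL := le_trans ss' s'L; rewrite /= ?s'L sL.
  exists [:: (e', forth y y' s, forth y y' s')].
    by apply: chain_move => //; apply: cl => //; exact: le_trans ss'.
  by rewrite /chain_length big_seq1/= forth_dist ler0_norm ?subr_le0// opprB.
have E' : ray ((e', y, y') :: c) e x s' = ray c e x (s' - `|y - y'|).
  by rewrite -(ray_cons hr) ?subr_ge0 ?(ltW Ls')// addrC subrK.
have [sL|Ls] := leP s `|y - y'|; last first.
  have Es : ray ((e', y, y') :: c) e x s = ray c e x (s - `|y - y'|).
    by rewrite -(ray_cons hr) ?subr_ge0 ?(ltW Ls)// addrC subrK.
  rewrite ?Es ?E'; have [||c' h1 h2] := IH _ (s - `|y - y'|) (s' - `|y - y'|) (ray_tail hr).
  - by rewrite subr_ge0 ltW.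
  - by rewrite lerD2r.
  by exists c' => //; rewrite h2; ring.
have [||c' h1 h2] := IH _ 0 (s' - `|y - y'|) (ray_tail hr).
- by [].
- by rewrite subr_ge0 ltW.
rewrite (ray0 (ray_tail hr)) in h1.
exists ((e', forth y y' s, y') :: c').
  by rewrite ?E'; split => //; exact: cl.
have fy : forth y y' `|y - y'| = y'.
  by have [] := forth_inv (betweenr y y'); rewrite distrC.
rewrite /chain_length big_cons/= -/(chain_length c') h2 -{2}fy forth_dist.
by rewrite ler0_norm ?subr_le0//; ring.
Qed.

(** Only two points are recorded, with parameters at the distance of their coordinates: enough to
    bound the length of chains, move by move. *)
Definition on_ray (g : R -> raw G) e z z' := exists s s',
  [/\ 0 <= s, 0 <= s', g s = edge_pt e z, g s' = edge_pt e z' & `|s - s'| = `|z - z'|].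

Lemma on_ray_chain q c e x e' y y' z z' : is_ray q c e x -> (e', y, y') \in c ->
  between y y' z -> between y y' z' -> on_ray (ray c e x) e' z z'.
Proof.
move=> hr; elim: c q hr => [//|[[e1 y1] y1'] c IH] q hr.
rewrite inE => /predU1P[[<- <- <-]|h] bz bz'; last first.
  have [s [s' [s0 s'0 E E' D]]] := IH _ (ray_tail hr) h bz bz'.
  exists (`|y1 - y1'| + s), (`|y1 - y1'| + s'); split.
  - by rewrite addr_ge0.
  - by rewrite addr_ge0.
  - by rewrite (ray_cons hr).
  - by rewrite (ray_cons hr).
  - by rewrite -D; congr (`|_|); ring.
have [E L] := forth_inv bz; have [E' L'] := forth_inv bz'.
exists `|z - y|, `|z' - y|; split => //=.
- by rewrite L E.
- by rewrite L' E'.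
- by rewrite -(forth_dist y y') E E'.
Qed.

Lemma on_ray_end q c e x z z' : is_ray q c e x -> x <= z -> x <= z' -> on_ray (ray c e x) e z z'.
Proof.
move=> hr; elim: c q hr => [|[[e1 y1] y1'] c IH] q hr xz xz'.
  exists (z - x), (z' - x); rewrite !subr_ge0 /=; split => //.
  - by rewrite addrC subrK.
  - by rewrite addrC subrK.
  - by congr (`|_|); ring.
have [s [s' [s0 s'0 E E' D]]] := IH _ (ray_tail hr) xz xz'.
exists (`|y1 - y1'| + s), (`|y1 - y1'| + s'); split.
- by rewrite addr_ge0.
- by rewrite addr_ge0.
- by rewrite (ray_cons hr).
- by rewrite (ray_cons hr).
- by rewrite -D; congr (`|_|); ring.
Qed.

(** [f] is the arc length along the ray, counted from [S]. One function [f] serving both rays forces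
    them to meet at equal parameters only. *)
Fixpoint depth_along (f : raw G -> R) (S : R) c e x : Prop :=
  if c is (e', y, y') :: c' then
    (forall z, between y y' z -> f (edge_pt e' z) = S + `|z - y|) /\
    depth_along f (S + `|y - y'|) c' e x
  else forall z, x <= z -> f (edge_pt e z) = S + (z - x).

Lemma ray_depth f S c e x s : depth_along f S c e x -> 0 <= s -> f (ray c e x s) = S + s.
Proof.
elim: c S s => [|[[e' y] y'] c IH] S s /=.
  by move=> h s0; rewrite h ?lerDl//; ring.
move=> [h1 h2] s0; have [sL|Ls] := leP s `|y - y'|.
  rewrite h1; last exact: forth_between.
  by rewrite /forth; case: ifP => _; rewrite addrAC subrr add0r ?normrN ger0_norm.
by rewrite (IH _ _ h2) ?subr_ge0 ?(ltW Ls)//; ring.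
Qed.

End Rays.

Section TwoRays.
Context {R : realType}.
Implicit Types (G : metric_graph R) (b : bool) (s t L : R).

Inductive pieces G (g : bool -> R -> raw G) (e : edge G) : R -> R -> Prop :=
| piece_one b z z' of on_ray (g b) e z z' : pieces g e z z'
| piece_cat z z' z'' of z <= z' & z' <= z'' & pieces g e z z' & pieces g e z' z'' : pieces g e z z''.

(** Two unit-speed rays from a common point that cover the graph and meet only at equal parameters.
    Such a graph is determined, up to isometry, by the set of meeting parameters. *)
Definition two_rays G (g : bool -> R -> raw G) : Prop :=
  [/\ forall b s, 0 <= s -> points (g b s),
      forall q, points q -> exists b s, 0 <= s /\ g b s = q,
      forall b b' s s', 0 <= s -> 0 <= s' -> g b s = g b' s' -> s = s',
      forall b s s', 0 <= s -> s <= s' -> exists2 c, chain (g b s) c (g b s') & chain_length c = s' - s &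
      g false 0 = g true 0 /\
      forall e z z', closed_edge e z -> closed_edge e z' -> z <= z' -> pieces g e z z'].

Definition crossings G (g : bool -> R -> raw G) : set R := [set s | 0 <= s /\ g false s = g true s].

(** A route of length at most [L] from parameter [s] on ray [b] to [s'] on ray [b'], which either
    stays on one ray or changes at one crossing [t]. *)
Definition near (X : set R) L b s b' s' :=
  (b = b' /\ `|s - s'| <= L) \/ exists2 t, X t & `|s - t| + `|t - s'| <= L.

(** Two changes of ray reduce to one: the last ray can be joined at the first crossing already, and
    the triangle inequality for the parameters does the rest. *)
Lemma near_trans X L L' b s b' s' b'' s'' :
  near X L b s b' s' -> near X L' b' s' b'' s'' -> near X (L + L') b s b'' s''.
Proof.
have tri (a c d : R) : `|a - d| <= `|a - c| + `|c - d| by exact: ler_distD.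
move=> [[<- h1]|[t Xt h1]] [[<- h2]|[t' Xt' h2]].
- by left; split => //; apply: le_trans (tri _ s' _) _; exact: lerD.
- right; exists t' => //; apply: (@le_trans _ _ (`|s - s'| + (`|s' - t'| + `|t' - s''|))).
    by rewrite addrA lerD2r.
  exact: lerD.
- right; exists t => //; apply: (@le_trans _ _ ((`|s - t| + `|t - s'|) + `|s' - s''|)).
    by rewrite -addrA lerD2l.
  exact: lerD.
- right; exists t => //; have h3 := tri t s' s''; have h4 := tri s' t' s''; lra.
Qed.

Section Metric.
Context (G : metric_graph R) (g : bool -> R -> raw G).
Hypothesis hg : two_rays g.
Local Notation X := (crossings g).

Lemma rays_eq_near L b s b' s' : 0 <= s -> 0 <= s' -> 0 <= L -> g b s = g b' s' -> near X L b s b' s'.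
Proof.
move=> s0 s'0 L0 E; have [_ _ h _ _] := hg; have ss' := h _ _ _ _ s0 s'0 E; rewrite -ss' in E *.
have [->|bb'] := eqVneq b b'; first by left; rewrite subrr normr0.
right; exists s; last by rewrite subrr normr0 addr0.
by split => //; case: b b' bb' E => [] [].
Qed.

Lemma pieces_start e z z' : pieces g e z z' -> exists b s, 0 <= s /\ g b s = edge_pt e z.
Proof. by elim=> [b1 y y' [t [t' [t0 _ E _ _]]]|//]; exists b1, t. Qed.

Lemma piece_near e z z' : pieces g e z z' -> forall b s b' s', 0 <= s -> 0 <= s' ->
  g b s = edge_pt e z -> g b' s' = edge_pt e z' -> near X `|z - z'| b s b' s'.
Proof.
have single b1 z1 z1' : on_ray (g b1) e z1 z1' -> forall b s b' s', 0 <= s -> 0 <= s' ->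
  g b s = edge_pt e z1 -> g b' s' = edge_pt e z1' -> near X `|z1 - z1'| b s b' s'.
  move=> [t [t' [t0 t'0 E E' D]]] b s b' s' s0 s'0 Es Es'.
  have n1 : near X 0 b s b1 t by apply: rays_eq_near => //; rewrite Es E.
  have n2 : near X 0 b1 t' b' s' by apply: rays_eq_near => //; rewrite Es' E'.
  have n3 : near X `|z1 - z1'| b1 t b1 t' by left; rewrite D.
  by have := near_trans (near_trans n1 n3) n2; rewrite add0r addr0.
elim=> [b1 y y' h|y y' y'' yy' y'y'' h1 IH1 h2 IH2]; first exact: single h.
move=> b s b' s' s0 s'0 Es Es'; have [b1 [t [t0 Et]]] := pieces_start h2.
have := near_trans (IH1 _ _ _ _ s0 t0 Es Et) (IH2 _ _ _ _ t0 s'0 Et Es').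
rewrite !ler0_norm ?subr_le0//; last exact: le_trans y'y''.
by congr near; ring.
Qed.

Lemma near_sym L b s b' s' : near X L b s b' s' -> near X L b' s' b s.
Proof.
move=> [[-> h]|[t Xt h]]; [left|right]; first by rewrite distrC.
by exists t => //; rewrite addrC [X in X + _]distrC [X in _ + X]distrC.
Qed.

Lemma chain_near q c q' b s b' s' : chain q c q' -> 0 <= s -> 0 <= s' -> g b s = q -> g b' s' = q' ->
  near X (chain_length c) b s b' s'.
Proof.
elim: c q b s => [|[[e z] z'] c IH] q b s /=.
  move=> -> s0 s'0 E E'; rewrite /chain_length big_nil; apply: rays_eq_near => //.
  by rewrite E E'.
move=> [ez ez' Eq hc] s0 s'0 E E'.
have [_ _ _ _ [_ hp]] := hg.
have zz : pieces g e z' z' by exact: hp.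
have [b1 [t [t0 Et]]] : exists b1 t, 0 <= t /\ g b1 t = edge_pt e z'.
  exact: pieces_start zz.
rewrite /chain_length big_cons/=; apply: near_trans (IH _ b1 t hc t0 s'0 Et E').
have [h|/ltW h] := leP z z'.
  by apply: (piece_near (hp _ _ _ ez ez' h)) => //; rewrite E.
by rewrite distrC; apply: near_sym; apply: (piece_near (hp _ _ _ ez' ez h)) => //; rewrite E.
Qed.

Lemma near_chain L b s b' s' : 0 <= s -> 0 <= s' -> near X L b s b' s' ->
  exists2 c, chain (g b s) c (g b' s') & chain_length c <= L.
Proof.
move=> s0 s'0; have [_ _ _ hc _] := hg.
have same b1 t t' : 0 <= t -> 0 <= t' -> exists2 c, chain (g b1 t) c (g b1 t') & chain_length c = `|t - t'|.
  move=> t0 t'0; have [tt'|/ltW tt'] := leP t t'.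
    by have [c h1 h2] := hc b1 t t' t0 tt'; exists c => //; rewrite h2 ler0_norm ?subr_le0// opprB.
  have [c /chain_sym[c' h1 h2] h3] := hc b1 t' t t'0 tt'; exists c' => //.
  by rewrite h2 h3 ger0_norm ?subr_ge0.
move=> [[<- h]|[t [t0 Xt] h]].
  by have [c h1 h2] := same b s s' s0 s'0; exists c => //; rewrite h2.
have [c h1 h2] := same b s t s0 t0; have [c' h1' h2'] := same b' t s' t0 s'0.
exists (c ++ c'); last by rewrite chain_length_cat h2 h2'.
apply: chain_cat h1 _; suff -> : g b t = g b' t by [].
by case: b b' {h1'} => [] [].
Qed.

Lemma gdist_near (q q' : pt G) b s b' s' : 0 <= s -> 0 <= s' -> g b s = val q -> g b' s' = val q' ->
  gdist q q' = inf [set L | near X L b s b' s'].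
Proof.
move=> s0 s'0 E E'; rewrite /gdist; set A := [set chain_length c | c in _].
set N := [set L | _].
have AN : A `<=` N by move=> _ [c hc <-]; exact: chain_near hc s0 s'0 E E'.
have NA L : N L -> exists2 a, A a & a <= L.
  move=> /(near_chain s0 s'0)[c hc cL]; exists (chain_length c) => //.
  by exists c => //=; rewrite -E -E'.
have N0 : lbound N 0.
  move=> L [[_ h]|[t _ h]]; first exact: le_trans (normr_ge0 _) h.
  by apply: le_trans h; rewrite addr_ge0.
have [_ _ _ _ [X0 _]] := hg.
have Nn : N !=set0.
  by exists (`|s - 0| + `|0 - s'|); right; exists 0.
have An : A !=set0 by have [L /NA[a Aa _]] := Nn; exists a.
apply/eqP; rewrite eq_le; apply/andP; split.
  apply: lb_le_inf => // L /NA[a Aa aL]; apply: le_trans aL.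
  by apply: ge_inf => //; exists 0 => x /AN; exact: N0.
by apply: lb_le_inf => // a /AN Na; apply: ge_inf => //; exists 0.
Qed.

End Metric.

(* The distance between two points of the rays only depends on the crossings. *)
Lemma isometric_two_rays G G' (g : bool -> R -> raw G) (g' : bool -> R -> raw G') :
  two_rays g -> two_rays g' -> crossings g = crossings g' ->
  isometric (@gdist R G) (@gdist R G').
Proof.
have rep (H : metric_graph R) (k : bool -> R -> raw H) : two_rays k -> exists r : pt H -> bool * R,
    forall q, 0 <= (r q).2 /\ k (r q).1 (r q).2 = val q.
  move=> [_ h _ _ _]; suff /choice[r hr] : forall q : pt H, exists bs : bool * R, 0 <= bs.2 /\ k bs.1 bs.2 = val q.
    by exists r.
  by move=> q; have [b [s hbs]] := h (val q) (set_mem (valP q)); exists (b, s).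
have to (H H' : metric_graph R) (k : bool -> R -> raw H) (k' : bool -> R -> raw H') (r : pt H -> bool * R) :
    two_rays k' -> (forall q, 0 <= (r q).2 /\ k (r q).1 (r q).2 = val q) ->
    exists f : pt H -> pt H', forall q, val (f q) = k' (r q).1 (r q).2.
  move=> [h _ _ _ _] hr; suff /choice[f hf] : forall q : pt H, exists q' : pt H', val q' = k' (r q).1 (r q).2.
    by exists f.
  by move=> q; exists (exist _ (k' (r q).1 (r q).2) (mem_set (h (r q).1 (r q).2 (hr q).1)) : pt H').
have inv (H H' : metric_graph R) (k : bool -> R -> raw H) (k' : bool -> R -> raw H') (r : pt H -> bool * R) (r' : pt H' -> bool * R) f f' :
    two_rays k -> two_rays k' -> crossings k = crossings k' ->
    (forall q, 0 <= (r q).2 /\ k (r q).1 (r q).2 = val q) ->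
    (forall q, 0 <= (r' q).2 /\ k' (r' q).1 (r' q).2 = val q) ->
    (forall q, val (f q) = k' (r q).1 (r q).2) -> (forall q, val (f' q) = k (r' q).1 (r' q).2) ->
    cancel f f'.
  move=> hk hk' X hr hr' hf hf' q; apply: val_inj; rewrite hf'.
  have [s0 Eq] := hr q; have [s'0 Eq'] := hr' (f q); rewrite hf in Eq'.
  have [_ _ h _ _] := hk'; have ss := h _ _ _ _ s'0 s0 Eq'; rewrite ss in Eq' *; rewrite -Eq.
  case: (eqVneq (r' (f q)).1 (r q).1) => [->//|bb].
  have : crossings k' (r q).2.
    by split => //; case: (r' (f q)).1 (r q).1 bb Eq' => [] [].
  rewrite -X => -[_ E].
  by case: (r' (f q)).1 (r q).1 {Eq Eq' bb} => [] [].
move=> hg hg' X.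
have [r hr] := rep _ _ hg; have [r' hr'] := rep _ _ hg'.
have [f hf] := to _ _ _ _ _ hg' hr; have [f' hf'] := to _ _ _ _ _ hg hr'.
exists f; split.
  exists f'; first exact: (inv _ _ _ _ _ _ _ _ hg hg' X hr hr' hf hf').
  exact: (inv _ _ _ _ _ _ _ _ hg' hg (esym X) hr' hr hf' hf).
move=> q q'; have [s0 E] := hr q; have [s'0 E'] := hr q'.
rewrite (gdist_near hg s0 s'0 E E') (gdist_near hg' s0 s'0 (esym (hf q)) (esym (hf q'))).
by rewrite X.
Qed.

End TwoRays.

Section MoreRays.
Context {R : realType} (G : metric_graph R).
Hypothesis hG : classG G.
Implicit Types (e : edge G) (b : bool) (q : raw G) (c : seq (edge G * R * R)) (x y z : R).

Lemma rays_two_rays q (c : bool -> seq (edge G * R * R)) (d : bool -> edge G) (x : bool -> R) f :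
  (forall b, is_ray q (c b) (d b) (x b)) -> (forall b, depth_along f 0 (c b) (d b) (x b)) ->
  (forall e' z z', closed_edge e' z -> closed_edge e' z' -> z <= z' ->
    pieces (fun b => ray (c b) (d b) (x b)) e' z z') ->
  two_rays (fun b => ray (c b) (d b) (x b)).
Proof.
move=> hr hd hp; split.
- move=> b s s0; have [e' [z [ez ->]]] := ray_closed (hr b) s0; exact: edge_pt_point.
- move=> r hr'; have [e' [z [ez Er]]] := pt_on_edge hG (d false) (exist _ r (mem_set hr') : pt G).
  have [b [s [s0 Es]]] := pieces_start (hp _ _ _ ez ez (lexx z)).
  by exists b, s; split => //; rewrite Es Er.
- move=> b b' s s' s0 s'0 E.
  by have := ray_depth (hd b) s0; rewrite E (ray_depth (hd b') s'0) !add0r.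
- by move=> b s s' s0 ss'; exact: ray_chain (hr b) s0 ss'.
- by split => //; rewrite !(ray0 (hr _)).
Qed.

Lemma on_ray_cons q e' y y' c e x e1 z z' : is_ray q ((e', y, y') :: c) e x ->
  on_ray (ray c e x) e1 z z' -> on_ray (ray ((e', y, y') :: c) e x) e1 z z'.
Proof.
move=> hr [s [s' [s0 s'0 E E' D]]].
exists (`|y - y'| + s), (`|y - y'| + s'); split.
- by rewrite addr_ge0.
- by rewrite addr_ge0.
- by rewrite (ray_cons hr).
- by rewrite (ray_cons hr).
- by rewrite -D; congr (`|_|); ring.
Qed.

Lemma covered_le (H : Type) (on : H -> edge G) lo hi e (z z' : R) : covered on lo hi e z z' -> z <= z'.
Proof. by elim=> // z1 z2 z3 _ h _; exact: le_trans. Qed.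

Lemma covered_pieces (H : Type) (on : H -> edge G) lo hi (g : bool -> R -> raw G) e (z z' : R) :
  (forall h y y', lo h <= y -> y <= y' -> (y'%:E <= hi h)%E -> exists b, on_ray (g b) (on h) y y') ->
  covered on lo hi e z z' -> pieces g e z z'.
Proof.
move=> hg; elim=> [h y y' <- ly yy yh|y1 y2 y3 c1 h1 c2 h2].
  by have [b hb] := hg h y y' ly yy yh; exact: piece_one hb.
by apply: piece_cat h1 h2; exact: covered_le c1 + exact: covered_le c2.
Qed.

End MoreRays.

(** * Networks in which the two-path bound is attained *)

Section TightNetworks.
Context {R : realType} (G : metric_graph R).
Implicit Types (B : set (vertex G)) (P : vertex G -> R) (W : edge G -> R).

Lemma walk_telescope P x p y : walk x p y -> \sum_(a <- p) (P (src a) - P (dst a)) = P x - P y.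
Proof.
elim: p x => [|a p IH] x /=; first by move=> /eqP ->; rewrite subrr big_nil.
by move=> /andP[/eqP <- /IH h]; rewrite big_cons h; ring.
Qed.

(** The drops of [P] along the two walks already add up to [T]. Hence no arc has slack, and an edge
    of positive capacity outside the walks would make the total exceed [T]. *)
Lemma network_tight B P W T x : network B P W T -> B !=set0 ->
  (forall v w, reach [set: edge G] v w) -> (forall e, ~ dead B e x) -> T <= 2 * P x ->
  exists p q y z, [/\ [/\ walk x p y, walk x q z, B y & B z], uniq (map fst (p ++ q)),
    forall a, a \in p ++ q -> P (src a) - P (dst a) = W a.1 &
    forall e, 0 < W e -> e \in map fst (p ++ q)].
Proof.
move=> [PW PB WT] [b0 Bb0] conn ndead Tx.
have [||p [q [y [z [wp wq By Bz upq]]]]] := @menger _ G x B.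
- by exists b0.
- move=> e; apply: contrapT => h; apply: (ndead e) => b Bb rb; apply: h.
  by exists b.
have tele : \sum_(a <- p ++ q) (P (src a) - P (dst a)) = 2 * P x.
  by rewrite big_cat/= (walk_telescope P wp) (walk_telescope P wq) (PB _ By) (PB _ Bz); ring.
have slack a : 0 <= W a.1 - (P (src a) - P (dst a)).
  rewrite subr_ge0; apply: le_trans (PW a.1); apply: le_trans (ler_norm _) _.
  by case: a => e []; rewrite /src /dst/= // distrC.
have WT' := WT _ upq; rewrite big_map in WT'.
have sum0 : \sum_(a <- p ++ q) (W a.1 - (P (src a) - P (dst a))) = 0.
  apply/eqP; rewrite eq_le sumr_ge0 ?andbT// sumrB tele.
  by rewrite subr_le0; exact: le_trans Tx.
exists p, q, y, z; split => //.
- move=> a apq; apply/eqP; rewrite eq_sym -subr_eq0; apply/eqP.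
  have := sum0; move=> /eqP; rewrite psumr_eq0 => [/allP/(_ _ apq)/eqP //|a' _].
  exact: slack.
- move=> e We; apply/negPn/negP => epq.
  have := WT (e :: map fst (p ++ q)); rewrite /= epq => /(_ upq).
  rewrite big_cons big_map.
  move: sum0; rewrite sumrB tele => sum0; lra.
Qed.

End TightNetworks.

Section Reflection.
Context {R : realType}.
Local Notation mu := (@lebesgue_measure R).

Lemma prim_reflect (a b : R) (f g : R -> R) : {within `[a, b], continuous g} ->
  prim `[a, b] f g -> prim `[- b, - a] (fun x => f (- x)) (fun x => - g (- x)).
Proof.
move=> cg pf y y' yy' /=; rewrite !in_itv/= => /andP[y1 y2] /andP[y'1 y'2].
have sub : `[- y', - y]%classic `<=` `[a, b]%classic.
  by move=> z; rewrite /= !in_itv/= => /andP[z1 z2]; apply/andP; split; lra.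
have cg' : {within `[- y', - y], continuous g} by exact: continuous_subspaceW cg.
have co : {within `[y, y'], continuous (fun x => g (- x))}.
  apply/withinP => x xy e e0; move/withinP : cg' => /(_ (- x)).
  have m (t : R) : `[y, y']%classic t -> `[- y', - y]%classic (- t).
    by rewrite /= !in_itv/= !lerN2 => /andP[-> ->].
  move=> /(_ (m _ xy) e e0)[d d0 hd]; exists d => // t /m mt tx; apply: hd => //.
  by rewrite -opprD normrN.
have i1 : mu.-integrable `[y, y'] (EFin \o (fun x => g (- x))).
  by apply: continuous_compact_integrable => //; exact: segment_compact.
split.
  apply: continuous_compact_integrable; first exact: segment_compact.
  by move=> x; apply: cvgN; exact: co.
have m1 : `[a, b]%classic (- y') by rewrite /= in_itv/=; apply/andP; split; lra.
have m2 : `[a, b]%classic (- y) by rewrite /= in_itv/=; apply/andP; split; lra.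
have yy'N : - y' <= - y by rewrite lerN2.
have [_ E] := pf (- y') (- y) yy'N m1 m2.
have -> : (fun x => - g (- x)) = (fun x => (-1) * g (- x)) by apply/funext => x; rewrite mulN1r.
rewrite RintegralZl//.
by rewrite mulN1r -[LHS]opprB E /Rintegral integration_by_substitution_oppr.
Qed.

End Reflection.

(** * The equality case *)

Section Tight.
Context {R : realType}.
Local Notation mu := (@lebesgue_measure R).
Implicit Types (I : set R) (w g W f k d : R -> R) (a b x : R).

(** The bound of the density by [well] holds almost everywhere only, while [prim_virial] needs it at
    every point; clamping changes the density on a null set. *)
Definition clamp g W x := Num.max (Num.min (g x) (W x)) (- W x).

Lemma clamp_le g W x : 0 <= W x -> `|clamp g W x| <= W x.
Proof.
move=> W0; rewrite /clamp ler_norml le_max lexx orbT/= ge_max ge_min lexx orbT/=.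
by apply: (@le_trans _ _ 0); rewrite ?oppr_le0.
Qed.

Lemma clamp_norm g W x : 0 <= W x -> `|clamp g W x| <= `|g x|.
Proof.
move=> W0; rewrite /clamp; have [h|h] := leP (g x) (W x).
  have [h'|h'] := leP (g x) (- W x); last by [].
  by rewrite normrN (ger0_norm W0) ler0_norm; lra.
by rewrite max_l ?(ger0_norm W0) ?ger0_norm; lra.
Qed.

Lemma clamp_id g W x : `|g x| <= W x -> clamp g W x = g x.
Proof.
rewrite ler_norml /clamp => /andP[h1 h2]; rewrite min_l//.
by rewrite max_l// lerNl; lra.
Qed.

Lemma prim_clamp I w g W : is_interval I -> prim I w g ->
  (forall x, 0 <= W x) -> (forall a b, I a -> I b -> measurable_fun `[a, b] W) ->
  (forall a b, I a -> I b -> {ae mu, forall x, a < x < b -> `|g x| <= W x}) ->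
  prim I w (clamp g W).
Proof.
move=> iI pw W0 mW gW a b ab Ia Ib; have [ig E] := pw _ _ ab Ia Ib.
have mg : measurable_fun (`[a, b] : set R) g by apply/measurable_EFinP; exact: measurable_int ig.
have mWab := mW _ _ Ia Ib.
have mc : measurable_fun (`[a, b] : set R) (clamp g W).
  apply: measurable_maxr; first exact: measurable_minr.
  exact: measurableT_comp.
have ic : mu.-integrable `[a, b] (EFin \o clamp g W).
  apply: le_integrable ig => //; first exact/measurable_EFinP.
  by move=> x _ /=; rewrite lee_fin; exact: clamp_norm.
split => //; rewrite E.
have i1 : mu.-integrable `[a, b] (EFin \o (fun x => g x - clamp g W x)) by have := integrableB _ ig ic; apply.
have i2 : mu.-integrable `[a, b] (EFin \o (fun x => clamp g W x - g x)) by have := integrableB _ ic ig; apply.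
apply/eqP; rewrite eq_le -[X in X && _]subr_le0 -[X in _ && X]subr_le0 -!RintegralB//.
have ae := gW _ _ Ia Ib.
apply/andP; split; apply: Rintegral_le0_ae => //; apply: filterS ae; try exact: (ae_filter_ringOfSetsType mu).
  by move=> x h xab; rewrite clamp_id ?subrr//; exact: h.
by move=> x h xab; rewrite clamp_id ?subrr//; exact: h.
Qed.

Lemma prim_Rintegral a b f : a <= b -> {within `[a, b], continuous f} ->
  prim `[a, b] (fun x => \int[mu]_(y in `[a, x]) f y) f.
Proof.
move=> ab cf y y' yy'; rewrite /= !in_itv/= => /andP[y1 y2] /andP[y'1 y'2].
have i1 : mu.-integrable `[a, b] (EFin \o f).
  by apply: continuous_compact_integrable => //; exact: segment_compact.
split; first exact: integrable_sub_itv i1.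
rewrite (@Rintegral_cat _ a y y') //; first by ring.
exact: integrable_sub_itv i1.
Qed.

(** The sum of [f] and of the integral [D] of [d] is nondecreasing and takes the same value at both
    ends, so it is constant. *)
Lemma prim_tight a b f k d : a <= b -> prim `[a, b] f k -> {within `[a, b], continuous d} ->
  (forall x, a <= x <= b -> `|k x| <= d x) -> f a - f b = \int[mu]_(x in `[a, b]) d x ->
  prim `[a, b] f (fun x => - d x).
Proof.
move=> ab pf cd kd fab.
pose D x := \int[mu]_(y in `[a, x]) d y.
have pD : prim `[a, b] D d by exact: prim_Rintegral.
have p0 := primD pf pD.
have ma : `[a, b]%classic a by rewrite /= in_itv/= lexx.
have mb : `[a, b]%classic b by rewrite /= in_itv/= lexx ab.
have mono x y : a <= x -> x <= y -> y <= b -> f x + D x <= f y + D y.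
  move=> ax xy yb.
  have mx : `[a, b]%classic x by rewrite /= in_itv/= ax (le_trans xy).
  have my : `[a, b]%classic y by rewrite /= in_itv/= yb (le_trans ax).
  have := prim_nonincreasing (primN p0) xy mx my; rewrite lerN2; apply => z /andP[xz zy].
  have := kd z; rewrite (le_trans ax (ltW xz)) (le_trans (ltW zy) yb) => /(_ isT).
  by rewrite ler_norml oppr_le0 => /andP[h _]; rewrite -lerBlDr sub0r.
have [_ Da] := pD _ _ ab ma mb.
have cst_ x : a <= x <= b -> f x = (f a + D a) - D x.
  move=> /andP[ax xb]; have h1 := mono a x (lexx a) ax xb; have h2 := mono x b ax xb (lexx b).
  have : f b + D b = f a + D a by move: Da; rewrite -fab; lra.
  move=> h3; rewrite h3 in h2.
  by apply/eqP; rewrite -subr_eq0; apply/eqP; lra.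
have iab : is_interval `[a, b] by exact: interval_is_interval.
apply: prim_eq (primB (@prim_cst _ _ (f a + D a)) pD) => //.
  by move=> x; rewrite inE /= in_itv/= => xab; rewrite [RHS]cst_.
by move=> x _; rewrite /= sub0r.
Qed.

Section Descent.
Variables (p lambda : R).
Hypotheses (hp : 2 < p) (hlambda : 0 < lambda).
Local Notation peak := (peak p lambda).
Local Notation virial := (virial p lambda).
Local Notation soliton := (soliton p lambda).

(** The energy density on the Nehari manifold, where the energy reduces to (1/2 - 1/p) times the
    p-th power norm; also the greatest rate at which [virial] can vary. *)
Definition dissipation w x := (2^-1 - p^-1) * `|w x| `^ p.

Lemma continuous_dissipation I w : {within I, continuous w} -> {within I, continuous (dissipation w)}.
Proof.
move=> cw x; apply: cvgM; first exact: cvg_cst.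
by apply: (cvg_comp w (fun y => `|y| `^ p) (cw x)); exact: continuous_normr_powR.
Qed.

Lemma dissipation_gt0 w x : w x != 0 -> 0 < dissipation w x.
Proof.
move=> wx; rewrite /dissipation mulr_gt0//; last by rewrite powR_gt0 ?normr_gt0.
by rewrite subr_gt0 ltf_pV2 ?posrE// (lt_trans _ hp).
Qed.

Lemma descent w k a b S : a <= b -> {within `[a, b], continuous w} ->
  (forall x, a <= x <= b -> 0 < w x <= peak) -> prim `[a, b] (virial \o w) k ->
  (forall x, a <= x <= b -> `|k x| <= dissipation w x) -> 0 <= S ->
  virial (w a) - virial (w b) = \int[mu]_(x in `[a, b]) dissipation w x -> w a = soliton 0 S ->
  forall x, a <= x <= b -> w x = soliton 0 (S + (x - a)).
Proof.
move=> ab cw wp pw kr S0 E wa.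
have iab : is_interval `[a, b] by exact: interval_is_interval.
apply: (flow_unique hp hlambda S0 wp) => //.
apply: prim_eq (prim_tight ab pw (continuous_dissipation cw) kr E) => // x.
rewrite inE /= in_itv/= => /wp/andP[w0 _]; by rewrite /dissipation gtr0_norm.
Qed.

Lemma ascent w k a b S : a <= b -> {within `[a, b], continuous w} ->
  (forall x, a <= x <= b -> 0 < w x <= peak) -> prim `[a, b] (virial \o w) k ->
  (forall x, a <= x <= b -> `|k x| <= dissipation w x) -> 0 <= S ->
  virial (w b) - virial (w a) = \int[mu]_(x in `[a, b]) dissipation w x -> w b = soliton 0 S ->
  forall x, a <= x <= b -> w x = soliton 0 (S + (b - x)).
Proof.
move=> ab cw wp pw kr S0 E wb x /andP[ax xb].
have cr := continuous_dissipation cw.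
have pt : prim `[a, b] (fun x => - (virial \o w) x) (fun x => - dissipation w x).
  apply: (prim_tight ab (primN pw) cr) => [y yab|]; first by rewrite normrN; exact: kr.
  by rewrite opprK addrC.
have crN : {within `[a, b], continuous (fun x => - dissipation w x)}.
  by move=> y; apply: cvgN; exact: cr.
have pr := primN (prim_reflect crN pt).
have wp' y : - b <= y <= - a -> 0 < w (- y) <= peak.
  by move=> /andP[y1 y2]; apply: wp; apply/andP; split; lra.
have iab : is_interval `[- b, - a] by exact: interval_is_interval.
have pf : prim `[- b, - a] (virial \o (fun y => w (- y))) (fun y => - ((2^-1 - p^-1) * w (- y) `^ p)).
  apply: prim_eq pr => // y; rewrite inE /= in_itv/= => yab; first by rewrite opprK.
  by have /andP[w0 _] := wp' _ yab; rewrite opprK /dissipation gtr0_norm.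
have := @flow_unique R p lambda hp hlambda (fun y => w (- y)) S (- b) (- a) S0 wp' pf.
rewrite opprK => /(_ wb (- x)); rewrite !opprK lerN2 lerN2 ax xb => /(_ isT) ->.
exact: (congr1 (fun t => soliton 0 (S + t)) (addrC (- x) b)).
Qed.

End Descent.
End Tight.

Section Equality.
Context {R : realType} (G : metric_graph R).
Local Notation mu := (@lebesgue_measure R).
Variables (p lambda : R) (Z : set (vertex G)) (e0 : edge G).
Hypotheses (hG : classG G) (hp : 2 < p) (hlambda : 0 < lambda) (he0 : half_line e0).
Variable u : pt G -> R.
Implicit Types (e : edge G) (x a b S : R).

Local Notation B := (@Vinf R G `|` Z).
Local Notation c := (soliton_energy p lambda).
Local Notation peak := (peak p lambda).
Local Notation well := (well p lambda).
Local Notation virial := (virial p lambda).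
Local Notation soliton := (soliton p lambda).

Hypothesis hu : nehari p lambda Z u.
Hypothesis hJ : (J p lambda u <= c%:E)%E.
Hypothesis hae : forall e, {ae mu, forall x, open_edge e x -> `|edge_deriv u e x| = well (on_edge u e x)}.
Hypothesis hpk : forall e x, closed_edge e x -> `|on_edge u e x| <= peak.
Hypothesis hmax : exists e1 x1, closed_edge e1 x1 /\ `|on_edge u e1 x1| = peak.

Let Hu : H1 u. Proof. by have [[]] := hu. Qed.
Let pk : 0 < peak. Proof. exact: peak_gt0. Qed.

Lemma extremal_nonzero e x : closed_edge e x -> on_edge u e x != 0.
Proof.
move=> ex; apply/eqP => u0.
have [e1 [x1 [ex1 u1]]] := hmax.
have z : exists e x, closed_edge e x /\ on_edge u e x = 0 by exists e, x.
by move: pk; rewrite -u1 (H1_vanish hG hp hlambda Hu hae z ex1) normr0 ltxx.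
Qed.

Definition amplitude e x : R := `|on_edge u e x|.
Definition action (q : raw G) : R := virial `|eval u q|.
Definition slope e : R -> R := clamp (dabs (on_edge u e) (edge_deriv u e)) (fun x => well (amplitude e x)).
Definition drift e x : R := (2^-1 - p^-1) * amplitude e x `^ p / well (amplitude e x) * slope e x.

Local Notation w := amplitude.
Local Notation V := action.
Local Notation d := (fun e => dissipation p (on_edge u e)).
Local Notation dw := slope.
Local Notation k := drift.

Let w_range e x : closed_edge e x -> 0 < w e x <= peak.
Proof. by move=> ex; rewrite /w normr_gt0 extremal_nonzero// hpk. Qed.

Let prim_w e : prim (closed_edge e) (w e) (dabs (on_edge u e) (edge_deriv u e)).
Proof. apply: prim_abs; [exact: closed_edge_interval|exact: H1_prim]. Qed.

Let cw e : {within closed_edge e, continuous (w e)}.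
Proof. exact: prim_within (closed_edge_interval hG (e := e)) (@prim_w e). Qed.

Let sub_closed e a b : closed_edge e a -> closed_edge e b -> `[a, b]%classic `<=` closed_edge e.
Proof. by move=> ea eb x; rewrite /= in_itv/=; exact: closed_edge_interval. Qed.

Let prim_dw e : prim (closed_edge e) (w e) (dw e).
Proof.
apply: (prim_clamp (closed_edge_interval hG (e := e)) (@prim_w e)).
- by move=> x; exact: well_ge0.
- move=> a b ea eb; apply: (measurableT_comp (f := well)).
    by apply: continuous_measurable_fun; exact: continuous_well.
  apply: subspace_continuous_measurable_fun; first exact: measurable_itv.
  exact: continuous_subspaceW (sub_closed ea eb) (@cw e).
- move=> a b ea eb; have h := hae e; apply: filterS h; first exact: (ae_filter_ringOfSetsType mu).
  move=> x h xab; have ex : open_edge e x by exact: between_closed_edge ea eb xab.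
  have -> : well (w e x) = `|edge_deriv u e x|.
    by rewrite h// /w; case: (ger0P (on_edge u e x)) => _ //; rewrite wellN.
  rewrite /dabs; case: (ltP 0 (on_edge u e x)) => s.
    by rewrite oppr_gt0 ltNge (ltW s)/= mul0r addr0 mul1r.
  by rewrite mul0r add0r; case: (0 < _); rewrite ?mul1r ?normrN// mul0r normr0.
Qed.

Let prim_V e : prim (closed_edge e) (fun x => V (edge_pt e x)) (k e).
Proof.
apply: (prim_virial hp hlambda (closed_edge_interval hG (e := e)) (@prim_dw e)); first exact: w_range.
by move=> x ex; apply: clamp_le; exact: well_ge0.
Qed.

Let k_le e x : `|k e x| <= dissipation p (on_edge u e) x.
Proof.
have g0 := well_ge0 p lambda (w e x); have wp0 := powR_ge0 (w e x) p.
have gl : `|dw e x| <= well (w e x) by exact: clamp_le.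
have kp : 0 <= 2^-1 - p^-1 by rewrite subr_ge0 lef_pV2 ?posrE ?ltW// (lt_trans _ hp).
rewrite /dissipation -/(w e x) /k normrM normrM (ger0_norm (mulr_ge0 kp wp0)) normfV (ger0_norm g0) -mulrA.
rewrite ler_piMr ?mulr_ge0//.
have [->|n0] := eqVneq (well (w e x)) 0; first by rewrite invr0 mul0r.
by rewrite mulrC ler_pdivrMr ?mul1r// lt_neqAle eq_sym n0.
Qed.

Let mu_ e : measurable_fun (open_edge e) (on_edge u e).
Proof. by apply: (on_edge_measurable hG); exact: H1_prim. Qed.

Let md e : measurable_fun (open_edge e) (dissipation p (on_edge u e)).
Proof.
apply: measurable_funM => //; apply/measurable_EFinP; exact: measurable_normpow.
Qed.

Let mk e : measurable_fun (open_edge e) (k e).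
Proof.
have mw : measurable_fun (open_edge e) (w e) by exact: measurableT_comp.
have mwell : measurable_fun (open_edge e) (fun x => well (w e x)).
  apply: (measurableT_comp (f := well)) => //.
  by apply: continuous_measurable_fun; exact: continuous_well.
apply: measurable_funM.
  apply: measurable_funM; first exact: md.
  rewrite (_ : (fun x => (well (w e x))^-1) = (fun x => well (w e x) `^ (-1))).
    exact: (measurableT_comp (@measurable_powR R (-1))).
  by apply/funext => x; rewrite powR_inv1// well_ge0.
apply: measurable_maxr; last exact: measurableT_comp.
apply: measurable_minr => //.
have mg : measurable_fun (open_edge e) (edge_deriv u e) by apply: measurable_funTS; exact: edge_deriv_measurable.
apply: measurable_funD; apply: measurable_indic_gt0 => //.
- exact: open_edge_measurable.
- exact: open_edge_measurable.
- exact: measurableT_comp.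
- exact: measurableT_comp.
Qed.

Let d_ge0 e x : 0 <= dissipation p (on_edge u e) x. Proof. exact: le_trans (normr_ge0 _) (k_le e x). Qed.

Let total_d : (total d <= c%:E)%E.
Proof.
have [A [C1 [C [EA EB EC ABC [A0 B0 C0]]]]] := nehari_real e0 hG hp hlambda hu.
have kp : 0 < 2^-1 - p^-1 by rewrite subr_gt0 ltf_pV2 ?posrE// (lt_trans _ hp).
apply: le_trans hJ; rewrite (nehari_energy e0 hG hp hlambda hu EC).
rewrite EFinM -EC -esumZl//; last first.
  by move=> e; apply: integral_ge0 => x _; rewrite lee_fin powR_ge0.
apply: le_esum => e _.
have g0 x : open_edge e x -> (0 <= (`|on_edge u e x| `^ p)%:E)%E by rewrite lee_fin powR_ge0.
by rewrite -(ge0_integralZl_EFin mu (open_edge_measurable hG e) g0 (measurable_normpow p (@mu_ e)) (ltW kp)).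
Qed.

Let VB (q : raw G) : eval u q = 0 -> V q = 0.
Proof. by move=> q0; rewrite /V q0 normr0 virial0. Qed.

Lemma extremal_bv_potential : bv_potential B V k c.
Proof.
split.
- exact: prim_V.
- exact: mk.
- move=> e eta he eta0.
  have c0 : {for 0, continuous virial} by apply: continuous_virial => //; have := pk; lra.
  move/cvgrPdist_lt: c0 => /(_ _ eta0)[t /= t0 ht].
  have t20 : 0 < t / 2 by rewrite divr_gt0.
  have [a a0 ha] := H1_decay hG Hu he t20; exists a => // x /ha hx; apply: ltW.
  have := ht (w e x); rewrite /= virial0 !sub0r !normrN; apply.
  rewrite normr_id; apply: le_lt_trans hx _.
  by rewrite ltr_pdivrMr// ltr_pMr// ltr1n.
- move=> b [bi|bZ]; apply: VB; first exact: eval_Vinf.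
  by have [[_ /(_ b bZ)]] := hu.
- apply: le_trans total_d; apply: le_esum => e _; apply: ge0_le_integral => //.
  + exact: open_edge_measurable.
  + by apply/measurable_EFinP; apply: measurableT_comp => //; exact: mk.
  + by apply/measurable_EFinP; exact: md.
  + by move=> x _; rewrite lee_fin.
Qed.

Let closed_lo (r : refinement B) (h : edge r) : closed_edge (on h) (lo h).
Proof. by split; [exact: lo_ge0|apply: le_trans (hi_len h); exact/ltW/lo_hi]. Qed.

Let closed_hi (r : refinement B) (h : edge r) t : hi h = t%:E -> closed_edge (on h) t.
Proof.
move=> ht; have := lo_hi h; have := hi_len h; rewrite ht lte_fin => h1 h2; split => //.
by apply: le_trans (ltW h2); exact: lo_ge0.
Qed.

Let seg_itv e a b : closed_edge e a -> closed_edge e b -> a <= b ->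
  (\int[mu]_(x in seg a b%:E) (dissipation p (on_edge u e) x)%:E = (\int[mu]_(x in `[a, b]) dissipation p (on_edge u e) x)%:E)%E.
Proof.
move=> ea eb ab; rewrite -integral_oo_cc//; last first.
  apply: continuous_compact_integrable; first exact: segment_compact.
  apply: continuous_dissipation => //; apply: continuous_subspaceW (sub_closed ea eb) _.
  exact: prim_within (closed_edge_interval hG (e := e)) (H1_prim hG Hu (e := e)).
congr (integral _ _ _); apply/seteqP; split => x; rewrite /seg /= in_itv/= lte_fin; first by move=> [-> ->].
by move=> /andP[].
Qed.

Let seg_open e a (b : \bar R) : 0 <= a -> (b <= len e)%E -> seg a b `<=` open_edge e.
Proof. by move=> a0 bl x [ax xb]; split; [exact: le_lt_trans ax|exact: lt_le_trans bl]. Qed.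

Let seg_k_le e a (b : \bar R) : 0 <= a -> (b <= len e)%E ->
  (\int[mu]_(x in seg a b) `|k e x|%:E <= \int[mu]_(x in seg a b) (dissipation p (on_edge u e) x)%:E)%E.
Proof.
move=> a0 bl; apply: ge0_le_integral => //; first exact: seg_measurable.
- apply/measurable_EFinP; apply: measurableT_comp => //.
  by apply: measurable_funS (@mk e); [exact: open_edge_measurable|exact: seg_open].
- by apply/measurable_EFinP; apply: measurable_funS (@md e); [exact: open_edge_measurable|exact: seg_open].
- by move=> x _; rewrite lee_fin.
Qed.

Let seg_d_fin e a (b : \bar R) : 0 <= a -> (b <= len e)%E ->
  (\int[mu]_(x in seg a b) (dissipation p (on_edge u e) x)%:E)%E \is a fin_num.
Proof.
move=> a0 bl; rewrite ge0_fin_numE; last by apply: integral_ge0 => x _; rewrite lee_fin.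
apply: (@le_lt_trans _ _ c%:E); last exact: ltry.
apply: le_trans total_d; apply: le_trans (term_le_total (d := d) e d_ge0).
apply: ge0_subset_integral => //; [exact: seg_measurable|exact: open_edge_measurable| | |].
- by apply/measurable_EFinP; exact: md.
- by move=> x _; rewrite lee_fin.
- exact: seg_open.
Qed.

(** The capacity is the whole energy of the piece, not the mere variation of [action]. It is
    positive on every piece, even on a plateau, so that tightness makes the two walks use all the
    edges. *)
Definition flux (r : refinement B) (h : edge r) : R :=
  fine (\int[mu]_(x in seg (lo h) (hi h)) (dissipation p (on_edge u (on h)) x)%:E)%E.

Let fluxE (r : refinement B) (h : edge r) :
  ((flux h)%:E = \int[mu]_(x in seg (lo h) (hi h)) (dissipation p (on_edge u (on h)) x)%:E)%E.
Proof. by rewrite /flux fineK//; apply: seg_d_fin; [exact: lo_ge0|exact: hi_len]. Qed.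

Lemma extremal_network (r : refinement B) : network (@bdry _ _ _ r) (fun v => V (at_ v)) (@flux r) c.
Proof.
have [PW PB _] := bv_potential_network hG (@subsetUl _ _ _) extremal_bv_potential r.
split => //.
  move=> h; apply: le_trans (PW h) _; rewrite /flux; apply: fine_le.
  - rewrite ge0_fin_numE; last by apply: integral_ge0 => x _; rewrite lee_fin.
    apply: le_lt_trans (seg_k_le (lo_ge0 h) (hi_len h)) _.
    by rewrite -ge0_fin_numE ?seg_d_fin ?lo_ge0 ?hi_len//; apply: integral_ge0 => x _; rewrite lee_fin.
  - exact: seg_d_fin (lo_ge0 h) (hi_len h).
  - exact: seg_k_le (lo_ge0 h) (hi_len h).
by move=> s us; apply: (refinement_sums (d := d)).
Qed.

Lemma flux_gt0 (r : refinement B) (h : edge r) : 0 < flux h.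
Proof.
have [b [lb eb bh]] : exists b : R, [/\ lo h < b, closed_edge (on h) b & (b%:E <= hi h)%E].
  have := lo_hi h; have := hi_len h; have l0 := lo_ge0 h; case E : (hi h) => [t| |] //.
    by rewrite lte_fin => tl lt_; exists t; split => //; exact: closed_hi.
  rewrite leye_eq => /eqP hl _; exists (lo h + 1); rewrite ltrDl ltr01 leey; split => //.
  by split; rewrite ?addr_ge0// hl leey.
have el := closed_lo h.
have cd : {within `[lo h, b], continuous (dissipation p (on_edge u (on h)))}.
  apply: continuous_dissipation => //; apply: continuous_subspaceW (sub_closed el eb) _.
  exact: prim_within (closed_edge_interval hG (e := on h)) (H1_prim hG Hu (e := on h)).
have [m mi hm] := EVT_min (ltW lb) cd.
have em : closed_edge (on h) m by apply: (sub_closed el eb); exact: mi.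
have m0 : 0 < dissipation p (on_edge u (on h)) m by apply: dissipation_gt0 => //; exact: extremal_nonzero.
rewrite -lte_fin fluxE.
apply: (@lt_le_trans _ _ (\int[mu]_(x in `[lo h, b]) dissipation p (on_edge u (on h)) x)%:E); last first.
  rewrite -seg_itv//; last exact: ltW.
  apply: ge0_subset_integral => //; [exact: seg_measurable|exact: seg_measurable| | |].
  - apply/measurable_EFinP; apply: measurable_funS (@md (on h)); first exact: open_edge_measurable.
    by apply: seg_open; [exact: lo_ge0|exact: hi_len].
  - by move=> x _; rewrite lee_fin.
  - by move=> x [x1 x2]; split => //; exact: lt_le_trans bh.
rewrite lte_fin; apply: (@lt_le_trans _ _ (dissipation p (on_edge u (on h)) m * (b - lo h))).
  by rewrite mulr_gt0// subr_gt0.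
have -> : dissipation p (on_edge u (on h)) m * (b - lo h) =
    \int[mu]_(x in `[lo h, b]) (cst (dissipation p (on_edge u (on h)) m) x).
  by rewrite Rintegral_cst//= lebesgue_measure_itv/= lte_fin lb -EFinD/=.
apply: le_Rintegral => //.
- by apply: continuous_compact_integrable; [exact: segment_compact|move=> z; exact: cvg_cst].
- by apply: continuous_compact_integrable => //; exact: segment_compact.
Qed.

Let wc e a b : closed_edge e a -> closed_edge e b -> {within `[a, b], continuous (w e)}.
Proof. by move=> ea eb; exact: continuous_subspaceW (sub_closed ea eb) (@cw e). Qed.

Let dissipation_abs e : dissipation p (w e) = dissipation p (on_edge u e).
Proof. by apply/funext => x; rewrite /dissipation /w normr_id. Qed.

Let pV e a b : closed_edge e a -> closed_edge e b -> prim `[a, b] (virial \o w e) (k e).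
Proof. by move=> ea eb; exact: primS (sub_closed ea eb) (@prim_V e). Qed.

Let descend e a b S : closed_edge e a -> closed_edge e b -> a <= b -> 0 <= S ->
  V (edge_pt e a) - V (edge_pt e b) = \int[mu]_(x in `[a, b]) dissipation p (on_edge u e) x ->
  w e a = soliton 0 S -> forall x, a <= x <= b -> w e x = soliton 0 (S + (x - a)).
Proof.
move=> ea eb ab S0 E wa; apply: (descent hp hlambda ab (wc ea eb) _ (pV ea eb) _ S0 _ wa).
- by move=> x xab; apply: w_range; exact: closed_edge_interval ea eb _ xab.
- by move=> x _; rewrite dissipation_abs; exact: k_le.
- by rewrite dissipation_abs; exact: E.
Qed.

Let ascend e a b S : closed_edge e a -> closed_edge e b -> a <= b -> 0 <= S ->
  V (edge_pt e b) - V (edge_pt e a) = \int[mu]_(x in `[a, b]) dissipation p (on_edge u e) x ->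
  w e b = soliton 0 S -> forall x, a <= x <= b -> w e x = soliton 0 (S + (b - x)).
Proof.
move=> ea eb ab S0 E wb; apply: (ascent hp hlambda ab (wc ea eb) _ (pV ea eb) _ S0 _ wb).
- by move=> x xab; apply: w_range; exact: closed_edge_interval ea eb _ xab.
- by move=> x _; rewrite dissipation_abs; exact: k_le.
- by rewrite dissipation_abs; exact: E.
Qed.

Definition start (r : refinement B) (a : edge r * bool) t : R := if a.2 then lo a.1 else t.
Definition finish (r : refinement B) (a : edge r * bool) t : R := if a.2 then t else lo a.1.

(** On a tight arc [action] drops at the greatest possible rate, so [|u|] continues the half-soliton
    by [descent] or [ascent], according to the direction in which the arc follows the coordinate. *)
Lemma arc_depth (r : refinement B) (a : edge r * bool) t S : hi a.1 = t%:E -> 0 <= S ->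
  V (at_ (src a)) - V (at_ (dst a)) = flux a.1 -> `|eval u (at_ (src a))| = soliton 0 S ->
  [/\ at_ (src a) = edge_pt (on a.1) (start a t), at_ (dst a) = edge_pt (on a.1) (finish a t),
      closed_edge (on a.1) (start a t), closed_edge (on a.1) (finish a t) &
      forall z, between (start a t) (finish a t) z -> w (on a.1) z = soliton 0 (S + `|z - start a t|)].
Proof.
case: a => h b /= ht S0; have el := closed_lo h; have et := closed_hi ht.
have lt_ : lo h <= t by have := lo_hi h; rewrite ht lte_fin => /ltW.
have ah : at_ (head h) = edge_pt (on h) t by rewrite at_head ht.
have at_l := at_tail h.
have fE : flux h = \int[mu]_(x in `[lo h, t]) dissipation p (on_edge u (on h)) x.
  by apply: EFin_inj; rewrite fluxE ht seg_itv.
rewrite /src /dst /start /finish; case: b => /=; rewrite ah at_l fE => E wS; (split; [exact: erefl|exact: erefl|exact: el + exact: et|exact: et + exact: el|move=> z]).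
- rewrite /between => /orP[/andP[z1 z2]|/andP[z1 z2]].
    have zp : 0 <= z - lo h by rewrite subr_ge0.
    have zz : lo h <= z <= t by rewrite z1.
    by rewrite (ger0_norm zp); exact: descend el et lt_ S0 E wS _ zz.
  have tl : t = lo h by apply/eqP; rewrite eq_le lt_ (le_trans z1 z2).
  have zl : z = lo h by apply/eqP; rewrite eq_le z2 -tl z1.
  by rewrite zl subrr normr0 addr0; exact: wS.
- rewrite /between => /orP[/andP[z1 z2]|/andP[z1 z2]].
    have tl : t = lo h by apply/eqP; rewrite eq_le lt_ (le_trans z1 z2).
    have zl : z = t by apply/eqP; rewrite eq_le z1 andbT tl z2.
    by rewrite zl subrr normr0 addr0; exact: wS.
  have zp : 0 <= t - z by rewrite subr_ge0.
  have zz : lo h <= z <= t by rewrite z1.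
  by rewrite distrC (ger0_norm zp); exact: ascend el et lt_ S0 E wS _ zz.
Qed.

(** Tightness of an infinite piece is first localized: the energy beyond [z] is at least [action] at
    [z], so the drop on [[lo h, z]] must exhaust the energy there as well. *)
Lemma end_depth (r : refinement B) (h : edge r) S : hi h = +oo%E -> 0 <= S ->
  V (at_ (tail h)) = flux h -> `|eval u (at_ (tail h))| = soliton 0 S ->
  forall z, lo h <= z -> w (on h) z = soliton 0 (S + (z - lo h)).
Proof.
rewrite at_tail => ho S0 E wS z lz; have el := closed_lo h.
have he : half_line (on h) by apply/eqP; rewrite -leye_eq -ho; exact: hi_len.
have ez : closed_edge (on h) z by split; [exact: le_trans (lo_ge0 h) lz|rewrite he leey].
move: (lz); rewrite le_eqVlt => /predU1P[<-|lz']; first by rewrite subrr addr0; exact: wS.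
have zz : lo h <= z <= z by rewrite lz lexx.
apply: (descend el ez lz S0 _ wS zz).
have zh : (z%:E < hi h)%E by rewrite ho ltry.
have := seg_split hG lz' zh d_ge0 (@md (on h)); rewrite -fluxE seg_itv// => split_.
have h2 : (`|V (edge_pt (on h) z)|%:E <= \int[mu]_(x in seg z +oo) (dissipation p (on_edge u (on h)) x)%:E)%E.
  apply: le_trans (bv_potential_half_line hG extremal_bv_potential he ez) _; apply: seg_k_le; last by rewrite he.
  exact: le_trans (lo_ge0 h) lz.
have h1 := bv_potential_itv extremal_bv_potential el ez lz.
have {}h1 := le_trans h1 (seg_k_le (lo_ge0 h) ez.2); rewrite seg_itv// lee_fin in h1.
rewrite ho in split_; have {h2 split_} := le_trans (leeD (lexx _) h2) split_; rewrite -EFinD lee_fin => h2.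
have a1 := ler_norm (V (edge_pt (on h) z)).
have a2 : V (edge_pt (on h) (lo h)) - V (edge_pt (on h) z) <= `|V (edge_pt (on h) z) - V (edge_pt (on h) (lo h))|.
  by rewrite distrC ler_norm.
apply/eqP; rewrite eq_le; apply/andP; split; first exact: le_trans a2 h1.
by rewrite lerBrDr E; apply: le_trans h2; rewrite lerD2l.
Qed.

Let V_ge0 (q : raw G) : 0 <= V q.
Proof.
have [hq|hq] := pselect (points q); last by rewrite VB// /eval insubF//; apply/negP; rewrite inE.
have [e [x [ex Eq]]] := pt_on_edge hG e0 (exist _ q (mem_set hq) : pt G).
rewrite /= in Eq; rewrite -Eq; apply: virial_ge0 => //; exact: (w_range ex).
Qed.

(** The parameter of the half-soliton with the value [|u|] at [q], unique by [soliton_inj]. It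
    depends on the point alone and serves as arc length for both rays. *)
Definition depth_of (q : raw G) : R := get [set s | 0 <= s /\ soliton 0 s = `|eval u q|].

Lemma depth_ofE (q : raw G) s : 0 <= s -> `|eval u q| = soliton 0 s -> depth_of q = s.
Proof.
move=> s0 E; have [h1 h2] : [set s | 0 <= s /\ soliton 0 s = `|eval u q|] (depth_of q).
  by apply: (@getI _ _ s); split; [exact: s0|exact: esym E].
by apply: (soliton_inj hp hlambda h1 s0); rewrite h2; exact: E.
Qed.

Let at_head_infinite (r : refinement B) (h : edge r) : hi h = +oo%E -> eval u (at_ (head h)) = 0.
Proof.
move=> ho; rewrite at_head ho /=; apply: eval_Vinf; exists (on h) => //.
by apply/eqP; rewrite -leye_eq -ho; exact: hi_len.
Qed.

Let between_ends (r : refinement B) (a : edge r * bool) t z : lo a.1 <= z -> z <= t ->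
  between (start a t) (finish a t) z.
Proof. by rewrite /start /finish /between; case: a.2 => -> ->; rewrite ?orbT. Qed.

(** Since [u] vanishes on the boundary and the soliton does not, a tight walk cannot end at a finite
    point: its last arc is an infinite piece, and the walk becomes a ray. [L] lists the parameters
    of its vertices; at all others the ray is inside a piece. *)
Lemma walk_ray (r : refinement B) (P : seq (edge r * bool)) v y S : walk v P y -> @bdry _ _ _ r y -> 0 <= S ->
  `|eval u (at_ v)| = soliton 0 S ->
  (forall a : edge r * bool, a \in P -> V (at_ (src a)) - V (at_ (dst a)) = flux a.1) ->
  exists (c : seq (edge G * R * R)) (e : edge G) (x : R) (L : seq R), [/\ is_ray (at_ v) c e x, depth_along depth_of S c e x,
    forall (a : edge r * bool) z z', a \in P -> lo a.1 <= z -> lo a.1 <= z' -> (z%:E <= hi a.1)%E -> (z'%:E <= hi a.1)%E ->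
      on_ray (ray c e x) (on a.1) z z' &
    forall s, 0 <= s -> s \notin L -> exists2 a : edge r * bool, a \in P &
      exists z, [/\ lo a.1 < z, (z%:E < hi a.1)%E & ray c e x s = edge_pt (on a.1) z]].
Proof.
move=> + By; have [b Bb yb] := bdry_at By.
have uy : eval u (at_ y) = 0.
  rewrite yb; case: Bb => [bi|bZ]; first exact: eval_Vinf.
  by have [[_ /(_ b bZ)]] := hu.
have absurd (q : raw G) S' : eval u q = 0 -> `|eval u q| = soliton 0 S' -> False.
  by move=> -> E; have := soliton_gt0 hp hlambda 0 S'; rewrite -E normr0 ltxx.
elim: P v S => [|a P IH] v S /=.
  by move=> /eqP -> S0 wS _; case: (absurd _ _ uy wS).
move=> /andP[/eqP <- wp] S0 wS tight.
have ta := tight a (mem_head _ _).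
have tp (a' : edge r * bool) : a' \in P -> V (at_ (src a')) - V (at_ (dst a')) = flux a'.1.
  by move=> ap; apply: tight; rewrite inE ap orbT.
case ht : (hi a.1) => [t| |].
- have [Es Ed cs cd dz] := arc_depth ht S0 ta wS.
  set y1 := start a t in Es cs dz *; set y2 := finish a t in Ed cd dz *.
  have d0 : 0 <= `|y1 - y2| := normr_ge0 _.
  have S'0 : 0 <= S + `|y1 - y2| by rewrite addr_ge0.
  have wS' : `|eval u (at_ (dst a))| = soliton 0 (S + `|y1 - y2|).
    by rewrite Ed distrC; exact: dz (betweenr _ _).
  have [c [e [x [L [hr hd hon hint]]]]] := IH _ _ wp S'0 wS' tp.
  have hr' : is_ray (at_ (src a)) ((on a.1, y1, y2) :: c) e x.
    by case: hr => h1 h2 h3; split => //=; split => //; rewrite -Ed.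
  exists ((on a.1, y1, y2) :: c), e, x, [:: 0, `|y1 - y2| & [seq `|y1 - y2| + s | s <- L]]; split.
  + exact: hr'.
  + split; last exact: hd.
    by move=> z bz; apply: depth_ofE; [rewrite addr_ge0|exact: dz].
  + move=> a' z z'; rewrite inE => /predU1P[->|ap] l1 l2 h1 h2; last first.
      by apply: on_ray_cons hr' _; exact: hon.
    rewrite ht !lee_fin in h1 h2.
    by apply: (on_ray_chain hr' (mem_head _ _)); exact: between_ends.
  + move=> s s0; rewrite !inE !negb_or => /and3P[sn0 snd snL].
    have [sl|ls] := leP s `|y1 - y2|.
      exists a; first by rewrite inE eqxx.
      have sl' : s < `|y1 - y2| by rewrite lt_neqAle snd.
      have s0' : 0 < s by rewrite lt_neqAle eq_sym sn0.
      have lt_ : lo a.1 < t by have := lo_hi a.1; rewrite ht lte_fin.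
      exists (forth y1 y2 s); rewrite ht lte_fin /= sl; split => //.
        move: sl'; rewrite /y1 /y2 /start /finish /forth; case: a.2.
          by rewrite (ltW lt_) => _; rewrite ltrDl.
        by rewrite leNgt lt_/= gtr0_norm ?subr_gt0// => sl'; rewrite ltrBrDl -ltrBrDr.
      move: sl'; rewrite /y1 /y2 /start /finish /forth; case: a.2.
        by rewrite (ltW lt_) distrC gtr0_norm ?subr_gt0// => sl'; rewrite -ltrBrDl.
      by rewrite leNgt lt_/= => _; rewrite ltrBlDr ltrDl.
    have [||a' ap' [z [z1 z2 z3]]] := hint (s - `|y1 - y2|).
    * by rewrite subr_ge0 ltW.
    * apply: contra snL => sL; apply/mapP; exists (s - `|y1 - y2|) => //.
      by rewrite addrC subrK.
    exists a'; first by rewrite inE ap' orbT.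
    by exists z; split => //=; rewrite leNgt ls.
- case: a ht ta tight wS wp => h [] /= ho ta tight wS wp; last first.
    by case: (absurd _ _ (at_head_infinite ho) wS).
  have dst0 : V (at_ (dst (h, true))) = 0 by apply: VB; exact: at_head_infinite.
  (* At infinity [action] is 0 and it is nowhere negative, while a further tight arc would lower it
     by a positive [flux]. *)
  have p0 : P = [::].
    case: P {IH tp} wp tight => [//|a' P] /= /andP[/eqP Ea' _] tight.
    have := tight a'; rewrite !inE eqxx orbT => /(_ isT); rewrite Ea' dst0.
    have := V_ge0 (at_ (dst a')); have := flux_gt0 a'.1 => f0 v0 E.
    by move: f0; rewrite -E sub0r oppr_gt0 ltNge v0.
  have he : half_line (on h) by apply/eqP; rewrite -leye_eq -ho; exact: hi_len.
  rewrite dst0 subr0 in ta.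
  have hd := end_depth ho S0 ta wS.
  have hr : is_ray (at_ (src (h, true))) [::] (on h) (lo h).
    by split; [exact: at_tail|exact: he|exact: closed_lo].
  exists [::], (on h), (lo h), [:: 0]; split => //.
  + move=> z lz; apply: depth_ofE; first by rewrite addr_ge0// subr_ge0.
    exact: hd.
  + move=> a z z'; rewrite p0 inE => /eqP -> /= lz lz' _ _.
    exact: on_ray_end hr lz lz'.
  + move=> s s0; rewrite inE => sn0; exists (h, true); first by rewrite inE eqxx.
    by exists (lo h + s); rewrite ho ltry ltrDl lt_neqAle eq_sym sn0 s0.
- by have := lo_hi a.1; rewrite ht.
Qed.

Lemma extremal_rays : (forall e s, ~ dead B e s) ->
  exists2 g : bool -> R -> raw G, two_rays g & finite_set (crossings g).
Proof.
move=> nd; have [e1 [x1 [ex1 u1]]] := hmax.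
have [r [_ ndr [v vE] _]] := refine_at hG (trivial_refinement hG B) ex1.
have {ndr} ndr := ndr nd.
have bn : @bdry _ _ _ r !=set0.
  have Be : B (head e0) by left; exists e0.
  by have [b hb _] := at_bdry r Be; exists b.
have Vv : c <= 2 * V (at_ v) by rewrite vE /action -/(on_edge u e1 x1) u1 virial_peak.
have [P [Q [y [z [[wP wQ By Bz] uPQ tight all_]]]]] :=
  network_tight (extremal_network r) bn (@refinement_conn _ _ _ r) (fun h => ndr h v) Vv.
have v0 : `|eval u (at_ v)| = soliton 0 0 by rewrite vE -/(on_edge u e1 x1) u1 soliton_center.
have tP (a : edge r * bool) : a \in P -> V (at_ (src a)) - V (at_ (dst a)) = flux a.1.
  by move=> aP; apply: tight; rewrite mem_cat aP.
have tQ (a : edge r * bool) : a \in Q -> V (at_ (src a)) - V (at_ (dst a)) = flux a.1.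
  by move=> aQ; apply: tight; rewrite mem_cat aQ orbT.
have [cP [eP [xP [LP [rP dP oP iP]]]]] := walk_ray wP By (lexx 0) v0 tP.
have [cQ [eQ [xQ [LQ [rQ dQ oQ iQ]]]]] := walk_ray wQ Bz (lexx 0) v0 tQ.
pose cc (b : bool) := if b then cQ else cP; pose ee (b : bool) := if b then eQ else eP; pose xx (b : bool) := if b then xQ else xP.
exists (fun b : bool => ray (cc b) (ee b) (xx b)).
  apply: (@rays_two_rays _ _ hG (at_ v) cc ee xx depth_of); [by case|by case|].
  move=> e t t' et et' tt'; apply: covered_pieces (refinement_covered r et et' tt').
  move=> h s s' ls ss' sh.
  have sh' : (s%:E <= hi h)%E by apply: le_trans sh; rewrite lee_fin.
  have ls' := le_trans ls ss'.
  have := all_ h (flux_gt0 h); rewrite map_cat mem_cat => /orP[] /mapP[a aP ha].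
    by exists false; rewrite ha in ls sh sh' ls' *; exact: oP.
  by exists true; rewrite ha in ls sh sh' ls' *; exact: oQ.
(* At any other common parameter the two rays would be at the same point inside a piece of each
   walk; pieces are disjoint, so this piece would belong to both walks, against
   edge-disjointness. *)
apply: (@sub_finite_set _ _ [set` LP ++ LQ]); last exact: finite_seq.
move=> s [s0 E]; apply: contrapT => /negP; rewrite mem_cat negb_or => /andP[sP sQ].
have [a aP [t [t1 t2 t3]]] := iP s s0 sP; have [a' aQ [t' [t1' t2' t3']]] := iQ s s0 sQ.
have op (h : edge r) (x : R) : lo h < x -> (x%:E < hi h)%E -> edge_pt (on h) x = inr (on h, x).
  move=> x1_ x2_; apply: edge_pt_open => //; split; first exact: le_lt_trans (lo_ge0 h) x1_.
  exact: lt_le_trans x2_ (hi_len h).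
move: E; rewrite /cc /ee /xx /= t3 t3' !op// => -[oE tE].
have [aa|/eqP aa] := eqVneq a.1 a'.1.
  move: uPQ; rewrite map_cat cat_uniq => /and3P[_ /hasPn h _].
  have := h a'.1; rewrite map_f// => /(_ isT); rewrite -aa /= map_f//.
rewrite -tE in t1' t2'.
have [h|h] := refinement_disj oE aa.
  by have := lt_le_trans t2 h; rewrite lte_fin => /lt_trans/(_ t1'); rewrite ltxx.
by have := lt_le_trans t2' h; rewrite lte_fin => /lt_trans/(_ t1); rewrite ltxx.
Qed.

End Equality.

(** * Towers of bubbles *)

Section Tower.
Context {R : realType} (ls : seq R).
Hypothesis ls0 : forall l, l \in ls -> 0 < l.
Local Notation T := (tower ls).
Local Notation n := (size ls).
Implicit Types (b : bool) (k m : nat) (s z : R).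

Definition half_circle k : R := ls`_k / 2.

Lemma half_circle_gt0 k : (k < n)%N -> 0 < half_circle k.
Proof. by move=> kn; rewrite divr_gt0// ls0// mem_nth. Qed.

Definition node k : vertex T := inl (inord k).

Lemma reach_node k : (k <= n)%N -> reach [set: edge T] (node 0) (node k).
Proof.
elim: k => [_|k IH kn]; first exact: reach_refl.
have E : node k = tail (inr (Ordinal kn, true) : edge T).
  by congr inl; apply: val_inj; rewrite /= inordK// ltnS ltnW.
have E' : node k.+1 = head (inr (Ordinal kn, true) : edge T).
  by congr inl; apply: val_inj; rewrite /= inordK// lift0.
rewrite E'; apply: reach_fwd => //; rewrite -E; apply: IH; exact: ltnW.
Qed.

Lemma node_ord (i : 'I_n.+1) : node i = inl i.
Proof. by rewrite /node inord_val. Qed.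

Lemma tower_classG : classG T.
Proof.
have r0 (v : vertex T) : reach [set: edge T] (node 0) v.
  case: v => [i|b]; first by rewrite -node_ord; apply: reach_node; rewrite -ltnS.
  have E : (inl b : edge T) = inl b by [].
  apply: (@reach_fwd _ T _ _ (inl b)) => //=.
  by have := reach_node (leq0n n); rewrite /node; have -> : inord 0 = ord0 :> 'I_n.+1 by apply: val_inj; rewrite /= inordK.
split.
- by move=> v w; apply: reach_trans (r0 w); exact: reach_sym.
- by move=> v; apply: (@finite_finset ((bool + 'I_n * bool) * bool)%type).
- case=> [b _|[i b]]; last by rewrite /half_line.
  rewrite /degree1; have -> : ends (head (inl b : edge T)) = [set ((inl b, true) : edge T * bool)].
    apply/seteqP; split => [[e c]|_ ->] //.
    by case: e => [b'|[i b']]; case: c => //= -[->].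
  exact: card_set1.
- have [m m0 hm] : exists2 m : R, 0 < m & forall l, l \in ls -> m <= l / 2.
    elim: ls ls0 => [|l l' IH] l0; first by exists 1.
    have [|m m0 hm] := IH; first by move=> x xl; apply: l0; rewrite inE xl orbT.
    exists (Num.min m (l / 2)); first by rewrite lt_min m0 divr_gt0// l0// mem_head.
    by move=> x; rewrite inE => /predU1P[->|/hm mx]; rewrite ge_min ?lexx ?orbT// mx.
  apply: (@lt_le_trans _ _ m%:E); first by rewrite lte_fin.
  apply: le_ereal_inf_tmp => _ [e _ <-]; case: e => [b|[i b]] /=; first exact: leey.
  by rewrite lee_fin hm// mem_nth.
Qed.

Definition circle b k : edge T := if insub k is Some i then inr (i, b) else inl b.

Lemma circleE b k (kn : (k < n)%N) : circle b k = inr (Ordinal kn, b).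
Proof. by rewrite /circle insubT. Qed.

Lemma circle_len b k : (k < n)%N -> len (circle b k) = (half_circle k)%:E.
Proof. by move=> kn; rewrite circleE. Qed.

Lemma circle_bottom b k : (k < n)%N -> edge_pt (circle b k) 0 = inl (node k).
Proof.
move=> kn; rewrite circleE /edge_pt eqxx; congr inl; congr inl; apply: val_inj.
by rewrite /= inordK// ltnS ltnW.
Qed.

Lemma circle_top b k : (k < n)%N -> edge_pt (circle b k) (half_circle k) = inl (node k.+1).
Proof.
move=> kn; rewrite (edge_pt_head tower_classG (circle_len b kn)) circleE.
by congr inl; congr inl; apply: val_inj; rewrite /= inordK// lift0.
Qed.

Lemma circle_closed b k z : (k < n)%N -> 0 <= z -> z <= half_circle k -> closed_edge (circle b k) z.
Proof. by move=> kn z0 zl; split => //; rewrite circle_len// lee_fin. Qed.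

(** Both rays of a tower start at its far end, the top of the last circle, and run along opposite
    half-circles down to the line, where each takes one half-line. *)
Fixpoint descend b k : seq (edge T * R * R) :=
  if k is k'.+1 then (circle b k', half_circle k', 0) :: descend b k' else [::].

Definition height k : R := \sum_(j < k) half_circle j.

Lemma heightS k : height k.+1 = height k + half_circle k.
Proof. by rewrite /height big_ord_recr. Qed.

Lemma height_le j m : (j <= m)%N -> (m <= n)%N -> height j <= height m.
Proof.
elim: m => [|m IH]; first by rewrite leqn0 => /eqP ->.
rewrite leq_eqVlt => /predU1P[-> //|jm] mn; rewrite heightS.
by apply: le_trans (IH jm (ltnW mn)) _; rewrite lerDl; exact/ltW/half_circle_gt0.
Qed.

Local Notation half b := (inl b : edge T).

Lemma half_start b : edge_pt (half b) 0 = inl (node 0).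
Proof. by rewrite /edge_pt eqxx; congr inl; congr inl; apply: val_inj; rewrite /= inordK. Qed.

Lemma descend_ray b k : (k <= n)%N -> is_ray (inl (node k)) (descend b k) (half b) 0.
Proof.
move=> kn; split => //; last by split => //; exact: leey.
elim: k kn => [_|k IH kn] /=; first by rewrite half_start.
have l0 := ltW (half_circle_gt0 kn).
split; [exact: circle_closed|exact: circle_closed|exact: circle_top|].
by rewrite circle_bottom//; apply: IH; exact: ltnW.
Qed.

(** Arc length from the top of the tower. Half-circles are parametrized upwards, whence the minus
    sign in front of their coordinate. *)
Definition depth (q : raw T) : R :=
  match q with
  | inl (inl i) => height n - height i
  | inl (inr _) => 0
  | inr (inl _, x) => height n + x
  | inr (inr (i, _), x) => height n - height i - x
  end.

Lemma depth_node k : (k <= n)%N -> depth (inl (node k)) = height n - height k.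
Proof. by move=> kn; rewrite /= inordK. Qed.

Lemma depth_circle b k z : (k < n)%N -> depth (edge_pt (circle b k) z) = height n - height k - z.
Proof.
move=> kn; have [->|z0] := eqVneq z 0; first by rewrite circle_bottom// depth_node ?subr0// ltnW.
have [->|zl] := eqVneq z (half_circle k).
  by rewrite circle_top// depth_node// heightS opprD addrA.
by rewrite /edge_pt (negbTE z0) circle_len// eqe (negbTE zl) circleE.
Qed.

Lemma depth_half b z : depth (edge_pt (half b) z) = height n + z.
Proof.
have [->|z0] := eqVneq z 0; last by rewrite /edge_pt (negbTE z0).
by rewrite half_start depth_node// /height big_ord0 subr0 addr0.
Qed.

Lemma descend_depth b k : (k <= n)%N -> depth_along depth (height n - height k) (descend b k) (half b) 0.
Proof.
elim: k => [_|k IH kn] /=.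
  by move=> z _; rewrite depth_half /height [X in _ - X]big_ord0 !subr0.
have l0 := half_circle_gt0 kn.
split.
  move=> z /orP[/andP[h1 h2]|/andP[h1 h2]].
    by have := lt_le_trans l0 (le_trans h1 h2); rewrite ltxx.
  by rewrite depth_circle// heightS ler0_norm ?subr_le0//; ring.
rewrite subr0 gtr0_norm// heightS.
have -> : height n - (height k + half_circle k) + half_circle k = height n - height k by ring.
by apply: IH; exact: ltnW.
Qed.

Lemma mem_descend b k m : (k < m)%N -> (circle b k, half_circle k, 0) \in descend b m.
Proof.
elim: m => // m IH; rewrite ltnS leq_eqVlt /= inE => /predU1P[->|/IH ->]; first by rewrite eqxx.
by rewrite orbT.
Qed.

Definition tower_ray b := ray (descend b n) (half b) 0.

Lemma tower_two_rays : two_rays tower_ray.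
Proof.
apply: (rays_two_rays tower_classG (q := inl (node n)) (f := depth)) => [b|b|].
- exact: descend_ray.
- by have := descend_depth b (leqnn n); rewrite subrr.
- case=> [b|[i b]] z z' [z0 zl] [z'0 z'l] zz'; apply: (@piece_one _ _ _ _ b).
    by apply: (on_ray_end (descend_ray b (leqnn n))).
  have E : inr (i, b) = circle b i.
    by rewrite (circleE b (ltn_ord i)); congr inr; congr pair; exact: val_inj.
  rewrite E in zl z'l *; rewrite circle_len// lee_fin in zl; rewrite circle_len// lee_fin in z'l.
  apply: (on_ray_chain (descend_ray b (leqnn n)) (mem_descend b (ltn_ord i))).
    by rewrite /between z0 zl orbT.
  by rewrite /between z'0 z'l orbT.
Qed.

Definition levels : set R := [set s | exists2 k, (k <= n)%N & s = height n - height k].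

Lemma descend_node b k m : (k <= m)%N -> (m <= n)%N ->
  ray (descend b m) (half b) 0 (height m - height k) = inl (node k).
Proof.
move=> km mn; elim: m km mn => [|m IH] km mn.
  move: km; rewrite leqn0 => /eqP ->; rewrite subrr; exact: ray0 (descend_ray b mn).
move: km; rewrite leq_eqVlt => /predU1P[->|km].
  by rewrite subrr; exact: ray0 (descend_ray b mn).
have l0 := half_circle_gt0 mn.
have E : height m.+1 - height k = `|half_circle m - 0| + (height m - height k).
  by rewrite subr0 gtr0_norm// heightS; ring.
rewrite E; have := ray_cons (descend_ray b mn) => /= ->; last by rewrite subr_ge0 height_le// ltnW.
by apply: IH => //; exact: ltnW.
Qed.

Definition side (e : edge T) : bool := match e with inl b => b | inr (_, b) => b end.

Lemma descend_side b k s : exists e z, side e = b /\ ray (descend b k) (half b) 0 s = edge_pt e z.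
Proof.
elim: k s => [|k IH] s /=; first by exists (half b), (0 + s).
case: ifP => _; last exact: IH.
by exists (circle b k), (forth (half_circle k) 0 s); split => //; rewrite /circle; case: insub.
Qed.

Lemma tower_crossings : crossings tower_ray = levels.
Proof.
apply/seteqP; split => s.
  move=> [s0 E]; have d b : depth (tower_ray b s) = s.
    by have := descend_depth b (leqnn n); rewrite subrr => /ray_depth-/(_ s s0) ->; rewrite add0r.
  have [e [z [eb h]]] := descend_side false n s; have [e' [z' [eb' h']]] := descend_side true n s.
  (* The two rays run on edges of different sides, so a common point cannot be interior to an edge;
     its depth then identifies its level. *)
  have [v vE] : exists v, tower_ray false s = inl v.
    move: E; rewrite /tower_ray h h' /edge_pt.
    case: ifP => _; first by exists (tail e).
    case: ifP => _; first by exists (head e).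
    case: ifP => _; first by exists (tail e').
    case: ifP => _; first by exists (head e').
    by move=> [ee _]; move: eb; rewrite ee eb'.
  have := d false; rewrite vE; case: v {vE} => [i|b] /= <-.
    by exists i => //; rewrite -ltnS.
  by exists n => //; rewrite subrr.
move=> [k kn ->].
have E b : tower_ray b (height n - height k) = inl (node k) by exact: descend_node.
split; last by rewrite !E.
by rewrite subr_ge0 height_le.
Qed.

End Tower.

Section TowerExists.
Context {R : realType}.

(** The last circle of the list is the top of the tower: adding one creates a new starting point and
    pushes the former levels away by half of its length. *)
Lemma levels_rcons (ls : seq R) l s : levels (rcons ls l) s <-> s = 0 \/ levels ls (s - l / 2).
Proof.
have hc k : (k < size ls)%N -> half_circle (rcons ls l) k = half_circle ls k.
  by move=> kn; rewrite /half_circle nth_rcons kn.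
have ht k : (k <= size ls)%N -> height (rcons ls l) k = height ls k.
  move=> kn; apply: eq_bigr => i _; apply: hc; exact: leq_trans (ltn_ord i) kn.
have top : height (rcons ls l) (size ls).+1 = height ls (size ls) + l / 2.
  by rewrite heightS ht// /half_circle nth_rcons ltnn eqxx.
rewrite /levels /= size_rcons; split.
  move=> [k]; rewrite leq_eqVlt => /predU1P[->|kn] ->; first by left; rewrite subrr.
  right; exists k => //; rewrite top ht//; ring.
move=> [->|[k kn E]]; first by exists (size ls).+1 => //; rewrite subrr.
exists k; first exact: leqW.
by rewrite top ht//; move: E => /(canRL (subrK _)) ->; ring.
Qed.

(** Two consecutive crossings bound two arcs of length [x - a], hence a circle of length
    [2 * (x - a)]. The gap nearest to the start gives the top circle, which [rcons] puts last; with
    no gap left the tower has no circle. *)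
Lemma tower_with_levels (xs : seq R) a : path <%R a xs -> exists2 ls : seq R,
  (forall l, l \in ls -> 0 < l) & forall s, levels ls s <-> a + s \in a :: xs.
Proof.
elim: xs a => [|x xs IH] a /=.
  move=> _; exists [::] => // s; rewrite inE; split.
    by move=> [k]; rewrite leqn0 => /eqP -> ->; rewrite subrr addr0.
  by rewrite -subr_eq0 addrAC subrr add0r => /eqP ->; exists 0%N => //; rewrite subrr.
move=> /andP[ax /IH[ls ls0 hls]].
exists (rcons ls (2 * (x - a))).
  by move=> l; rewrite mem_rcons inE => /predU1P[->|/ls0//]; rewrite mulr_gt0// subr_gt0.
move=> s; rewrite levels_rcons hls inE.
have -> : x + (s - 2 * (x - a) / 2) = a + s by field.
rewrite !inE; split => [[->|->]|/predU1P[h|]]; rewrite ?addr0 ?eqxx ?orbT//; last by right.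
by left; apply: (addrI a); rewrite h addr0.
Qed.

Lemma two_rays_tower (G : metric_graph R) (g : bool -> R -> raw G) :
  two_rays g -> finite_set (crossings g) -> isometric_to_tower G.
Proof.
move=> hg /finite_seqP[xs hX].
pose ys := sort <=%R (undup [seq x <- xs | x != 0]).
have ys_xs x : x \in ys = (x != 0) && (x \in xs) by rewrite mem_sort mem_undup mem_filter.
have X0 : crossings g 0 by split => //; case: hg => _ _ _ _ [].
have pys : path <%R 0 ys.
  rewrite path_min_sorted; first by rewrite sort_lt_sorted undup_uniq.
  apply/allP => x; rewrite ys_xs => /andP[x0 xx].
  have : crossings g x by rewrite hX.
  by move=> [x0' _]; rewrite lt_neqAle eq_sym x0.
have [ls ls0 hls] := tower_with_levels pys.
exists ls => //; apply: (isometric_two_rays hg (tower_two_rays ls0)).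
rewrite tower_crossings//; apply/seteqP; split => s.
  rewrite hls add0r inE ys_xs hX /= => ->; rewrite andbT.
  by case: eqP.
rewrite hls add0r inE ys_xs => /predU1P[->//|/andP[_ sx]]; by rewrite hX.
Qed.

End TowerExists.

Section Extremals.
Context {R : realType} (G : metric_graph R).
Variables (p lambda : R) (Z : set (vertex G)) (e0 : edge G).
Hypotheses (hG : classG G) (hp : 2 < p) (hlambda : 0 < lambda) (he0 : half_line e0).
Local Notation c := (soliton_energy p lambda).
Local Notation N := (nehari p lambda Z).
Local Notation M := (nodal_nehari p lambda Z).
Local Notation Jl := (J p lambda).

Lemma extremal_tower u : (Fedges Z #= `I_0)%card -> N u -> (Jl u <= c%:E)%E -> isometric_to_tower G.
Proof.
move=> F0 hu hJ; have nd := Fedges0_nodead F0.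
have [_ h] := nehari_lower hG hp hlambda he0 nd hu; have [hae hpk hmax] := h hJ.
have [g hg fg] := extremal_rays hG hp hlambda he0 hu hJ hae hpk hmax nd.
exact: two_rays_tower hg fg.
Qed.

Lemma level_nehari_eq : (Fedges Z #= `I_0)%card -> level Jl N = c%:E.
Proof.
move=> F0; apply/eqP; rewrite eq_le (level_nehari_le Z hG hp hlambda he0)/=.
apply: le_ereal_inf_tmp => _ [u hu <-].
by have [] := nehari_lower hG hp hlambda he0 (Fedges0_nodead F0) hu.
Qed.

Lemma nodal_gt u : (Fedges Z #<= `I_1)%card -> M u -> (c%:E + level Jl N < Jl u)%E.
Proof.
move=> F1 hu; have Bn : (@Vinf R G `|` Z) !=set0 by exists (head e0); left; exists e0.
rewrite (J_parts e0 hG hp hlambda hu).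
have [_ hP hN] := hu.
have [r Er _] := level_nehari_fin Z hG hp hlambda he0.
have lev v : N v -> (level Jl N <= Jl v)%E.
  by move=> hv; apply: ge_ereal_inf; exists (Jl v) => //; exists v.
have lP := lev _ hP; have lN := lev _ hN.
rewrite Er in lP lN *.
have [h|h] := nodal_lower hG hp hlambda he0 (Fedges1_nested hG Bn F1) hu.
  by apply: (lte_leD _ h lN).
by rewrite addeC; apply: (lee_ltD _ lP h).
Qed.

End Extremals.

Theorem theorem1p6 (R : realType) (p lambda : R) (G : metric_graph R)
    (Z : set (vertex G))
    (hp : 2 < p) (hlambda : 0 < lambda)
    (hG : classG G) (hhalf : exists e : edge G, half_line e)
    (hZ : Z `<=` ~` @Vinf R G) (hZ1 : forall v, Z v -> degree1 v) :
  let N := nehari p lambda Z in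
  let M := nodal_nehari p lambda Z in
  let Jl := @J R G p lambda in
  let s := s_level p lambda in
  [/\ (level Jl N <= s)%E,
      (level Jl M <= s + level Jl N)%E,
      (Fedges Z #= `I_0)%card ->
        level Jl N = s /\
        (~ (isometric_to_line G \/ isometric_to_tower G) -> ~ achieved Jl N)
    & (Fedges Z #<= `I_1)%card ->
        level Jl M = (s + level Jl N)%E /\ ~ achieved Jl M].
Proof.
move=> N M Jl s; have [e0 he0] := hhalf.
have sE : s = (soliton_energy p lambda)%:E by exact: s_level_eq.
have le1 : (level Jl N <= (soliton_energy p lambda)%:E)%E by exact: level_nehari_le hG hp hlambda he0.
have le2 : (level Jl M <= (soliton_energy p lambda)%:E + level Jl N)%E.
  exact: level_nodal_le hG hp hlambda he0.
rewrite sE; split=> // [F0|F1].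
- have E := level_nehari_eq hG hp hlambda he0 F0.
  split; first exact: E.
  (* The line is the tower without circles, so the second alternative covers both cases. *)
  move=> not_tower [u hu uE]; apply: not_tower; right.
  by apply: (extremal_tower hG hp hlambda he0 F0 hu); rewrite -/Jl uE -/N E lexx.
- have gt u : M u -> _ := @nodal_gt _ _ _ _ _ _ hG hp hlambda he0 u F1.
  have E : level Jl M = ((soliton_energy p lambda)%:E + level Jl N)%E.
    apply/eqP; rewrite eq_le le2/=.
    by apply: le_ereal_inf_tmp => _ [u /gt/ltW hu <-].
  split; first exact: E.
  by move=> [u hu uE]; have := gt u hu; rewrite -/Jl -/N -E uE ltxx.
Qed.
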